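(* Let $A$ be a simple unital $C^*$-algebra. If $A$ is $\mathcal{Z}$-absorbing, i.e. $A\cong A\otimes\mathcal{Z}$ where $\mathcal{Z}$ is the Jiang–Su algebra, then $A$ is tracially $\mathcal{Z}$-absorbing.
   Context: Cuntz subequivalence: for positive elements $a,b$ of a $C^*$-algebra $B$, $a\precsim b$ means there is a sequence $(x_n)$ in $B$ with $\lim_n\|a-x_nbx_n^*\|=0$. A completely positive contractive (c.p.c.) map $\varphi:B\to C$ has order zero if $\varphi(a)\varphi(b)=0$ whenever $a,b\in B_+$ satisfy $ab=0$. A unital $C^*$-algebra $A$ is tracially $\mathcal{Z}$-absorbing if $A\not\cong\mathbb{C}$ and for every finite set $F\subset A$, every $\varepsilon>0$, every non-zero positive $a\in A$ and every positive integer $n$ there is a c.p.c. order zero map $\varphi:M_n\to A$ such that: (1) $1-\varphi(1)\precsim a$; (2) $\|[\varphi(x),y]\|<\varepsilon$ for every $x\in M_n$ with $\|x\|=1$ and every $y\in F$. *)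

(* Defs.v *)
From HB Require Import structures.
From mathcomp Require Import all_boot all_order all_algebra.
From mathcomp Require Import complex.
From mathcomp Require Import all_classical all_reals all_analysis.
Import Order.TTheory GRing.Theory Num.Theory.
Import numFieldNormedType.Exports.

Set Implicit Arguments.
Unset Strict Implicit.
Unset Printing Implicit Defensive.

Local Open Scope classical_set_scope.
Local Open Scope ring_scope.
Local Open Scope complex_scope.

HB.mixin Record NzRing_isStarRing A of GRing.NzRing A := {
  star : A -> A;
  starK : involutive star;
  starD : {morph star : x y / x + y};
  starM : forall x y, star (x * y) = star y * star x
}.

#[short(type="starRingType")]
HB.structure Definition StarRing := {A of NzRing_isStarRing A & GRing.NzRing A}.

HB.mixin Record StarRing_isStarAlgebra (R : realType) A
    of StarRing A & GRing.Algebra R[i] A := {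
  starZ : forall (c : R[i]) (x : A), star (c *: x) = c^* *: star x
}.

#[short(type="starAlgType")]
HB.structure Definition StarAlgebra (R : realType) :=
  {A of StarRing A & GRing.Algebra R[i] A & StarRing_isStarAlgebra R A}.

(* Ring structures with a norm are already joined by numDomainType in the
   hierarchy, so no structure can inherit from both nzRingType and normedModType;
   hence a C*-algebra carries its own, real-valued, norm. *)
HB.mixin Record StarAlgebra_isCStar (R : realType) A of StarAlgebra R A := {
  cnorm : A -> R;
  cnorm_eq0 : forall x, cnorm x = 0 -> x = 0;
  cnormD : forall x y, cnorm (x + y) <= cnorm x + cnorm y;
  cnormZ : forall (c : R[i]) x, (cnorm (c *: x))%:C = `|c| * (cnorm x)%:C;
  cnormM : forall x y, cnorm (x * y) <= cnorm x * cnorm y;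
  cnorm_star : forall x, cnorm (star x * x) = cnorm x ^+ 2;
  cnorm_complete : forall u : nat -> A,
    (forall eps : R, 0 < eps -> exists N, forall m n,
      (N <= m)%N -> (N <= n)%N -> cnorm (u m - u n) < eps) ->
    exists l, (fun n => cnorm (u n - l)) @ \oo --> (0 : R)
}.

(* A ring of type nzRingType has a unit and satisfies 1 != 0, so this is the
   type of nonzero unital complex C*-algebras. *)
#[short(type="cstarType")]
HB.structure Definition CStar (R : realType) :=
  {A of StarAlgebra R A & StarAlgebra_isCStar R A}.

Definition cclosure (R : realType) (A : cstarType R) (S : set A) : set A :=
  [set x | forall eps : R, 0 < eps -> exists2 y, S y & cnorm (x - y) < eps].

Section ComplexStar.
Variable R : realType.

Let conjM (x y : R[i]) : (x * y)^* = y^* * x^*.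
Proof. by rewrite rmorphM mulrC. Qed.

HB.instance Definition _ := NzRing_isStarRing.Build R[i]
  (@conjcK R) (@rmorphD _ _ (@conjc R)) conjM.
HB.instance Definition _ := NzRing_isStarRing.Build R[i]^o
  (@conjcK R) (@rmorphD _ _ (@conjc R)) conjM.

Let conjZ (c : R[i]) (x : R[i]^o) : star (c *: x) = c^* *: star x.
Proof. exact: (rmorphM (@conjc R)). Qed.

HB.instance Definition _ := StarRing_isStarAlgebra.Build R R[i]^o conjZ.
End ComplexStar.

Definition mxstar (A : starRingType) m n (X : 'M[A]_(m, n)) : 'M[A]_(n, m) :=
  (map_mx star X)^T.

Section MatrixStar.
Variables (A : starRingType) (n : nat).
Implicit Types X Y : 'M[A]_n.+1.

Let mxstarK : involutive (@mxstar A n.+1 n.+1).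
Proof. by move=> X; apply/matrixP => i j; rewrite !mxE starK. Qed.

Let mxstarD : {morph @mxstar A n.+1 n.+1 : X Y / X + Y}.
Proof. by move=> X Y; apply/matrixP => i j; rewrite !mxE starD. Qed.

Let mxstarM X Y : mxstar (X * Y) = mxstar Y * mxstar X.
Proof.
have star0 : star (0 : A) = 0.
  by apply: (addrI (star (0 : A))); rewrite -starD !addr0.
apply/matrixP => i j; rewrite !mxE (big_morph _ (@starD A) star0).
by apply: eq_bigr => k _; rewrite !mxE starM.
Qed.

HB.instance Definition _ :=
  NzRing_isStarRing.Build 'M[A]_n.+1 mxstarK mxstarD mxstarM.
End MatrixStar.

Definition positive (A : starRingType) (a : A) := exists b : A, a = star b * b.

Definition completely_positive (A B : starRingType) (phi : A -> B) :=
  forall (k : nat) (X : 'M[A]_k.+1), positive X -> positive (map_mx phi X).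

Definition order_zero (A B : starRingType) (phi : A -> B) :=
  forall a b : A, positive a -> positive b -> a * b = 0 -> phi a * phi b = 0.

Definition cuntz_sub (R : realType) (A : cstarType R) (a b : A) :=
  exists x : nat -> A,
    (fun n => cnorm (a - x n * b * star (x n))) @ \oo --> (0 : R).

Definition l2norm (R : realType) n (v : 'cV[R[i]]_n) : R :=
  Num.sqrt (\sum_i (complex.Re (v i 0) ^+ 2 + complex.Im (v i 0) ^+ 2)).

(* The C*-norm of M_n; the norm that the library puts on matrices is the
   entrywise maximum norm. *)
Definition opnorm (R : realType) n (X : 'M[R[i]]_n) : R :=
  sup [set l2norm (X *m v) | v in [set v | l2norm v <= 1]].

Definition cpc_order_zero (R : realType) (A : cstarType R) n
    (phi : {linear 'M[R[i]]_n.+1 -> A}) :=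
  [/\ completely_positive phi,
      forall x, cnorm (phi x) <= opnorm x
    & order_zero phi].

Definition star_hom (R : realType) (A B : starAlgType R)
    (f : {lrmorphism A -> B}) := forall x, f (star x) = star (f x).

Definition star_iso (R : realType) (A B : starAlgType R) :=
  exists f : {lrmorphism A -> B}, star_hom f /\ bijective f.

Definition simple_cstar (R : realType) (A : cstarType R) :=
  forall I : set A,
    cclosure I `<=` I -> I 0 -> (forall x y, I x -> I y -> I (x + y)) ->
    (forall a x, I x -> I (a * x) /\ I (x * a)) ->
    I = [set 0] \/ I = setT.

(* C, with alpha : A -> C and beta : B -> C in the roles of a |-> a (x) 1 and
   b |-> 1 (x) b, is the completion of the algebraic tensor product of A and B
   for some C*-norm: the third clause says that
   a (x) b |-> alpha a * beta b is injective on the algebraic tensor product,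
   each element of which can be written as a sum of a_i (x) b_i with linearly
   independent b_i, and vanishes only if all the a_i do. *)
Definition cstar_tensor (R : realType) (A B C : cstarType R)
    (alpha : {lrmorphism A -> C}) (beta : {lrmorphism B -> C}) :=
  [/\ star_hom alpha /\ star_hom beta,
      forall a b, alpha a * beta b = beta b * alpha a,
      forall n (a : 'I_n -> A) (b : 'I_n -> B),
        (forall c : 'I_n -> R[i],
            \sum_i c i *: b i = 0 -> forall i, c i = 0) ->
        \sum_i alpha (a i) * beta (b i) = 0 -> forall i, a i = 0
    & cclosure [set x | exists n (a : 'I_n -> A) (b : 'I_n -> B),
                 x = \sum_i alpha (a i) * beta (b i)] = setT].

(* C is the minimal tensor product of A and B: its norm restricts to the least
   C*-norm on the algebraic tensor product. *)
Definition min_tensor (R : realType) (A B C : cstarType R) :=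
  exists (alpha : {lrmorphism A -> C}) (beta : {lrmorphism B -> C}),
    cstar_tensor alpha beta /\
    forall (C' : cstarType R)
        (alpha' : {lrmorphism A -> C'}) (beta' : {lrmorphism B -> C'}),
      cstar_tensor alpha' beta' ->
      forall n (a : 'I_n -> A) (b : 'I_n -> B),
        cnorm (\sum_i alpha (a i) * beta (b i))
          <= cnorm (\sum_i alpha' (a i) * beta' (b i)).

(* The dimension drop algebra I(p, q): continuous f : [0, 1] -> M_p (x) M_q
   with f 0 in M_p (x) 1 and f 1 in 1 (x) M_q.  M_p (x) M_q is M_(p * q), with
   mxvec_index i j for the pair of indices (i, j).  The values of f outside
   [0, 1] are irrelevant. *)
Definition dimdrop (R : realType) (p q : nat)
    (f : R -> 'M[R[i]^o]_(p * q)) :=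
  [/\ {within `[0, 1], continuous f},
      exists a : 'M[R[i]]_p, forall i i' j j',
        f 0 (mxvec_index i j) (mxvec_index i' j') = a i i' *+ (j == j')
    & exists b : 'M[R[i]]_q, forall i i' j j',
        f 1 (mxvec_index i j) (mxvec_index i' j') = b j j' *+ (i == i')].

(* mu is an injective unital *-homomorphism I(p, q) -> Z. *)
Record dimdrop_embedding (R : realType) (p q : nat) (Z : cstarType R)
    (mu : (R -> 'M[R[i]^o]_(p * q)) -> Z) : Prop := {
  dimdropD : forall f g, dimdrop f -> dimdrop g ->
    mu (fun t => f t + g t) = mu f + mu g;
  dimdropZ : forall (c : R[i]) f, dimdrop f ->
    mu (fun t => c *: f t) = c *: mu f;
  dimdropM : forall f g, dimdrop f -> dimdrop g ->
    mu (fun t => f t *m g t) = mu f * mu g;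
  dimdrop_star : forall f, dimdrop f ->
    mu (fun t => mxstar (f t)) = star (mu f);
  dimdrop1 : mu (fun=> 1%:M) = 1;
  dimdrop_inj : forall f g, dimdrop f -> dimdrop g ->
    mu f = mu g <-> {in `[0, 1], f =1 g}
}.

Definition tracial_state (R : realType) (A : cstarType R)
    (tau : {linear A -> R[i]^o}) :=
  [/\ tau 1 = 1,
      forall a, 0 <= (tau (star a * a) : R[i])
    & forall a b, tau (a * b) = tau (b * a)].

(* The Jiang-Su algebra is, up to isomorphism, the simple inductive limit of a
   sequence of prime dimension drop algebras, with unital injective connecting
   maps, that has a unique tracial state.  The limit is the closure of the
   increasing union of the images of the I(p_k, q_k). *)
Definition jiang_su (R : realType) (Z : cstarType R) :=
  [/\ simple_cstar Z,
      exists tau : {linear Z -> R[i]^o}, tracial_state tau /\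
        forall tau' : {linear Z -> R[i]^o}, tracial_state tau' -> tau' =1 tau
    & exists (p q : nat -> nat)
        (mu : forall k, (R -> 'M[R[i]^o]_(p k * q k)) -> Z),
        let D k := mu k @` [set f | dimdrop f] in
        [/\ forall k, [/\ (0 < p k)%N, (0 < q k)%N & coprime (p k) (q k)],
            forall k, dimdrop_embedding (mu k),
            forall k, D k `<=` D k.+1
          & cclosure (\bigcup_k D k) = setT]].

Definition Z_absorbing (R : realType) (A : cstarType R) :=
  exists Z B : cstarType R, [/\ jiang_su Z, min_tensor A Z B & star_iso A B].

Definition tracially_Z_absorbing (R : realType) (A : cstarType R) :=
  ~ star_iso A R[i]^o /\
  forall (F : set A) (eps : R) (a : A) (n : nat),
    finite_set F -> 0 < eps -> positive a -> a != 0 ->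
    exists phi : {linear 'M[R[i]]_n.+1 -> A},
      [/\ cpc_order_zero phi,
          cuntz_sub (1 - phi 1) a
        & forall x y, opnorm x = 1 -> F y ->
            cnorm (phi x * y - y * phi x) < eps].

(* Main.v *)
(* Let [pi : Z -> A] be the embedding of the Jiang-Su algebra, whose image commutes
   with a copy of [A] that together with it spans a dense subspace.  As [Z] has a
   unique trace, the normalised traces of an element of a building block [I(p_k, q_k)]
   over all points of the intervals of the later stages are uniformly close to it, and
   [p_l, q_l] tend to infinity since [Z] is simple.  Hence, cutting the interval of
   stage [k] into small cells, one finds over the interval of a late stage [l] nearly
   [d / N] continuous orthonormal [N]-frames that nearly exhaust the space, are
   moved around by the matrix units of the cells, and are compatible with the boundary
   conditions.  Weighting the frames by functions that cut off the incompatible ones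
   near the endpoints gives an order zero map [phi : M_N -> Z] that almost commutes with
   stage [k], whose defect [1 - phi 1 = b^2] is annihilated by some [f] of trace close
   to one, which persists at all later stages.

   To compare [1 - pi (phi 1)] with a nonzero positive [a], write
   [1 = \sum_(i < m) x_i a x_i^*] by simplicity of [A], and take at a still later stage a
   map [psi : M_(2 m) -> Z] of the same kind almost commuting with the [x_i a x_j^*].
   Since [b] is small in trace, there is [v] with
   [v psi2 (E_00 + E_mm) v^* = b^2], where [psi2] is [psi] with squared weights and the
   two matrix units serve the two endpoints.  Then
   [X = pi v \sum_i pi (psi (E_(0,i) + E_(m,m+i))) x_i] satisfies
   [X a X^* ~ pi (b^2) = 1 - pi (phi 1)]. *)
From HB Require Import structures.
From mathcomp Require Import all_boot all_order all_algebra.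
From mathcomp Require Import complex ring lra.
From mathcomp Require Import all_classical all_reals all_analysis.
Require Import Defs.
Import Order.TTheory GRing.Theory Num.Theory numFieldNormedType.Exports.

Set Implicit Arguments.
Unset Strict Implicit.
Unset Printing Implicit Defensive.

Local Open Scope classical_set_scope.
Local Open Scope ring_scope.
Local Open Scope complex_scope.


(** * Elementary theory of C*-algebras *)

(** The embeddings [mu k] are given only as algebraic maps, so every norm estimate comes from
    algebra: an element is exhibited as the real part of a unitary, or all its powers are bounded
    with a bad constant that repeated squaring removes. Comparison in [Z] is carried out by hand.
    The obstacle is that a dimension drop algebra imposes two different block structures at 0 and 1,
    and a frame fits each of them only up to a remainder. The weights must kill that remainder at
    the ends, which is where the defect comes from. A small trace of the defect would not locate its
    support; the element [f] provides a large space that [b] kills, so that [b] sees only a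
    complement small enough to be covered by a frame. The doubling to [2 m] has the same origin: the
    intertwiners fitting the two ends use different vectors, and orthogonal components let them be
    glued with no cross terms. Late stages are forced by rounding, since dimensions are rounded down
    to multiples of [N] times a multiplicity. *)

Section CStarBasics.
Variables (R : realType) (A : cstarType R).
Implicit Types (x y z : A) (r e : R).

Lemma star0 : star (0 : A) = 0.
Proof. by apply: (addrI (star (0 : A))); rewrite -starD !addr0. Qed.

Lemma starN x : star (- x) = - star x.
Proof. by apply: (addrI (star x)); rewrite -starD !subrr star0. Qed.

Lemma starB x y : star (x - y) = star x - star y.
Proof. by rewrite starD starN. Qed.

Lemma star1 : star (1 : A) = 1.
Proof. by rewrite -[LHS]mulr1 -[X in _ * X]starK -starM mulr1 starK. Qed.

Lemma star_sum (I : Type) (s : seq I) (P : pred I) (F : I -> A) :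
  star (\sum_(i <- s | P i) F i) = \sum_(i <- s | P i) star (F i).
Proof. exact: (big_morph _ (@starD A) star0). Qed.

Lemma starZc (c : R[i]) x : star (c *: x) = conjc c *: star x.
Proof. exact: starZ. Qed.

Lemma normc_real r : `|r%:C| = `|r|%:C :> R[i].
Proof. by rewrite normc_def /= expr0n addr0 sqrtr_sqr. Qed.

Lemma starZr r x : star (r%:C *: x) = r%:C *: star x.
Proof. by rewrite starZc conjc_real. Qed.

Lemma cnormZr r x : cnorm (r%:C *: x) = `|r| * cnorm x.
Proof.
by have := cnormZ r%:C x; rewrite normc_real -rmorphM => -[].
Qed.

Lemma cnorm0 : cnorm (0 : A) = 0.
Proof. by rewrite -(scale0r (0 : A)) cnormZr normr0 mul0r. Qed.

Lemma cnormN x : cnorm (- x) = cnorm x.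
Proof.
have -> : - x = (-1)%:C *: x by rewrite rmorphN1 scaleN1r.
by rewrite cnormZr normrN1 mul1r.
Qed.

Lemma cnorm_ge0 x : 0 <= cnorm x.
Proof.
have := cnormD x (- x); rewrite subrr cnorm0 cnormN -mulr2n pmulrn_lge0 //.
Qed.

Lemma cnormB x y : cnorm (x - y) <= cnorm x + cnorm y.
Proof. by rewrite -(cnormN y) cnormD. Qed.

Lemma cnorm_distC x y : cnorm (x - y) = cnorm (y - x).
Proof. by rewrite -cnormN opprB. Qed.

Lemma cnorm_tri z x y : cnorm (x - y) <= cnorm (x - z) + cnorm (z - y).
Proof. by have := cnormD (x - z) (z - y); rewrite addrA subrK. Qed.

Lemma cnorm_sum (I : Type) (s : seq I) (P : pred I) (F : I -> A) :
  cnorm (\sum_(i <- s | P i) F i) <= \sum_(i <- s | P i) cnorm (F i).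
Proof.
elim/big_rec2: _ => [|i x y _ h]; first by rewrite cnorm0.
by rewrite (le_trans (cnormD _ _)) // lerD2l.
Qed.

(** The C*-identity and submultiplicativity bound [cnorm y ^+ 2] by [cnorm (star y) * cnorm y]; one
    factor cancels, and the involution gives the other inequality. *)
Lemma cnorm_st x : cnorm (star x) = cnorm x.
Proof.
suff le y : cnorm y <= cnorm (star y).
  by apply/eqP; rewrite eq_le -{2}(starK x) !le.
have := cnorm_star y; have := cnormM (star y) y => /[swap] ->.
have [->|y0] := eqVneq (cnorm y) 0; first by rewrite cnorm_ge0.
by rewrite expr2 ler_pM2r // lt0r y0 cnorm_ge0.
Qed.

Lemma cnorm_starr x : cnorm (x * star x) = cnorm x ^+ 2.
Proof. by rewrite -(cnorm_st x) -cnorm_star starK. Qed.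

Lemma cnorm1 : cnorm (1 : A) = 1.
Proof.
have := cnorm_star (1 : A); rewrite mulr1 star1 => h.
have n0 : cnorm (1 : A) != 0.
  by apply: contra_neq (oner_neq0 A) => /cnorm_eq0.
by apply: (mulfI n0); rewrite mulr1 -expr2.
Qed.

Lemma cnormZ1 r : cnorm (r%:C%:A : A) = `|r|.
Proof. by rewrite cnormZr cnorm1 mulr1. Qed.

Lemma cnorm_small x : (forall e, 0 < e -> cnorm x <= e) -> x = 0.
Proof.
move=> h; apply: cnorm_eq0; apply/eqP; rewrite eq_le cnorm_ge0 andbT.
by apply/ler_addgt0Pl => e e0; rewrite addr0 h.
Qed.

(** Iterating the C*-identity reaches only exponents [2 ^ n], which is enough to stand in for the
    spectral radius formula. *)
Lemma cnormX_sa x n : star x = x -> cnorm (x ^+ (2 ^ n)) = cnorm x ^+ (2 ^ n).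
Proof.
move=> sx; elim: n => [|n IH]; first by rewrite !expr1.
have sX : star (x ^+ (2 ^ n)) = x ^+ (2 ^ n).
  elim: (2 ^ n)%N => [|m IHm]; first by rewrite star1.
  by rewrite {1}exprS starM IHm sx exprSr.
by rewrite expnSr !exprM -IH -cnorm_star sX.
Qed.

(* If [h] and [k] are commuting self-adjoint elements with [h^2 + k^2 = 1],
   then [h + i k] is unitary and [h] is its real part. *)
Lemma cnorm_unitary_part (h k : A) r : star h = h -> star k = k ->
  h * k = k * h -> 0 < r -> h ^+ 2 + k ^+ 2 = (r ^+ 2)%:C%:A -> cnorm h <= r.
Proof.
move=> sh sk hk r0 hk2.
set u := h + 'i *: k.
have su : star u = h - 'i *: k.
  rewrite starD starZc sh sk.
  have -> : conjc ('i : R[i]) = - 'i.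
    by apply/eqP; rewrite eq_complex /= oppr0 !eqxx.
  by rewrite scaleNr.
have uu : star u * u = (r ^+ 2)%:C%:A.
  rewrite su mulrDr !mulrBl -hk2.
  rewrite -!scalerAl -!scalerAr hk scalerA -['i * 'i]expr2 sqr_i scaleN1r.
  by rewrite opprK addrA subrK -!expr2.
have nu : cnorm u = r.
  apply/eqP; rewrite -(@eqrXn2 _ 2) ?cnorm_ge0 // ?ltW //.
  by rewrite -cnorm_star uu cnormZ1 ger0_norm ?sqr_ge0.
have h2 : (2 : R)%:C *: h = u + star u.
  by rewrite su addrACA subrr addr0 rmorph_nat scaler_nat.
have : cnorm (2%:C *: h) <= r + r.
  by rewrite h2 (le_trans (cnormD _ _)) // cnorm_st nu.
by rewrite cnormZr ger0_norm // mulr_natl -mulr2n ler_pMn2r.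
Qed.

End CStarBasics.

(** * Square roots from a majorised iteration *)

Section CStarSqrt.
Variables (R : realType) (A : cstarType R).
Implicit Types (x y z k : A) (r e : R).

Lemma cvg0P (u : nat -> R) : u @ \oo --> (0 : R) <->
  forall e, 0 < e -> exists N, forall n, (N <= n)%N -> `|u n| < e.
Proof.
split=> [/cvgr0Pnorm_lt h e e0|h].
  by have [N _ hN] := h e e0; exists N => n /hN.
apply/cvgr0Pnorm_lt => e /h[N hN]; exists N => //= n; exact: hN.
Qed.

Lemma complete_limit (u : nat -> A) :
  (forall e, 0 < e -> exists N, forall m n, (N <= m)%N -> (N <= n)%N ->
     cnorm (u m - u n) < e) ->
  exists l, forall e, 0 < e -> exists N, forall n, (N <= n)%N ->
    cnorm (u n - l) < e.
Proof.
move=> /cnorm_complete[l /cvg0P hl]; exists l => e /hl[N hN]; exists N => n.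
by move=> /hN; rewrite ger0_norm ?cnorm_ge0.
Qed.

(** A scalar majorant of the iteration run below in the algebra: it dominates the norms of the
    iterates and of their increments. Being increasing and bounded it is Cauchy, which also covers
    [cnorm k = 1], where the convergence is not geometric. *)
Let xi n : R := iter n (fun t => (1 + t ^+ 2) / 2) 0.

Let xi01 n : 0 <= xi n <= 1.
Proof.
elim: n => [|n /andP[IH0 IH1]] /=; first by rewrite lexx ler01.
have : xi n ^+ 2 <= 1 by rewrite expr_le1.
by have := sqr_ge0 (xi n); lra.
Qed.

Let xiS n : xi n.+1 = (1 + xi n ^+ 2) / 2. Proof. by []. Qed.

Let xi_nd n : xi n <= xi n.+1.
Proof. by rewrite xiS; have := sqr_ge0 (1 - xi n); nra. Qed.

Let xi_mono m n : (m <= n)%N -> xi m <= xi n.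
Proof.
by move=> /subnK <-; elim: (n - m)%N => // i IH; exact: le_trans (xi_nd _).
Qed.

Let xi_cauchy e : 0 < e -> exists N, forall m n, (N <= m)%N -> (N <= n)%N ->
  xi m - xi n < e.
Proof.
move=> e0; pose S := [set xi n | n in setT].
have hS : has_sup S.
  split; first by exists (xi 0), 0%N.
  by exists 1 => _ [n _ <-]; case/andP: (xi01 n).
have [_ [N _ <-] hN] := sup_adherent e0 hS.
exists N => m n _ /xi_mono; have : xi m <= sup S.
  by apply: ub_le_sup; [case: hS|exists m].
lra.
Qed.

Section Iteration.
Variable k : A.
Hypotheses (sk : star k = k) (k1 : cnorm k <= 1).

Let u n : A := iter n (fun x => (2^-1)%:C *: (k + x ^+ 2)) 0.

Let uS n : u n.+1 = (2^-1)%:C *: (k + u n ^+ 2). Proof. by []. Qed.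

Let su n : star (u n) = u n.
Proof.
elim: n => [|n IH]; first by rewrite /= star0.
by rewrite uS starZr starD sk expr2 starM IH.
Qed.

Let cu z n : z * k = k * z -> z * u n = u n * z.
Proof.
move=> h; elim: n => [|n IH]; first by rewrite /= mulr0 mul0r.
rewrite uS -scalerAr -scalerAl mulrDr mulrDl h; congr (_ *: (_ + _)).
by rewrite mulrA IH -mulrA IH mulrA.
Qed.

Let nu n : cnorm (u n) <= xi n.
Proof.
elim: n => [|n IH]; first by rewrite /= cnorm0.
rewrite uS cnormZr xiS ger0_norm ?invr_ge0 // mulrC ler_pM2r ?invr_gt0 //.
rewrite (le_trans (cnormD _ _)) // lerD // (le_trans (cnormM _ _)) //.
by rewrite expr2 ler_pM ?cnorm_ge0.
Qed.

Let du n : cnorm (u n.+1 - u n) <= xi n.+1 - xi n.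
Proof.
elim: n => [|n IH].
  rewrite /= !subr0 !expr0n /= !addr0 cnormZr ger0_norm ?invr_ge0 //.
  by have := k1; lra.
rewrite uS {2}uS -scalerBr opprD addrACA subrr add0r.
have -> : u n.+1 ^+ 2 - u n ^+ 2 =
    u n.+1 * (u n.+1 - u n) + (u n.+1 - u n) * u n.
  by rewrite mulrBr mulrBl addrA subrK.
rewrite cnormZr ger0_norm ?invr_ge0 //.
have h1 := le_trans (cnormM (u n.+1) (u n.+1 - u n))
  (ler_pM (cnorm_ge0 _) (cnorm_ge0 _) (nu _) IH).
have h2 := le_trans (cnormM (u n.+1 - u n) (u n))
  (ler_pM (cnorm_ge0 _) (cnorm_ge0 _) IH (nu _)).
have h3 := le_trans (cnormD _ _) (lerD h1 h2).
rewrite mulrC ler_pdivrMr // (le_trans h3) //.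
by rewrite (xiS n.+1) {5}xiS; lra.
Qed.

Let duu m n : (m <= n)%N -> cnorm (u n - u m) <= xi n - xi m.
Proof.
move=> /subnK <-; elim: (n - m)%N => [|i IH].
  by rewrite !subrr cnorm0.
have := du (i + m); have := cnorm_tri (u (i + m)) (u (i + m).+1) (u m).
rewrite addSn; lra.
Qed.

(** The limit [l] of the iterates solves [2 l = k + l ^ 2], that is [(1 - l) ^ 2 = 1 - k].
    Commutation passes to [l] because the iterates are polynomials in [k]; the bound on [1 - s]
    records that [s] is positive. *)
Lemma csqrt : exists s, [/\ star s = s, s ^+ 2 = 1 - k, cnorm (1 - s) <= 1
  & forall z, z * k = k * z -> z * s = s * z].
Proof.
have [|l hl] := @complete_limit u.
  move=> e /xi_cauchy[N hN]; exists N => m n Nm Nn.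
  have [mn|/ltnW nm] := leqP m n.
    by rewrite cnorm_distC; exact: le_lt_trans (duu mn) (hN _ _ _ _).
  exact: le_lt_trans (duu nm) (hN _ _ _ _).
have sl : star l = l.
  apply/eqP; rewrite -subr_eq0; apply/eqP/cnorm_small => e e0.
  have [N /(_ N (leqnn N)) hN] := hl (e / 2) (divr_gt0 e0 (ltr0Sn _ _)).
  have := cnorm_tri (u N) (star l) l.
  rewrite -{1}su -starB cnorm_st (cnorm_distC l (u N)); lra.
have nl : cnorm l <= 1.
  apply/ler_addgt0Pl => e e0; have [N /(_ N (leqnn N)) hN] := hl e e0.
  have := cnorm_tri (u N) l 0; rewrite !subr0 (cnorm_distC l (u N)).
  have := nu N; have /andP[_] := xi01 N; lra.
have cl z : z * k = k * z -> z * l = l * z.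
  move=> zk; apply/eqP; rewrite -subr_eq0; apply/eqP/cnorm_small => e e0.
  have c0 : 0 < e / (2 * (cnorm z + 1)).
    by rewrite divr_gt0 // mulr_gt0 // ltr_wpDl ?cnorm_ge0.
  have [N /(_ N (leqnn N)) hN] := hl _ c0.
  have -> : z * l - l * z = z * (l - u N) + (u N - l) * z.
    by rewrite mulrBr mulrBl (cu _ zk) addrA subrK.
  rewrite (le_trans (cnormD _ _)) //.
  have := cnormM z (l - u N); have := cnormM (u N - l) z.
  rewrite (cnorm_distC l); have := ltW hN.
  rewrite ler_pdivlMr; last by rewrite mulr_gt0 // ltr_wpDl ?cnorm_ge0.
  have := cnorm_ge0 (u N - l); nra.
have l2 : 2%:C *: l = k + l ^+ 2.
  apply/eqP; rewrite -subr_eq0; apply/eqP/cnorm_small => e e0.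
  have [N hN] := hl (e / 6) (divr_gt0 e0 (ltr0Sn _ _)).
  have h1 := hN N (leqnn N); have h2 := hN N.+1 (leqnSn N).
  have uu : 2%:C *: u N.+1 = k + u N ^+ 2.
    by rewrite uS scalerA -rmorphM mulfV ?pnatr_eq0 // scale1r.
  have -> : 2%:C *: l - (k + l ^+ 2) = 2%:C *: (l - u N.+1) +
      (u N * (u N - l) + (u N - l) * l).
    rewrite scalerBr uu mulrBr mulrBl [u N * u N - _ + _]addrA subrK -!expr2.
    by rewrite !opprD !addrA subrK.
  have h3 := cnormD (2%:C *: (l - u N.+1))
    (u N * (u N - l) + (u N - l) * l).
  have h4 := cnormD (u N * (u N - l)) ((u N - l) * l).
  have h5 := cnormM (u N) (u N - l); have h6 := cnormM (u N - l) l.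
  have h7 := nu N; have /andP[_ h8] := xi01 N.
  have h9 := cnorm_ge0 (u N - l).
  rewrite cnormZr (cnorm_distC l) ger0_norm // in h3.
  nra.
exists (1 - l); split.
- by rewrite starB star1 sl.
- rewrite -sqrrN opprB sqrrB1 -[l *+ 2]scaler_nat.
  by rewrite -(rmorph_nat (real_complex R)) l2 opprD addrCA subrr addr0 addrC.
- by rewrite opprB addrC subrK.
- by move=> z /cl h; rewrite mulrBr mulrBl mulr1 mul1r h.
Qed.

End Iteration.

(** Supplies the imaginary part that [cnorm_unitary_part] asks for. *)
Lemma cnorm_sq_sum (h : A) : star h = h -> cnorm h <= 1 ->
  exists s, [/\ star s = s, h ^+ 2 + s ^+ 2 = 1 & h * s = s * h].
Proof.
move=> sh h1; have [||s [ss s2 _ hs]] := @csqrt (h ^+ 2).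
- by rewrite expr2 starM sh.
- by rewrite (le_trans (cnormM _ _)) // mulr_ile1 ?cnorm_ge0.
by exists s; rewrite s2 addrC subrK hs // -exprS -exprSr.
Qed.

End CStarSqrt.

(** * Positive elements, invertibility and simplicity *)

Section CStarPositive.
Variables (R : realType) (A : cstarType R).
Implicit Types (x y z h : A) (r e : R).

(** Positivity read off the norm: for self-adjoint [x] the condition says that the spectrum lies in
    [[0, 2 M]]. In this form sums of positive elements are visibly positive, which is not clear for
    [positive]. *)
Definition cpos x := star x = x /\ exists2 M, 0 <= M & cnorm (M%:C%:A - x) <= M.

Lemma cposD x y : cpos x -> cpos y -> cpos (x + y).
Proof.
move=> [sx [M M0 hM]] [sy [N N0 hN]]; split; first by rewrite starD sx sy.
exists (M + N); first exact: addr_ge0.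
rewrite rmorphD scalerDl opprD addrACA.
by rewrite (le_trans (cnormD _ _)) // lerD.
Qed.

Lemma cpos0 : cpos 0.
Proof. by split; [exact: star0 | exists 0; rewrite // scale0r subrr cnorm0]. Qed.

Lemma cposZ r x : 0 <= r -> cpos x -> cpos (r%:C *: x).
Proof.
move=> r0 [sx [M M0 hM]]; split; first by rewrite starZr sx.
exists (r * M); first exact: mulr_ge0.
by rewrite rmorphM -scalerA -scalerBr cnormZr ger0_norm // ler_wpM2l.
Qed.

Lemma cposR r : 0 <= r -> cpos r%:C%:A.
Proof.
move=> r0; split; first by rewrite starZr star1.
by exists r; rewrite // subrr cnorm0.
Qed.

Lemma cpos_sum (I : Type) (s : seq I) (F : I -> A) :
  (forall i, cpos (F i)) -> cpos (\sum_(i <- s) F i).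
Proof.
move=> h; elim/big_rec: _ => [|i x _ hx]; first exact: cpos0.
exact: cposD.
Qed.

(** After scaling [h] below norm one, its partner [s] with sum of squares one is itself the real
    part of a unitary, hence a contraction, and [r ^ 2 - h ^ 2] is [r ^ 2] times the square of
    [s]. *)
Lemma cpos_sq h : star h = h -> cpos (h ^+ 2).
Proof.
move=> sh; pose r := cnorm h + 1.
have r0 : 0 < r by rewrite ltr_wpDl ?cnorm_ge0.
have sk : star (r^-1%:C *: h) = r^-1%:C *: h by rewrite starZr sh.
have k1 : cnorm (r^-1%:C *: h) <= 1.
  rewrite cnormZr ger0_norm ?invr_ge0 ?(ltW r0) // mulrC ler_pdivrMr //.
  by rewrite mul1r lerDl.
have [s [ss e hs]] := cnorm_sq_sum sk k1.
have s1 : cnorm s <= 1.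
  apply: (@cnorm_unitary_part _ _ s (r^-1%:C *: h)) => //.
  by rewrite addrC e expr1n scale1r.
split; first by rewrite expr2 starM sh.
exists (r ^+ 2); first exact: sqr_ge0.
have -> : (r ^+ 2)%:C%:A - h ^+ 2 = (r ^+ 2)%:C *: s ^+ 2.
  have -> : s ^+ 2 = 1 - (r^-1%:C *: h) ^+ 2 by rewrite -e addrAC subrr add0r.
  rewrite exprZn scalerBr scalerA -rmorphXn -rmorphM -exprMn.
  by rewrite mulfV ?gt_eqF // expr1n scale1r.
rewrite cnormZr ger0_norm ?sqr_ge0 // ler_piMr ?sqr_ge0 //.
by rewrite (le_trans (cnormM _ _)) // mulr_ile1 ?cnorm_ge0.
Qed.

Lemma cpos_sqrt x : cpos x -> exists y, [/\ cpos y, y ^+ 2 = x &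
  forall z, z * x = x * z -> z * y = y * z].
Proof.
(* [M] may be zero; [M + 1] satisfies the same bound and can be divided by. *)
move=> [sx [M M0 hM]]; pose N := M + 1.
have N0 : 0 < N by rewrite ltr_wpDl.
have hN : cnorm (N%:C%:A - x) <= N.
  rewrite rmorphD scalerDl addrAC (le_trans (cnormD _ _)) // lerD //.
  by rewrite cnormZ1 normr1.
pose k := 1 - N^-1%:C *: x.
have kE : k = N^-1%:C *: (N%:C%:A - x).
  by rewrite scalerBr scalerA -rmorphM mulVf ?gt_eqF // scale1r.
have [||s [ss s2 s1 cs]] := @csqrt _ _ k.
- by rewrite starB star1 starZr sx.
- rewrite kE cnormZr ger0_norm ?invr_ge0 ?(ltW N0) // mulrC ler_pdivrMr //.
  by rewrite mul1r.
have ps : cpos s by split=> //; exists 1 => //; rewrite scale1r.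
exists ((Num.sqrt N)%:C *: s); split; first exact: cposZ.
- rewrite exprZn -rmorphXn sqr_sqrtr ?(ltW N0) // s2 opprB addrC subrK.
  by rewrite scalerA -rmorphM mulfV ?gt_eqF // scale1r.
- move=> z zx; rewrite -scalerAr -scalerAl cs // mulrBr mulrBl mulr1 mul1r.
  by rewrite -scalerAr -scalerAl zx.
Qed.

(** With [y] a square root of [x + d ^ 2], the sum [h ^ 2 + y ^ 2] is the scalar [d ^ 2], so the
    unitary trick gives [cnorm h <= d] for every positive [d]. *)
Lemma sq_add_pos_eq0 h x : star h = h -> cpos x -> h ^+ 2 + x = 0 -> h = 0.
Proof.
move=> sh px e; apply: cnorm_small => d d0.
have [y [[sy _] y2 cy]] := cpos_sqrt (cposD px (cposR (sqr_ge0 d))).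
apply: (@cnorm_unitary_part _ _ h y) => //; last by rewrite y2 addrA e add0r.
apply: cy; have -> : x = - h ^+ 2 by apply/eqP; rewrite -addr_eq0 addrC e.
rewrite mulrDr mulrDl mulrN mulNr -exprS -exprSr.
by rewrite -scalerAr -scalerAl mulr1 mul1r.
Qed.

Lemma sa_sq_eq0 h : star h = h -> h ^+ 2 = 0 -> h = 0.
Proof.
by move=> sh e; apply: (sq_add_pos_eq0 sh cpos0); rewrite addr0.
Qed.

Lemma star_mul_eq0 x : star x * x = 0 -> x = 0.
Proof.
move=> e; apply: cnorm_eq0; apply/eqP; rewrite -sqrf_eq0 -cnorm_star e.
by rewrite cnorm0.
Qed.

Lemma sa_real_imag x : exists h k, [/\ star h = h, star k = k,
  (2 : R)%:C *: x = h - 'i *: k &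
  h ^+ 2 + k ^+ 2 = 2%:C *: (star x * x + x * star x)].
Proof.
exists (x + star x), ('i *: (x - star x)); split.
- by rewrite starD starK addrC.
- rewrite starZc starB starK.
  have -> : conjc ('i : R[i]) = - 'i.
    by apply/eqP; rewrite eq_complex /= oppr0 !eqxx.
  by rewrite scaleNr -scalerN opprB.
- rewrite scalerA -['i * 'i]expr2 sqr_i scaleN1r opprK addrACA subrr addr0.
  by rewrite rmorph_nat scaler_nat.
- rewrite exprZn sqr_i scaleN1r !expr2.
  rewrite rmorph_nat scaler_nat mulr2n !(mulrDr, mulrDl, mulrN, mulNr).
  rewrite !(opprD, opprK) addrACA [X in X + _]addrACA [X in _ + X]addrACA.
  by rewrite !subrr add0r addr0 addrACA.
Qed.

(* For [v := star (u * w)] both [star v * v] and [v * star v] are negative,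
   whereas their sum is a positive multiple of the sum of the squares of the
   real and imaginary parts of [v]. *)
Lemma star_mul_neg_sq u w : star w = w -> star u * u = - w ^+ 2 -> u = 0 :> A.
Proof.
move=> sw uu; pose S := u * star u; pose v := star (u * w).
have sS : star S = S by rewrite starM starK.
have v1 : star v * v = - S ^+ 2.
  rewrite /v starK starM sw mulrA -(mulrA u) -expr2.
  have -> : w ^+ 2 = - (star u * u) by rewrite uu opprK.
  by rewrite mulrN mulNr expr2 /S !mulrA.
have v2 : v * star v = - (w ^+ 2) ^+ 2.
  rewrite /v starK starM sw mulrA -(mulrA w) uu mulrN mulNr.
  by rewrite -exprS -exprSr -exprM.
have sw2 : star (w ^+ 2) = w ^+ 2 by rewrite expr2 starM sw.
have [h [k [sh sk vhk e]]] := sa_real_imag v.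
have p : cpos (2%:C *: (S ^+ 2 + (w ^+ 2) ^+ 2)).
  by apply: cposZ => //; apply: cposD; exact: cpos_sq.
have hk0 : h ^+ 2 + k ^+ 2 + 2%:C *: (S ^+ 2 + (w ^+ 2) ^+ 2) = 0.
  by rewrite e v1 v2 -scalerDr -opprD addNr scaler0.
have h0 : h = 0.
  by apply: (sq_add_pos_eq0 sh (cposD (cpos_sq sk) p)); rewrite addrA.
have k0 : k = 0.
  apply: (sq_add_pos_eq0 sk (cposD (cpos_sq sh) p)).
  by rewrite addrCA addrA.
have v0 : v = 0.
  move: vhk; rewrite h0 k0 scaler0 subrr => /eqP.
  by rewrite scaler_eq0 rmorph_nat pnatr_eq0 /= => /eqP.
have S0 : S = 0.
  apply: (sa_sq_eq0 sS); apply/eqP; rewrite -oppr_eq0 -v1 v0 mulr0.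
  exact/eqP.
by rewrite -(starK u) (star_mul_eq0 (x := star u)) ?star0 // starK.
Qed.

(** Here [y] is the absolute value of [h] and [m = y - h] is twice its negative part, so that
    [m * h * m] is minus a square. By [star_mul_neg_sq] this forces [x * m = 0]; then [m] is
    nilpotent and self-adjoint, hence zero, and [h = y] is positive. *)
Lemma cpos_star_mul x : cpos (star x * x).
Proof.
set h := star x * x.
have sh : star h = h by rewrite starM starK.
have [y [py y2 cy]] := cpos_sqrt (cpos_sq sh).
have [w [[sw _] w2 cw]] := cpos_sqrt py.
have hy : h * y = y * h by apply: cy; rewrite -exprS -exprSr.
have [sy _] := py.
pose m := y - h; have sm : star m = m by rewrite starB sy sh.
have my : m * y = - (m * h).
  by rewrite /m !mulrBl -expr2 y2 hy opprB -expr2.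
have wy : w * y = y * w by rewrite -w2 -exprS -exprSr.
have wm : w * m = m * w.
  suff : m * w = w * m by [].
  apply: cw; rewrite /m mulrBl mulrBr hy -expr2; congr (_ - _).
have mhm : star (x * m) * (x * m) = - (m * w) ^+ 2.
  have -> : (m * w) ^+ 2 = m * y * m.
    by rewrite -w2 !expr2 -{2}wm !mulrA.
  by rewrite my mulNr opprK starM sm mulrA -(mulrA m).
have xm0 : x * m = 0.
  apply: (star_mul_neg_sq (w := m * w)) => //.
  by rewrite starM sw sm wm.
have mhm0 : m * h * m = 0.
  by rewrite -mulrA /h -(mulrA (star x)) xm0 !mulr0.
have m2 : star (m ^+ 2) = m ^+ 2 by rewrite expr2 starM sm.
have m0 : m = 0.
  apply: (sa_sq_eq0 sm); apply: (sa_sq_eq0 m2).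
  have -> : (m ^+ 2) ^+ 2 = m * m ^+ 3 by rewrite -exprM -exprS.
  have -> : m ^+ 3 = m * y * m - m * h * m.
    by rewrite -mulrBl -mulrBr !exprS expr0 mulr1 mulrA.
  by rewrite my mulNr mhm0 oppr0 addr0 mulr0.
by have /eqP := m0; rewrite subr_eq0 => /eqP <-.
Qed.

Lemma neumann k : cnorm k < 1 ->
  exists g : A, g * (1 - k) = 1 /\ (1 - k) * g = 1.
Proof.
move=> k1; have k0 := cnorm_ge0 k.
pose u n : A := \sum_(i < n) k ^+ i.
have kX n : cnorm (k ^+ n) <= cnorm k ^+ n.
  elim: n => [|n IH]; first by rewrite !expr0 cnorm1.
  by rewrite !exprS (le_trans (cnormM _ _)) // ler_wpM2l.
have du m n : (m <= n)%N -> cnorm (u n - u m) <= cnorm k ^+ m / (1 - cnorm k).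
  move=> mn; rewrite ler_pdivlMr ?subr_gt0 //.
  suff h i : cnorm (u (i + m)%N - u m) * (1 - cnorm k) <=
      cnorm k ^+ m - cnorm k ^+ (i + m)%N.
    by rewrite -{1}(subnK mn) (le_trans (h _)) // gerBl exprn_ge0.
  elim: i => [|i IH]; first by rewrite !subrr cnorm0 mul0r.
  have -> : u (i.+1 + m)%N - u m = k ^+ (i + m)%N + (u (i + m)%N - u m).
    by rewrite addSn {1}/u big_ord_recr /= addrAC addrC.
  have := kX (i + m)%N; have := cnormD (k ^+ (i + m)%N) (u (i + m)%N - u m).
  rewrite addSn exprS; nra.
have [|l hl] := @complete_limit _ _ u.
  move=> e e0; have c0 : 0 < e * (1 - cnorm k) by rewrite mulr_gt0 ?subr_gt0.
  have : (cnorm k ^+ n) @[n --> \oo] --> (0 : R).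
    by apply: cvg_expr; rewrite ger0_norm.
  move=> /cvg0P/(_ _ c0)[N hN]; exists N => m n Nm Nn.
  have hi i j : (N <= i)%N -> (i <= j)%N -> cnorm (u j - u i) < e.
    move=> Ni /du/le_lt_trans; apply; rewrite ltr_pdivrMr ?subr_gt0 //.
    by have := hN i Ni; rewrite ger0_norm // exprn_ge0.
  have [mn|/ltnW nm] := leqP m n; last exact: hi.
  by rewrite cnorm_distC hi.
have kl : k * l = l * k.
  apply/eqP; rewrite -subr_eq0; apply/eqP/cnorm_small => e e0.
  have [N /(_ N (leqnn N)) hN] := hl (e / 2) (divr_gt0 e0 (ltr0Sn _ _)).
  have cu : k * u N = u N * k.
    by rewrite mulr_sumr mulr_suml; apply: eq_bigr => i _; rewrite -exprS exprSr.
  have -> : k * l - l * k = k * (l - u N) + (u N - l) * k.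
    by rewrite mulrBr mulrBl cu addrA subrK.
  have := cnormD (k * (l - u N)) ((u N - l) * k).
  have := cnormM k (l - u N); have := cnormM (u N - l) k.
  rewrite (cnorm_distC l); have := cnorm_ge0 (u N - l); nra.
have l1 : l - k * l = 1.
  apply/eqP; rewrite -subr_eq0; apply/eqP/cnorm_small => e e0.
  have [N hN] := hl (e / 2) (divr_gt0 e0 (ltr0Sn _ _)).
  have h1 := hN N (leqnn N); have h2 := hN N.+1 (leqnSn N).
  have uu : u N.+1 = 1 + k * u N.
    rewrite /u big_ord_recl expr0 mulr_sumr; congr (_ + _).
    by apply: eq_bigr => i _; rewrite -exprS.
  have -> : l - k * l - 1 = k * (u N - l) - (u N.+1 - l).
    by rewrite mulrBr uu opprB opprD [RHS]addrC !addrA subrK addrAC.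
  have := cnormB (k * (u N - l)) (u N.+1 - l); have := cnormM k (u N - l).
  have := cnorm_ge0 (u N - l); nra.
by exists l; split; [rewrite mulrBr mulr1 -kl | rewrite mulrBl mul1r].
Qed.

(** Dividing by [M] gives [1 - k] with [cnorm k < 1], which has an inverse by the Neumann series and
    a square root [s]; [g] is the inverse of [s] divided by the square root of [M]. *)
Lemma sqrt_inv_near_scalar x M : 0 < M -> star x = x ->
  cnorm (M%:C%:A - x) < M -> exists g, g * x * star g = 1.
Proof.
move=> M0 sx hM; pose k := 1 - M^-1%:C *: x.
have kE : k = M^-1%:C *: (M%:C%:A - x).
  by rewrite scalerBr scalerA -rmorphM mulVf ?gt_eqF // scale1r.
have k1 : cnorm k < 1.
  rewrite kE cnormZr ger0_norm ?invr_ge0 ?(ltW M0) // mulrC ltr_pdivrMr //.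
  by rewrite mul1r.
have [||s [ss s2 _ _]] := @csqrt _ _ k; last 1 first.
- have [g [g1 g2]] := neumann k1.
  have gs : g * s * s = 1 by rewrite -mulrA -expr2 s2.
  have sg : s * (s * g) = 1 by rewrite mulrA -expr2 s2.
  have gss : g * s = s * g.
    have : g * s * (s * (s * g)) = g * s by rewrite sg mulr1.
    by rewrite (mulrA (g * s)) gs mul1r.
  pose q := g * s; have q1 : s * q = 1 by rewrite /q gss.
  have sq : star q = q.
    have : star q * (s * q) = q by rewrite mulrA -{1}ss -starM q1 star1 mul1r.
    by rewrite q1 mulr1.
  have xE : x = M%:C *: s ^+ 2.
    rewrite s2 opprB addrC subrK scalerA -rmorphM mulfV ?gt_eqF //.
    by rewrite scale1r.
  exists ((Num.sqrt M)^-1%:C *: q).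
  rewrite starZr sq xE -!scalerAr -!scalerAl !scalerA -!rmorphM.
  rewrite expr2 (mulrA q) -/q gs mul1r q1.
  by rewrite mulrCA -invfM -expr2 sqr_sqrtr ?ltW // mulfV ?gt_eqF // scale1r.
- by rewrite starB star1 starZr sx.
- exact: ltW.
Qed.

(** The closure of the finite sums of [x * c * y] is a closed two-sided ideal containing [c], hence
    everything. *)
Lemma simple_near c eps : simple_cstar A -> c != 0 -> 0 < eps ->
  exists s : seq (A * A), cnorm (1 - \sum_(p <- s) p.1 * c * p.2) < eps.
Proof.
move=> simA c0 eps0.
pose S := [set z | exists s : seq (A * A), z = \sum_(p <- s) p.1 * c * p.2].
have [||||I0|IT] := simA (cclosure S) _ _ _ _.
- move=> z hz e e0; have [y hy zy] := hz (e / 2) (divr_gt0 e0 (ltr0Sn _ _)).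
  have [w Sw yw] := hy (e / 2) (divr_gt0 e0 (ltr0Sn _ _)).
  by exists w => //; have := cnorm_tri y z w; lra.
- by move=> e e0; exists 0; [exists [::]; rewrite big_nil | rewrite subrr cnorm0].
- move=> x y hx hy e e0.
  have [x' [s ->] xx] := hx (e / 2) (divr_gt0 e0 (ltr0Sn _ _)).
  have [y' [t ->] yy] := hy (e / 2) (divr_gt0 e0 (ltr0Sn _ _)).
  exists (\sum_(p <- s ++ t) p.1 * c * p.2); first by exists (s ++ t).
  rewrite big_cat /= opprD addrACA (le_lt_trans (cnormD _ _)) //; lra.
- move=> a x hx.
  have bnd e : 0 < e -> exists2 s : seq (A * A),
      cnorm (a * x - \sum_(p <- s) (a * p.1) * c * p.2) < e &
      cnorm (x * a - \sum_(p <- s) p.1 * c * (p.2 * a)) < e.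
    move=> e0; have d0 : 0 < e / (cnorm a + 1).
      by rewrite divr_gt0 // ltr_wpDl ?cnorm_ge0.
    have [_ [s ->] h] := hx _ d0; exists s.
      have -> : \sum_(p <- s) a * p.1 * c * p.2 = a * \sum_(p <- s) p.1 * c * p.2.
        by rewrite mulr_sumr; apply: eq_bigr => p _; rewrite !mulrA.
      rewrite -mulrBr (le_lt_trans (cnormM _ _)) //.
      move: h; rewrite ltr_pdivlMr ?ltr_wpDl ?cnorm_ge0 //.
      by have := cnorm_ge0 (x - \sum_(p <- s) p.1 * c * p.2); nra.
    have -> : \sum_(p <- s) p.1 * c * (p.2 * a) = (\sum_(p <- s) p.1 * c * p.2) * a.
      by rewrite mulr_suml; apply: eq_bigr => p _; rewrite !mulrA.
    rewrite -mulrBl (le_lt_trans (cnormM _ _)) //.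
    move: h; rewrite ltr_pdivlMr ?ltr_wpDl ?cnorm_ge0 //.
    by have := cnorm_ge0 (x - \sum_(p <- s) p.1 * c * p.2); nra.
  split=> e /bnd[s h1 h2].
    exists (\sum_(p <- s) a * p.1 * c * p.2) => //.
    by exists [seq (a * p.1, p.2) | p <- s]; rewrite big_map.
  exists (\sum_(p <- s) p.1 * c * (p.2 * a)) => //.
  by exists [seq (p.1, p.2 * a) | p <- s]; rewrite big_map.
- have : cclosure S c.
    move=> e e0; exists c; last by rewrite subrr cnorm0.
    by exists [:: (1, 1)]; rewrite big_seq1 mul1r mulr1.
  by rewrite I0 => /eqP; rewrite (negbTE c0).
- have : cclosure S 1 by rewrite IT.
  by move=> /(_ eps eps0)[_ [s ->] hz]; exists s.
Qed.

(** Polarisation: conjugating [c] by [p.1 + star p.2] yields [p.1 * c * p.2], its adjoint and two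
    positive terms. The mixed terms sum to nearly 2, so the total is invertible and can be
    normalised to exactly 1 by a further conjugation. *)
Lemma simple_full c : simple_cstar A -> positive c -> c != 0 ->
  exists s : seq A, \sum_(x <- s) x * c * star x = 1.
Proof.
move=> simA [b cb] c0.
have [s hz] := simple_near simA c0 (divr_gt0 ltr01 (ltr0Sn R 1)).
set z := \sum_(p <- s) _ in hz.
pose w (p : A * A) := p.1 + star p.2.
have sc : star c = c by rewrite cb starM starK.
pose E := \sum_(p <- s) (p.1 * c * star p.1 + star p.2 * c * p.2).
have wE : \sum_(p <- s) w p * c * star (w p) = (z + star z) + E.
  rewrite star_sum -!big_split; apply: eq_bigr => p _ /=.
  rewrite starD starK !starM sc !mulrA !mulrDl !mulrDr.
  by rewrite [X in X + _ = _]addrC addrACA.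
have pE : cpos E.
  apply: cpos_sum => p; apply: cposD.
    by rewrite cb mulrA -{1}(starK p.1) -starM -mulrA; exact: cpos_star_mul.
  by rewrite cb mulrA -starM -mulrA; exact: cpos_star_mul.
have [sE [M M0 hM]] := pE.
(* In the scalar [M + 2], [M] accounts for [E] and 2 for [z + star z]; since [z] is within one half
   of 1, the distance stays below [M + 1]. *)
have [|||g hg] := @sqrt_inv_near_scalar ((z + star z) + E) (M + 2).
- by rewrite ltr_wpDl.
- by rewrite !starD starK sE [star z + z]addrC.
- have -> : (M + 2)%:C%:A - (z + star z + E) =
      (M%:C%:A - E) + ((1 - z) + star (1 - z)).
    rewrite rmorphD scalerDl [z + _ + _]addrC opprD addrACA starB star1.
    by congr (_ + _); rewrite rmorph_nat scaler_nat mulr2n opprD addrACA.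
  have := cnormD (M%:C%:A - E) ((1 - z) + star (1 - z)).
  have := cnormD (1 - z) (star (1 - z)); rewrite cnorm_st; lra.
exists [seq g * w p | p <- s]; rewrite big_map -hg -wE.
rewrite mulr_sumr mulr_suml; apply: eq_bigr => p _.
by rewrite starM !mulrA.
Qed.

End CStarPositive.

Section StarHom.
Variables (R : realType) (A B : cstarType R) (f : {lrmorphism A -> B}).
Hypothesis sf : star_hom f.

(** Being the real part of a unitary is an algebraic relation and survives [f]; this settles
    self-adjoint elements, and the C*-identity the others. *)
Lemma star_hom_contractive x : cnorm (f x) <= cnorm x.
Proof.
have sa h : star h = h -> cnorm (f h) <= cnorm h.
  move=> sh; have [->|h0] := eqVneq h 0; first by rewrite raddf0 !cnorm0.
  have r0 : 0 < cnorm h.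
    by rewrite lt0r cnorm_ge0 andbT; apply: contra_neq h0 => /cnorm_eq0.
  have sk : star ((cnorm h)^-1%:C *: h) = (cnorm h)^-1%:C *: h.
    by rewrite starZr sh.
  have k1 : cnorm ((cnorm h)^-1%:C *: h) <= 1.
    by rewrite cnormZr ger0_norm ?invr_ge0 ?cnorm_ge0 // mulVf ?gt_eqF.
  have [s [ss e hs]] := cnorm_sq_sum sk k1.
  have : cnorm (f ((cnorm h)^-1%:C *: h)) <= 1.
    apply: (@cnorm_unitary_part _ _ _ (f s)) => //.
    - by rewrite -sf sk.
    - by rewrite -sf ss.
    - by rewrite -!rmorphM hs.
    - by rewrite -!rmorphXn -rmorphD e rmorph1 expr1n scale1r.
  rewrite linearZ cnormZr ger0_norm ?invr_ge0 ?cnorm_ge0 //.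
  by rewrite mulrC ler_pdivrMr // mul1r.
rewrite -(@ler_pXn2r _ 2) ?nnegrE ?cnorm_ge0 // -!cnorm_star -sf -rmorphM.
by apply: sa; rewrite starM starK.
Qed.

End StarHom.

(** * Continuous paths of matrices and orthonormal frames *)

Section ComplexNorm.
Variable R : realType.
Implicit Types (z w : R[i]) (r : R).

(** The modulus with values in [R]; the norm written [|z|] takes values in [R[i]]. *)
Definition nc z : R := Normc.normc z.

Lemma ncE z : `|z| = (nc z)%:C. Proof. by []. Qed.
Lemma nc_ge0 z : 0 <= nc z.
Proof. by rewrite -ler0c -ncE. Qed.
Lemma nc0 : nc 0 = 0. Proof. exact: Normc.normc0. Qed.
Lemma nc1 : nc 1 = 1. Proof. exact: Normc.normc1. Qed.
Lemma ncM z w : nc (z * w) = nc z * nc w. Proof. exact: Normc.normcM. Qed.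
Lemma ncD z w : nc (z + w) <= nc z + nc w. Proof. exact: le_normcD. Qed.
Lemma ncN z : nc (- z) = nc z.
Proof. by apply: complexI; rewrite -!ncE normrN. Qed.
Lemma ncJ z : nc (conjc z) = nc z.
Proof. by apply: complexI; rewrite -!ncE normcJ. Qed.
Lemma nc_real r : nc r%:C = `|r|.
Proof. by apply: complexI; rewrite -ncE normc_real. Qed.
Lemma nc_eq0 z : nc z = 0 -> z = 0. Proof. exact: Normc.eq0_normc. Qed.
Lemma nc_gt0 z : z != 0 -> 0 < nc z.
Proof. by move=> z0; rewrite lt0r nc_ge0 andbT; apply: contra_neq z0 => /nc_eq0. Qed.
Lemma nc_Re z : `|complex.Re z| <= nc z.
Proof. by rewrite -lecR -ncE normc_ge_Re. Qed.
Lemma nc_sqr z : nc z ^+ 2 = complex.Re z ^+ 2 + complex.Im z ^+ 2.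
Proof.
by case: z => a b; rewrite /nc /= sqr_sqrtr // addr_ge0 ?sqr_ge0.
Qed.
Lemma nc_Im z : `|complex.Im z| <= nc z.
Proof.
rewrite -(@ler_pXn2r _ 2) ?nnegrE ?nc_ge0 // nc_sqr real_normK ?num_real //.
by rewrite lerDr sqr_ge0.
Qed.
Lemma nc_le z : nc z <= `|complex.Re z| + `|complex.Im z|.
Proof.
rewrite -(@ler_pXn2r _ 2) ?nnegrE ?nc_ge0 ?addr_ge0 // nc_sqr sqrrD.
by rewrite !real_normK ?num_real // addrAC lerDl mulrn_wge0 // mulr_ge0.
Qed.
Lemma nc_dist z w : `|nc z - nc w| <= nc (z - w).
Proof.
have := ncD (z - w) w; have := ncD (w - z) z.
by rewrite !subrK -(ncN (w - z)) opprB ler_norml; lra.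
Qed.
Lemma nc_sum (I : Type) (s : seq I) (P : pred I) (F : I -> R[i]) :
  nc (\sum_(i <- s | P i) F i) <= \sum_(i <- s | P i) nc (F i).
Proof.
elim/big_rec2: _ => [|i x y _ h]; first by rewrite nc0.
by rewrite (le_trans (ncD _ _)) // lerD2l.
Qed.
Lemma cReD z w : complex.Re (z + w) = complex.Re z + complex.Re w.
Proof. by case: z w => ? ? []. Qed.
Lemma cReN z : complex.Re (- z) = - complex.Re z. Proof. by case: z. Qed.
Lemma cImD z w : complex.Im (z + w) = complex.Im z + complex.Im w.
Proof. by case: z w => ? ? []. Qed.
Lemma cReMr r z : complex.Re (r%:C * z) = r * complex.Re z.
Proof. by case: z => a b /=; rewrite mul0r subr0. Qed.
Lemma cRe_sum (I : Type) (s : seq I) (P : pred I) (F : I -> R[i]) :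
  complex.Re (\sum_(i <- s | P i) F i) = \sum_(i <- s | P i) complex.Re (F i).
Proof. exact: (big_morph _ cReD erefl). Qed.
Lemma nc_sqrC z : conjc z * z = (nc z ^+ 2)%:C.
Proof.
case: z => a b; rewrite nc_sqr; apply/eqP; rewrite eq_complex /=.
by apply/andP; split; apply/eqP; ring.
Qed.
End ComplexNorm.

Section Continuity.
Variable R : realType.
Implicit Types (f g : R -> R[i]) (a b : R -> R) (t s e d : R).

(** Continuity on the unit interval alone, in epsilon-delta form, so that values outside it never
    enter, as in [dimdrop]. *)
Definition contC f := forall t, 0 <= t <= 1 -> forall e, 0 < e ->
  exists2 d, 0 < d & forall s, 0 <= s <= 1 -> `|s - t| < d -> nc (f s - f t) < e.

Definition contR a := contC (fun t => (a t)%:C).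

Lemma contRP a : contR a <-> forall t, 0 <= t <= 1 -> forall e, 0 < e ->
  exists2 d, 0 < d & forall s, 0 <= s <= 1 -> `|s - t| < d -> `|a s - a t| < e.
Proof.
split=> h t t01 e e0; have [d d0 hd] := h t t01 e e0; exists d => // s s01 st.
  by have := hd s s01 st; rewrite -rmorphB nc_real.
by rewrite -rmorphB nc_real hd.
Qed.

Lemma contC_eq f g : (forall t, 0 <= t <= 1 -> f t = g t) -> contC f -> contC g.
Proof.
move=> fg h t t01 e e0; have [d d0 hd] := h t t01 e e0; exists d => // s s01 st.
by rewrite -!fg // hd.
Qed.

Lemma contC_cst z : contC (fun=> z).
Proof. by move=> t _ e e0; exists 1 => // s _ _; rewrite subrr nc0. Qed.

Lemma contCD f g : contC f -> contC g -> contC (fun t => f t + g t).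
Proof.
move=> hf hg t t01 e e0.
have [d d0 hd] := hf t t01 (e / 2) (divr_gt0 e0 (ltr0Sn _ _)).
have [c c0 hc] := hg t t01 (e / 2) (divr_gt0 e0 (ltr0Sn _ _)).
exists (Num.min d c) => [|s s01]; first by rewrite lt_min d0.
rewrite lt_min => /andP[/(hd s s01) h1 /(hc s s01) h2].
by rewrite opprD addrACA; have := ncD (f s - f t) (g s - g t); lra.
Qed.

Lemma contCM f g : contC f -> contC g -> contC (fun t => f t * g t).
Proof.
move=> hf hg t t01 e e0.
pose B := nc (f t) + nc (g t) + 1.
have B0 : 0 < B by rewrite ltr_wpDl // addr_ge0 // nc_ge0.
have c0 : 0 < Num.min 1 (e / B) by rewrite lt_min ltr01 divr_gt0.
have [d d0 hd] := hf t t01 _ c0; have [c cc0 hc] := hg t t01 _ c0.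
exists (Num.min d c) => [|s s01]; first by rewrite lt_min d0.
rewrite lt_min => /andP[/(hd s s01) + /(hc s s01)].
rewrite !lt_min !ltr_pdivlMr // => /andP[h1 h2] /andP[h3 h4].
have -> : f s * g s - f t * g t =
    (f s - f t) * (g s - g t) + ((f s - f t) * g t + f t * (g s - g t)) by ring.
have := ncD ((f s - f t) * (g s - g t)) ((f s - f t) * g t + f t * (g s - g t)).
have := ncD ((f s - f t) * g t) (f t * (g s - g t)); rewrite !ncM.
move: h1 h2 h3 h4; rewrite /B.
have := nc_ge0 (f s - f t); have := nc_ge0 (g s - g t).
have := nc_ge0 (f t); have := nc_ge0 (g t).
move: (nc (f s - f t)) (nc (g s - g t)) (nc (f t)) (nc (g t)) => x y u v.
move=> v0 u0 y0 x0 x1 xe y1 ye h1 h2.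
pose M := Num.max x y.
have xM : x <= M by rewrite le_max lexx.
have yM : y <= M by rewrite le_max lexx orbT.
have M1 : M < 1 by rewrite gt_max x1.
have ME : M * (u + v + 1) < e by rewrite /M; case: (leP x y).
have : x * y <= M by nra.
have : x * v <= M * v by nra.
have : u * y <= u * M by nra.
nra.
Qed.

Lemma contC_sum (I : Type) (r : seq I) (P : pred I) (F : I -> R -> R[i]) :
  (forall i, P i -> contC (F i)) -> contC (fun t => \sum_(i <- r | P i) F i t).
Proof.
move=> h; elim: r => [|i r IH].
  by apply: contC_eq (contC_cst 0) => t _; rewrite big_nil.
case Pi: (P i); last by apply: contC_eq IH => t _; rewrite big_cons Pi.
apply: contC_eq (contCD (h i Pi) IH) => t _.
by rewrite big_cons Pi.
Qed.

Lemma contC_lip (h : R[i] -> R[i]) f : (forall z w, nc (h z - h w) <= nc (z - w)) ->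
  contC f -> contC (fun t => h (f t)).
Proof.
move=> hh hf t t01 e e0; have [d d0 hd] := hf t t01 e e0; exists d => // s s01 st.
exact: le_lt_trans (hh _ _) (hd s s01 st).
Qed.

Lemma contC_conj f : contC f -> contC (fun t => conjc (f t)).
Proof. by apply: contC_lip => z w; rewrite -rmorphB ncJ. Qed.

Lemma contCN f : contC f -> contC (fun t => - f t).
Proof. by apply: contC_lip => z w; rewrite -opprD ncN. Qed.

Lemma contR_Re f : contC f -> contR (fun t => complex.Re (f t)).
Proof.
apply: (contC_lip (h := fun z => (complex.Re z)%:C)) => z w.
by rewrite -rmorphB nc_real -cReN -cReD nc_Re.
Qed.

Lemma contR_Im f : contC f -> contR (fun t => complex.Im (f t)).
Proof.
apply: (contC_lip (h := fun z => (complex.Im z)%:C)) => z w.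
by rewrite -rmorphB nc_real (_ : _ - _ = complex.Im (z - w)) ?nc_Im //; case: z w => ? ? [].
Qed.

Lemma contR_nc f : contC f -> contR (fun t => nc (f t)).
Proof.
apply: (contC_lip (h := fun z => (nc z)%:C)) => z w.
by rewrite -rmorphB nc_real nc_dist.
Qed.

Lemma contR_cst r : contR (fun=> r). Proof. exact: contC_cst. Qed.

Lemma contR_id : contR id.
Proof.
by move=> t _ e e0; exists e => // s _; rewrite -rmorphB nc_real.
Qed.

Lemma contRD a b : contR a -> contR b -> contR (fun t => a t + b t).
Proof. by move=> ha /(contCD ha); apply: contC_eq => t _; rewrite rmorphD. Qed.

Lemma contRM a b : contR a -> contR b -> contR (fun t => a t * b t).
Proof. by move=> ha /(contCM ha); apply: contC_eq => t _; rewrite rmorphM. Qed.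

Lemma contRN a : contR a -> contR (fun t => - a t).
Proof. by move=> /contCN; apply: contC_eq => t _; rewrite rmorphN. Qed.

Lemma contR_abs a : contR a -> contR (fun t => `|a t|).
Proof. by move=> /contR_nc; apply: contC_eq => t _; rewrite nc_real. Qed.

Lemma contR_max a b : contR a -> contR b -> contR (fun t => Num.max (a t) (b t)).
Proof.
move=> ha hb; have hab := contR_abs (contRD ha (contRN hb)).
have := contRM (contRD (contRD ha hb) hab) (contR_cst 2^-1).
by apply: contC_eq => t _; rewrite maxr_absE.
Qed.

Lemma contR_min a b : contR a -> contR b -> contR (fun t => Num.min (a t) (b t)).
Proof.
move=> ha hb; have hab := contR_abs (contRD ha (contRN hb)).
have := contRM (contRD (contRD ha hb) (contRN hab)) (contR_cst 2^-1).
by apply: contC_eq => t _; rewrite minr_absE.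
Qed.

Lemma contR_comp (h : R -> R) a : (forall x, {for x, continuous h}) -> contR a ->
  contR (fun t => h (a t)).
Proof.
move=> hh /contRP ha; apply/contRP => t t01 e e0.
have /cvgrPdist_lt/(_ e e0)/nbhs_ballP[c /= c0 hc] := hh (a t).
have [d d0 hd] := ha t t01 c c0; exists d => // s s01 st.
by rewrite distrC; apply: hc; rewrite /ball /= distrC hd.
Qed.

Lemma contR_sqrt a : contR a -> contR (fun t => Num.sqrt (a t)).
Proof. by apply: contR_comp => x; exact: sqrt_continuous. Qed.

Lemma contR_inv a : (forall t, 0 <= t <= 1 -> a t != 0) -> contR a ->
  contR (fun t => (a t)^-1).
Proof.
move=> a0 /contRP ha; apply/contRP => t t01 e e0.
have /cvgrPdist_lt/(_ e e0)/nbhs_ballP[c /= c0 hc] := inv_continuous (a0 t t01).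
have [d d0 hd] := ha t t01 c c0; exists d => // s s01 st.
by rewrite distrC; apply: hc; rewrite /ball /= distrC hd.
Qed.

Lemma within_contR a : contR a -> {within `[0, 1], continuous a}.
Proof.
move=> /contRP h; apply/subspace_continuousP => t; rewrite /= in_itv /= => t01.
apply/cvgrPdist_lt => e e0; have [d d0 hd] := h t t01 e e0.
near=> s; rewrite distrC; apply: hd.
  by near: s; apply: withinT => //= s; rewrite in_itv.
near: s; apply: cvg_within; apply/nbhs_ballP; exists d => // s.
by rewrite /ball /= distrC.
Unshelve. all: by end_near.
Qed.

Lemma contR_min_pos a : contR a -> (forall t, 0 <= t <= 1 -> 0 < a t) ->
  exists2 m, 0 < m & forall t, 0 <= t <= 1 -> m <= a t.
Proof.
move=> /within_contR ha a0; have [c c01 hc] := EVT_min ler01 ha.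
exists (a c); first by apply: a0; move: c01; rewrite in_itv.
by move=> t t01; apply: hc; rewrite in_itv /=.
Qed.

Lemma contC_bounded f : contC f -> exists2 K, 0 < K &
  forall t, 0 <= t <= 1 -> nc (f t) <= K.
Proof.
move=> /contR_nc/within_contR ha; have [c c01 hc] := EVT_max ler01 ha.
exists (nc (f c) + 1); first by rewrite ltr_wpDl ?nc_ge0.
by move=> t t01; rewrite ler_wpDr // hc // inE /= in_itv.
Qed.

Lemma mx_contP n (f : R -> 'M[R[i]^o]_n) : {within `[0, 1], continuous f} <->
  forall i j, contC (fun t => f t i j).
Proof.
split=> [/subspace_continuousP h i j t t01 e e0|h].
  have /cvg_ballP/(_ e%:C) := h t t01; rewrite ltcR => /(_ e0) /nbhs_ballP[d /= d0 hd].
  exists d => // s s01 st; have := hd s; rewrite /ball /= distrC => /(_ st s01)[_].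
  by move=> /(_ i j); rewrite /ball /= ncE ltcR -ncN opprB.
apply/subspace_continuousP => t; rewrite /= in_itv /= => t01.
apply/cvg_ballP => e e0.
have [r re r0] : exists2 r, e = r%:C & 0 < r.
    by case: e e0 => x y; rewrite ltcE => /andP[/= /eqP -> x0]; exists x.
have /choice[d hd] : forall p : 'I_n * 'I_n, exists d, 0 < d /\ forall s,
    0 <= s <= 1 -> `|s - t| < d -> nc (f s p.1 p.2 - f t p.1 p.2) < r.
  by move=> [i j]; have [d d0 hd] := h i j t t01 r r0; exists d.
have d0 : 0 < \big[Num.min/1]_p d p.
  by elim/big_ind: _ => // [x y x0 y0|p _]; [rewrite lt_min x0 | case: (hd p)].
near=> s; split=> // i j; rewrite /ball /= ncE re ltcR -ncN opprB.
apply: (hd (i, j)).2.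
  by near: s; apply: withinT => //= s; rewrite in_itv.
apply: (@lt_le_trans _ _ (\big[Num.min/1]_p d p)); last exact: bigmin_le_cond.
near: s; apply: cvg_within; apply/nbhs_ballP.
by exists (\big[Num.min/1]_p d p) => // s; rewrite /ball /= distrC.
Unshelve. all: by end_near.
Qed.

Lemma contC_unif f e : contC f -> 0 < e -> exists2 d, 0 < d &
  forall s t, 0 <= s <= 1 -> 0 <= t <= 1 -> `|s - t| < d -> nc (f s - f t) < e.
Proof.
move=> hf e0.
have /compact_near_coveringP h := @segment_compact R 0 1.
pose P d t := 0 <= t <= 1 -> forall s, 0 <= s <= 1 -> `|s - t| < d ->
  nc (f s - f t) < e.
have /= : \forall d \near 0^'+, `[0, 1]%classic `<=` P d.
  apply: h => x; rewrite /= in_itv /= => x01.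
  have [d d0 hd] := hf x x01 (e / 2) (divr_gt0 e0 (ltr0Sn _ _)).
  near=> y c => /= y01 s s01 sy.
  have yx : `|y - x| < d / 2.
    near: y; apply/nbhs_ballP; exists (d / 2); first by rewrite /= divr_gt0.
    by move=> y; rewrite /ball /= distrC.
  have cd : c < d / 2 by near: c; apply: nbhs_right_lt; rewrite divr_gt0.
  have h1 : nc (f y - f x) < e / 2 by apply: hd => //; lra.
  have h2 : nc (f s - f x) < e / 2.
    apply: hd => //; have -> : s - x = (s - y) + (y - x) by ring.
    by rewrite (le_lt_trans (ler_normD _ _)) //; lra.
  have -> : f s - f y = (f s - f x) - (f y - f x) by ring.
  by have := ncD (f s - f x) (- (f y - f x)); rewrite ncN; lra.
move=> hn; near (0 : R)^'+ => d.
have d0 : 0 < d by near: d; exact: nbhs_right_gt.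
have hd : `[0, 1]%classic `<=` P d by near: d.
by exists d => // s t s01 t01; apply: hd => //; rewrite /= in_itv.
Unshelve. all: by end_near.
Qed.

Lemma contC_unif_fam (T : finType) (F : T -> R -> R[i]) e :
  (forall i, contC (F i)) -> 0 < e -> exists2 d, 0 < d & forall i s t,
    0 <= s <= 1 -> 0 <= t <= 1 -> `|s - t| < d -> nc (F i s - F i t) < e.
Proof.
move=> h e0; have /choice[d hd] : forall i, exists d, 0 < d /\ forall s t,
    0 <= s <= 1 -> 0 <= t <= 1 -> `|s - t| < d -> nc (F i s - F i t) < e.
  by move=> i; have [d d0 hd] := contC_unif (h i) e0; exists d.
exists (\big[Num.min/1]_i d i).
  by elim/big_ind: _ => // [x y x0 y0|p _]; [rewrite lt_min x0 | case: (hd p)].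
move=> i s t s01 t01 st; apply: (hd i).2 => //.
by rewrite (lt_le_trans st) // bigmin_le_cond.
Qed.

End Continuity.

(** * Orthonormal families with prescribed ranges *)

Section Adjoint.
Variable R : realType.
Local Notation C := R[i].

Definition adj m n (X : 'M[C]_(m, n)) : 'M[C]_(n, m) := map_mx (@conjc R) X^T.

Lemma adjE m n (X : 'M[C]_(m, n)) i j : adj X i j = conjc (X j i).
Proof. by rewrite !mxE. Qed.

Lemma adjK m n (X : 'M[C]_(m, n)) : adj (adj X) = X.
Proof. by apply/matrixP => i j; rewrite !adjE conjcK. Qed.

Lemma adjM m n p (X : 'M[C]_(m, n)) (Y : 'M[C]_(n, p)) :
  adj (X *m Y) = adj Y *m adj X.
Proof. by rewrite /adj trmx_mul map_mxM. Qed.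

Lemma adjD m n (X Y : 'M[C]_(m, n)) : adj (X + Y) = adj X + adj Y.
Proof. by apply/matrixP => i j; rewrite !mxE rmorphD. Qed.

Lemma adjB m n (X Y : 'M[C]_(m, n)) : adj (X - Y) = adj X - adj Y.
Proof. by apply/matrixP => i j; rewrite !mxE rmorphB. Qed.

Lemma adjZ m n (c : C) (X : 'M[C]_(m, n)) : adj (c *: X) = conjc c *: adj X.
Proof. by apply/matrixP => i j; rewrite !mxE rmorphM. Qed.

Lemma adj0 m n : adj (0 : 'M[C]_(m, n)) = 0.
Proof. by apply/matrixP => i j; rewrite !mxE rmorph0. Qed.

Lemma adj1 n : adj (1%:M : 'M[C]_n) = 1%:M.
Proof. by apply/matrixP => i j; rewrite !mxE conjc_nat eq_sym. Qed.

Lemma adj_sum m n (I : Type) (s : seq I) (P : pred I) (F : I -> 'M[C]_(m, n)) :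
  adj (\sum_(i <- s | P i) F i) = \sum_(i <- s | P i) adj (F i).
Proof. exact: (big_morph _ (@adjD m n) (adj0 m n)). Qed.

Definition dot n (u v : 'cV[C]_n) : C := (adj u *m v) 0 0.

Lemma dotE n (u v : 'cV[C]_n) : dot u v = \sum_i conjc (u i 0) * v i 0.
Proof. by rewrite /dot mxE; apply: eq_bigr => i _; rewrite adjE. Qed.

Lemma mul_adj_dot n (u v : 'cV[C]_n) : adj u *m v = (dot u v)%:M.
Proof. by rewrite [LHS]mx11_scalar. Qed.

Lemma dotC n (u v : 'cV[C]_n) : dot v u = conjc (dot u v).
Proof. by rewrite /dot -[in LHS](adjK u) -adjM adjE. Qed.

Lemma dotDr n (u v w : 'cV[C]_n) : dot u (v + w) = dot u v + dot u w.
Proof. by rewrite /dot mulmxDr mxE. Qed.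

Lemma dotZr n c (u v : 'cV[C]_n) : dot u (c *: v) = c * dot u v.
Proof. by rewrite /dot -scalemxAr mxE. Qed.

Lemma dotDl n (u v w : 'cV[C]_n) : dot (u + v) w = dot u w + dot v w.
Proof. by rewrite /dot adjD mulmxDl mxE. Qed.

Lemma dotZl n c (u v : 'cV[C]_n) : dot (c *: u) v = conjc c * dot u v.
Proof. by rewrite /dot adjZ -scalemxAl mxE. Qed.

Lemma dot_adj m n (X : 'M[C]_(m, n)) u v : dot (adj X *m u) v = dot u (X *m v).
Proof. by rewrite /dot adjM adjK mulmxA. Qed.

Definition sqn n (u : 'cV[C]_n) : R := \sum_i nc (u i 0) ^+ 2.

Lemma dot_sqn n (u : 'cV[C]_n) : dot u u = (sqn u)%:C.
Proof.
by rewrite dotE rmorph_sum; apply: eq_bigr => i _; rewrite nc_sqrC.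
Qed.

Lemma sqn_ge0 n (u : 'cV[C]_n) : 0 <= sqn u.
Proof. by apply: sumr_ge0 => i _; exact: sqr_ge0. Qed.

Lemma sqn_gt0 n (u : 'cV[C]_n) : u != 0 -> 0 < sqn u.
Proof.
move=> u0; rewrite lt0r sqn_ge0 andbT; apply: contra u0 => /eqP e.
apply/eqP/matrixP => i j; rewrite mxE ord1; apply: nc_eq0; apply/eqP.
rewrite -sqrf_eq0; apply/eqP; apply: le_anti; rewrite sqr_ge0 andbT -e.
by rewrite /sqn (bigD1 i) //= lerDl sumr_ge0 // => k _; exact: sqr_ge0.
Qed.

Lemma sqnD n (u v : 'cV[C]_n) :
  sqn (u + v) = sqn u + sqn v + 2 * complex.Re (dot u v).
Proof.
apply: complexI; rewrite -dot_sqn dotDl !dotDr !dot_sqn (dotC u v).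
by case: (dot u v) => a b; rewrite !rmorphD /=; apply/eqP; rewrite eq_complex /=;
  apply/andP; split; apply/eqP; ring.
Qed.

Lemma sqnZ n (c : C) (u : 'cV[C]_n) : sqn (c *: u) = nc c ^+ 2 * sqn u.
Proof. by rewrite mulr_sumr; apply: eq_bigr => i _; rewrite mxE ncM exprMn. Qed.

Lemma sqn_entry n (u : 'cV[C]_n) i : nc (u i 0) ^+ 2 <= sqn u.
Proof.
by rewrite /sqn (bigD1 i) //= lerDl sumr_ge0 // => k _; exact: sqr_ge0.
Qed.

Lemma sqn_big_entry n (u : 'cV[C]_n) e : 0 <= e -> n%:R * e ^+ 2 < sqn u ->
  exists i, e < nc (u i 0).
Proof.
move=> e0 h; apply: contrapT => hN; move: h; apply/negP; rewrite -leNgt.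
have hi i : nc (u i 0) ^+ 2 <= e ^+ 2.
  rewrite ler_pXn2r ?nnegrE ?nc_ge0 // leNgt; apply/negP => ei.
  by apply: hN; exists i.
rewrite (le_trans (ler_sum _ (fun i _ => hi i))) //.
by rewrite sumr_const card_ord mulr_natl.
Qed.

(** The index type is [nat] and only the first [n] vectors count, so that a family is extended or
    truncated without changing its type. *)
Definition orthon d n (v : nat -> 'cV[C]_d) := forall r s, (r < n)%N -> (s < n)%N ->
  dot (v r) (v s) = (r == s)%:R.

Definition proj d n (v : nat -> 'cV[C]_d) : 'M[C]_d :=
  \sum_(r < n) v r *m adj (v r).

Lemma adj_proj d n (v : nat -> 'cV[C]_d) : adj (proj n v) = proj n v.
Proof. by rewrite adj_sum; apply: eq_bigr => r _; rewrite adjM adjK. Qed.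

Lemma projE d n (v : nat -> 'cV[C]_d) u :
  proj n v *m u = \sum_(r < n) dot (v r) u *: v r.
Proof.
rewrite mulmx_suml; apply: eq_bigr => r _.
by rewrite -mulmxA mul_adj_dot mul_mx_scalar.
Qed.

Lemma proj_id d n (v : nat -> 'cV[C]_d) r : orthon n v -> (r < n)%N ->
  proj n v *m v r = v r.
Proof.
move=> ov rn; rewrite projE (bigD1 (Ordinal rn)) //= ov // eqxx scale1r.
rewrite big1 ?addr0 // => s sr; rewrite ov // (_ : (s == r :> nat) = false).
  by rewrite scale0r.
by apply/negbTE; apply: contraNneq sr => e; apply/eqP/val_inj.
Qed.

Lemma adj_compl d n (v : nat -> 'cV[C]_d) r : orthon n v -> (r < n)%N ->
  adj (v r) *m (1%:M - proj n v) = 0.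
Proof.
move=> ov rn; rewrite -[LHS]adjK adjM adjB adj1 adj_proj adjK mulmxBl mul1mx.
by rewrite proj_id // subrr adj0.
Qed.

Definition subunit d (b : 'M[C]_d) := forall u : 'cV[C]_d,
  complex.Re (dot u (b *m u)) <= sqn u.

Lemma mxtrace_sum d (I : Type) (s : seq I) (P : pred I) (F : I -> 'M[C]_d) :
  \tr (\sum_(i <- s | P i) F i) = \sum_(i <- s | P i) \tr (F i).
Proof. exact: (raddf_sum (@mxtrace C d)). Qed.

(** If the range of [b] were contained in the span of the family, the trace of [b] would be a sum of
    [n] diagonal coefficients, each at most one. *)
Lemma greedy d n (v : nat -> 'cV[C]_d) b : orthon n v -> subunit b ->
  n%:R < complex.Re (\tr b) -> (1%:M - proj n v) *m b != 0.
Proof.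
move=> ov sb nb; apply: contraTneq nb; rewrite mulmxBl mul1mx => /eqP.
rewrite subr_eq0 -leNgt => /eqP {1}->; rewrite mulmx_suml mxtrace_sum cRe_sum.
have -> : n%:R = \sum_(r < n) (1 : R) by rewrite sumr_const card_ord.
apply: ler_sum => r _; rewrite -mulmxA mxtrace_mulC.
rewrite [_ *m b *m _]mx11_scalar mxtrace_scalar mulr1n -mulmxA.
rewrite (le_trans (sb _)) // -lecR -dot_sqn ov // eqxx.
by rewrite [X in X <= _]rmorph1.
Qed.

Lemma orthon_le d n m (v : nat -> 'cV[C]_d) : (m <= n)%N -> orthon n v -> orthon m v.
Proof. by move=> mn ov r s rm sm; apply: ov; exact: leq_trans mn. Qed.

Lemma orthonS d n (v : nat -> 'cV[C]_d) w : orthon n v ->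
  (1%:M - proj n v) *m w != 0 -> forall v',
  (forall r, (r < n)%N -> v' r = v r) ->
  v' n = (Num.sqrt (sqn ((1%:M - proj n v) *m w)))^-1%:C *: ((1%:M - proj n v) *m w) ->
  orthon n.+1 v'.
Proof.
move=> ov; set z := _ *m w => z0 v' vv vn.
have s0 := sqn_gt0 z0.
have oz r : (r < n)%N -> dot (v r) z = 0.
  by move=> rn; rewrite /dot mulmxA adj_compl // mul0mx mxE.
have nn : dot (v' n) (v' n) = 1.
  rewrite vn dotZl dotZr dot_sqn conjc_real -!rmorphM mulrA -invfM -expr2.
  by rewrite sqr_sqrtr ?ltW // mulVf ?gt_eqF.
move=> r s; rewrite !ltnS (leq_eqVlt r) (leq_eqVlt s) => /orP[/eqP->|rn] /orP[/eqP->|sn].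
- by rewrite nn eqxx.
- by rewrite dotC vn dotZr (vv s) // oz // mulr0 conjc0 gtn_eqF.
- by rewrite vn dotZr (vv r) // oz // mulr0 ltn_eqF.
- by rewrite !vv // ov.
Qed.

(** The range allowed for the vector of index [r]: that of [f] for the first [R1] vectors, the whole
    space afterwards. *)
Definition fam d R1 (f : 'M[C]_d) r := if (r < R1)%N then f else 1%:M.

Lemma subunit1 d : subunit (1%:M : 'M[C]_d).
Proof. by move=> u; rewrite mul1mx dot_sqn. Qed.

Lemma fam_greedy d n R1 (f : 'M[C]_d) (v : nat -> 'cV[C]_d) : orthon n v ->
  subunit f -> (forall r, (r < R1)%N -> r%:R < complex.Re (\tr f)) ->
  (n < d)%N -> (1%:M - proj n v) *m fam R1 f n != 0.
Proof.
move=> ov sf hf nd; apply: greedy => //; rewrite /fam.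
  by case: ifP => // _; exact: subunit1.
case: ifP => [/hf //|_].
have -> : \tr (1%:M : 'M[C]_d) = (d%:R)%:C.
  by rewrite mxtrace_scalar rmorph_nat.
by rewrite /= ltr_nat.
Qed.

Definition in_range d R1 n (f : 'M[C]_d) (v : nat -> 'cV[C]_d) :=
  forall r, (r < n)%N -> (r < R1)%N -> exists x, v r = f *m x.

(** Gram-Schmidt does not leave the range of [f]: as long as the index is below [R1], the vectors
    subtracted lie in that range too. *)
Lemma in_range_step d n R1 (f : 'M[C]_d) (v v' : nat -> 'cV[C]_d) x (a : C) :
  in_range R1 n f v -> (forall r, (r < n)%N -> v' r = v r) ->
  v' n = a *: ((1%:M - proj n v) *m (fam R1 f n *m x)) ->
  in_range R1 n.+1 f v'.
Proof.
move=> rv vv vn r; rewrite ltnS leq_eqVlt => /orP[/eqP->|rn] rR; last first.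
  by rewrite vv //; exact: rv.
have /choice[y hy] : forall s : 'I_n, exists y, v s = f *m y.
  by move=> s; apply: rv => //; exact: ltn_trans rR.
move: vn; rewrite /fam rR mulmxBl mul1mx projE => ->.
exists (a *: (x - \sum_(s < n) dot (v s) (f *m x) *: y s)).
rewrite -scalemxAr mulmxBr mulmx_sumr; congr (_ *: (_ - _)).
by apply: eq_bigr => s _; rewrite -scalemxAr -hy.
Qed.

Lemma orthon_extend d n m R1 (f : 'M[C]_d) (v : nat -> 'cV[C]_d) :
  subunit f -> (forall r, (r < R1)%N -> r%:R < complex.Re (\tr f)) ->
  (n <= d)%N -> (m <= n)%N -> orthon m v -> in_range R1 m f v ->
  exists v', [/\ orthon n v', in_range R1 n f v' &
    forall r, (r < m)%N -> v' r = v r].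
Proof.
move=> sf hf nd mn ov rv; elim: n mn nd => [|n IH].
  by move=> _ _; exists v; split=> [r s|r|r _] //; rewrite ltn0.
rewrite leq_eqVlt => /orP[/eqP <- _|]; first by exists v.
rewrite ltnS => mn nd; have [w [ow rw wv]] := IH mn (ltnW nd).
have := fam_greedy ow sf hf nd; set c := _ *m _ => c0.
have [x cx0] : exists x : 'cV[C]_d, c *m x != 0.
  apply: contrapT => h; move/eqP: c0; apply; apply/matrixP => i j.
  have : c *m delta_mx j 0 = (0 : 'cV_d).
    by apply/eqP; apply: contrapT => /negP hx; apply: h; exists (delta_mx j 0).
  by rewrite -colE => /matrixP/(_ i 0); rewrite !mxE.
rewrite /c -mulmxA in cx0.
set z := _ *m _ in cx0.
pose v' r := if (r < n)%N then w r else (Num.sqrt (sqn z))^-1%:C *: z.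
have vw r : (r < n)%N -> v' r = w r by rewrite /v' => ->.
have vn : v' n = (Num.sqrt (sqn z))^-1%:C *: z by rewrite /v' ltnn.
exists v'; split.
- exact: orthonS cx0 _ vw vn.
- exact: in_range_step rw vw vn.
- by move=> r rm; rewrite vw ?wv //; exact: leq_trans mn.
Qed.

Lemma orthon_full d (v : nat -> 'cV[C]_d) : orthon d v -> proj d v = 1%:M.
Proof.
move=> ov; pose V : 'M[C]_d := \matrix_(i, j) v j i 0.
have VV : adj V *m V = 1%:M.
  apply/matrixP => i j; have := ov _ _ (ltn_ord i) (ltn_ord j).
  rewrite dotE !mxE -[(_ == _ :> nat)]/(i == j) => <-.
  by apply: eq_bigr => k _; rewrite !mxE.
rewrite -(mulmx1C VV); apply/matrixP => i j; rewrite !mxE summxE.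
by apply: eq_bigr => k _; rewrite !mxE big_ord1 !mxE.
Qed.

End Adjoint.

(** * Nowhere vanishing paths and continuous frames *)

Section PathLifting.
Variable R : realType.
Local Notation C := R[i].

Definition contM m n (F : R -> 'M[C]_(m, n)) :=
  forall i j, contC (fun t => F t i j).

Lemma contM_eq m n (F G : R -> 'M[C]_(m, n)) :
  (forall t, 0 <= t <= 1 -> F t = G t) -> contM F -> contM G.
Proof. by move=> FG h i j; apply: contC_eq (h i j) => t /FG ->. Qed.

Lemma contM_cst m n (X : 'M[C]_(m, n)) : contM (fun=> X).
Proof. by move=> i j; exact: contC_cst. Qed.

Lemma contMD m n (F G : R -> 'M[C]_(m, n)) : contM F -> contM G ->
  contM (fun t => F t + G t).
Proof.
by move=> hF hG i j; apply: contC_eq (contCD (hF i j) (hG i j)) => t _; rewrite mxE.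
Qed.

Lemma contMN m n (F : R -> 'M[C]_(m, n)) : contM F -> contM (fun t => - F t).
Proof. by move=> hF i j; apply: contC_eq (contCN (hF i j)) => t _; rewrite mxE. Qed.

Lemma contM_mul m n p (F : R -> 'M[C]_(m, n)) (G : R -> 'M[C]_(n, p)) :
  contM F -> contM G -> contM (fun t => F t *m G t).
Proof.
move=> hF hG i j; apply: contC_eq (contC_sum (index_enum _) (P := predT)
  (fun k _ => contCM (hF i k) (hG k j))) => t _.
by rewrite mxE.
Qed.

Lemma contM_sum m n (I : Type) (s : seq I) (P : pred I)
    (F : I -> R -> 'M[C]_(m, n)) : (forall i, P i -> contM (F i)) ->
  contM (fun t => \sum_(i <- s | P i) F i t).
Proof.
move=> h i j; apply: contC_eq (contC_sum s (fun k Pk => h k Pk i j)) => t _.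
by rewrite summxE.
Qed.

Lemma contM_adj m n (F : R -> 'M[C]_(m, n)) : contM F -> contM (fun t => adj (F t)).
Proof.
by move=> hF i j; apply: contC_eq (contC_conj (hF j i)) => t _; rewrite adjE.
Qed.

Lemma contMZ m n (a : R -> C) (F : R -> 'M[C]_(m, n)) : contC a -> contM F ->
  contM (fun t => a t *: F t).
Proof.
by move=> ha hF i j; apply: contC_eq (contCM ha (hF i j)) => t _; rewrite mxE.
Qed.

Lemma contC_tr n (F : R -> 'M[C]_n) : contM F -> contC (fun t => \tr (F t)).
Proof. by move=> hF; apply: (contC_sum (index_enum _)) => i _; exact: hF. Qed.

Lemma contR_sqn n (F : R -> 'cV[C]_n) : contM F -> contR (fun t => sqn (F t)).
Proof.
move=> hF; apply: contC_eq (contC_sum (index_enum _) (P := predT)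
  (fun i _ => contRM (contR_nc (hF i 0)) (contR_nc (hF i 0)))) => t _.
by rewrite /sqn rmorph_sum.
Qed.

Definition hat (x : R) : R := Num.max 0 (1 - `|x|).

Lemma hat_eq0 x : 1 <= `|x| -> hat x = 0.
Proof. by move=> h; rewrite /hat max_l // subr_le0. Qed.

Lemma hat_in x : `|x| <= 1 -> hat x = 1 - `|x|.
Proof. by move=> h; rewrite /hat max_r // subr_ge0. Qed.

Lemma grid_point N (x : R) : (0 < N)%N -> 0 <= x <= N%:R ->
  exists k : nat, (k < N)%N /\ 0 <= x - k%:R <= 1.
Proof.
case: N => // N _; elim: N => [|N IH] /andP[x0 xN].
  by exists 0%N; rewrite subr0 x0 xN.
have [h|h] := leP x N.+1%:R.
  have [|k [kN hk]] := IH; first by rewrite x0 h.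
  by exists k; split; first exact: ltnW.
exists N.+1; split=> //; rewrite subr_ge0 ltW //= lerBlDr addrC natr1.
by rewrite xN.
Qed.

Definition polyline d N (Y : nat -> 'cV[C]_d) (t : R) : 'cV[C]_d :=
  \sum_(k < N.+1) (hat (t * N%:R - k%:R))%:C *: Y k.

Lemma contM_polyline d N (Y : nat -> 'cV[C]_d) : contM (polyline N Y).
Proof.
apply: contM_sum => k _; apply: contMZ (contM_cst _).
apply: contR_max (contR_cst 0) _; apply: contRD (contR_cst 1) _.
apply/contRN/contR_abs/contRD; last exact: contR_cst.
exact: (contRM (@contR_id R) (@contR_cst R N%:R)).
Qed.

Lemma polylineE d N (Y : nat -> 'cV[C]_d) t k : (k < N)%N ->
  0 <= t * N%:R - k%:R <= 1 ->
  polyline N Y t = (1 - (t * N%:R - k%:R))%:C *: Y k + (t * N%:R - k%:R)%:C *: Y k.+1.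
Proof.
move=> kN; set l := _ - _ => /andP[l0 l1].
have k1N : (k < N.+1)%N by exact: ltnW.
have k2N : (k.+1 < N.+1)%N by [].
rewrite /polyline (bigD1 (Ordinal k1N)) // (bigD1 (Ordinal k2N)) /=; last first.
  by rewrite -val_eqE /= eqn_leq ltnn.
rewrite big1 => [|i /andP[ik ik1]].
  rewrite addr0 -/l (hat_in (x := l)); last by rewrite ger0_norm.
  have -> : hat (t * N%:R - k.+1%:R) = l.
    have -> : t * N%:R - k.+1%:R = l - 1 by rewrite -addn1 natrD opprD addrA.
    by rewrite hat_in ler0_norm; [ring|lra|lra|lra].
  by rewrite ger0_norm.
rewrite hat_eq0 ?scale0r //.
have -> : t * N%:R - i%:R = l + k%:R - i%:R by rewrite subrK.
have [ki|ki|ki] := ltngtP k i; last by rewrite -val_eqE /= ki eqxx in ik.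
- have k2i : (k.+2 <= i)%N.
    by rewrite ltn_neqAle ki andbT; apply: contraNneq ik1 => e; apply/eqP/val_inj; rewrite /= e.
  have : (k.+2%:R : R) <= i%:R by rewrite ler_nat.
  rewrite -addn2 natrD => h; rewrite ler0_norm; lra.
- have : (i.+1%:R : R) <= k%:R by rewrite ler_nat.
  rewrite -addn1 natrD => h; rewrite ger0_norm; lra.
Qed.

Lemma polyline_neq0 m d N (c : R -> 'M[C]_(m, d)) (Y : nat -> 'cV[C]_d) : (0 < N)%N ->
  (forall k t l, (k < N)%N -> 0 <= t <= 1 -> `|t - k%:R / N%:R| <= N%:R^-1 ->
     0 <= l <= 1 -> c t *m ((1 - l)%:C *: Y k + l%:C *: Y k.+1) != 0) ->
  [/\ polyline N Y 0 = Y 0%N, polyline N Y 1 = Y N &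
      forall t, 0 <= t <= 1 -> c t *m polyline N Y t != 0].
Proof.
move=> N0 h; have NR0 : 0 < N%:R :> R by rewrite ltr0n.
split.
- rewrite (@polylineE _ _ _ _ 0) // mul0r ?subr0 ?lexx ?ler01 //.
  by rewrite scale1r scale0r addr0.
- have hN : N%:R - N.-1%:R = 1 :> R.
    by rewrite -{1}(prednK N0) -addn1 natrD addrAC subrr add0r.
  rewrite (@polylineE _ _ _ _ N.-1) ?prednK // mul1r hN ?lexx ?ler01 //.
  by rewrite subrr scale0r add0r scale1r.
- move=> t t01; have [|k [kN hk]] := @grid_point N (t * N%:R) N0.
    by move: t01 => /andP[t0 t1]; rewrite mulr_ge0 ?ler0n //= ler_piMl ?ler0n.
  rewrite (polylineE _ kN hk); apply: h => //.
  have -> : t - k%:R / N%:R = (t * N%:R - k%:R) / N%:R.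
    by rewrite mulrBl mulfK // gt_eqF.
  have hk1 : `|t * N%:R - k%:R| <= 1 by move: hk => /andP[k0 k1]; rewrite ger0_norm.
  by rewrite normrM normfV (ger0_norm (ltW NR0)) ler_piMl // invr_ge0 ltW.
Qed.

Lemma mulmx_entry_le m d (X : 'M[C]_(m, d)) (u : 'cV[C]_d) (e M : R) i : 0 <= e ->
  (forall j, nc (X i j) <= e) -> (forall j, nc (u j 0) <= M) ->
  nc ((X *m u) i 0) <= d%:R * (e * M).
Proof.
move=> e0 hX hu; rewrite mxE (le_trans (nc_sum _ _ _)) //.
rewrite mulr_natl -[X in _ <= _ *+ X](card_ord d) -sumr_const.
by apply: ler_sum => j _; rewrite ncM ler_pM // nc_ge0.
Qed.

(** A segment between two vectors at a non-obtuse angle avoids zero: the cross term is nonnegative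
    and [(1 - l) ^ 2 + l ^ 2] is at least one half. *)
Lemma sqn_comb d (u v : 'cV[C]_d) (a l : R) : 0 <= l <= 1 ->
  0 <= complex.Re (dot u v) -> a <= sqn u -> a <= sqn v -> 0 <= a ->
  a / 2 <= sqn ((1 - l)%:C *: u + l%:C *: v).
Proof.
move=> /andP[l0 l1] uv au av a0.
have E : dot ((1 - l)%:C *: u) (l%:C *: v) = ((1 - l) * l)%:C * dot u v.
  by rewrite dotZl dotZr conjc_real mulrA rmorphM.
have {}E : complex.Re (dot ((1 - l)%:C *: u) (l%:C *: v)) =
    (1 - l) * l * complex.Re (dot u v) by rewrite E; exact: cReMr.
rewrite sqnD !sqnZ !nc_real E.
rewrite !ger0_norm ?subr_ge0 //.
have h1 : 0 <= (1 - l) * l * complex.Re (dot u v).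
  by rewrite !mulr_ge0 // subr_ge0.
have h2 : (1 - l) ^+ 2 * a <= (1 - l) ^+ 2 * sqn u by rewrite ler_wpM2l ?sqr_ge0.
have h3 : l ^+ 2 * a <= l ^+ 2 * sqn v by rewrite ler_wpM2l ?sqr_ge0.
have : 0 <= 2 * (a * (l - 2^-1) ^+ 2) := mulr_ge0 (ler0n _ 2) (mulr_ge0 a0 (sqr_ge0 _)).
have -> : 2 * (a * (l - 2^-1) ^+ 2) = (1 - l) ^+ 2 * a + l ^+ 2 * a - a / 2.
  by field.
lra.
Qed.

(** On a fine grid, a coordinate vector not killed by [c] is chosen at every second point. Two
    consecutive choices are joined through a multiple of the first by plus or minus ['i]. The factor
    ['i] makes the first angle right, and the sign makes the second one non-obtuse, so [sqn_comb]
    keeps both segments out of the kernel even when [c] has rank one. *)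
Lemma nonvanishing_path d (c : R -> 'M[C]_d) (x0 x1 : 'cV[C]_d) : contM c ->
  (forall t, 0 <= t <= 1 -> c t != 0) -> c 0 *m x0 != 0 -> c 1 *m x1 != 0 ->
  exists x : R -> 'cV[C]_d, [/\ contM x, x 0 = x0, x 1 = x1 &
    forall t, 0 <= t <= 1 -> c t *m x t != 0].
Proof.
move=> cc c0 cx0 cx1.
have I0 : 0 <= (0 : R) <= 1 by rewrite lexx ler01.
have I1 : 0 <= (1 : R) <= 1 by rewrite lexx ler01.
have d0 : (0 < d)%N.
  rewrite lt0n; apply/eqP => d0; case/negP: (c0 0 I0); apply/eqP/matrixP => i.
  by have := ltn_ord i; rewrite {2}d0.
have dR0 : 0 < d%:R :> R by rewrite ltr0n.
have dR1 : 1 <= d%:R :> R by rewrite ler1n.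
have entry_of_neq0 m (X : 'M[C]_(d, m)) : X != 0 -> exists p, X p.1 p.2 != 0.
  move=> X0; apply: contrapT => h; case/negP: X0; apply/eqP/matrixP => i j.
  by rewrite mxE; apply/eqP/negPn/negP => ?; apply: h; exists (i, j).
pose good t (y : 'cV[C]_d) k := exists i, k <= nc ((c t *m y) i 0).
have [k0 k0_gt0 [gx0 gx1 gb]] : exists2 k0, 0 < k0 & [/\ good 0 x0 k0, good 1 x1 k0 &
    forall t, 0 <= t <= 1 -> exists j : 'I_d, good t (delta_mx j 0) k0].
  have cs : contR (fun t => \sum_(p : 'I_d * 'I_d) nc (c t p.1 p.2)).
    apply: contC_eq (contC_sum (index_enum _) (P := predT)
      (fun p _ => contR_nc (cc p.1 p.2))) => t _.
    by rewrite rmorph_sum.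
  have [t t01|m m0 hm] := contR_min_pos cs.
    have [p p0] := entry_of_neq0 _ _ (c0 t t01).
    rewrite (bigD1 p) //= ltr_wpDr ?nc_gt0 //.
    by apply: sumr_ge0 => *; exact: nc_ge0.
  have [p0 hp0] := entry_of_neq0 _ _ cx0; have [p1 hp1] := entry_of_neq0 _ _ cx1.
  move: hp0 hp1; rewrite !(ord1 p0.2) !(ord1 p1.2) => hp0 hp1.
  exists (Num.min (m / (#|{: 'I_d * 'I_d}|%:R)) (Num.min (nc ((c 0 *m x0) p0.1 0))
      (nc ((c 1 *m x1) p1.1 0)))).
    rewrite !lt_min !nc_gt0 // !andbT divr_gt0 // ltr0n card_prod card_ord.
    by rewrite muln_gt0 d0.
  split.
  - by exists p0.1; rewrite !ge_min lexx orbT.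
  - by exists p1.1; rewrite !ge_min lexx !orbT.
  move=> t t01; apply: contrapT => h.
  have hn p : nc (c t p.1 p.2) < m / (#|{: 'I_d * 'I_d}|%:R).
    rewrite ltNge; apply/negP => hp; apply: h; exists p.2, p.1.
    by rewrite -colE [X in _ <= nc X]mxE ge_min; apply/orP; left.
  have := hm t t01; apply/negP; rewrite -ltNge.
  have -> : m = \sum_(p : 'I_d * 'I_d) m / (#|{: 'I_d * 'I_d}|%:R).
    rewrite sumr_const -[_ *+ _]mulr_natr divfK // pnatr_eq0 card_prod card_ord.
    by rewrite muln_eq0 negb_or -lt0n d0.
  apply: ltr_sum => [|p _]; last exact: hn.
  by apply/hasP; exists (Ordinal d0, Ordinal d0); rewrite ?mem_index_enum.
pose M := 1 + \sum_i nc (x0 i 0) + \sum_i nc (x1 i 0).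
have s_ge0 (x : 'cV[C]_d) : 0 <= \sum_i nc (x i 0).
  by apply: sumr_ge0 => *; exact: nc_ge0.
have s_ge (x : 'cV[C]_d) i : nc (x i 0) <= \sum_i nc (x i 0).
  by rewrite (bigD1 i) //= lerDl sumr_ge0 // => *; exact: nc_ge0.
have M1 : 1 <= M by rewrite /M; have := s_ge0 x0; have := s_ge0 x1; lra.
have Mx0 i : nc (x0 i 0) <= M.
  by rewrite /M; have := s_ge x0 i; have := s_ge0 x1; lra.
have Mx1 i : nc (x1 i 0) <= M.
  by rewrite /M; have := s_ge x1 i; have := s_ge0 x0; lra.
have Mb j i : nc ((delta_mx j 0 : 'cV[C]_d) i 0) <= M.
  by rewrite mxE; case: (_ && _); rewrite ?nc1 ?nc0; lra.
pose k1 := k0 / 2; have k1_gt0 : 0 < k1 by rewrite divr_gt0.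
(* The estimate of [sqn_comb] bounds the square norm below by [k1 ^ 2 / 2], so some entry exceeds
   [k2]. The oscillation [e] allowed for [c] over a mesh costs at most [k2 / 2] on vectors with
   entries bounded by [2 * M]. The halving in [k1] pays for moving a vector to a neighbouring grid
   point. *)
pose k2 := k1 / (2 * d%:R).
have k2_gt0 : 0 < k2 by rewrite divr_gt0 // mulr_gt0.
pose e := k2 / (4 * d%:R * M).
have e0 : 0 < e by rewrite divr_gt0 // !mulr_gt0 // (lt_le_trans ltr01).
have eE : d%:R * (e * (2 * M)) = k2 / 2.
  have M0 : M != 0 by rewrite gt_eqF // (lt_le_trans ltr01).
  have D0 : d%:R != 0 :> R by rewrite gt_eqF.
  by rewrite /e; clearbody M; field; rewrite M0 D0.
have k21 : k2 <= k1.
  rewrite /k2 ler_pdivrMr ?mulr_gt0 //; move: (k1) k1_gt0 => k k_gt0; nra.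
have [dl dl0 hdl] := contC_unif_fam (T := prod 'I_d 'I_d)
  (F := fun p t => c t p.1 p.2) (fun p => cc p.1 p.2) e0.
have close s t (y : 'cV[C]_d) i : 0 <= s <= 1 -> 0 <= t <= 1 -> `|s - t| < dl ->
    (forall j, nc (y j 0) <= 2 * M) ->
    nc ((c s *m y) i 0) <= nc ((c t *m y) i 0) + k2 / 2.
  move=> s01 t01 st hy.
  have := mulmx_entry_le (X := c s - c t) (u := y) (i := i) (ltW e0) _ hy.
  rewrite eE mulmxBl => /(_ _)/le_trans h.
  have {}h : nc ((c s *m y - c t *m y) i 0) <= k2 / 2.
    apply: h => // j; rewrite !mxE.
    by have := hdl (i, j) s t s01 t01 st => /ltW.
  have -> : (c s *m y) i 0 = (c t *m y) i 0 + (c s *m y - c t *m y) i 0.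
    by rewrite !mxE addrCA subrr addr0.
  by rewrite (le_trans (ncD _ _)) // lerD2l.
have [n hn] : exists n : nat, dl^-1 < n%:R.
  by exists (Num.bound dl^-1); apply: archi_boundP; rewrite invr_ge0 ltW.
pose n1 := n.+1; pose N := n1.*2.
have N0 : (0 < N)%N by rewrite double_gt0.
have NR0 : 0 < N%:R :> R by rewrite ltr0n.
have Ndl : N%:R^-1 < dl.
  rewrite -[dl]invrK ltf_pV2 ?posrE ?invr_gt0 // (lt_le_trans hn) //.
  by rewrite ler_nat /N -addnn /n1 addSn ltnW // ltnS leq_addr.
pose tt k : R := k%:R / N%:R.
have tt01 k : (k <= N)%N -> 0 <= tt k <= 1.
  by move=> kN; rewrite divr_ge0 ?ler0n //= ler_pdivrMr // mul1r ler_nat.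
have ttS k : `|tt k.+1 - tt k| = N%:R^-1.
  by rewrite /tt -mulrBl -natrB // subSnn mul1r ger0_norm ?invr_ge0 ?ler0n.
have /choice[b hb] : forall i, exists j, (i <= n1)%N ->
    good (tt i.*2) (delta_mx j 0) k0.
  move=> i; have [in1|_] := boolP (i <= n1)%N; last by exists (Ordinal d0).
  have [|j hj] := gb (tt i.*2); first by apply: tt01; rewrite leq_double.
  by exists j.
pose X i : 'cV[C]_d := if i == 0%N then x0 else if i == n1 then x1 else delta_mx (b i) 0.
have gX i : (i <= n1)%N -> good (tt i.*2) (X i) k0.
  rewrite /X; have [->|i0] := eqVneq i 0%N; first by rewrite /tt mul0r.
  have [-> _|_] := eqVneq i n1; first by rewrite /tt mulfV // gt_eqF.
  exact: hb.
have MX i j : nc (X i j 0) <= M.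
  by rewrite /X; case: ifP => // _; case: ifP.
have /choice[sg hsg] : forall i, exists s : bool,
    0 <= complex.Re (dot (c (tt i.*2.+1) *m (((-1) ^+ s * 'i) *: X i))
                   (c (tt i.*2.+1) *m X i.+1)).
  move=> i; set a := c _; set z := dot (a *m ('i *: X i)) (a *m X i.+1).
  have /orP[h|h] := le_total 0 (complex.Re z).
    by exists false; rewrite expr0 mul1r.
  exists true; rewrite expr1 mulN1r scaleNr mulmxN -scaleN1r dotZl.
  by rewrite rmorphN rmorph1 mulN1r cReN oppr_ge0.
(* Even indices carry the chosen vectors, odd ones their rotations; [N] is even, so that the last
   vertex is [x1] itself. *)
pose Y k := if odd k then ((-1) ^+ sg k./2 * 'i) *: X k./2 else X k./2.
have nsg s : nc ((-1) ^+ (s : bool) * 'i : C) = 1.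
  rewrite ncM (_ : nc ('i : C) = 1) ?mulr1; last first.
    by rewrite /nc /= expr0n add0r expr1n sqrtr1.
  by case: s; rewrite ?expr0 ?expr1 ?ncN nc1.
have MY k j : nc (Y k j 0) <= M.
  by rewrite /Y; case: ifP => // _; rewrite mxE ncM nsg mul1r.
have gY k : (k < N)%N -> good (tt k) (Y k) k1 /\ good (tt k) (Y k.+1) k1.
  move=> kN.
  have hk : (k./2 < n1)%N by rewrite ltn_half_double.
  have k10 : k1 <= k0 by rewrite /k1; lra.
  have weaken t y : good t y k0 -> good t y k1.
    by move=> [i hi]; exists i; exact: le_trans hi.
  have move_good s t (y : 'cV[C]_d) : 0 <= s <= 1 -> 0 <= t <= 1 -> `|s - t| < dl ->
      (forall j, nc (y j 0) <= M) -> good s y k0 -> good t y k1.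
    move=> s01 t01 st hy [i hi]; exists i.
    have := close s t y i s01 t01 st; rewrite /k1.
    have hy2 : forall j, nc (y j 0) <= 2 * M by move=> j; have := hy j; lra.
    move=> /(_ hy2); move: k21; rewrite /k1; lra.
  have good_phase s t (y : 'cV[C]_d) : good t y k0 -> good t (((-1) ^+ (s : bool) * 'i) *: y) k0.
    by move=> [i hi]; exists i; rewrite -scalemxAr mxE ncM nsg mul1r.
  have [ko|ke] := boolP (odd k).
    have kE : k = k./2.*2.+1 by rewrite -[LHS]odd_double_half ko add1n.
    have hS : k.+1./2 = k./2.+1 by rewrite {1}kE -doubleS doubleK.
    split.
      rewrite /Y ko.
      apply: (@move_good (tt k./2.*2)) => //.
      - by apply: tt01; rewrite leq_double ltnW.
      - by apply: tt01; exact: ltnW.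
      - by rewrite {2}kE distrC ttS.
      - by move=> j; rewrite mxE ncM nsg mul1r.
      - by apply: good_phase; apply: gX; exact: ltnW.
    have -> : Y k.+1 = X k./2.+1 by rewrite /Y oddS ko hS.
    apply: (@move_good (tt k./2.+1.*2)) => //.
    - by apply: tt01; rewrite leq_double.
    - by apply: tt01; exact: ltnW.
    - by rewrite {2}kE doubleS ttS.
    - exact: gX.
  have kE : k = k./2.*2 by rewrite -[LHS]odd_double_half (negbTE ke).
  have hS : k.+1./2 = k./2 by rewrite {1}kE; exact: uphalf_double.
  split; first by rewrite /Y (negbTE ke) {1}kE; apply/weaken/gX/ltnW.
  have -> : Y k.+1 = ((-1) ^+ sg k./2 * 'i) *: X k./2.
    by rewrite /Y oddS ke hS.
  by rewrite {1}kE; apply/weaken/good_phase/gX/ltnW.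
have dotY k : (k < N)%N ->
    0 <= complex.Re (dot (c (tt k) *m Y k) (c (tt k) *m Y k.+1)).
  move=> kN; have [ko|ke] := boolP (odd k).
    have kE : k = k./2.*2.+1 by rewrite -[LHS]odd_double_half ko add1n.
    have hS : k.+1./2 = k./2.+1 by rewrite {1}kE -doubleS doubleK.
    have -> : Y k.+1 = X k./2.+1 by rewrite /Y oddS ko hS.
    by rewrite /Y ko; have := hsg k./2; rewrite -kE.
  have kE : k = k./2.*2 by rewrite -[LHS]odd_double_half (negbTE ke).
  have hS : k.+1./2 = k./2 by rewrite {1}kE; exact: uphalf_double.
  have -> : Y k.+1 = ((-1) ^+ sg k./2 * 'i) *: X k./2.
    by rewrite /Y oddS ke hS.
  have Re0 (s : bool) (r : R) : complex.Re (((-1) ^+ s * 'i : C) * r%:C) = 0.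
    case: s; first by rewrite expr1 mulN1r mulNr cReN /= mul0r mulr0 subr0 oppr0.
    by rewrite expr0 mul1r /= mul0r mulr0 subr0.
  by rewrite /Y (negbTE ke) -scalemxAr dotZr dot_sqn Re0.
have [|p0 p1 pn] := @polyline_neq0 d d N c Y N0.
  move=> k t l kN t01 tk l01; set y := _ + _.
  have My j : nc (y j 0) <= 2 * M.
    rewrite !mxE (le_trans (ncD _ _)) // !ncM !nc_real.
    move: l01 => /andP[l0 l1]; rewrite !ger0_norm ?subr_ge0 //.
    have := MY k j; have := MY k.+1 j.
    have := nc_ge0 (Y k j 0); have := nc_ge0 (Y k.+1 j 0); nra.
  have [[i hi] [i' hi']] := gY k kN.
  have sq z (j : 'I_d) : k1 <= nc ((z : 'cV[C]_d) j 0) -> k1 ^+ 2 <= sqn z.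
    move=> h; apply: le_trans (sqn_entry z j).
    by rewrite ler_pXn2r ?nnegrE ?nc_ge0 // ltW.
  have s2 : k1 ^+ 2 / 2 <= sqn (c (tt k) *m y).
    rewrite mulmxDr -!scalemxAr; apply: sqn_comb => //; first exact: dotY.
    - exact: sq hi.
    - exact: sq hi'.
    - exact: sqr_ge0.
  have [|j hj] := @sqn_big_entry _ _ (c (tt k) *m y) k2 (ltW k2_gt0).
    apply: lt_le_trans s2.
    have -> : d%:R * k2 ^+ 2 = k1 ^+ 2 / 4 / d%:R by rewrite /k2; field; rewrite gt_eqF.
    rewrite ltr_pdivrMr //.
    have : 0 < k1 ^+ 2 by rewrite exprn_gt0.
    move: (k1 ^+ 2) => q q0; nra.
  have kt : `|tt k - t| < dl by rewrite distrC (le_lt_trans tk).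
  have := close (tt k) t y j (tt01 k (ltnW kN)) t01 kt My.
  move=> hc; apply: contraTneq (hc) => ->.
  have -> : (0 : 'cV[C]_d) j 0 = 0 by rewrite mxE.
  rewrite nc0 add0r -ltNge.
  by apply: lt_trans hj; rewrite ltr_pdivrMr // ltr_pMr // ltr1n.
exists (polyline N Y); split=> //.
- exact: contM_polyline.
- by rewrite p1 /Y odd_double doubleK /X eqxx.
Qed.

(* Sequential Gram-Schmidt along the interval: each new vector is a normalised
   nowhere vanishing path in the range of [f] (or, from [R1] on, in the whole
   space) projected off the previous vectors. *)
Lemma orthonormal_frame d n R1 (f : R -> 'M[C]_d) (v0 v1 : nat -> 'cV[C]_d) :
  contM f -> (forall t, 0 <= t <= 1 -> subunit (f t)) ->
  (forall t r, 0 <= t <= 1 -> (r < R1)%N -> r%:R < complex.Re (\tr (f t))) ->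
  (n <= d)%N -> orthon n v0 -> orthon n v1 ->
  (forall r, (r < n)%N -> exists x, v0 r = fam R1 (f 0) r *m x) ->
  (forall r, (r < n)%N -> exists x, v1 r = fam R1 (f 1) r *m x) ->
  exists v : nat -> R -> 'cV[C]_d, [/\ forall r, contM (v r),
    forall t, 0 <= t <= 1 -> orthon n (v ^~ t),
    forall t, 0 <= t <= 1 -> in_range R1 n (f t) (v ^~ t) &
    forall r, (r < n)%N -> v r 0 = v0 r /\ v r 1 = v1 r].
Proof.
move=> cf sf hf; elim: n => [|n IH] nd o0 o1 r0 r1.
  exists (fun _ _ => 0); split=> //; first by move=> r; exact: contM_cst.
have [||||v [cv ov rv ev]] := IH (ltnW nd).
- exact: orthon_le o0.
- exact: orthon_le o1.
- by move=> r rn; apply: r0; exact: ltnW.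
- by move=> r rn; apply: r1; exact: ltnW.
have I0 : 0 <= (0 : R) <= 1 by rewrite lexx ler01.
have I1 : 0 <= (1 : R) <= 1 by rewrite lexx ler01.
pose c t := (1%:M - proj n (v ^~ t)) *m fam R1 (f t) n.
have cc : contM c.
  apply: contM_mul.
    apply: contMD (contM_cst _) _; apply/contMN/contM_sum => r _.
    exact: contM_mul (cv r) (contM_adj (cv r)).
  apply: (@contM_eq _ _ (if (n < R1)%N then f else fun=> 1%:M)).
    by move=> t _; rewrite /fam; case: ifP.
  by case: ifP => // _; exact: contM_cst.
have c0 t : 0 <= t <= 1 -> c t != 0.
  move=> t01; apply: fam_greedy => //; first exact: ov.
    exact: sf.
  by move=> r; exact: hf.
(* A prescribed end vector is already orthogonal to the earlier ones, so projecting and normalising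
   leave it unchanged. *)
have endpoint t w x : 0 <= t <= 1 -> orthon n.+1 w -> w n = fam R1 (f t) n *m x ->
    (forall r, (r < n)%N -> v r t = w r) -> c t *m x = w n.
  move=> t01 ow wn vw; rewrite /c -mulmxA -wn mulmxBl mul1mx projE.
  rewrite big1 ?subr0 // => r _; rewrite vw // ow //; last exact: leqW (ltn_ord r).
  by rewrite ltn_eqF // scale0r.
have unit_neq0 w : orthon n.+1 w -> w n != 0 :> 'cV[C]_d.
  move=> ow; apply: contraTneq (oner_neq0 C) => w0.
  by have := ow n n (leqnn _) (leqnn _); rewrite w0 eqxx /dot mulmx0 mxE => h; rewrite -[1]/(true%:R) -h eqxx.
have [x0 hx0] := r0 n (leqnn _); have [x1 hx1] := r1 n (leqnn _).
have cx0 : c 0 *m x0 = v0 n by apply: endpoint => // r rn; case: (ev r rn).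
have cx1 : c 1 *m x1 = v1 n by apply: endpoint => // r rn; case: (ev r rn).
have [||x [cx xe0 xe1 xn]] := nonvanishing_path cc c0 (x0 := x0) (x1 := x1).
- by rewrite cx0 unit_neq0.
- by rewrite cx1 unit_neq0.
pose z t := c t *m x t.
have z0 t : 0 <= t <= 1 -> 0 < Num.sqrt (sqn (z t)).
  by move=> t01; rewrite sqrtr_gt0; exact: sqn_gt0 (xn t t01).
pose v' r := if r == n then fun t => (Num.sqrt (sqn (z t)))^-1%:C *: z t else v r.
have vn : v' n = fun t => (Num.sqrt (sqn (z t)))^-1%:C *: z t by rewrite /v' eqxx.
have vv r : (r < n)%N -> v' r = v r by move=> rn; rewrite /v' ltn_eqF.
have cz : contM z by exact: contM_mul.
have norm1 w : orthon n.+1 w -> Num.sqrt (sqn (w n)) = 1 :> R.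
  move=> ow; have := ow n n (leqnn _) (leqnn _).
  by rewrite dot_sqn eqxx => /complexI ->; rewrite sqrtr1.
exists v'; split.
- move=> r; rewrite /v'; case: ifP => // _; apply: (contMZ _ cz).
  apply: contR_inv; first by move=> t /z0; exact: lt0r_neq0.
  by apply/contR_sqrt/contR_sqn; exact: cz.
- move=> t t01; apply: (orthonS (w := fam R1 (f t) n *m x t) (ov t t01)).
  + by rewrite mulmxA; exact: xn.
  + by move=> r rn; rewrite vv.
  + by rewrite vn /z /c mulmxA.
- move=> t t01; apply: (in_range_step (x := x t)
      (a := (Num.sqrt (sqn (z t)))^-1%:C) (rv t t01)).
  + by move=> r rn; rewrite vv.
  + by rewrite vn /z /c mulmxA.
- move=> r; rewrite ltnS leq_eqVlt => /orP[/eqP->|rn]; last by rewrite vv //; exact: ev.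
  by rewrite vn /z xe0 xe1 cx0 cx1 !norm1 // invr1 !scale1r.
Qed.

End PathLifting.

(** * Dimension drop algebras and their embeddings *)

Section Kron.
Variable R : realType.
Local Notation C := R[i].

Definition vidx P Q (k : 'I_(P * Q)) : 'I_P * 'I_Q :=
  enum_val (cast_ord (esym (mxvec_cast P Q)) k).

Lemma vidxK P Q (i : 'I_P) (j : 'I_Q) : vidx (mxvec_index i j) = (i, j).
Proof. by rewrite /vidx cast_ordK enum_rankK. Qed.

Lemma mxvec_vidx P Q (k : 'I_(P * Q)) : mxvec_index (vidx k).1 (vidx k).2 = k.
Proof. by case/mxvec_indexP: k => i j; rewrite vidxK. Qed.

Lemma sum_vidx P Q (F : 'I_P -> 'I_Q -> C) :
  \sum_(k < P * Q) F (vidx k).1 (vidx k).2 = \sum_i \sum_j F i j.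
Proof.
rewrite pair_bigA /= (reindex (fun p : 'I_P * 'I_Q => mxvec_index p.1 p.2)) /=.
  by apply: eq_bigr => p _; rewrite vidxK.
exists (@vidx P Q) => [[i j] _|k _]; [exact: vidxK | exact: mxvec_vidx].
Qed.

Definition kron P1 P2 Q1 Q2 (a : 'M[C]_(P1, P2)) (b : 'M[C]_(Q1, Q2)) :
    'M[C]_(P1 * Q1, P2 * Q2) :=
  \matrix_(k, l) (a (vidx k).1 (vidx l).1 * b (vidx k).2 (vidx l).2).

Lemma kronE P1 P2 Q1 Q2 (a : 'M[C]_(P1, P2)) (b : 'M[C]_(Q1, Q2)) i i' j j' :
  kron a b (mxvec_index i i') (mxvec_index j j') = a i j * b i' j'.
Proof. by rewrite mxE !vidxK. Qed.

Lemma kronP P1 P2 Q1 Q2 (X Y : 'M[C]_(P1 * Q1, P2 * Q2)) :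
  (forall i i' j j', X (mxvec_index i i') (mxvec_index j j') =
     Y (mxvec_index i i') (mxvec_index j j')) -> X = Y.
Proof.
move=> h; apply/matrixP => k l; case/mxvec_indexP: k => i i'.
by case/mxvec_indexP: l => j j'; exact: h.
Qed.

Lemma kronM P1 P2 P3 Q1 Q2 Q3 (a : 'M[C]_(P1, P2)) (b : 'M[C]_(Q1, Q2))
    (a' : 'M[C]_(P2, P3)) (b' : 'M[C]_(Q2, Q3)) :
  kron a b *m kron a' b' = kron (a *m a') (b *m b').
Proof.
apply/matrixP => k l; rewrite !mxE big_distrlr -sum_vidx /=.
by apply: eq_bigr => m _; rewrite !mxE mulrACA.
Qed.

Lemma kronDl P1 P2 Q1 Q2 (a a' : 'M[C]_(P1, P2)) (b : 'M[C]_(Q1, Q2)) :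
  kron (a + a') b = kron a b + kron a' b.
Proof. by apply/matrixP => k l; rewrite !mxE mulrDl. Qed.

Lemma kronDr P1 P2 Q1 Q2 (a : 'M[C]_(P1, P2)) (b b' : 'M[C]_(Q1, Q2)) :
  kron a (b + b') = kron a b + kron a b'.
Proof. by apply/matrixP => k l; rewrite !mxE mulrDr. Qed.

Lemma kronZl P1 P2 Q1 Q2 c (a : 'M[C]_(P1, P2)) (b : 'M[C]_(Q1, Q2)) :
  kron (c *: a) b = c *: kron a b.
Proof. by apply/matrixP => k l; rewrite !mxE mulrA. Qed.

Lemma kronZr P1 P2 Q1 Q2 c (a : 'M[C]_(P1, P2)) (b : 'M[C]_(Q1, Q2)) :
  kron a (c *: b) = c *: kron a b.
Proof. by apply/matrixP => k l; rewrite !mxE mulrCA. Qed.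

Lemma kron0l P1 P2 Q1 Q2 (b : 'M[C]_(Q1, Q2)) : kron (0 : 'M[C]_(P1, P2)) b = 0.
Proof. by apply/matrixP => k l; rewrite !mxE mul0r. Qed.

Lemma kron0r P1 P2 Q1 Q2 (a : 'M[C]_(P1, P2)) : kron a (0 : 'M[C]_(Q1, Q2)) = 0.
Proof. by apply/matrixP => k l; rewrite !mxE mulr0. Qed.

Lemma kron_suml P1 P2 Q1 Q2 (I : Type) (s : seq I) (B : pred I)
    (F : I -> 'M[C]_(P1, P2)) (b : 'M[C]_(Q1, Q2)) :
  kron (\sum_(i <- s | B i) F i) b = \sum_(i <- s | B i) kron (F i) b.
Proof.
apply: (big_morph (fun a => kron a b)) => [x y|]; [exact: kronDl | exact: kron0l].
Qed.

Lemma kron_sumr P1 P2 Q1 Q2 (I : Type) (s : seq I) (B : pred I)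
    (F : I -> 'M[C]_(Q1, Q2)) (a : 'M[C]_(P1, P2)) :
  kron a (\sum_(i <- s | B i) F i) = \sum_(i <- s | B i) kron a (F i).
Proof. by apply: (big_morph (kron a)) => [x y|]; [exact: kronDr | exact: kron0r]. Qed.

Lemma adj_kron P1 P2 Q1 Q2 (a : 'M[C]_(P1, P2)) (b : 'M[C]_(Q1, Q2)) :
  adj (kron a b) = kron (adj a) (adj b).
Proof. by apply/matrixP => k l; rewrite !mxE rmorphM. Qed.

Lemma kron11 P Q : kron (1%:M : 'M[C]_P) (1%:M : 'M[C]_Q) = 1%:M.
Proof.
apply: kronP => i i' j j'; rewrite kronE !mxE -natrM mulnb; congr ((nat_of_bool _)%:R).
apply/andP/eqP => [[/eqP-> /eqP->] //|].
by move/(congr1 (@vidx P Q)); rewrite !vidxK => -[-> ->].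
Qed.

Lemma tr_kron P Q (a : 'M[C]_P) (b : 'M[C]_Q) : \tr (kron a b) = \tr a * \tr b.
Proof.
rewrite /mxtrace big_distrlr -sum_vidx /=.
by apply: eq_bigr => k _; rewrite mxE.
Qed.

End Kron.

(** * Dimension drop algebras and their generators *)

Section DimensionDrop.
Variable R : realType.
Local Notation C := R[i].
Implicit Types (g h : R -> R).

Lemma contR_1B : contR (fun t : R => 1 - t).
Proof.
apply/contRP => t _ e e0; exists e => // s _ st.
by rewrite (_ : 1 - s - (1 - t) = - (s - t)) ?normrN //; ring.
Qed.

(** [dimdrop] with its boundary conditions as Kronecker products, whose algebra gives the closure
    properties at once. *)
Definition ddrop P Q (f : R -> 'M[C]_(P * Q)) := [/\ contM f,
  exists a : 'M[C]_P, f 0 = kron a 1%:M & exists b : 'M[C]_Q, f 1 = kron 1%:M b].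

Lemma dimdropP P Q (f : R -> 'M[C]_(P * Q)) : dimdrop f <-> ddrop f.
Proof.
split=> -[cf [a ha] [b hb]]; split.
- exact/mx_contP.
- by exists a; apply: kronP => i i' j j'; rewrite ha kronE !mxE mulr_natr.
- by exists b; apply: kronP => i i' j j'; rewrite hb kronE !mxE mulr_natl.
- exact/mx_contP.
- by exists a => i i' j j'; rewrite ha kronE !mxE mulr_natr.
- by exists b => i i' j j'; rewrite hb kronE !mxE mulr_natl.
Qed.

Section Closure.
Variables P Q : nat.
Implicit Types f : R -> 'M[C]_(P * Q).

Let I0 : 0 <= (0 : R) <= 1. Proof. by rewrite lexx ler01. Qed.
Let I1 : 0 <= (1 : R) <= 1. Proof. by rewrite lexx ler01. Qed.

Lemma ddrop_eq f f' : (forall t, 0 <= t <= 1 -> f t = f' t) -> ddrop f -> ddrop f'.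
Proof.
move=> e [cf [a ha] [b hb]]; split; first exact: contM_eq cf.
  by exists a; rewrite -e.
by exists b; rewrite -e.
Qed.

Lemma ddropD f f' : ddrop f -> ddrop f' -> ddrop (fun t => f t + f' t).
Proof.
move=> [cf [a ha] [b hb]] [cf' [a' ha'] [b' hb']]; split; first exact: contMD.
  by exists (a + a'); rewrite ha ha' kronDl.
by exists (b + b'); rewrite hb hb' kronDr.
Qed.

Lemma ddropZ (c : C) f : ddrop f -> ddrop (fun t => c *: f t).
Proof.
move=> [cf [a ha] [b hb]]; split; first exact: contMZ (contC_cst _) cf.
  by exists (c *: a); rewrite ha kronZl.
by exists (c *: b); rewrite hb kronZr.
Qed.

Lemma ddropM f f' : ddrop f -> ddrop f' -> ddrop (fun t => f t *m f' t).
Proof.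
move=> [cf [a ha] [b hb]] [cf' [a' ha'] [b' hb']]; split; first exact: contM_mul.
  by exists (a *m a'); rewrite ha ha' kronM mulmx1.
by exists (b *m b'); rewrite hb hb' kronM mulmx1.
Qed.

Lemma ddrop_adj f : ddrop f -> ddrop (fun t => adj (f t)).
Proof.
move=> [cf [a ha] [b hb]]; split; first exact: contM_adj.
  by exists (adj a); rewrite ha adj_kron adj1.
by exists (adj b); rewrite hb adj_kron adj1.
Qed.

Lemma ddrop_scalar (z : R -> C) : contC z -> ddrop (fun t => (z t)%:M : 'M[C]_(P * Q)).
Proof.
move=> cz; split.
- apply: (@contM_eq _ _ _ (fun t => z t *: 1%:M)) => [t _|].
    by rewrite scalemx1.
  exact: contMZ cz (contM_cst _).
- by exists (z 0)%:M; rewrite -[LHS]scalemx1 -[X in kron X _]scalemx1 kronZl kron11.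
- by exists (z 1)%:M; rewrite -[LHS]scalemx1 -[X in kron _ X]scalemx1 kronZr kron11.
Qed.

Lemma ddrop0 : ddrop (fun=> 0 : 'M[C]_(P * Q)).
Proof.
apply: ddrop_eq (ddrop_scalar (contC_cst 0)) => t _.
by rewrite raddf0.
Qed.

Lemma ddrop_sum (I : Type) (s : seq I) (B : pred I) (F : I -> R -> 'M[C]_(P * Q)) :
  (forall i, B i -> ddrop (F i)) -> ddrop (fun t => \sum_(i <- s | B i) F i t).
Proof.
move=> h; elim: s => [|i s IH].
  by apply: ddrop_eq ddrop0 => t _; rewrite big_nil.
case Bi: (B i); last by apply: ddrop_eq IH => t _; rewrite big_cons Bi.
by apply: ddrop_eq (ddropD (h i Bi) IH) => t _; rewrite big_cons Bi.
Qed.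

End Closure.

(** The three systems of matrix units available over a subinterval: those of the left factor when it
    contains 0, those of the right factor when it contains 1, and all of them when it contains
    neither. *)
Inductive corner := AtZero | AtOne | Inside.

Definition usize P Q s := match s with AtZero => P | AtOne => Q | Inside => (P * Q)%N end.

Definition unitmx_of P Q s : 'I_(usize P Q s) -> 'I_(usize P Q s) -> 'M[C]_(P * Q) :=
  match s return 'I_(usize P Q s) -> 'I_(usize P Q s) -> 'M[C]_(P * Q) with
  | AtZero => fun a b => kron (delta_mx a b) 1%:M
  | AtOne => fun a b => kron 1%:M (delta_mx a b)
  | Inside => fun a b => delta_mx a b
  end.

(* The functions [g] such that [g] times a matrix unit of the system [s]
   satisfies the boundary conditions of the dimension drop algebra. *)
Definition admissible s g := [/\ contR g, s <> AtZero -> g 0 = 0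
  & s <> AtOne -> g 1 = 0].

Lemma admissibleM s g h : admissible s g -> contR h -> admissible s (fun t => g t * h t).
Proof.
move=> [cg g0 g1] ch; split; first exact: contRM.
  by move=> /g0->; rewrite mul0r.
by move=> /g1->; rewrite mul0r.
Qed.

Lemma admissible_comp s g (phi : R -> R) : admissible s g ->
  (forall h, contR h -> contR (fun t => phi (h t))) -> phi 0 = 0 ->
  admissible s (fun t => phi (g t)).
Proof.
move=> [cg g0 g1] cphi p0; split; first exact: cphi.
  by move=> /g0->.
by move=> /g1->.
Qed.

Section Units.
Variables P Q : nat.
Hypotheses (P0 : (0 < P)%N) (Q0 : (0 < Q)%N).

Lemma mul_unitmx_of (s : corner) (a b c d : 'I_(usize P Q s)) :
  unitmx_of a b *m unitmx_of c d = (b == c)%:R *: unitmx_of a d.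
Proof.
case: s a b c d => a b c d /=.
- by rewrite kronM mul_delta_mx_cond mulmx1 -scaler_nat kronZl.
- by rewrite kronM mul_delta_mx_cond mulmx1 -scaler_nat kronZr.
- by rewrite mul_delta_mx_cond scaler_nat.
Qed.

Lemma adj_delta m n (a : 'I_m) (b : 'I_n) : adj (delta_mx a b : 'M[C]_(m, n)) = delta_mx b a.
Proof. by apply/matrixP => i j; rewrite !mxE conjc_nat andbC. Qed.

Lemma adj_unitmx_of (s : corner) (a b : 'I_(usize P Q s)) : adj (unitmx_of a b) = unitmx_of b a.
Proof.
by case: s a b => a b /=; rewrite ?adj_kron ?adj1 adj_delta.
Qed.

Lemma sum_delta n : \sum_(a < n) delta_mx a a = 1%:M :> 'M[C]_n.
Proof. by rewrite mx1_sum_delta. Qed.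

Lemma sum_unitmx_of (s : corner) : \sum_(a < usize P Q s) unitmx_of a a = 1%:M :> 'M[C]_(P * Q).
Proof.
case: s => /=.
- by rewrite -kron_suml sum_delta kron11.
- by rewrite -kron_sumr sum_delta kron11.
- exact: sum_delta.
Qed.

Lemma usize_gt0 (s : corner) : (0 < usize P Q s)%N.
Proof. by case: s => //=; rewrite muln_gt0 P0. Qed.

Definition ntr (X : 'M[C]_(P * Q)) : C := \tr X / (P * Q)%:R.

Lemma tr_delta n (a b : 'I_n) : \tr (delta_mx a b : 'M[C]_n) = (a == b)%:R.
Proof.
rewrite /mxtrace (bigD1 a) //= mxE eqxx /= big1 ?addr0 // => i ia.
by rewrite mxE (negbTE ia).
Qed.

Lemma ntr_unitmx_of (s : corner) (a b : 'I_(usize P Q s)) :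
  ntr (unitmx_of a b) = (a == b)%:R / (usize P Q s)%:R.
Proof.
have p0 : P%:R != 0 :> C by rewrite pnatr_eq0 -lt0n.
have q0 : Q%:R != 0 :> C by rewrite pnatr_eq0 -lt0n.
rewrite /ntr; case: s a b => a b /=.
- by rewrite tr_kron tr_delta mxtrace1 natrM invfM mulrA mulrAC mulfK.
- rewrite tr_kron tr_delta mxtrace1 natrM invfM [P%:R * _]mulrC mulrA.
  by rewrite -[_ * P%:R / _]mulrA mulfV // mulr1.
- by rewrite tr_delta.
Qed.

Lemma ddrop_unit (s : corner) (z : R -> C) (a b : 'I_(usize P Q s)) : contC z ->
  (s <> AtZero -> z 0 = 0) -> (s <> AtOne -> z 1 = 0) ->
  ddrop (fun t => z t *: unitmx_of a b).
Proof.
move=> cz z0 z1; split; first exact: contMZ cz (contM_cst _).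
- case: s a b z0 z1 => a b z0 z1 /=; last 2 first.
  + by exists 0; rewrite z0 // scale0r kron0l.
  + by exists 0; rewrite z0 // scale0r kron0l.
  by exists (z 0 *: delta_mx a b); rewrite kronZl.
- case: s a b z0 z1 => a b z0 z1 /=.
  + by exists 0; rewrite z1 // scale0r kron0r.
  + by exists (z 1 *: delta_mx a b); rewrite kronZr.
  + by exists 0; rewrite z1 // scale0r kron0r.
Qed.

Lemma ddrop_unitR (s : corner) g (a b : 'I_(usize P Q s)) : admissible s g ->
  ddrop (fun t => (g t)%:C *: unitmx_of a b).
Proof.
move=> [cg g0 g1]; apply: ddrop_unit => //.
  by move=> /g0->.
by move=> /g1->.
Qed.

(** The entries of the value at 0, the entries of the value at 1, and the entries of the remainder,
    each cut into four nonnegative functions. *)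
Definition gen_index : finType :=
  ('I_P * 'I_P + 'I_Q * 'I_Q + 'I_(P * Q) * 'I_(P * Q) * 'I_4)%type.

Definition quarter (z : C) (k : 'I_4) : R :=
  match val k with
  | 0%N => Num.max 0 (complex.Re z)
  | 1%N => Num.max 0 (complex.Im z)
  | 2%N => Num.max 0 (- complex.Re z)
  | _ => Num.max 0 (- complex.Im z)
  end.

Lemma quarterE z : z = \sum_(k < 4) 'i ^+ k * (quarter z k)%:C.
Proof.
rewrite !big_ord_recr big_ord0 /= /quarter /=.
have mx (x : R) : x = Num.max 0 x - Num.max 0 (- x).
  by case: (leP 0 x) => h; case: (leP 0 (- x)); lra.
case: z => a b /=; rewrite add0r expr0 mul1r expr1 sqr_i exprSr sqr_i.
apply/eqP; rewrite eq_complex /=.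
move: (mx a) (mx b); move: (Num.max 0 a) (Num.max 0 b) (Num.max 0 (- a)) (Num.max 0 (- b)).
by move=> x y u v -> ->; apply/andP; split; apply/eqP; ring.
Qed.

Lemma quarter_ge0 z k : 0 <= quarter z k.
Proof. by rewrite /quarter; case: (val k) => [|[|[|n]]]; rewrite le_max lexx. Qed.

Lemma quarter_le z k : quarter z k <= nc z.
Proof.
have := nc_Re z; have := nc_Im z; rewrite !ler_norml => /andP[h1 h2] /andP[h3 h4].
by rewrite /quarter; case: (val k) => [|[|[|n]]]; rewrite ge_max nc_ge0 /=; lra.
Qed.

Lemma quarter0 k : quarter 0 k = 0.
Proof.
by rewrite /quarter; case: (val k) => [|[|[|n]]] /=; rewrite ?oppr0 maxxx.
Qed.

Lemma contR_quarter (z : R -> C) k : contC z -> contR (fun t => quarter (z t) k).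
Proof.
move=> cz; rewrite /quarter; case: (val k) => [|[|[|n]]];
  apply: contR_max (contR_cst 0) _; [exact: contR_Re | exact: contR_Im | |].
  by apply/contRN/contR_Re.
by apply/contRN/contR_Im.
Qed.

(* [f] is interpolated linearly between its boundary values; the remainder
   vanishes at both ends, and its entries are combinations of four nonnegative
   functions. *)
Lemma ddrop_generate f (c : R) : ddrop f ->
  (forall t i j, 0 <= t <= 1 -> nc (f t i j) <= c) ->
  exists (z : gen_index -> C) (g : gen_index -> R -> R)
    (u : gen_index -> {s & ('I_(usize P Q s) * 'I_(usize P Q s))%type}),
  [/\ forall x, admissible (tag (u x)) (g x),
      forall x t, 0 <= t <= 1 -> 0 <= g x t <= 1,
      forall x, nc (z x) <= 4 * c
    & forall t, 0 <= t <= 1 -> f t =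
        \sum_x z x *: ((g x t)%:C *: unitmx_of (tagged (u x)).1 (tagged (u x)).2)].
Proof.
move=> [cf [a ha] [b hb]] fc.
have I0 : 0 <= (0 : R) <= 1 by rewrite lexx ler01.
have I1 : 0 <= (1 : R) <= 1 by rewrite lexx ler01.
pose r t i j := f t i j - ((1 - t)%:C * f 0 i j + t%:C * f 1 i j).
have c0 : 0 <= c.
  have k : 'I_(P * Q) by apply: (Ordinal (n := P * Q) (m := 0)); rewrite muln_gt0 P0.
  by have := fc 0 k k I0; have := nc_ge0 (f 0 k k); lra.
have rc t i j : 0 <= t <= 1 -> nc (r t i j) <= 4 * c.
  move=> t01; have h1 := fc t i j t01; have h2 := fc 0 i j I0; have h3 := fc 1 i j I1.
  have := ncD (f t i j) (- ((1 - t)%:C * f 0 i j + t%:C * f 1 i j)).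
  have := ncD ((1 - t)%:C * f 0 i j) (t%:C * f 1 i j).
  rewrite ncN !ncM !nc_real; case/andP: t01 => t0 t1.
  rewrite !ger0_norm ?subr_ge0 // -/(r t i j).
  have := nc_ge0 (f 0 i j); have := nc_ge0 (f 1 i j); nra.
(* Dividing the remainder by its bound [4 * c] brings the functions [g] into [[0, 1]]. If [c = 0],
   the inverse is 0 by convention, and the remainder vanishes as well. *)
pose z (x : gen_index) : C := match x with
  | inl (inl p) => a p.1 p.2
  | inl (inr p) => b p.1 p.2
  | inr (p, k) => (4 * c)%:C * 'i ^+ (k : nat) end.
pose g (x : gen_index) (t : R) : R := match x with
  | inl (inl p) => 1 - t
  | inl (inr p) => t
  | inr (p, k) => (4 * c)^-1 * quarter (r t p.1 p.2) k end.
pose u (x : gen_index) : {s & ('I_(usize P Q s) * 'I_(usize P Q s))%type} := match x with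
  | inl (inl p) => existT _ AtZero p
  | inl (inr p) => existT _ AtOne p
  | inr (p, k) => existT _ Inside p end.
have cr i j : contC (fun t => r t i j).
  have c1 : contR (fun t : R => 1 - t).
    exact: contR_1B.
  apply: contCD (cf i j) (contCN (contCD _ _)).
    exact: contCM c1 (contC_cst _).
  exact: contCM (@contR_id R) (contC_cst _).
have r0 i j : r 0 i j = 0 by rewrite /r subr0 mul1r mul0r addr0 subrr.
have r1 i j : r 1 i j = 0 by rewrite /r subrr mul1r mul0r add0r subrr.
exists z, g, u; split.
- case=> [[p|p]|[p k]] /=.
  + by split; [exact: contR_1B | move=> /(_ erefl) | move=> _; rewrite /= subrr].
  + by split; [exact: contR_id | move=> _ | move=> /(_ erefl)].
  + split; first exact: contRM (contR_cst _) (contR_quarter _ (cr _ _)).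
      by move=> _; rewrite /= r0 quarter0 mulr0.
    by move=> _; rewrite /= r1 quarter0 mulr0.
- case=> [[p|p]|[p k]] t t01 /=; [lra | by [] | ].
  rewrite mulr_ge0 ?quarter_ge0 ?invr_ge0 ?mulr_ge0 //=.
  have [->|cn0] := eqVneq c 0; first by rewrite mulr0 invr0 mul0r ler01.
  rewrite mulrC ler_pdivrMr ?mul1r; last by rewrite mulr_gt0 // lt0r cn0.
  exact: le_trans (quarter_le _ _) (rc _ _ _ t01).
- have q0 : 'I_Q by exact: (Ordinal Q0).
  have p0 : 'I_P by exact: (Ordinal P0).
  case=> [[p|p]|[p k]] /=.
  + have := fc 0 (mxvec_index p.1 q0) (mxvec_index p.2 q0) I0.
    by rewrite ha kronE mxE eqxx mulr1; have := nc_ge0 (a p.1 p.2); lra.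
  + have := fc 1 (mxvec_index p0 p.1) (mxvec_index p0 p.2) I1.
    by rewrite hb kronE mxE eqxx mul1r; have := nc_ge0 (b p.1 p.2); lra.
  + rewrite ncM nc_real ger0_norm ?mulr_ge0 //.
    have -> : nc ('i ^+ (k : nat) : C) = 1.
      elim: (val k) => [|n IH]; first by rewrite expr0 nc1.
      by rewrite exprS ncM IH /nc /= expr0n add0r expr1n sqrtr1 mulr1.
    by rewrite mulr1.
- move=> t t01; rewrite /index_enum; rewrite !big_sumType /=.
  have -> : \sum_(p : 'I_P * 'I_P) a p.1 p.2 *: ((1 - t)%:C *: kron (delta_mx p.1 p.2) 1%:M)
      = (1 - t)%:C *: f 0.
    rewrite ha {2}(matrix_sum_delta a) pair_bigA kron_suml scaler_sumr.
    by apply: eq_bigr => p _; rewrite kronZl !scalerA mulrC.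
  have -> : \sum_(p : 'I_Q * 'I_Q) b p.1 p.2 *: (t%:C *: kron 1%:M (delta_mx p.1 p.2))
      = t%:C *: f 1.
    rewrite hb {2}(matrix_sum_delta b) pair_bigA kron_sumr scaler_sumr.
    by apply: eq_bigr => p _; rewrite kronZr !scalerA mulrC.
  have -> : \sum_(p : 'I_(P * Q) * 'I_(P * Q) * 'I_4)
      z (inr p) *: ((g (inr p) t)%:C *: unitmx_of (tagged (u (inr p))).1 (tagged (u (inr p))).2)
      = \matrix_(i, j) r t i j.
    rewrite [RHS]matrix_sum_delta pair_bigA.
    transitivity (\sum_(p : 'I_(P * Q) * 'I_(P * Q) * 'I_4)
      ((4 * c)%:C * 'i ^+ (p.2 : nat)) *: (((4 * c)^-1 *
        quarter (r t p.1.1 p.1.2) p.2)%:C *: (delta_mx p.1.1 p.1.2 : 'M[C]_(P * Q)))).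
      by apply: eq_bigr => -[].
    rewrite -(pair_bigA _ (fun (p : 'I_(P * Q) * 'I_(P * Q)) (k : 'I_4) =>
      ((4 * c)%:C * 'i ^+ (k : nat)) *:
        (((4 * c)^-1 * quarter (r t p.1 p.2) k)%:C *: (delta_mx p.1 p.2 : 'M[C]_(P * Q))))).
    apply: eq_bigr => p _ /=; rewrite mxE {2}(quarterE (r t p.1 p.2)) scaler_suml.
    apply: eq_bigr => k _; rewrite scalerA; congr (_ *: _).
    rewrite mulrAC -rmorphM mulrA.
    have [cz|cn0] := eqVneq c 0.
      have -> : r t p.1 p.2 = 0.
        apply: nc_eq0; apply: le_anti; rewrite nc_ge0 andbT.
        by rewrite (le_trans (rc _ _ _ t01)) // cz mulr0.
      by rewrite quarter0 !mulr0 mul0r.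
    by rewrite mulfV ?mul1r 1?mulrC // mulf_neq0 // pnatr_eq0.
  apply/matrixP => i j; rewrite !mxE /r; ring.
Qed.

End Units.
End DimensionDrop.

Section PowerBound.
Variables (R : realType) (A : cstarType R).

(* The norm is computed from powers, as for the spectral radius: a bound with a bad
   constant [K] on all of them gives the optimal one. *)
Lemma cnorm_pow_bound (x : A) (c K : R) : 0 <= c ->
  (forall n, cnorm ((star x * x) ^+ (2 ^ n)) <= K * c ^+ (2 ^ n.+1)) -> cnorm x <= c.
Proof.
move=> c0 h.
have hx n : cnorm x ^+ (2 ^ n.+1) <= K * c ^+ (2 ^ n.+1).
  have -> : cnorm x ^+ (2 ^ n.+1) = cnorm ((star x * x) ^+ (2 ^ n)).
    by rewrite cnormX_sa ?starM ?starK // cnorm_star -exprM -expnS.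
  exact: h.
rewrite leNgt; apply/negP => cx.
have x0 : 0 < cnorm x by exact: le_lt_trans cx.
have [c00|cn0] := eqVneq c 0.
  have := hx 0%N; rewrite c00 expr0n mulr0; apply/negP; rewrite -ltNge.
  by rewrite exprn_gt0.
have cp : 0 < c by rewrite lt0r cn0.
(* If [cnorm x] were [c * (1 + d)] with [d > 0], Bernoulli's inequality would make the powers of
   [1 + d] exceed the fixed constant [K]. *)
pose d := cnorm x / c - 1.
have d0 : 0 < d by rewrite subr_gt0 ltr_pdivlMr // mul1r.
have hd n : (2 ^ n.+1)%:R * d <= K.
  have h1 : (1 + d) ^+ (2 ^ n.+1) <= K.
    by rewrite /d addrC subrK expr_div_n ler_pdivrMr ?exprn_gt0 // hx.
  have h2 m : 1 + m%:R * d <= (1 + d) ^+ m.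
    elim: m => [|m IH]; first by rewrite mul0r addr0 expr0.
    rewrite exprS -natr1 mulrDl mul1r; have : 0 <= m%:R * d by rewrite mulr_ge0 // ltW.
    by move: IH; move: ((1 + d) ^+ m) (m%:R * d) => u v; nra.
  by have := h2 (2 ^ n.+1)%N; lra.
have K0 : 0 <= K by apply: le_trans (hd 0%N); rewrite mulr_ge0 // ltW.
pose n := Num.bound (K / d).
have : K / d < n%:R by apply: archi_boundP; rewrite divr_ge0 // ltW.
rewrite ltr_pdivrMr // ltNge => /negP; apply.
apply: le_trans (hd n); apply: ler_wpM2r; [exact: ltW | rewrite ler_nat].
by apply: ltnW; rewrite (leq_trans (ltn_expl n (ltnSn 1))) // leq_exp2l.
Qed.

End PowerBound.

(** * Norms and traces on the image of one building block *)

Section Embedding.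
Variables (R : realType) (Z : cstarType R) (P Q : nat).
Hypotheses (P0 : (0 < P)%N) (Q0 : (0 < Q)%N).
Local Notation C := R[i].
Local Notation d := (P * Q)%N.
Variable mu : (R -> 'M[C^o]_(P * Q)) -> Z.
Hypothesis hmu : dimdrop_embedding mu.
Local Notation umx := (unitmx_of R).
Implicit Types (f : R -> 'M[C]_(P * Q)) (g h : R -> R).

Lemma mxstarE m n (X : 'M[C]_(m, n)) : mxstar X = adj X.
Proof. by apply/matrixP => i j; rewrite !mxE. Qed.

Lemma emD f f' : ddrop f -> ddrop f' -> mu (fun t => f t + f' t) = mu f + mu f'.
Proof. by move=> /dimdropP hf /dimdropP hf'; exact: (dimdropD hmu). Qed.

Lemma emZ (c : C) f : ddrop f -> mu (fun t => c *: f t) = c *: mu f.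
Proof. by move=> /dimdropP hf; exact: (dimdropZ hmu). Qed.

Lemma emM f f' : ddrop f -> ddrop f' -> mu (fun t => f t *m f' t) = mu f * mu f'.
Proof. by move=> /dimdropP hf /dimdropP hf'; exact: (dimdropM hmu). Qed.

Lemma em_eq f f' : ddrop f -> ddrop f' -> (forall t, 0 <= t <= 1 -> f t = f' t) ->
  mu f = mu f'.
Proof.
move=> /dimdropP hf /dimdropP hf' e; apply/(dimdrop_inj hmu hf hf') => t.
by rewrite in_itv; exact: e.
Qed.

Lemma em_inj f f' : ddrop f -> ddrop f' -> mu f = mu f' ->
  forall t, 0 <= t <= 1 -> f t = f' t.
Proof.
move=> /dimdropP hf /dimdropP hf' /(dimdrop_inj hmu hf hf') e t t01.
by apply: e; rewrite in_itv.
Qed.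

Lemma em_star f : ddrop f -> mu (fun t => adj (f t)) = star (mu f).
Proof.
move=> hf; rewrite -(dimdrop_star hmu); last exact/dimdropP.
by congr mu; apply/funext => t; rewrite -mxstarE.
Qed.

Lemma em1 : mu (fun=> 1%:M) = 1. Proof. exact: (dimdrop1 hmu). Qed.

Lemma em0 : mu (fun=> 0) = 0.
Proof.
rewrite -[RHS](scale0r (mu (fun=> 0))) -(emZ 0 (@ddrop0 R P Q)).
by congr mu; apply/funext => t; rewrite scale0r.
Qed.

Lemma em_sum (I : Type) (s : seq I) (B : pred I) (F : I -> R -> 'M[C]_(P * Q)) :
  (forall i, B i -> ddrop (F i)) ->
  mu (fun t => \sum_(i <- s | B i) F i t) = \sum_(i <- s | B i) mu (F i).
Proof.
move=> h; elim: s => [|i s IH].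
  by rewrite big_nil -em0; congr mu; apply/funext => t; rewrite big_nil.
rewrite big_cons -IH; case: ifP => Bi; last first.
  by congr mu; apply/funext => t; rewrite big_cons Bi.
rewrite -emD; [|exact: h|exact: ddrop_sum].
by congr mu; apply/funext => t; rewrite big_cons Bi.
Qed.

(** The basic elements from which norms and traces are computed; meaningful when [g] is admissible
    for [s]. *)
Definition el s g (a b : 'I_(usize P Q s)) : Z :=
  mu (fun t => (g t)%:C *: umx a b).

Lemma elM (s : corner) g h (a b c e : 'I_(usize P Q s)) :
  admissible s g -> admissible s h ->
  el g a b * el h c e = (b == c)%:R *: el (fun t => g t * h t) a e.
Proof.
move=> hg hh; have dd k x y : admissible s k ->
    ddrop (fun t => (k t)%:C *: @unitmx_of R P Q s x y) by exact: ddrop_unitR.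
rewrite /el -emM; [|exact: dd|exact: dd].
have hgh : admissible s (fun t => g t * h t) by apply: admissibleM => //; case: hh.
rewrite -emZ; last exact: dd.
congr mu; apply/funext => t.
by rewrite -scalemxAr -scalemxAl mul_unitmx_of !scalerA rmorphM mulrC [X in _ *: _ = (_ * X) *: _]mulrC.
Qed.

Lemma el_star (s : corner) g (a b : 'I_(usize P Q s)) : admissible s g ->
  star (el g a b) = el g b a.
Proof.
move=> hg; rewrite /el -em_star; last exact: ddrop_unitR.
by congr mu; apply/funext => t; rewrite adjZ adj_unitmx_of conjc_real.
Qed.

Lemma el_eq (s : corner) g h (a b : 'I_(usize P Q s)) : admissible s g ->
  admissible s h -> (forall t, 0 <= t <= 1 -> g t = h t) -> el g a b = el h a b.
Proof.
move=> hg hh e; apply: em_eq; [exact: ddrop_unitR | exact: ddrop_unitR |].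
by move=> t t01; rewrite e.
Qed.

(** The bound must come from relations alone. The diagonal element [x] with function [g ^ 2] and
    [1 - y] have squares summing to one, so [x] is the real part of a unitary; the C*-identity
    passes from [x] to [el g a b]. *)
Lemma el_le1 (s : corner) g (a b : 'I_(usize P Q s)) : admissible s g ->
  (forall t, 0 <= t <= 1 -> 0 <= g t <= 1) -> cnorm (el g a b) <= 1.
Proof.
move=> hg g01; have [cg _ _] := hg.
(* The square root itself equals one where [g] vanishes; its difference from one vanishes there, so
   it stays admissible, and the missing unit is restored in [1 - y]. *)
pose k x : R := 1 - Num.sqrt (1 - x ^+ 4).
have ck h : contR h -> contR (fun t => k (h t)).
  move=> ch; apply: contRD (contR_cst 1) _; apply/contRN/contR_sqrt.
  apply: contRD (contR_cst 1) _; apply/contRN.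
  apply: contC_eq (contRM ch (contRM ch (contRM ch ch))) => t _.
  by congr (_%:C); ring.
have hk : admissible s (fun t => k (g t)).
  by apply: admissible_comp => //; rewrite /k expr0n subr0 sqrtr1 subrr.
have hgg : admissible s (fun t => g t * g t) by exact: admissibleM.
pose x := el (fun t => g t * g t) b b; pose y := el (fun t => k (g t)) b b.
have xy : x * y = y * x.
  rewrite !elM //; congr (_ *: _); apply: el_eq.
  - by apply: admissibleM; case: hk.
  - by apply: admissibleM => //; case: hgg.
  - by move=> t _; rewrite mulrC.
have e : x ^+ 2 + (1 - y) ^+ 2 = 1.
  have sum0 : x * x + (y * y + (- 2)%:C *: y) = 0.
    rewrite !elM // !eqxx !scale1r /y /el -emZ; last exact: ddrop_unitR.
    have hkk : admissible s (fun t => k (g t) * k (g t)).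
      by apply: admissibleM => //; case: hk.
    have hg4 : admissible s (fun t => g t * g t * (g t * g t)).
      by apply: admissibleM => //; case: hgg.
    have dk : ddrop (fun t => (k (g t) * k (g t))%:C *: umx b b) by exact: ddrop_unitR.
    have dg : ddrop (fun t => (g t * g t * (g t * g t))%:C *: umx b b) by exact: ddrop_unitR.
    have dy : ddrop (fun t => (- 2)%:C *: ((k (g t))%:C *: umx b b)).
      by apply/ddropZ/ddrop_unitR.
    rewrite -emD // -emD //; last exact: ddropD.
    rewrite -em0; apply: em_eq; [by apply: ddropD => //; exact: ddropD|exact: ddrop0|].
    move=> t t01; rewrite scalerA -rmorphM -!scalerDl -!rmorphD.
    suff E : g t * g t * (g t * g t) + (k (g t) * k (g t) + - 2 * k (g t)) = 0.
      by rewrite E rmorph0 scale0r.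
    have /andP[t0 t1] := g01 t t01.
    have : 0 <= 1 - g t ^+ 4 by rewrite subr_ge0 exprn_ile1.
    rewrite /k => /sqr_sqrtr; move: (Num.sqrt _) => q q2.
    by rewrite (_ : _ + _ = q ^+ 2 - (1 - g t ^+ 4)); [rewrite q2 subrr | ring].
  rewrite -[(1 - y) ^+ 2]sqrrN opprB sqrrB1 !expr2 addrA addrA.
  have -> : - (y *+ 2) = (- 2)%:C *: y by rewrite rmorphN scaleNr rmorph_nat scaler_nat.
  by rewrite -(addrA (x * x)) sum0 add0r.
have nx : cnorm x <= 1.
  apply: (@cnorm_unitary_part _ _ _ (1 - y)) => //.
  - by rewrite /x el_star.
  - by rewrite starB star1 /y el_star.
  - by rewrite mulrBr mulrBl mulr1 mul1r xy.
  - by rewrite e expr1n scale1r.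
rewrite -(@ler_pXn2r _ 2) ?nnegrE ?cnorm_ge0 // -cnorm_star expr1n.
by rewrite el_star // elM // eqxx scale1r.
Qed.

Lemma em_generate f (c : R) : ddrop f ->
  (forall t i j, 0 <= t <= 1 -> nc (f t i j) <= c) ->
  exists (z : gen_index P Q -> C) (g : gen_index P Q -> R -> R)
    (u : gen_index P Q -> {s & ('I_(usize P Q s) * 'I_(usize P Q s))%type}),
  [/\ forall x, admissible (tag (u x)) (g x),
      forall x t, 0 <= t <= 1 -> 0 <= g x t <= 1,
      forall x, nc (z x) <= 4 * c,
      mu f = \sum_x z x *: el (g x) (tagged (u x)).1 (tagged (u x)).2
    & forall t, 0 <= t <= 1 -> f t =
        \sum_x z x *: ((g x t)%:C *: umx (tagged (u x)).1 (tagged (u x)).2)].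
Proof.
move=> hf fc; have [z [g [u [ag g01 zc e]]]] := ddrop_generate P0 Q0 hf fc.
exists z, g, u; split=> //.
transitivity (\sum_x mu (fun t => z x *: ((g x t)%:C *:
    umx (tagged (u x)).1 (tagged (u x)).2))); last first.
  by apply: eq_bigr => x _; rewrite emZ //; exact: ddrop_unitR.
have dx x : ddrop (fun t => z x *: ((g x t)%:C *:
    umx (tagged (u x)).1 (tagged (u x)).2)) by apply/ddropZ/ddrop_unitR.
rewrite -em_sum //; apply: em_eq => //; exact: ddrop_sum.
Qed.

(** The constant depends on the matrix sizes but not on [f]; where the sharp constant matters it is
    recovered by [cnorm_pow_bound]. *)
Lemma em_crude_bound : exists2 K : R, 0 < K & forall f c, ddrop f ->
  (forall t i j, 0 <= t <= 1 -> nc (f t i j) <= c) -> cnorm (mu f) <= K * c.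
Proof.
exists (4 * #|{: gen_index P Q}|.+1%:R); first by rewrite mulr_gt0.
move=> f c hf fc; have [z [g [u [ag g01 zc -> _]]]] := em_generate hf fc.
have c0 : 0 <= c.
  have k : 'I_d by apply: (Ordinal (n := d) (m := 0)); rewrite muln_gt0 P0.
  by apply: le_trans (fc 0 k k _); rewrite ?nc_ge0 ?lexx ?ler01.
rewrite (le_trans (cnorm_sum _ _ _)) //.
apply: (@le_trans _ _ (\sum_(x : gen_index P Q) 4 * c)).
  apply: ler_sum => x _.
  have -> : cnorm (z x *: el (g x) (tagged (u x)).1 (tagged (u x)).2) =
      nc (z x) * cnorm (el (g x) (tagged (u x)).1 (tagged (u x)).2).
    by apply: complexI; rewrite cnormZ ncE -rmorphM.
  rewrite (le_trans _ (zc x)) // ler_piMr ?nc_ge0 // el_le1 //; exact: g01.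
rewrite sumr_const -[_ *+ _]mulr_natr mulrAC ler_wpM2r // ler_wpM2l //.
by rewrite ler_nat.
Qed.

Section Trace.
(** The trace properties are asked on the range of [mu] only, so that both [tau] and the fibre
    traces of later stages qualify. *)
Variable T : Z -> C.
Hypothesis TD : forall f f', ddrop f -> ddrop f' -> T (mu f + mu f') = T (mu f) + T (mu f').
Hypothesis TZ : forall c f, ddrop f -> T (c *: mu f) = c * T (mu f).
Hypothesis Ttr : forall f f', ddrop f -> ddrop f' -> T (mu f * mu f') = T (mu f' * mu f).

Lemma T_sum (I : Type) (r : seq I) (F : I -> R -> 'M[C]_(P * Q)) :
  (forall i, ddrop (F i)) -> T (\sum_(i <- r) mu (F i)) = \sum_(i <- r) T (mu (F i)).
Proof.
move=> h; elim: r => [|i r IH].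
  by have := TZ 0 (@ddrop0 R P Q); rewrite scale0r mul0r !big_nil.
by rewrite !big_cons -IH -em_sum // TD //; exact: ddrop_sum.
Qed.

Lemma contR_ddrop g : contR g -> ddrop (fun t => (g t)%:C%:M : 'M[C]_(P * Q)).
Proof. exact: ddrop_scalar. Qed.

(** Writing [g] as the square of its root turns [el g a b] into a product of two admissible
    elements. Exchanging the factors kills the off-diagonal traces and equalises the diagonal ones,
    whose sum is the trace of a scalar function. *)
Lemma trace_el (s : corner) g (a b : 'I_(usize P Q s)) : admissible s g ->
  (forall t, 0 <= t <= 1 -> 0 <= g t) ->
  T (el g a b) = (a == b)%:R / (usize P Q s)%:R * T (mu (fun t => (g t)%:C%:M)).
Proof.
move=> hg g0; have [cg _ _] := hg.
have hr : admissible s (fun t => Num.sqrt (g t)).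
  by apply: admissible_comp => //; [move=> h; exact: contR_sqrt | rewrite sqrtr0].
have hrr : admissible s (fun t => Num.sqrt (g t) * Num.sqrt (g t)).
  by apply: admissibleM => //; case: hr.
have gE (x y : 'I_(usize P Q s)) : el g x y = el (fun t => Num.sqrt (g t) * Num.sqrt (g t)) x y.
  apply: (@el_eq s _ _ x y hg hrr) => t t01.
  by rewrite -expr2 sqr_sqrtr // g0.
have T0 : T 0 = 0 by have := TZ 0 (@ddrop0 R P Q); rewrite scale0r mul0r.
have dd x y : ddrop (fun t => (Num.sqrt (g t))%:C *: @unitmx_of R P Q s x y).
  exact: ddrop_unitR.
have comm (x y z w : 'I_(usize P Q s)) : T (el (fun t => Num.sqrt (g t)) x y * el (fun t => Num.sqrt (g t)) z w) =
    T (el (fun t => Num.sqrt (g t)) z w * el (fun t => Num.sqrt (g t)) x y).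
  exact: Ttr.
have [ab|ab] := eqVneq a b; last first.
  rewrite mul0r mul0r gE; have := comm a a a b; rewrite !elM // eqxx scale1r => ->.
  by rewrite eq_sym (negbTE ab) scale0r.
rewrite -ab {b ab}.
have diag (c : 'I_(usize P Q s)) : T (el g c c) = T (el g a a).
  by rewrite !gE; have := comm a c c a; rewrite !elM // !eqxx !scale1r.
have : \sum_(c < usize P Q s) T (el g c c) = T (mu (fun t => (g t)%:C%:M)).
  have dg c : ddrop (fun t => (g t)%:C *: @umx P Q s c c) by exact: ddrop_unitR.
  transitivity (T (\sum_(c < usize P Q s) mu (fun t => (g t)%:C *: umx c c))).
    by symmetry; apply: T_sum.
  rewrite -em_sum; last by move=> c _; exact: dg.
  congr (T (mu _)); apply/funext => t.
  by rewrite -scaler_sumr sum_unitmx_of scalemx1.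
rewrite (eq_bigr (fun=> T (el g a a))) // sumr_const card_ord => <-.
rewrite mulr1n mul1r -[T _ *+ _]mulr_natl mulrA mulVf ?mul1r //.
by rewrite pnatr_eq0 -lt0n usize_gt0.
Qed.

Lemma contC_ntr f : contM f -> contC (fun t => ntr (f t)).
Proof. by move=> cf; apply: contCM (contC_cst _); exact: contC_tr. Qed.

Lemma ntrZ (c : C) (X : 'M[C]_(P * Q)) : ntr (c *: X) = c * ntr X.
Proof. by rewrite /ntr mxtraceZ mulrA. Qed.

(** Every trace factors through the pointwise normalised trace: this holds on the generators by
    [trace_el] and extends by linearity. *)
Lemma trace_center f : ddrop f -> T (mu f) = T (mu (fun t => (ntr (f t))%:M)).
Proof.
move=> hf; have [cf _ _] := hf.
have [c c0 hc] : exists2 c : R, 0 < c & forall t i j, 0 <= t <= 1 -> nc (f t i j) <= c.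
  have /choice[c hc] : forall p : 'I_d * 'I_d, exists c : R, 0 < c /\
      forall t, 0 <= t <= 1 -> nc (f t p.1 p.2) <= c.
    by move=> p; have [c c0 hc] := contC_bounded (cf p.1 p.2); exists c.
  exists (1 + \sum_p c p).
    by rewrite ltr_pwDl // sumr_ge0 // => p _; rewrite ltW // (hc p).1.
  move=> t i j t01; rewrite (le_trans ((hc (i, j)).2 t t01)) //.
  rewrite (bigD1 (i, j)) //= addrCA lerDl addr_ge0 // sumr_ge0 // => p _.
  by rewrite ltW // (hc p).1.
have [z [g [u [ag g01 _ e ef]]]] := em_generate hf hc.
have dx x : ddrop (fun t => z x *: ((g x t)%:C *:
    umx (tagged (u x)).1 (tagged (u x)).2)) by apply/ddropZ/ddrop_unitR.
have ds x : ddrop (fun t => (z x * ((tagged (u x)).1 == (tagged (u x)).2)%:R /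
      (usize P Q (tag (u x)))%:R) *: ((g x t)%:C%:M : 'M[C]_(P * Q))).
  by apply/ddropZ/contR_ddrop; case: (ag x).
transitivity (\sum_x T (mu (fun t => z x *: ((g x t)%:C *:
    umx (tagged (u x)).1 (tagged (u x)).2)))).
  rewrite -T_sum // e; congr T; apply: eq_bigr => x _.
  by rewrite emZ //; exact: ddrop_unitR.
transitivity (\sum_x T (mu (fun t => (z x * ((tagged (u x)).1 == (tagged (u x)).2)%:R /
      (usize P Q (tag (u x)))%:R) *: ((g x t)%:C%:M : 'M[C]_(P * Q))))).
  apply: eq_bigr => x _; have dg : ddrop (fun t => (g x t)%:C%:M : 'M[C]_(P * Q)).
    by apply: contR_ddrop; case: (ag x).
  rewrite emZ; last exact: ddrop_unitR.
  rewrite TZ; last exact: ddrop_unitR.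
  rewrite emZ // TZ //.
  have := @trace_el (tag (u x)) (g x) (tagged (u x)).1 (tagged (u x)).2 (ag x).
  rewrite /el => ->; first by rewrite !mulrA.
  by move=> t /(g01 x t)/andP[].
rewrite -T_sum // -em_sum //; congr T; apply: em_eq.
- exact: ddrop_sum.
- by apply: ddrop_scalar; exact: contC_ntr.
move=> t t01; rewrite ef // /ntr mxtrace_sum mulr_suml.
rewrite (raddf_sum (@scalar_mx C (P * Q))) /=; apply: eq_bigr => x _.
rewrite -/(ntr _) !ntrZ ntr_unitmx_of // scale_scalar_mx; congr (_%:M).
by rewrite -!mulrA; congr (_ * _); rewrite [RHS]mulrC mulrA.
Qed.

End Trace.

Definition bump (c r t : R) : R := Num.max 0 (Num.min 1 (2 - `|t - c| / r)).

Lemma contR_bump c r : contR (bump c r).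
Proof.
apply: contR_max (contR_cst 0) _; apply: contR_min (contR_cst 1) _.
apply: contRD (contR_cst 2) _; apply: contRN; apply: contRM (contR_cst _).
by apply: contR_abs; apply: contRD (@contR_id R) (contR_cst _).
Qed.

Lemma bump_ge0 c r t : 0 <= bump c r t.
Proof. by rewrite /bump le_max lexx. Qed.

Lemma bump_le1 c r t : bump c r t <= 1.
Proof. by rewrite /bump ge_max ler01 ge_min lexx. Qed.

Lemma bump_eq1 c r t : 0 < r -> `|t - c| <= r -> bump c r t = 1.
Proof.
move=> r0 h; have : `|t - c| / r <= 1 by rewrite ler_pdivrMr // mul1r.
by move=> h'; rewrite /bump min_l ?max_r //; lra.
Qed.

Lemma bump_eq0 c r t : 0 < r -> 2 * r <= `|t - c| -> bump c r t = 0.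
Proof.
move=> r0 h; have : 2 <= `|t - c| / r by rewrite ler_pdivlMr.
by move=> h'; rewrite /bump max_l // ge_min; apply/orP; right; lra.
Qed.

Lemma admissible_bump s c r : 0 < r -> 2 * r <= c -> c + 2 * r <= 1 ->
  admissible s (bump c r).
Proof.
move=> r0 h1 h2; split; first exact: contR_bump.
  by move=> _; rewrite bump_eq0 // sub0r normrN ger0_norm //; lra.
by move=> _; rewrite bump_eq0 // ger0_norm; lra.
Qed.

Lemma em_neq0 f t : ddrop f -> 0 <= t <= 1 -> f t != 0 -> mu f != 0.
Proof.
move=> hf t01; apply: contra => /eqP; rewrite -em0.
by move/(em_inj hf (@ddrop0 R P Q))/(_ t t01) => ->.
Qed.

Lemma delta_sandwich n (X : 'M[C]_n) (k a b l : 'I_n) :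
  delta_mx k a *m X *m delta_mx b l = X a b *: delta_mx k l.
Proof.
apply/matrixP => i j; rewrite mxE (bigD1 b) //= [X in _ + X]big1 ?addr0 => [|m mb].
  rewrite !mxE (bigD1 a) //= [X in _ + X]big1 ?addr0 => [|m ma].
    rewrite !mxE !eqxx andbT /=.
    by case: (i == k); case: (j == l); rewrite ?mul1r ?mul0r ?mulr1 ?mulr0.
  by rewrite mxE (negbTE ma) andbF mul0r.
by rewrite [delta_mx b l m j]mxE (negbTE mb) mulr0.
Qed.

(* Compressing with the matrix units of a bump function turns [f] into its
   normalised trace times a projection of norm one. *)
Lemma ntr_le_norm f t : ddrop f -> 0 <= t <= 1 -> nc (ntr (f t)) <= cnorm (mu f).
Proof.
move=> hf t01; have [cf _ _] := hf.
have [K K0 hK] := em_crude_bound.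
apply/ler_addgt0Pl => e e0; pose e' := e / K.
have e'0 : 0 < e' by rewrite divr_gt0.
have [dl dl0 hdl] := contC_ntr cf t01 e'0.
pose r := Num.min dl 1 / 16.
have r0 : 0 < r by rewrite divr_gt0 // lt_min dl0 ltr01.
have r1 : r <= 1 / 16 by rewrite ler_wpM2r // ge_min lexx orbT.
have rd : 16 * r <= dl.
  by rewrite /r mulrC divfK // ge_min lexx.
(* The centre is moved off [t] towards the interior, so that the bump of half-width [2 * r] vanishes
   at both ends even when [t] is an end point; its support stays within [5 * r] of [t], well inside
   [dl]. *)
pose c := if t <= 1 / 2 then t + 3 * r else t - 3 * r.
have c1 : 2 * r <= c by rewrite /c; case: ifP => h; lra.
have c2 : c + 2 * r <= 1 by rewrite /c; case: ifP => h; lra.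
have tc : `|t - c| <= 3 * r.
  rewrite /c; case: ifP => _; rewrite opprD ?opprK addrA subrr add0r ?normrN ger0_norm //; lra.
have c01 : 0 <= c <= 1 by lra.
have k : 'I_d by apply: (Ordinal (n := d) (m := 0)); rewrite muln_gt0 P0.
have ag : admissible Inside (bump c r) by exact: admissible_bump.
have ag2 : admissible Inside (fun s => bump c r s * bump c r s).
  by apply: admissibleM => //; exact: contR_bump.
have ah : admissible Inside (bump c (r / 2)).
  by apply: admissible_bump; lra.
have g01 s : 0 <= s <= 1 -> 0 <= bump c r s <= 1.
  by move=> _; rewrite bump_ge0 bump_le1.
pose E a b : Z := @el Inside (bump c r) a b.
pose lam := ntr (f t).
have cN z x : cnorm (z *: x) = nc z * cnorm (x : Z).
  by apply: complexI; rewrite cnormZ ncE -rmorphM.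
pose w := mu (fun s => ((bump c r s * bump c r s)%:C * ntr (f s)) *: delta_mx k k).
have wE : d%:R *: w = \sum_(a < d) E k a * mu f * E a k.
  have dE a b : ddrop (fun s => (bump c r s)%:C *: @unitmx_of R P Q Inside a b).
    exact: ddrop_unitR.
  have dw : ddrop (fun s => ((bump c r s * bump c r s)%:C * ntr (f s)) *:
      @unitmx_of R P Q Inside k k).
    case: ag2 => cg2 g20 g21; apply: ddrop_unit.
    - by apply: contCM => //; exact: contC_ntr.
    - by move=> /g20->; rewrite mul0r.
    - by move=> /g21->; rewrite mul0r.
  rewrite -emZ // (eq_bigr (fun a => mu (fun s => (bump c r s)%:C *: delta_mx k a *m f s *m
      ((bump c r s)%:C *: delta_mx a k)))); last first.
    move=> a _; rewrite emM; [|apply: ddropM => //; exact: dE|exact: dE].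
    by rewrite emM //; exact: dE.
  rewrite -em_sum; last first.
    by move=> a _; apply: ddropM; [apply: ddropM => //; exact: dE|exact: dE].
  congr mu; apply/funext => s.
  rewrite (eq_bigr (fun a => ((bump c r s * bump c r s)%:C * f s a a) *: delta_mx k k)).
    rewrite -scaler_suml -mulr_sumr -/(\tr _) scalerA; congr (_ *: _).
    rewrite mulrCA; congr (_ * _).
    by rewrite /ntr mulrC divfK // pnatr_eq0 -lt0n muln_gt0 P0.
  move=> a _; rewrite -scalemxAr -!scalemxAl scalerA -rmorphM -scalerA; congr (_ *: _).
  exact: delta_sandwich.
have nw : cnorm w <= cnorm (mu f).
  have d0 : 0 < d%:R :> R by rewrite ltr0n muln_gt0 P0.
  rewrite -(ler_pM2l d0) -[d%:R in X in X <= _]ger0_norm ?ler0n // -nc_real.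
  rewrite rmorph_nat -cN wE (le_trans (cnorm_sum _ _ _)) //.
  rewrite mulr_natl -[X in _ <= _ *+ X](card_ord d) -sumr_const; apply: ler_sum => a _.
  rewrite (le_trans (cnormM _ _)) //.
  apply: (@le_trans _ _ (cnorm (mu f) * 1)); last by rewrite mulr1.
  apply: ler_pM; rewrite ?cnorm_ge0 //; last exact: el_le1.
  rewrite (le_trans (cnormM _ _)) // ler_piMl ?cnorm_ge0 //; exact: el_le1.
pose x2 := @el Inside (fun s => bump c r s * bump c r s) k k.
(* The wider bump acts as a unit on the narrower one, which is not zero. *)
have x21 : 1 <= cnorm x2.
  pose x3 := @el Inside (bump c (r / 2)) k k.
  have x30 : 0 < cnorm x3.
    rewrite lt0r cnorm_ge0 andbT; apply/eqP => /cnorm_eq0/eqP; apply/negP.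
    apply: (@em_neq0 _ c) => //; first exact: ddrop_unitR.
    rewrite bump_eq1 ?subrr ?normr0 ?scale1r; try lra.
    apply: contra_neq (oner_neq0 C) => /matrixP/(_ k k).
    by rewrite !mxE !eqxx.
  have e23 : x2 * x3 = x3.
    rewrite elM // eqxx scale1r; apply: el_eq => //.
      by apply: admissibleM => //; exact: contR_bump.
    move=> s _; have [h|h] := leP `|s - c| r.
      by rewrite !(@bump_eq1 c r) // !mul1r.
    by rewrite (@bump_eq0 c (r / 2)) ?mulr0 //; lra.
  by rewrite -(ler_pM2r x30) mul1r -{1}e23 cnormM.
have hdiff : cnorm (w - lam *: x2) <= e.
  have [cg2 g20 g21] := ag2.
  have dw : ddrop (fun s => ((bump c r s * bump c r s)%:C * ntr (f s)) *: @umx P Q Inside k k).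
    apply: ddrop_unit.
    - by apply: contCM => //; exact: contC_ntr.
    - by move=> /g20->; rewrite mul0r.
    - by move=> /g21->; rewrite mul0r.
  have dx : ddrop (fun s => (bump c r s * bump c r s)%:C *: @umx P Q Inside k k).
    exact: ddrop_unitR.
  rewrite -scaleNr /x2 /el -emZ // -emD //; last exact: ddropZ.
  have -> : e = K * e' by rewrite /e' mulrC divfK // gt_eqF.
  apply: hK; first by apply: ddropD => //; exact: ddropZ.
  move=> s i j s01.
  have -> : ((bump c r s * bump c r s)%:C * ntr (f s)) *: @umx P Q Inside k k +
      - lam *: ((bump c r s * bump c r s)%:C *: @umx P Q Inside k k) =
      ((bump c r s * bump c r s)%:C * (ntr (f s) - lam)) *: @umx P Q Inside k k.
    by rewrite scalerA -scalerDl; congr (_ *: _); rewrite mulNr mulrBr (mulrC lam).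
  rewrite [X in nc X]mxE !ncM.
  have -> : nc ((@umx P Q Inside k k) i j) = ((i == k) && (j == k))%:R.
    by rewrite /= mxE; case: (_ && _); rewrite ?nc1 ?nc0.
  have [h|h] := leP (2 * r) `|s - c|.
    by rewrite bump_eq0 // mul0r nc0 !mul0r ltW.
  have st : `|s - t| < dl.
    have := ler_normD (s - c) (c - t); rewrite addrA subrK (distrC c t).
    have := tc; lra.
  have := hdl s s01 st => /ltW h1.
  have h2 : nc (bump c r s * bump c r s)%:C <= 1.
    by rewrite nc_real ger0_norm ?mulr_ge0 ?bump_ge0 // mulr_ile1 ?bump_ge0 ?bump_le1.
  have h3 : ((i == k) && (j == k))%:R <= 1 :> R by case: (_ && _); rewrite ?lexx ?ler01.
  rewrite -[e']mulr1; apply: ler_pM => //; first by rewrite mulr_ge0 ?nc_ge0.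
  by rewrite -[e']mul1r; apply: ler_pM => //; exact: nc_ge0.
have : nc lam <= nc lam * cnorm x2 by rewrite ler_peMr ?nc_ge0.
rewrite -cN; have := cnormD w (- (w - lam *: x2)); rewrite cnormN.
rewrite opprB addrCA subrr addr0; lra.
Qed.

End Embedding.

(** * Fibres and traces of the inductive limit *)

Lemma linear_of (K : pzRingType) (U V : lmodType K) (f : U -> V) :
  linear f -> exists g : {linear U -> V}, g =1 f.
Proof.
move=> h; pose L := GRing.isLinear.Build K U V *:%R f h.
by exists (HB.pack_for {linear U -> V} f L).
Qed.

Section UltraLimit.
Variables (R : realType) (U : set_system nat).
Hypotheses (UU : UltraFilter U) (Uoo : \oo `<=` U).

Lemma ultra_eventually (N : nat) : U [set n | (N <= n)%N].
Proof. by apply: Uoo; exists N. Qed.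

(** Compactness gives a cluster point of the image, and an ultrafilter converges to its cluster
    points. *)
Lemma ultra_lim_real (u : nat -> R) M : (forall n, `|u n| <= M) ->
  exists l, forall e, 0 < e -> U [set n | `|u n - l| < e].
Proof.
move=> hM.
have hU : (u @ U) `[- M, M]%classic.
  apply: (@filterS _ U _ setT) => [n _|]; last exact: filterT.
  by have := hM n; rewrite ler_norml => h1; rewrite /= in_itv.
have [l [_ hl]] := @segment_compact R (- M) M (u @ U) _ hU.
exists l => e e0; case: (in_ultra_setVsetC [set n | `|u n - l| < e] UU) => // hC.
have := hl (~` [set x | `|x - l| < e]) (ball l e) hC (nbhsx_ballx _ _ e0).
by move=> [x [/= hx]]; rewrite /ball /= distrC => /hx.
Qed.

Lemma ultra_lim (u : nat -> R[i]) M : (forall n, nc (u n) <= M) ->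
  exists l, forall e, 0 < e -> U [set n | nc (u n - l) < e].
Proof.
move=> hM.
have [a ha] := @ultra_lim_real (fun n => complex.Re (u n)) M
  (fun n => le_trans (nc_Re _) (hM n)).
have [b hb] := @ultra_lim_real (fun n => complex.Im (u n)) M
  (fun n => le_trans (nc_Im _) (hM n)).
exists (a +i* b) => e e0; have e2 : 0 < e / 2 by rewrite divr_gt0.
apply: filterS (filterI (ha _ e2) (hb _ e2)) => n [/= h1 h2].
apply: le_lt_trans (nc_le _) _.
by move: h1 h2; case: (u n) => x y /=; lra.
Qed.

Lemma ultra_ex (P : set nat) : U P -> exists n, P n.
Proof. exact: filter_ex. Qed.

End UltraLimit.

(** * Fibres over later stages and uniform convergence of traces *)

Section InductiveSystem.
Variables (R : realType) (Z : cstarType R).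
Local Notation C := R[i].
Variables (p q : nat -> nat).
Variable mu : forall k, (R -> 'M[C^o]_(p k * q k)) -> Z.
Arguments mu : clear implicits.
Hypotheses (p0 : forall k, (0 < p k)%N) (q0 : forall k, (0 < q k)%N).
Hypothesis hmu : forall k, dimdrop_embedding (mu k).

Definition DD k : set Z := [set x | exists2 f, ddrop f & mu k f = x].

Hypothesis incl : forall k, DD k `<=` DD k.+1.
Hypothesis dense : forall x (e : R), 0 < e -> exists k, exists2 y, DD k y & cnorm (x - y) < e.

Lemma DD_le k l : (k <= l)%N -> DD k `<=` DD l.
Proof.
by move=> /subnK <-; elim: (l - k)%N => // i IH; exact: subset_trans IH (@incl _).
Qed.

Lemma DDD k x y : DD k x -> DD k y -> DD k (x + y).
Proof.
move=> [f hf <-] [g hg <-]; exists (fun t => f t + g t); first exact: ddropD.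
exact: (emD (hmu k)).
Qed.

Lemma DDZ k c x : DD k x -> DD k (c *: x).
Proof.
move=> [f hf <-]; exists (fun t => c *: f t); first exact: ddropZ.
exact: (emZ (hmu k)).
Qed.

Lemma DDM k x y : DD k x -> DD k y -> DD k (x * y).
Proof.
move=> [f hf <-] [g hg <-]; exists (fun t => f t *m g t); first exact: ddropM.
exact: (emM (hmu k)).
Qed.

Lemma DD_star k x : DD k x -> DD k (star x).
Proof.
move=> [f hf <-]; exists (fun t => adj (f t)); first exact: ddrop_adj.
exact: (em_star (hmu k)).
Qed.

Lemma DD1 k : DD k 1.
Proof.
exists (fun=> 1%:M); last exact: (em1 (hmu k)).
exact: (@ddrop_scalar R (p k) (q k) (fun=> 1) (contC_cst 1)).
Qed.

Lemma DD0 k : DD k 0.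
Proof. exists (fun=> 0); [exact: ddrop0 | exact: (em0 (hmu k))]. Qed.

Lemma DDN k x : DD k x -> DD k (- x).
Proof. by move=> hx; rewrite -scaleN1r; exact: DDZ. Qed.

Lemma DDB k x y : DD k x -> DD k y -> DD k (x - y).
Proof. by move=> hx hy; apply: DDD => //; exact: DDN. Qed.

Lemma DD_sum k (I : Type) (s : seq I) (B : pred I) (F : I -> Z) :
  (forall i, B i -> DD k (F i)) -> DD k (\sum_(i <- s | B i) F i).
Proof.
by move=> h; elim/big_ind: _ => // [|x y]; [exact: DD0 | exact: DDD].
Qed.

Lemma DD_mu k f : ddrop f -> DD k (mu k f).
Proof. by move=> hf; exists f. Qed.

(* Junk value [0] outside the [k]-th building block. *)
Definition fib k (x : Z) : R -> 'M[C]_(p k * q k) :=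
  if pselect (exists2 f, ddrop f & mu k f = x) is left h then sval (cid2 h)
  else fun=> 0.

Lemma fibP k x : DD k x -> ddrop (fib k x) /\ mu k (fib k x) = x.
Proof.
by move=> h; rewrite /fib; case: pselect => // h'; case: (cid2 h').
Qed.

Lemma fib_mu k f t : ddrop f -> 0 <= t <= 1 -> fib k (mu k f) t = f t.
Proof.
move=> hf; have [h1 h2] := fibP (DD_mu hf).
exact: (em_inj (hmu k) h1 hf h2).
Qed.

Lemma fibD k x y t : DD k x -> DD k y -> 0 <= t <= 1 ->
  fib k (x + y) t = fib k x t + fib k y t.
Proof.
move=> /fibP[hx ex] /fibP[hy ey] t01.
rewrite -[in LHS]ex -[in LHS]ey -(emD (hmu k)) //.
exact: (fib_mu (ddropD hx hy)).
Qed.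

Lemma fibZ k c x t : DD k x -> 0 <= t <= 1 -> fib k (c *: x) t = c *: fib k x t.
Proof.
move=> /fibP[hx ex] t01; rewrite -[in LHS]ex -(emZ (hmu k)) //.
exact: (fib_mu (ddropZ c hx)).
Qed.

Lemma fibM k x y t : DD k x -> DD k y -> 0 <= t <= 1 ->
  fib k (x * y) t = fib k x t *m fib k y t.
Proof.
move=> /fibP[hx ex] /fibP[hy ey] t01.
rewrite -[in LHS]ex -[in LHS]ey -(emM (hmu k)) //.
exact: (fib_mu (ddropM hx hy)).
Qed.

Lemma fib_star k x t : DD k x -> 0 <= t <= 1 -> fib k (star x) t = adj (fib k x t).
Proof.
move=> /fibP[hx ex] t01; rewrite -[in LHS]ex -(em_star (hmu k)) //.
exact: (fib_mu (ddrop_adj hx)).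
Qed.

Lemma fib1 k t : 0 <= t <= 1 -> fib k 1 t = 1%:M.
Proof.
move=> t01; rewrite -(em1 (hmu k)); exact: (fib_mu (@ddrop_scalar R (p k) (q k) (fun=> 1) (contC_cst 1))).
Qed.

Lemma fib0 k t : 0 <= t <= 1 -> fib k 0 t = 0.
Proof. by move=> t01; rewrite -(em0 (hmu k)); exact: (fib_mu (@ddrop0 _ _ _)). Qed.

Lemma fibN k x t : DD k x -> 0 <= t <= 1 -> fib k (- x) t = - fib k x t.
Proof. by move=> hx t01; rewrite -scaleN1r fibZ // scaleN1r. Qed.

Lemma fibB k x y t : DD k x -> DD k y -> 0 <= t <= 1 ->
  fib k (x - y) t = fib k x t - fib k y t.
Proof. by move=> hx hy t01; rewrite fibD ?fibN //; exact: DDN. Qed.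

Lemma fib_sum k (I : Type) (s : seq I) (F : I -> Z) t : (forall i, DD k (F i)) ->
  0 <= t <= 1 -> fib k (\sum_(i <- s) F i) t = \sum_(i <- s) fib k (F i) t.
Proof.
move=> h t01; elim: s => [|i s IH]; first by rewrite !big_nil fib0.
by rewrite !big_cons fibD // ?IH //; exact: DD_sum.
Qed.

Lemma ntrD k (X Y : 'M[C]_(p k * q k)) : ntr (X + Y) = ntr X + ntr Y.
Proof. by rewrite /ntr mxtraceD mulrDl. Qed.

Lemma ntrB k (X Y : 'M[C]_(p k * q k)) : ntr (X - Y) = ntr X - ntr Y.
Proof. by rewrite /ntr raddfB mulrBl. Qed.

Lemma ntr1 k : ntr (1%:M : 'M[C]_(p k * q k)) = 1.
Proof. by rewrite /ntr mxtrace1 mulfV // pnatr_eq0 -lt0n muln_gt0 p0 q0. Qed.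

Lemma ntr_mulC k (X Y : 'M[C]_(p k * q k)) : ntr (X *m Y) = ntr (Y *m X).
Proof. by rewrite /ntr mxtrace_mulC. Qed.

Definition trf k t x : C := ntr (fib k x t).

Lemma trf_le k x t : DD k x -> 0 <= t <= 1 -> nc (trf k t x) <= cnorm x.
Proof.
move=> /fibP[hx ex] t01; rewrite -[in X in _ <= X]ex.
exact: (ntr_le_norm (p0 k) (q0 k) (hmu k)).
Qed.

Lemma tr_adj_mul n m (X : 'M[C]_(m, n)) :
  \tr (adj X *m X) = (\sum_i \sum_j nc (X j i) ^+ 2)%:C.
Proof.
rewrite rmorph_sum; apply: eq_bigr => i _; rewrite mxE rmorph_sum.
by apply: eq_bigr => j _; rewrite adjE nc_sqrC.
Qed.

Lemma trf_pos k x t : DD k x -> 0 <= t <= 1 ->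
  exists2 r : R, 0 <= r & trf k t (star x * x) = r%:C.
Proof.
move=> hx t01; rewrite /trf fibM ?fib_star //; last exact: DD_star.
rewrite /ntr tr_adj_mul -(rmorph_nat (real_complex R)) -fmorphV -rmorphM.
eexists; last by [].
rewrite mulr_ge0 ?invr_ge0 // sumr_ge0 // => i _; rewrite sumr_ge0 // => j _.
exact: sqr_ge0.
Qed.

Section UniformTrace.
Variable tau : {linear Z -> C^o}.
Hypothesis tau_unique : forall tau' : {linear Z -> C^o},
  tracial_state tau' -> tau' =1 tau.

Let near_small (a : C) : (forall e : R, 0 < e -> nc a <= e) -> a = 0.
Proof.
move=> h; apply: nc_eq0; apply: le_anti; rewrite nc_ge0 andbT.
by apply/ler_addgt0Pl => e e0; rewrite addr0 h.
Qed.

(* Otherwise an ultrafilter limit of the offending fibre traces would be a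
   tracial state different from [tau]. *)
Lemma uniform_trace k z (eta : R) : DD k z -> 0 < eta ->
  exists2 l0, (k <= l0)%N & forall l t, (l0 <= l)%N -> 0 <= t <= 1 ->
    nc (trf l t z - tau z) < eta.
Proof.
move=> hz eta0; apply: contrapT => hno.
have /choice[Lt hLt] : forall n, exists Lt : nat * R,
    [/\ (n <= Lt.1)%N, (k <= Lt.1)%N, 0 <= Lt.2 <= 1 &
        eta <= nc (trf Lt.1 Lt.2 z - tau z)].
  move=> n; apply: contrapT => h; apply: hno.
  exists (maxn n k) => [|l t]; first exact: leq_maxr.
  rewrite geq_max => /andP[nl kl] t01; rewrite ltNge; apply/negP => h'.
  by apply: h; exists (l, t).
pose L n := (Lt n).1; pose s n := (Lt n).2.
have s01 n : 0 <= s n <= 1 by case: (hLt n).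
have Ln n : (n <= L n)%N by case: (hLt n).
(* The stages need not contain best approximations, so near-best ones are chosen, with slack
   [1 / (n + 1)]. By density they converge to the given element, whatever it is; this extends the
   fibre traces to all of [Z] before the limit is taken. *)
have /choice[a ha] : forall ny : nat * Z, exists x, DD (L ny.1) x /\
    forall x', DD (L ny.1) x' -> cnorm (ny.2 - x) <= cnorm (ny.2 - x') + ny.1.+1%:R^-1.
  move=> [n y] /=; pose E := [set cnorm (y - x) | x in DD (L n)].
  have hE : has_inf E.
    split; first by exists (cnorm (y - 0)), 0 => //; exact: DD0.
    by exists 0 => _ [x _ <-]; exact: cnorm_ge0.
  have n0 : 0 < n.+1%:R^-1 :> R by rewrite invr_gt0.
  have [_ [x hx <-] hlt] := inf_adherent n0 hE.
  exists x; split=> // x' hx'; rewrite (le_trans (ltW hlt)) // lerD2r.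
  apply: ge_inf; first by case: hE.
  by exists x'.
pose ap n y := a (n, y).
have apD n y : DD (L n) (ap n y) by case: (ha (n, y)).
have ap_lim y e : 0 < e -> exists N, forall n, (N <= n)%N -> cnorm (y - ap n y) < e.
  move=> e0; have e2 : 0 < e / 2 by rewrite divr_gt0.
  have [K [x hx yx]] := dense y e2.
  pose N1 := Num.bound (e / 2)^-1.
  have hN1 : (e / 2)^-1 < N1%:R by apply: archi_boundP; rewrite invr_ge0 ltW.
  exists (maxn K N1) => n; rewrite geq_max => /andP[Kn Nn].
  have := (ha (n, y)).2 x (DD_le (leq_trans Kn (Ln n)) hx).
  have : n.+1%:R^-1 < e / 2.
    rewrite -[e / 2]invrK ltf_pV2 ?posrE ?invr_gt0 // (lt_le_trans hN1) //.
    by rewrite ler_nat ltnW.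
  rewrite /= -/(ap n y) => h3 h4; apply: le_lt_trans h4 _.
  rewrite [ltRHS](splitr e); exact: ltrD.
have [U [UU Uoo]] := ultraFilterLemma eventually_filter.
have Uev N : U [set n | (N <= n)%N] by exact: ultra_eventually.
have Uex P : U P -> exists n, P n by exact: ultra_ex.
pose T n y := trf (L n) (s n) (ap n y).
have Tle n x y : DD (L n) x -> DD (L n) y ->
    nc (trf (L n) (s n) x - trf (L n) (s n) y) <= cnorm (x - y).
  move=> hx hy; rewrite /trf -ntrB -fibB // -/(trf _ _ _).
  by apply: trf_le => //; exact: DDB.
have Tz y n x : DD (L n) x -> nc (T n y - trf (L n) (s n) x) <= cnorm (ap n y - x).
  by move=> hx; exact: Tle.
have /choice[S hS] : forall y, exists l, forall e, 0 < e -> U [set n | nc (T n y - l) < e].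
  move=> y; apply: (@ultra_lim R U UU (fun n => T n y) (cnorm y + cnorm y + 1)) => n.
  rewrite (le_trans (trf_le (apD _ _) (s01 n))) //.
  have h3 : cnorm (y - ap n y) <= cnorm y + n.+1%:R^-1.
    by have := (ha (n, y)).2 0 (DD0 _); rewrite subr0.
  have h1 : n.+1%:R^-1 <= 1 :> R by rewrite invf_le1 ?ler1n.
  have := cnorm_tri y (ap n y) 0; rewrite !subr0 (cnorm_distC (ap n y)); move: h1 h3; move: (n.+1%:R^-1) => r; lra.
have Slim y b : (forall e, 0 < e -> exists N, forall n, (N <= n)%N -> nc (T n y - b n) < e) ->
    forall e, 0 < e -> U [set n | nc (b n - S y) < e].
  move=> hb e e0; have e2 : 0 < e / 2 by rewrite divr_gt0.
  have [N hN] := hb _ e2.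
  apply: filterS (filterI (hS y _ e2) (Uev N)) => n [/= h1 /hN h2].
  have := ncD (b n - T n y) (T n y - S y); rewrite addrA subrK.
  by rewrite -(ncN (b n - T n y)) opprB; lra.
have Suniq y c : (forall e, 0 < e -> U [set n | nc (T n y - c) < e]) -> S y = c.
  move=> hc; apply/eqP; rewrite -subr_eq0; apply/eqP/near_small => e e0.
  have e2 : 0 < e / 2 by rewrite divr_gt0.
  have [n [/= h1 h2]] := Uex _ (filterI (hS y _ e2) (hc _ e2)).
  have := ncD (S y - T n y) (T n y - c); rewrite addrA subrK.
  by rewrite -(ncN (S y - T n y)) opprB; lra.
have Slin : linear (S : Z -> C^o).
  move=> c x y; apply: Suniq => e e0.
  pose e3 := e / (4 * (nc c + 2)).
  have c0 := nc_ge0 c.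
  have e30 : 0 < e3 by rewrite divr_gt0 // mulr_gt0 // ltr_wpDl.
  have eE : 4 * (nc c + 2) * e3 = e by rewrite /e3 mulrC divfK // gt_eqF // mulr_gt0 // ltr_wpDl.
  have [N1 h1] := ap_lim (c *: x + y) _ e30.
  have [N2 h2] := ap_lim x _ e30; have [N3 h3] := ap_lim y _ e30.
  apply: filterS (filterI (filterI (hS x _ e30) (hS y _ e30))
    (filterI (Uev N1) (filterI (Uev N2) (Uev N3)))).
  move=> n [[/= Sx Sy] [/h1 a1 [/h2 a2 /h3 a3]]].
  have hc : DD (L n) (c *: ap n x + ap n y) by apply: DDD => //; exact: DDZ.
  have TE : trf (L n) (s n) (c *: ap n x + ap n y) = c * T n x + T n y.
    rewrite /trf fibD ?fibZ // ?ntrD /ntr ?mxtraceZ ?mulrA //; exact: DDZ.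
  have := Tz (c *: x + y) n _ hc; rewrite TE.
  have : cnorm (ap n (c *: x + y) - (c *: ap n x + ap n y)) <= e3 * (nc c + 2).
    have -> : ap n (c *: x + y) - (c *: ap n x + ap n y) =
       - (c *: x + y - ap n (c *: x + y)) + (c *: (x - ap n x) + (y - ap n y)).
      by rewrite opprB scalerBr [X in _ = _ + X]addrACA -opprD addrA subrK.
    have := cnormD (- (c *: x + y - ap n (c *: x + y))) (c *: (x - ap n x) + (y - ap n y)).
    have := cnormD (c *: (x - ap n x)) (y - ap n y).
    have -> : cnorm (c *: (x - ap n x)) = nc c * cnorm (x - ap n x).
      by apply: complexI; rewrite cnormZ ncE -rmorphM.
    by rewrite cnormN; have := cnorm_ge0 (x - ap n x); nra.
  have -> : T n (c *: x + y) - (c *: S x + S y : C^o) =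
      (T n (c *: x + y) - (c * T n x + T n y)) + (c * (T n x - S x) + (T n y - S y)).
    by rewrite mulrBr [X in _ = _ + X]addrACA -opprD addrA subrK.
  have := ncD (T n (c *: x + y) - (c * T n x + T n y)) (c * (T n x - S x) + (T n y - S y)).
  have := ncD (c * (T n x - S x)) (T n y - S y); rewrite ncM.
  by have := nc_ge0 (T n x - S x); nra.
have prod x y e : 0 < e -> exists N, forall n, (N <= n)%N ->
    nc (T n (x * y) - trf (L n) (s n) (ap n x * ap n y)) < e.
  move=> e0; pose M := cnorm x + cnorm y + 1.
  have M0 : 0 < M by rewrite ltr_wpDl // addr_ge0 // cnorm_ge0.
  pose e3 := Num.min 1 (e / (4 * M)).
  have e30 : 0 < e3 by rewrite lt_min ltr01 divr_gt0 // mulr_gt0.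
  have e31 : e3 <= 1 by rewrite ge_min lexx.
  have e3M : 4 * M * e3 <= e.
    by rewrite mulrC -ler_pdivlMr ?mulr_gt0 // ge_min lexx orbT.
  have [N1 h1] := ap_lim (x * y) _ e30.
  have [N2 h2] := ap_lim x _ e30; have [N3 h3] := ap_lim y _ e30.
  exists (maxn N1 (maxn N2 N3)) => n; rewrite !geq_max => /and3P[/h1 a1 /h2 a2 /h3 a3].
  apply: le_lt_trans (Tz _ _ _ (DDM (apD n x) (apD n y))) _.
  have -> : ap n (x * y) - ap n x * ap n y = - (x * y - ap n (x * y)) +
      ((x - ap n x) * y + ap n x * (y - ap n y)).
    have -> : (x - ap n x) * y + ap n x * (y - ap n y) = x * y - ap n x * ap n y.
      by rewrite mulrBl mulrBr addrA subrK.
    by rewrite opprB addrA subrK.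
  have := cnormD (- (x * y - ap n (x * y))) ((x - ap n x) * y + ap n x * (y - ap n y)).
  have := cnormD ((x - ap n x) * y) (ap n x * (y - ap n y)).
  have := cnormM (x - ap n x) y; have := cnormM (ap n x) (y - ap n y).
  have : cnorm (ap n x) <= cnorm x + 1.
    by have := cnorm_tri x (ap n x) 0; rewrite !subr0 (cnorm_distC (ap n x)); lra.
  rewrite cnormN; move: a1 a2 a3 e3M; rewrite /M.
  have := cnorm_ge0 (x - ap n x); have := cnorm_ge0 (y - ap n y).
  have := cnorm_ge0 x; have := cnorm_ge0 y; have := cnorm_ge0 (ap n x).
  move: (cnorm (x - ap n x)) (cnorm (y - ap n y)) (cnorm (ap n x)) (cnorm x) (cnorm y).
  move=> u v w X Y w0 Y0 X0 v0 u0 h4 h5 h6 h7 h8 h9 h10.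
  have : u * Y <= e3 * Y by rewrite ler_wpM2r // ltW.
  have : w * v <= (X + 1) * e3 by apply: ler_pM => //; exact: ltW.
  nra.
have S_state : exists tau' : {linear Z -> C^o}, tracial_state tau' /\ tau' =1 S.
  have [tau' tE] := linear_of Slin; exists tau'; split=> //; split.
  - rewrite tE; apply: Suniq => e e0; have [N hN] := ap_lim 1 _ e0.
    apply: filterS (Uev N) => n /hN h /=; have := Tz 1 n 1 (DD1 _).
    by rewrite cnorm_distC /trf fib1 // ntr1 => /le_lt_trans; apply.
  - move=> x; rewrite tE.
    have lim := Slim _ _ (prod (star x) x).
    (* The approximant of [star x] is not the adjoint of that of [x]; it is compared with that
       adjoint, for which the fibre trace is visibly nonnegative. *)
    have pos e : 0 < e -> exists2 r : R, 0 <= r & nc (r%:C - S (star x * x)) < e.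
      move=> e0.
      have e2 : 0 < e / 2 by rewrite divr_gt0.
      have e3 : 0 < e / 2 / (2 * (cnorm x + 1)).
        by rewrite divr_gt0 // mulr_gt0 // ltr_wpDl // cnorm_ge0.
      pose d := Num.min 1 (e / 2 / (2 * (cnorm x + 1))).
      have d0 : 0 < d by rewrite lt_min ltr01.
      have dE : 2 * (cnorm x + 1) * d <= e / 2.
        rewrite mulrC -ler_pdivlMr ?ge_min ?lexx ?orbT //.
        by rewrite mulr_gt0 // ltr_wpDl // cnorm_ge0.
      have d1 : d <= 1 by rewrite ge_min lexx.
      have [N1 h1] := ap_lim x _ d0; have [N2 h2] := ap_lim (star x) _ d0.
      have [n [/= h3 [/h1 a1 /h2 a2]]] :=
        Uex _ (filterI (lim _ e2) (filterI (Uev N1) (Uev N2))).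
      have [r r0 rE] := trf_pos (apD n x) (s01 n); exists r => //.
      rewrite -rE.
      have := ncD (trf (L n) (s n) (star (ap n x) * ap n x) -
         trf (L n) (s n) (ap n (star x) * ap n x))
         (trf (L n) (s n) (ap n (star x) * ap n x) - S (star x * x)).
      rewrite addrA subrK => /le_lt_trans; apply.
      have : nc (trf (L n) (s n) (star (ap n x) * ap n x) -
         trf (L n) (s n) (ap n (star x) * ap n x)) <= 2 * d * (cnorm x + 1).
        apply: le_trans (Tle _ _ _ (DDM (DD_star (apD n x)) (apD n x))
          (DDM (apD n (star x)) (apD n x))) _.
        rewrite -mulrBl; apply: le_trans (cnormM _ _) _.
        have : cnorm (star (ap n x) - ap n (star x)) <= 2 * d.
          have := cnorm_tri (star x) (star (ap n x)) (ap n (star x)).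
          rewrite -starB cnorm_st (cnorm_distC (ap n x)); lra.
        have : cnorm (ap n x) <= cnorm x + 1.
          by have := cnorm_tri x (ap n x) 0; rewrite !subr0 (cnorm_distC (ap n x)); lra.
        by move=> *; apply: ler_pM => //; exact: cnorm_ge0.
      by move: dE h3; lra.
    rewrite lecE; apply/andP; split; apply/eqP => /=.
      apply/eqP; rewrite -normr_eq0; apply/eqP/le_anti; rewrite normr_ge0 andbT.
      apply/ler_addgt0Pl => e /pos[r r0 hr]; rewrite addr0.
      have := nc_Im (r%:C - S (star x * x)).
      by rewrite cImD (_ : complex.Im (- _) = - complex.Im (S (star x * x)));
        [rewrite /= add0r normrN; lra | case: (S _)].
    apply/eqP; rewrite (_ : (_ <= _) = true) //; apply/ler_addgt0Pl => e /pos[r r0 hr].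
    have := nc_Re (r%:C - S (star x * x)); rewrite cReD cReN /= ler_norml; lra.
  - move=> x y; rewrite !tE; apply: Suniq => e e0.
    have e2 : 0 < e / 2 by rewrite divr_gt0.
    have [N hN] := prod x y _ e2.
    apply: filterS (filterI (Uev N) (Slim _ _ (prod y x) _ e2)) => n [/hN h1 /= h2].
    have e1 : trf (L n) (s n) (ap n x * ap n y) = trf (L n) (s n) (ap n y * ap n x).
      by rewrite /trf (fibM (apD n x) (apD n y) (s01 n)) (fibM (apD n y) (apD n x) (s01 n)) ntr_mulC.
    have := ncD (T n (x * y) - trf (L n) (s n) (ap n x * ap n y))
      (trf (L n) (s n) (ap n x * ap n y) - S (y * x)).
    move: h2; rewrite -e1 => h2.
    by rewrite addrA subrK => /le_lt_trans -> //; rewrite [ltRHS](splitr e) ltrD.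
have [tau' [st tE]] := S_state.
have tz : tau z = S z by rewrite -tE (tau_unique st).
have e2 : 0 < eta / 2 by rewrite divr_gt0.
have [N hN] := ap_lim z _ e2.
have [n [/= h1 /hN h2]] := Uex _ (filterI (hS z _ e2) (Uev N)).
have [_ kL _] := hLt n; apply/negP; rewrite -ltNge -/(L n) -/(s n) tz.
have := Tz z n z (DD_le kL hz).
have := ncD (trf (L n) (s n) z - T n z) (T n z - S z); rewrite addrA subrK.
rewrite -(ncN (trf (L n) (s n) z - T n z)) opprB (cnorm_distC (ap n z)); lra.
Qed.

End UniformTrace.
End InductiveSystem.

(** One nonzero column of each matrix gives [m] nonzero orthogonal vectors, and the scaled adjoint
    is a left inverse of the matrix that they form. *)
Lemma orthogonal_ranges (R : realType) n m (a : 'I_m -> 'M[R[i]]_n) :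
  (forall i, a i != 0) -> (forall i j, i != j -> adj (a i) *m a j = 0) -> (m <= n)%N.
Proof.
move=> a0 ao.
have /choice[c hc] : forall i, exists c, col c (a i) != 0.
  move=> i; apply: contrapT => h; have /eqP := a0 i; apply.
  apply/matrixP => k c; rewrite mxE; apply: contrapT => hk; apply: h; exists c.
  by apply/eqP => /matrixP/(_ k 0); rewrite !mxE.
pose w i := col (c i) (a i).
have wo i j : i != j -> dot (w i) (w j) = 0.
  move=> ij; rewrite /w !colE -[a i]adjK dot_adj mulmxA ao // mul0mx.
  by rewrite dotE big1 // => k _; rewrite [X in _ * X]mxE mulr0.
have w0 i : w i != 0 by exact: hc.
move: w wo w0 => w wo w0.
pose A : 'M[R[i]]_(m, n) := \matrix_(i, k) ((sqn (w i))%:C^-1 * conjc (w i k 0)).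
pose B : 'M[R[i]]_(n, m) := \matrix_(k, j) w j k 0.
apply: (@mulmx1_min _ m n A B); apply/matrixP => i j; rewrite mxE.
under eq_bigr do rewrite !mxE -mulrA.
rewrite -mulr_sumr -dotE mxE; case: eqVneq => [->|/wo ->]; last by rewrite mulr0.
by rewrite dot_sqn mulVf // eq_complex /= eqxx andbT gt_eqF // sqn_gt0.
Qed.

(** * Growth of the matrix sizes *)

Section Growth.
Variables (R : realType) (Z : cstarType R).
Local Notation C := R[i].
Variables (p q : nat -> nat).
Variable mu : forall k, (R -> 'M[C^o]_(p k * q k)) -> Z.
Arguments mu : clear implicits.
Hypotheses (p0 : forall k, (0 < p k)%N) (q0 : forall k, (0 < q k)%N).
Hypothesis hmu : forall k, dimdrop_embedding (mu k).
Hypothesis incl : forall k, DD mu k `<=` DD mu k.+1.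
Hypothesis dense : forall x (e : R), 0 < e ->
  exists k, exists2 y, DD mu k y & cnorm (x - y) < e.
Hypothesis Zsimple : simple_cstar Z.

Lemma approx_sandwich (x : Z) (s : seq (Z * Z)) (e : R) : 0 < e ->
  exists k s', (forall u, u \in s' -> DD mu k u.1 /\ DD mu k u.2) /\
    cnorm (\sum_(u <- s) u.1 * x * u.2 - \sum_(u <- s') u.1 * x * u.2) < e.
Proof.
elim: s e => [|[a b] s IH] e e0.
  by exists 0%N, [::]; split=> //; rewrite !big_nil subrr cnorm0.
have e2 : 0 < e / 2 by rewrite divr_gt0.
have [k1 [s1 [hs1 h1]]] := IH _ e2.
pose M := (cnorm a + 1) * cnorm x + cnorm x * cnorm b + 1.
have M0 : 0 < M by rewrite ltr_wpDl // addr_ge0 ?mulr_ge0 ?addr_ge0 ?cnorm_ge0.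
pose dl := Num.min 1 (e / 2 / M).
have dl0 : 0 < dl by rewrite lt_min ltr01 !divr_gt0.
have dl1 : dl <= 1 by rewrite ge_min lexx.
have dlM : dl * M <= e / 2 by rewrite -ler_pdivlMr // ge_min lexx orbT.
have [k2 [a' ha' haa]] := dense a dl0; have [k3 [b' hb' hbb]] := dense b dl0.
exists (maxn k1 (maxn k2 k3)), ((a', b') :: s1); split.
  move=> u; rewrite inE => /orP[/eqP-> /=|/hs1[u1 u2]].
    split.
      by apply: (DD_le incl _ ha'); rewrite !leq_max leqnn orbT.
    by apply: (DD_le incl _ hb'); rewrite !leq_max leqnn !orbT.
  by split; [apply: (DD_le incl _ u1) | apply: (DD_le incl _ u2)]; exact: leq_maxl.
rewrite !big_cons opprD addrACA /=.
apply: le_lt_trans (cnormD _ _) _; rewrite [ltRHS](splitr e) ler_ltD //.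
have -> : a * x * b - a' * x * b' = (a - a') * (x * b) + a' * x * (b - b').
  by rewrite mulrBl mulrBr !mulrA addrA subrK.
apply: le_trans (cnormD _ _) _; apply: le_trans dlM.
have h2 : cnorm ((a - a') * (x * b)) <= dl * (cnorm x * cnorm b).
  apply: le_trans (cnormM _ _) _; apply: ler_pM (cnorm_ge0 _) (cnorm_ge0 _) (ltW haa) (cnormM _ _).
have h3 : cnorm (a' * x * (b - b')) <= (cnorm a + 1) * cnorm x * dl.
  apply: le_trans (cnormM _ _) _; apply: ler_pM (cnorm_ge0 _) (cnorm_ge0 _) _ (ltW hbb).
  apply: le_trans (cnormM _ _) _; apply: ler_wpM2r; first exact: cnorm_ge0.
  by have := cnorm_tri a a' 0; rewrite !subr0 (cnorm_distC a'); lra.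
by rewrite /M; move: h2 h3; lra.
Qed.

(** By simplicity some sum of [a * x * b], with all [a] and [b] in a single stage, is at distance
    less than one from 1. Where the fibre of [x] vanishes so does that of the sum, and the fibre
    trace of the difference would equal one. *)
Lemma fib_eventually_neq0 k x : DD mu k x -> x != 0 ->
  exists2 l0, (k <= l0)%N & forall l t, (l0 <= l)%N -> 0 <= t <= 1 -> fib mu l x t != 0.
Proof.
move=> hx x0; have h12 : 0 < 1 / 2 :> R by rewrite divr_gt0.
have [s hs] := simple_near Zsimple x0 h12.
have [m [s' [hs' ss']]] := approx_sandwich x s h12.
exists (maxn k m) => [|l t]; first exact: leq_maxl.
rewrite geq_max => /andP[kl ml] t01; apply/eqP => fx0.
have hS : {in s', forall u, DD mu l u.1 /\ DD mu l u.2}.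
  by move=> u /hs'[u1 u2]; split; [exact: (DD_le incl ml u1) | exact: (DD_le incl ml u2)].
have hxl := DD_le incl kl hx.
pose S := \sum_(u <- s') u.1 * x * u.2.
have [DS fS] : DD mu l S /\ fib mu l S t = 0.
  rewrite /S; elim: s' hS {hs' ss' S} => [|u s' IH] hS.
    by rewrite big_nil; split; [exact: DD0 | exact: fib0].
  have [D1 D2] := hS u (mem_head _ _).
  have [|D3 f3] := IH; first by move=> w ws; apply: hS; rewrite inE ws orbT.
  rewrite big_cons.
  have Du : DD mu l (u.1 * x * u.2) by do 2?[apply: DDM => //].
  split; first exact: DDD.
  rewrite fibD // f3 addr0 fibM ?fibM ?fx0 ?mulmx0 ?mul0mx //; exact: DDM.
have := cnorm_tri (\sum_(u <- s) u.1 * x * u.2) 1 S => h.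
have := trf_le p0 q0 hmu (DDB hmu (DD1 hmu l) DS) t01.
rewrite /trf fibB ?fib1 //; last exact: DD1.
by rewrite fS subr0 ntr1 // nc1; move: ss' hs h; rewrite -/S; lra.
Qed.

(** Stage 0 contains [B + 1] orthogonal nonzero elements. At late stages their fibres at both ends
    are nonzero with orthogonal ranges, and there they come from matrices of size [p l] and
    [q l]. *)
Lemma growth B : exists l0, forall l, (l0 <= l)%N -> (B < p l)%N /\ (B < q l)%N.
Proof.
(* The centres are [4 * r] apart and away from the ends, and each bump lives within [2 * r] of its
   centre, so the products vanish. *)
pose r : R := (4 * B.+2%:R)^-1; pose c (i : 'I_B.+1) : R := i.+1%:R / B.+2%:R.
have B2 : 0 < B.+2%:R :> R by [].
have r0 : 0 < r by rewrite invr_gt0 mulr_gt0.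
have rE : B.+2%:R^-1 = 4 * r by rewrite /r invfM mulrA mulfV // mul1r.
have cE i : c i = 4 * r * i.+1%:R by rewrite /c rE mulrC.
have one : 4 * r * B.+2%:R = 1 by rewrite -rE mulVf ?gt_eqF.
have ca (i : 'I_B.+1) : admissible Inside (bump (c i) r).
  have h1 : i.+1%:R + 1 <= B.+2%:R :> R by rewrite natr1 ler_nat ltnS.
  have h2 : 1 <= i.+1%:R :> R by rewrite ler1n.
  by apply: admissible_bump => //; rewrite cE; nra.
have a0 : 'I_(usize (p 0%N) (q 0%N) Inside) by exact: Ordinal (usize_gt0 (p0 0%N) (q0 0%N) Inside).
pose x i := el (mu 0%N) (bump (c i) r) a0 a0.
have Dx i : DD mu 0%N (x i) by apply: DD_mu; exact: ddrop_unitR.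
have xo (i j : 'I_B.+1) : i != j -> star (x i) * x j = 0.
  move=> ij; rewrite /x el_star // elM // eqxx scale1r.
  rewrite (@el_eq _ _ _ _ _ (hmu 0%N) Inside _ (fun=> 0)) //.
  - rewrite /el (_ : (fun _ => _) = fun=> 0); first exact: em0 (hmu 0%N).
    by apply/funext => t; rewrite scale0r.
  - by apply: admissibleM => //; exact: contR_bump.
  - by split=> //; exact: contR_cst.
  move=> t _; have [h|h] := leP (2 * r) `|t - c i|; first by rewrite bump_eq0 // mul0r.
  rewrite [X in _ * X]bump_eq0 ?mulr0 // leNgt; apply/negP => h'.
  have : `|c i - c j| < 4 * r.
    have -> : c i - c j = (t - c j) - (t - c i) by ring.
    by apply: le_lt_trans (ler_normB _ _) _; lra.
  rewrite !cE -mulrBr normrM (gtr0_norm (mulr_gt0 _ r0)) // gtr_pMr ?mulr_gt0 //.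
  rewrite ltNge => /negP; apply.
  have [ij'|ij'] := ltnP i j.
    rewrite distrC ler_normr; apply/orP; left; rewrite lerBrDr addrC.
    by rewrite natr1 ler_nat.
  rewrite ler_normr; apply/orP; left; rewrite lerBrDr addrC natr1 ler_nat.
  by rewrite ltnS ltn_neqAle ij' andbT; apply: contraNneq ij => /val_inj ->.
have x0 i : x i != 0.
  apply: (@em_neq0 _ _ _ _ _ (hmu 0%N) _ (c i)).
  - exact: ddrop_unitR.
  - rewrite divr_ge0 // ler_pdivrMr // mul1r ler_nat; exact: leqW (ltn_ord i).
  rewrite bump_eq1 ?subrr ?normr0 ?ltW // scale1r.
  by apply/eqP => /matrixP/(_ a0 a0); rewrite !mxE !eqxx => /eqP; rewrite oner_eq0.
have /choice[L hL] : forall i, exists l0, forall l t, (l0 <= l)%N -> 0 <= t <= 1 ->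
    fib mu l (x i) t != 0.
  by move=> i; have [l0 _ h] := fib_eventually_neq0 (Dx i) (x0 i); exists l0.
exists (\max_i L i)%N => l hl.
have f0 i t : 0 <= t <= 1 -> fib mu l (x i) t != 0.
  by apply: hL; apply: leq_trans hl; exact: leq_bigmax.
have Dl i : DD mu l (x i) by exact: (DD_le incl (leq0n l) (Dx i)).
have fo i j t : 0 <= t <= 1 -> i != j -> adj (fib mu l (x i) t) *m fib mu l (x j) t = 0.
  move=> t01 ij; rewrite -fib_star // -fibM //; last exact: DD_star.
  by rewrite xo // fib0.
have t0 : 0 <= (0 : R) <= 1 by rewrite lexx ler01.
have t1 : 0 <= (1 : R) <= 1 by rewrite lexx ler01.
split.
- have /choice[a ha] : forall i, exists a, fib mu l (x i) 0 = kron a 1%:M.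
    by move=> i; have [[_ [a ha] _] _] := fibP (Dl i); exists a.
  apply: (@orthogonal_ranges R _ _ a) => [i|i j ij].
    by apply: contra_neq (f0 i 0 t0) => a00; rewrite ha a00 kron0l.
  have := fo i j 0 t0 ij; rewrite !ha adj_kron adj1 kronM mulmx1 => /matrixP h.
  apply/matrixP => u v; pose w := Ordinal (q0 l).
  by have := h (mxvec_index u w) (mxvec_index v w); rewrite kronE !mxE eqxx mulr1.
have /choice[a ha] : forall i, exists a, fib mu l (x i) 1 = kron 1%:M a.
  by move=> i; have [[_ _ [a ha]] _] := fibP (Dl i); exists a.
apply: (@orthogonal_ranges R _ _ a) => [i|i j ij].
  by apply: contra_neq (f0 i 1 t1) => a00; rewrite ha a00 kron0r.
have := fo i j 1 t1 ij; rewrite !ha adj_kron adj1 kronM mulmx1 => /matrixP h.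
apply/matrixP => u v; pose w := Ordinal (p0 l).
by have := h (mxvec_index w u) (mxvec_index w v); rewrite kronE !mxE eqxx mul1r.
Qed.

End Growth.

(** * Order zero maps from frames *)

Section Endpoints.
Variables (R : realType) (P Q : nat).
Local Notation C := R[i].
Local Notation d := (P * Q)%N.

(* The endpoint [s%:R] of the unit interval is treated uniformly for [s : bool]:
   there, elements of the dimension drop algebra are [bmult s] copies of a matrix
   of size [bsize s]. *)
Definition bsize (s : bool) := if s then Q else P.
Definition bmult (s : bool) := if s then P else Q.

Lemma bsize_mult s : (bsize s * bmult s)%N = d.
Proof. by case: s => //=; rewrite mulnC. Qed.

Definition bpair (s : bool) : 'I_d -> 'I_(bsize s) * 'I_(bmult s) :=
  match s with true => fun k => ((vidx k).2, (vidx k).1) | false => @vidx P Q end.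

Definition bunpair (s : bool) : 'I_(bsize s) * 'I_(bmult s) -> 'I_d :=
  match s with
  | true => fun x => mxvec_index x.2 x.1
  | false => fun x => mxvec_index x.1 x.2
  end.

Lemma bpairK s : cancel (@bpair s) (@bunpair s).
Proof. by case: s => k /=; rewrite mxvec_vidx. Qed.

Lemma bunpairK s : cancel (@bunpair s) (@bpair s).
Proof. by case: s => -[a b] /=; rewrite vidxK. Qed.

(** The isometry onto the copy of index [k] in the block decomposition at the end [s]. *)
Definition emb (s : bool) (k : 'I_(bmult s)) : 'M[C]_(d, bsize s) :=
  \matrix_(i, a) (bpair s i == (a, k))%:R.

Lemma adj_emb_mul s (k l : 'I_(bmult s)) : adj (emb k) *m emb l = (k == l)%:R%:M.
Proof.
apply/matrixP => a b; rewrite !mxE (bigD1 (bunpair (a, k))) //= big1 => [|i ik].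
  rewrite !mxE bunpairK eqxx conjc_nat mul1r addr0 xpair_eqE.
  by case: (a == b); case: (k == l); rewrite //= ?mulr1n ?mulr0n.
rewrite adjE !mxE; case: eqP => [e|]; last by rewrite conjc_nat mul0r.
by move: ik; rewrite -e bpairK eqxx.
Qed.

(** This is [kron a 1%:M] at the end 0 and [kron 1%:M a] at the end 1, in a form common to both. *)
Definition blockop s (a : 'M[C]_(bsize s)) : 'M[C]_d :=
  \sum_k emb k *m a *m adj (emb k).

Lemma emb_mulE s (k : 'I_(bmult s)) n (a : 'M[C]_(bsize s, n)) i j :
  (emb k *m a) i j = ((bpair s i).2 == k)%:R * a (bpair s i).1 j.
Proof.
rewrite mxE (bigD1 (bpair s i).1) //= big1 => [|c ci].
  by rewrite mxE addr0 [bpair s i]surjective_pairing xpair_eqE eqxx.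
rewrite mxE [bpair s i]surjective_pairing xpair_eqE eq_sym (negbTE ci) mul0r //.
Qed.

Lemma blockopE s (a : 'M[C]_(bsize s)) i j : blockop a i j =
  a (bpair s i).1 (bpair s j).1 * ((bpair s i).2 == (bpair s j).2)%:R.
Proof.
have E (k : 'I_(bmult s)) x :
    (a *m adj (emb k)) x j = ((bpair s j).2 == k)%:R * a x (bpair s j).1.
  by rewrite -[a *m _]adjK adjM adjK adjE emb_mulE rmorphM /= conjc_nat adjE conjcK.
rewrite /blockop summxE (bigD1 (bpair s i).2) //= big1 => [|k ki].
  by rewrite -mulmxA emb_mulE E eqxx mul1r addr0 mulrC eq_sym.
by rewrite -mulmxA emb_mulE eq_sym (negbTE ki) mul0r.
Qed.

Lemma blockop_emb s (a : 'M[C]_(bsize s)) (k : 'I_(bmult s)) :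
  blockop a *m emb k = emb k *m a.
Proof.
rewrite /blockop mulmx_suml (bigD1 k) //= big1 ?addr0 => [|l lk].
  by rewrite -!mulmxA adj_emb_mul eqxx mulmx1.
by rewrite -!mulmxA adj_emb_mul (negbTE lk) -scalemx1 scale0r !mulmx0.
Qed.

Lemma blockopM s (a b : 'M[C]_(bsize s)) : blockop (a *m b) = blockop a *m blockop b.
Proof.
rewrite [X in _ = _ *m X]/blockop mulmx_sumr; apply: eq_bigr => k _.
by rewrite !mulmxA blockop_emb.
Qed.

Lemma tr_blockop s (a : 'M[C]_(bsize s)) : \tr (blockop a) = (bmult s)%:R * \tr a.
Proof.
rewrite mxtrace_sum (eq_bigr (fun=> \tr a)) => [|k _].
  by rewrite sumr_const card_ord mulr_natl.
by rewrite mxtrace_mulC mulmxA adj_emb_mul eqxx mul1mx.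
Qed.

Lemma ddrop_blockP (f : R -> 'M[C]_d) :
  ddrop f <-> contM f /\ forall s : bool, exists a : 'M[C]_(bsize s), f s%:R = blockop a.
Proof.
have E0 (a : 'M[C]_P) : kron a (1%:M : 'M[C]_Q) = @blockop false a.
  by apply/matrixP => i j; rewrite blockopE !mxE.
have E1 (a : 'M[C]_Q) : kron (1%:M : 'M[C]_P) a = @blockop true a.
  by apply/matrixP => i j; rewrite blockopE !mxE mulrC.
split=> [[cf [a ha] [b hb]]|[cf h]].
  by split=> // -[]; [exists b; rewrite hb E1 | exists a; rewrite ha E0].
split=> //; first by have [a ->] := h false; exists a; rewrite E0.
by have [a ->] := h true; exists a; rewrite E1.
Qed.

Lemma dot_emb s (k l : 'I_(bmult s)) (u v : 'cV[C]_(bsize s)) :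
  dot (emb k *m u) (emb l *m v) = (k == l)%:R * dot u v.
Proof.
by rewrite /dot adjM -mulmxA (mulmxA (adj (emb k))) adj_emb_mul mul_scalar_mx
  -scalemxAr mxE.
Qed.

Lemma orthon_emb s n n' (u : nat -> 'cV[C]_(bsize s)) (rho : nat -> nat)
    (k : nat -> 'I_(bmult s)) : orthon n' u ->
  (forall r, (r < n)%N -> (rho r < n')%N) ->
  (forall r r', (r < n)%N -> (r' < n)%N -> rho r = rho r' -> k r = k r' -> r = r') ->
  orthon n (fun r => emb (k r) *m u (rho r)).
Proof.
move=> ou hrho inj r r' rn r'n; rewrite dot_emb ou; [|exact: hrho|exact: hrho].
rewrite -natrM mulnb; congr (_ _)%:R; apply/andP/eqP => [[/eqP e1 /eqP e2]|->//].
exact: inj.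
Qed.

Lemma subunit_block s (a : 'M[C]_(bsize s)) : (0 < bmult s)%N ->
  subunit (blockop a) -> subunit a.
Proof.
move=> b0 h u; have := h (emb (Ordinal b0) *m u).
rewrite mulmxA blockop_emb -mulmxA dot_emb eqxx mul1r => /le_trans; apply.
by rewrite -lecR -!dot_sqn dot_emb eqxx mul1r.
Qed.

End Endpoints.
Arguments bpair P Q s i : clear implicits.

Lemma sum_codom (V : nmodType) (T T' : finType) (f : T -> T') (F : T' -> V) :
  injective f -> \sum_(y | y \in codom f) F y = \sum_x F (f x).
Proof.
move=> fi; rewrite -big_uniq /=; first by rewrite big_map big_enum.
by rewrite map_inj_uniq // enum_uniq.
Qed.

(** Each [fY v t] is an isometry of the [N]-dimensional space, and different [v] have orthogonal
    ranges. The members in the image of [ffi s] fit the end [s]: they come in groups of [bmult]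
    members, which at that end are the copies of a single [fU]. *)
Record frame (R : realType) (P Q N : nat) := Frame {
  fV : finType;
  fY : fV -> R -> 'M[R[i]]_(P * Q, N);
  fVs : bool -> finType;
  ffi : forall s : bool, fVs s * 'I_(bmult P Q s) -> fV;
  fU : forall s : bool, fVs s -> 'M[R[i]]_(bsize P Q s, N);
  f_cont : forall v, contM (fY v);
  f_orth : forall v v' t, 0 <= t <= 1 -> adj (fY v t) *m fY v' t = (v == v')%:R%:M;
  f_inj : forall s, injective (@ffi s);
  f_end : forall s v k, fY (@ffi s (v, k)) s%:R = emb R k *m fU v
}.

(** * Weighted sums of matrix copies *)

Section Phi.
Variables (R : realType) (P Q N : nat) (F : frame R P Q N).
Local Notation C := R[i].
Local Notation d := (P * Q)%N.
Local Notation V := (fV F).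
Local Notation Y := (@fY R P Q N F).
Implicit Types (W : V -> R -> R) (z : 'M[C]_N).

(** Copies of [z] along the frame, scaled by weights. Products multiply the weights pointwise, and
    this makes the map order zero. *)
Definition phi W z (t : R) : 'M[C]_d :=
  \sum_v (W v t)%:C *: (Y v t *m z *m adj (Y v t)).

Lemma phiM W W' z z' t : 0 <= t <= 1 ->
  phi W z t *m phi W' z' t = phi (fun v t => W v t * W' v t) (z *m z') t.
Proof.
move=> t01; rewrite /phi mulmx_suml; apply: eq_bigr => v _.
rewrite mulmx_sumr (bigD1 v) //= big1 ?addr0 => [|v' v'v].
  rewrite -scalemxAl -scalemxAr scalerA rmorphM; congr (_ *: _).
  have -> : Y v t *m z *m adj (Y v t) *m (Y v t *m z' *m adj (Y v t)) =
      Y v t *m z *m (adj (Y v t) *m Y v t) *m (z' *m adj (Y v t)) by rewrite !mulmxA.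
  by rewrite f_orth // eqxx mulmx1 !mulmxA.
rewrite -scalemxAl -scalemxAr -!mulmxA (mulmxA (adj _) (Y v' t)) f_orth //.
by rewrite eq_sym (negbTE v'v) -scalemx1 scale0r mul0mx !mulmx0 !scaler0.
Qed.

Lemma phi_adj W z t : adj (phi W z t) = phi W (adj z) t.
Proof.
rewrite /phi adj_sum; apply: eq_bigr => v _.
by rewrite adjZ conjc_real !adjM adjK mulmxA.
Qed.

Lemma phiD W z z' t : phi W (z + z') t = phi W z t + phi W z' t.
Proof.
by rewrite /phi -big_split; apply: eq_bigr => v _; rewrite mulmxDr mulmxDl scalerDr.
Qed.

Lemma phiZ W c z t : phi W (c *: z) t = c *: phi W z t.
Proof.
rewrite /phi scaler_sumr; apply: eq_bigr => v _.
by rewrite -scalemxAr -scalemxAl !scalerA mulrC.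
Qed.

Lemma phiDw W W' z t :
  phi (fun v t => W v t + W' v t) z t = phi W z t + phi W' z t.
Proof.
by rewrite /phi -big_split; apply: eq_bigr => v _; rewrite rmorphD scalerDl.
Qed.

Lemma phi_eq W W' z t : (forall v, W v t = W' v t) -> phi W z t = phi W' z t.
Proof. by move=> e; apply: eq_bigr => v _; rewrite e. Qed.

Lemma tr_phi1 W t : 0 <= t <= 1 -> \tr (phi W 1%:M t) = N%:R * (\sum_v W v t)%:C.
Proof.
move=> t01; rewrite mxtrace_sum rmorph_sum mulr_sumr; apply: eq_bigr => v _.
rewrite mxtraceZ mulmx1 mxtrace_mulC f_orth // eqxx mxtrace1 mulrC //.
Qed.

(** At each end the members fitting the block structure get weight one and all others weight zero,
    which makes [phi] satisfy the boundary conditions. *)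
Definition weight W := (forall v, contR (W v)) /\
  forall (s : bool) v, W v s%:R = (v \in codom (@ffi R P Q N F s))%:R.

Lemma ddrop_phi W z : weight W -> ddrop (phi W z).
Proof.
move=> [cW eW]; apply/ddrop_blockP; split=> [|s].
  apply: contM_sum => v _; apply: contMZ; first exact: cW.
  by apply: contM_mul (contM_adj (@f_cont _ _ _ _ F v)); apply: contM_mul (contM_cst _); exact: f_cont.
exists (\sum_(v : fVs F s) fU v *m z *m adj (fU v)); rewrite /phi /blockop.
rewrite (bigID (fun v => v \in codom (@ffi R P Q N F s))) /= [X in _ + X]big1 ?addr0; last first.
  by move=> v /negbTE hv; rewrite eW hv scale0r.
rewrite sum_codom; last exact: f_inj.
pose G v k := (W (@ffi R P Q N F s (v, k)) s%:R)%:C *: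
   (Y (@ffi R P Q N F s (v, k)) s%:R *m z *m adj (Y (@ffi R P Q N F s (v, k)) s%:R)).
rewrite (eq_bigr (fun x => G x.1 x.2)) => [|[v k] _ //]; rewrite -(pair_bigA _ G).
rewrite exchange_big; apply: eq_bigr => k _; rewrite mulmx_sumr mulmx_suml.
apply: eq_bigr => v _; rewrite /G eW codom_f scale1r f_end adjM.
by rewrite !mulmxA.
Qed.

End Phi.

Section OpNorm.
Variable R : realType.
Local Notation C := R[i].

Lemma l2normE n (u : 'cV[C]_n) : l2norm u = Num.sqrt (sqn u).
Proof.
by rewrite /l2norm; congr Num.sqrt; apply: eq_bigr => i _; rewrite nc_sqr.
Qed.

Lemma sqn_mul_bound n (z : 'M[C]_n) (u : 'cV[C]_n) :
  sqn (z *m u) <= opnorm z ^+ 2 * sqn u.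
Proof.
pose E := [set l2norm (z *m v) | v in [set v : 'cV[C]_n | l2norm v <= 1]].
(* [opnorm] bounds the values only once the set is known to be bounded; the row sums of moduli give
   a bound. *)
have hE : has_sup E.
  split; first by exists (l2norm (z *m 0)), 0 => //=; rewrite l2normE /sqn big1 ?sqrtr0 // => i _; rewrite mxE nc0 expr0n.
  exists (Num.sqrt (\sum_i (\sum_j nc (z i j)) ^+ 2)) => _ [v /= hv <-].
  rewrite l2normE ler_sqrt; last by apply: sumr_ge0 => i _; exact: sqr_ge0.
  apply: ler_sum => i _; rewrite ler_pXn2r ?nnegrE ?nc_ge0 ?sumr_ge0 // => [|j _]; last exact: nc_ge0.
  rewrite mxE; apply: le_trans (nc_sum _ _ _) _; apply: ler_sum => j _.
  rewrite ncM ler_piMr ?nc_ge0 // -(@ler_pXn2r _ 2) ?nnegrE ?nc_ge0 // expr1n.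
  apply: le_trans (sqn_entry v j) _; move: hv; rewrite l2normE => hv.
  by rewrite -(sqr_sqrtr (sqn_ge0 v)) -[leRHS](expr1n _ 2) ler_pXn2r ?nnegrE ?sqrtr_ge0.
have [->|u0] := eqVneq u 0.
  by rewrite mulmx0 [sqn 0]big1 ?mulr0 // => i _; rewrite mxE nc0 expr0n.
have su := sqn_gt0 u0; pose c := (Num.sqrt (sqn u))^-1.
have c0 : 0 < c by rewrite invr_gt0 sqrtr_gt0.
have c2 : c ^+ 2 * sqn u = 1 by rewrite exprVn sqr_sqrtr ?sqn_ge0 // mulVf // gt_eqF.
have h : l2norm (z *m (c%:C *: u)) <= opnorm z.
  apply: ub_le_sup; first by case: hE.
  by exists (c%:C *: u) => //=; rewrite l2normE sqnZ nc_real (gtr0_norm c0) c2 sqrtr1.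
have o0 : 0 <= opnorm z by apply: le_trans h; rewrite l2normE sqrtr_ge0.
move: h; rewrite l2normE -scalemxAr sqnZ nc_real (gtr0_norm c0) => h.
have : c ^+ 2 * sqn (z *m u) <= opnorm z ^+ 2.
  rewrite -[leLHS]sqr_sqrtr; last by rewrite mulr_ge0 ?sqn_ge0 ?exprn_ge0 ?(ltW c0).
  by rewrite ler_pXn2r ?nnegrE ?sqrtr_ge0.
move=> h'; apply: (@le_trans _ _ (c ^+ 2 * sqn (z *m u) * sqn u)).
  by rewrite mulrAC c2 mul1r.
by rewrite ler_wpM2r ?sqn_ge0.
Qed.

Lemma opnorm_ge0 n (z : 'M[C]_n) : 0 <= opnorm z.
Proof.
rewrite /opnorm; have [h|h] := pselect (has_sup [set l2norm (z *m v) | v in [set v : 'cV[C]_n | l2norm v <= 1]]).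
  apply: le_trans (ub_le_sup (h.2) _); last first.
    exists 0 => //=; rewrite l2normE [sqn _]big1 ?sqrtr0 // => i _; rewrite mxE nc0 expr0n //.
  by rewrite l2normE sqrtr_ge0.
by rewrite sup_out.
Qed.

(** Expanding the square norm of [c u - w / c], where [w] is [z] applied to [adj z *m u], gives the
    bound with no eigenvalues. *)
Lemma sqn_adj_bound n (z : 'M[C]_n) (c : R) (u : 'cV[C]_n) : 0 < c ->
  (forall v, sqn (z *m v) <= c ^+ 2 * sqn v) -> sqn (adj z *m u) <= c ^+ 2 * sqn u.
Proof.
move=> c0 h; set w := z *m (adj z *m u).
have hw : sqn w <= c ^+ 2 * sqn (adj z *m u) by exact: h.
have : dot u w = (sqn (adj z *m u))%:C by rewrite -dot_sqn dot_adj.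
have := sqn_ge0 (c%:C *: u + (- c^-1)%:C *: w).
rewrite sqnD !sqnZ !nc_real dotZl dotZr normrN normfV (gtr0_norm c0) => h1 h2.
move: h1; rewrite h2 conjc_real -!rmorphM /= mulrA mulrN mulfV ?gt_eqF // mulN1r => h1.
have : c^-1 ^+ 2 * sqn w <= sqn (adj z *m u).
  by rewrite exprVn mulrC ler_pdivrMr ?exprn_gt0 // mulrC.
lra.
Qed.

Lemma sqn_cstar_bound n (z : 'M[C]_n) (u : 'cV[C]_n) :
  sqn (adj z *m z *m u) <= (opnorm z ^+ 2) ^+ 2 * sqn u.
Proof.
rewrite -mulmxA; have := opnorm_ge0 z; rewrite le_eqVlt => /orP[/eqP o0|o0].
  have : sqn (z *m u) <= 0 by rewrite (le_trans (sqn_mul_bound _ _)) // -o0 expr0n mul0r.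
  have [-> _|/sqn_gt0] := eqVneq (z *m u) 0; last by move=> h /(lt_le_trans h); rewrite ltxx.
  by rewrite mulmx0 [sqn 0]big1 ?mulr_ge0 ?sqn_ge0 ?exprn_ge0 -?o0 // => i _; rewrite mxE nc0 expr0n.
apply: le_trans (sqn_adj_bound _ o0 (sqn_mul_bound z)) _.
by rewrite (expr2 (opnorm z ^+ 2)) -mulrA ler_wpM2l ?sqr_ge0 // sqn_mul_bound.
Qed.

End OpNorm.

(** * Cut-off weights and the size of a frame *)

Section Weights.
Variable R : realType.

Definition clamp (x : R) := Num.max 0 (Num.min 1 x).

Lemma clamp_ge0 x : 0 <= clamp x.
Proof. by rewrite le_max lexx. Qed.

Lemma clamp_le1 x : clamp x <= 1.
Proof. by rewrite ge_max ler01 ge_min lexx. Qed.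

Lemma clamp_eq1 x : 1 <= x -> clamp x = 1.
Proof. by move=> h; rewrite /clamp min_l // max_r. Qed.

Lemma clamp_eq0 x : x <= 0 -> clamp x = 0.
Proof. by move=> h; rewrite /clamp max_l // ge_min h orbT. Qed.

Lemma contR_clamp a : contR a -> contR (fun t => clamp (a t)).
Proof. by move=> h; apply: contR_max (contR_cst 0) _; exact: contR_min (contR_cst 1) h. Qed.

(** Slope 3 leaves room for two nested ramps: the one with [c = 1] starts where the one with [c = 0]
    has reached one, and both are one at the opposite end. *)
Definition ramp (s : bool) c t := clamp (3 * (if s then 1 - t else t) - c).

Lemma contR_ramp s c : contR (ramp s c).
Proof.
apply: contR_clamp; apply: contRD (contRN (contR_cst c)); apply: contRM (contR_cst 3) _.
by case: s; [exact: contR_1B | exact: contR_id].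
Qed.

Variables (P Q N : nat) (F : frame R P Q N).
Local Notation V := (fV F).
Local Notation C := R[i].

(* The factors vanish near the endpoint [s] on those vectors of the frame that do not
   belong to the block structure at [s]; the larger [c], the smaller the weight. *)
Definition fac c (s : bool) (v : V) t : R :=
  if v \in codom (@ffi R P Q N F s) then 1 else ramp s c t.

Definition wt c (v : V) t : R := fac c false v t * fac c true v t.

Lemma fac01 c s v t : 0 <= fac c s v t <= 1.
Proof.
by rewrite /fac; case: ifP; rewrite ?ler01 ?lexx // clamp_ge0 clamp_le1.
Qed.

Lemma wt01 c v t : 0 <= wt c v t <= 1.
Proof.
have /andP[a0 a1] := fac01 c false v t; have /andP[b0 b1] := fac01 c true v t.
by rewrite /wt mulr_ge0 // mulr_ile1.
Qed.

Lemma weight_wt c : 0 <= c <= 2 -> weight (wt c).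
Proof.
move=> /andP[c0 c2]; split=> [v|s v].
  have cf s : contR (fac c s v).
    by rewrite /fac; case: (_ \in _); [exact: contR_cst | exact: contR_ramp].
  exact: contRM.
rewrite /wt; have -> : fac c false v s%:R * fac c true v s%:R =
    fac c s v s%:R * fac c (~~ s) v s%:R by case: s => //=; rewrite mulrC.
have -> : fac c (~~ s) v s%:R = 1.
  by rewrite /fac; case: (_ \in _) => //; rewrite /ramp clamp_eq1 //; case: (s) => /=; lra.
rewrite mulr1 /fac; case: (_ \in _) => //; rewrite /ramp clamp_eq0 //; case: (s) => /=; lra.
Qed.

Lemma wt_step v t : wt 1 v t != 0 -> wt 0 v t = 1.
Proof.
rewrite mulf_eq0 negb_or => /andP[h0 h1].
have h s : fac 1 s v t != 0 -> fac 0 s v t = 1.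
  rewrite /fac /ramp; case: (_ \in _) => // h; rewrite clamp_eq1 // subr0 leNgt.
  by apply: contra h => /ltW h; rewrite clamp_eq0 // subr_le0.
by rewrite /wt !h // mulr1.
Qed.

Lemma weightM (W W' : V -> R -> R) : weight W -> weight W' ->
  weight (fun v t => W v t * W' v t).
Proof.
move=> [cW eW] [cW' eW']; split=> [v|s v]; first exact: contRM.
by rewrite eW eW' -natrM mulnb andbb.
Qed.

Lemma weight_comp (W : V -> R -> R) (h : R -> R) : weight W -> h 0 = 0 -> h 1 = 1 ->
  (forall a, contR a -> contR (fun t => h (a t))) -> weight (fun v t => h (W v t)).
Proof.
move=> [cW eW] h0 h1 ch; split=> [v|s v]; first exact: ch.
by rewrite eW; case: (_ \in _).
Qed.

(** Inclusion-exclusion: a member fitting both ends has weight one throughout, and every other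
    weight is nonnegative. *)
Lemma sum_wt_ge c t : (#|{: fVs F false * 'I_(bmult P Q false)}|%:R : R) +
  #|{: fVs F true * 'I_(bmult P Q true)}|%:R - #|V|%:R <= \sum_v wt c v t.
Proof.
have hc s : (#|{: fVs F s * 'I_(bmult P Q s)}|%:R : R) =
    \sum_v (v \in codom (@ffi R P Q N F s))%:R.
  rewrite -natr_sum -(card_codom (@f_inj R P Q N F s)); congr (_%:R).
  by rewrite -sum1_card big_mkcond; apply: eq_bigr => v _; case: (_ \in _).
have -> : (#|V|%:R : R) = \sum_(v : V) 1 by rewrite sumr_const.
rewrite !hc -big_split -sumrB; apply: ler_sum => v _ /=.
have /andP[w0 _] := wt01 c v t; move: w0; rewrite /wt /fac.
by case: (v \in codom _); case: (v \in codom _); rewrite /= ?mulr1n ?mulr0n ?mulr1 ?mul1r; lra.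
Qed.

(** The complement of the projection onto the frame is a projection, so its trace is nonnegative. *)
Lemma frame_le : (N * #|V| <= P * Q)%N.
Proof.
have : \tr (phi (F := F) (fun _ _ => 1) 1%:M 0) = (N * #|V|)%:R.
  by rewrite tr_phi1 ?lexx ?ler01 // sumr_const natrM rmorph_nat.
pose X := phi (F := F) (fun _ _ => 1) 1%:M 0.
have XX : adj (1%:M - X) *m (1%:M - X) = 1%:M - X.
  rewrite adjB adj1 phi_adj adj1 mulmxBl mul1mx mulmxBr mulmx1 phiM ?lexx ?ler01 //.
  rewrite mulmx1 (@phi_eq _ _ _ _ _ _ (fun _ _ => 1)) => [|v]; last by rewrite mulr1.
  by rewrite subrr subr0.
move=> tX; have := tr_adj_mul (1%:M - X); rewrite XX.
have -> : \tr (1%:M - X) = ((P * Q)%:R - (N * #|V|)%:R : R)%:C.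
  by rewrite raddfB /= mxtrace1 tX rmorphB /= !rmorph_nat.
move=> /complexI h; rewrite -(ler_nat R) -subr_ge0 h.
by apply: sumr_ge0 => i _; apply: sumr_ge0 => j _; exact: sqr_ge0.
Qed.
End Weights.

Section OrderZero.
Variables (R : realType) (Z : cstarType R) (P Q N : nat).
Hypotheses (P0 : (0 < P)%N) (Q0 : (0 < Q)%N).
Local Notation C := R[i].
Variable mu : (R -> 'M[C^o]_(P * Q)) -> Z.
Hypothesis hmu : dimdrop_embedding mu.
Variable F : frame R P Q N.
Local Notation V := (fV F).
Implicit Types (W : V -> R -> R) (z : 'M[C]_N).

Definition Ph W z := mu (phi W z).

Lemma PhM W W' z z' : weight W -> weight W' ->
  Ph W z * Ph W' z' = Ph (fun v t => W v t * W' v t) (z *m z').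
Proof.
move=> hW hW'; have h := ddrop_phi z hW; have h' := ddrop_phi z' hW'.
rewrite /Ph -(emM hmu) //; apply: (em_eq hmu).
- exact: ddropM.
- apply: ddrop_phi; exact: weightM.
by move=> t t01; rewrite phiM.
Qed.

Lemma Ph_star W z : weight W -> star (Ph W z) = Ph W (adj z).
Proof.
move=> hW; rewrite /Ph -(em_star hmu); last exact: ddrop_phi.
by congr mu; apply/funext => t; rewrite phi_adj.
Qed.

Lemma PhD W z z' : weight W -> Ph W (z + z') = Ph W z + Ph W z'.
Proof.
move=> hW; rewrite /Ph -(emD hmu); try exact: ddrop_phi.
by congr mu; apply/funext => t; rewrite phiD.
Qed.

Lemma PhZ W c z : weight W -> Ph W (c *: z) = c *: Ph W z.
Proof.
move=> hW; rewrite /Ph -(emZ hmu); last exact: ddrop_phi.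
by congr mu; apply/funext => t; rewrite phiZ.
Qed.

Lemma Ph0 W : weight W -> Ph W 0 = 0.
Proof. by move=> hW; rewrite -(scale0r (0 : 'M[C]_N)) PhZ // scale0r. Qed.

Lemma Ph_sum W (I : Type) (s : seq I) (G : I -> 'M[C]_N) : weight W ->
  Ph W (\sum_(i <- s) G i) = \sum_(i <- s) Ph W (G i).
Proof. by move=> hW; apply: big_morph => [x y|]; [exact: PhD | exact: Ph0]. Qed.

(** Chosen so that [1 - phi (gap c)] squares to [1 - phi (wt c)]; it is 0 where the weight is 0 and
    1 where it is 1, hence again a weight. *)
Definition gap c (v : V) t : R := 1 - Num.sqrt (1 - wt c v t).

Lemma weight_gap c : 0 <= c <= 2 -> weight (gap c).
Proof.
move=> hc; apply: (weight_comp (h := fun x => 1 - Num.sqrt (1 - x))) (weight_wt F hc) _ _ _.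
- by rewrite subr0 sqrtr1 subrr.
- by rewrite subrr sqrtr0 subr0.
move=> a ca; apply: contRD (contR_cst 1) _; apply/contRN/contR_sqrt.
exact: contRD (contR_cst 1) (contRN ca).
Qed.

Definition defect c (t : R) : 'M[C]_(P * Q) := 1%:M - phi (F := F) (gap c) 1%:M t.

Lemma ddrop_defect c : 0 <= c <= 2 -> ddrop (defect c).
Proof.
move=> hc; apply: (@ddrop_eq _ _ _ (fun t => 1%:M + (-1) *: phi (F := F) (gap c) 1%:M t)).
  by move=> t _; rewrite scaleN1r.
apply: ddropD; first exact: (@ddrop_scalar R P Q (fun=> 1) (contC_cst 1)).
by apply: ddropZ; apply: ddrop_phi; exact: weight_gap.
Qed.

Lemma defect_adj c t : adj (defect c t) = defect c t.
Proof. by rewrite /defect adjB adj1 phi_adj adj1. Qed.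

Lemma defect_sq c t : 0 <= t <= 1 ->
  defect c t *m defect c t = 1%:M - phi (wt (F := F) c) 1%:M t.
Proof.
move=> t01; rewrite /defect mulmxBl mul1mx mulmxBr mulmx1 phiM // mulmx1.
rewrite -addrA -opprD; congr (_ - _).
suff -> : phi (wt (F := F) c) 1%:M t = phi (F := F) (gap c) 1%:M t +
    (phi (F := F) (gap c) 1%:M t - phi (F := F) (fun v t => gap c v t * gap c v t) 1%:M t) by [].
rewrite addrA; apply/eqP; rewrite -subr_eq opprK -!phiDw; apply/eqP/phi_eq => v.
have /andP[w0 w1] := wt01 c v t.
have := sqr_sqrtr (_ : 0 <= 1 - wt c v t); rewrite subr_ge0 => /(_ w1) h.
by rewrite /gap; move: h; lra.
Qed.

(** The smaller weight [wt 1] lives where [wt 0] equals one, and there the root of the defect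
    vanishes. This is the relation [b * f = 0] behind the comparison. *)
Lemma defect_orth t : 0 <= t <= 1 -> defect 0 t *m phi (wt (F := F) 1) 1%:M t = 0.
Proof.
move=> t01; rewrite /defect mulmxBl mul1mx phiM // mulmx1; apply/eqP.
rewrite subr_eq0; apply/eqP/phi_eq => v.
have [->|/wt_step e] := eqVneq (wt 1 v t) 0; first by rewrite mulr0.
by rewrite /gap e subrr sqrtr0 subr0 mul1r.
Qed.

Lemma phi_entry_bound W z t (c : R) : 0 <= t <= 1 -> 0 <= c ->
  (forall v, 0 <= W v t <= 1) -> (forall i j, nc (z i j) <= c) ->
  forall i j, nc (phi W z t i j) <= #|V|%:R * (N%:R * N%:R) * c.
Proof.
move=> t01 c0 hW hz i j.
have hY (v : V) a b : nc (fY v t a b) <= 1.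
  have := f_orth v v t01; rewrite eqxx => /matrixP/(_ b b); rewrite !mxE eqxx => h.
  rewrite -(@ler_pXn2r _ 2) ?nnegrE ?nc_ge0 // expr1n.
  have : sqn (col b (fY v t)) = 1.
    apply: complexI; rewrite -dot_sqn dotE -[RHS]h.
    by apply: eq_bigr => k _; rewrite !mxE.
  by move=> <-; have := sqn_entry (col b (fY v t)) a; rewrite mxE.
rewrite /phi summxE; apply: le_trans (nc_sum _ _ _) _.
have -> : #|V|%:R * (N%:R * N%:R) * c = \sum_(v : V) (N%:R * N%:R) * c.
  by rewrite sumr_const -mulrA mulr_natl.
apply: ler_sum => v _; rewrite mxE ncM nc_real.
have /andP[w0 w1] := hW v; rewrite ger0_norm //.
apply: (@le_trans _ _ (1 * nc ((fY v t *m z *m adj (fY v t)) i j))).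
  by rewrite ler_wpM2r ?nc_ge0.
rewrite mul1r mxE; apply: le_trans (nc_sum _ _ _) _.
have -> : N%:R * N%:R * c = \sum_(k < N) (N%:R * c) by rewrite sumr_const card_ord -mulrA mulr_natl.
apply: ler_sum => k _; rewrite ncM adjE ncJ.
apply: (@le_trans _ _ (nc ((fY v t *m z) i k) * 1)); first by rewrite ler_wpM2l ?nc_ge0.
rewrite mulr1 mxE; apply: le_trans (nc_sum _ _ _) _.
have -> : N%:R * c = \sum_(l < N) c by rewrite sumr_const card_ord mulr_natl.
apply: ler_sum => l _; rewrite ncM; apply: le_trans (hz l k).
by rewrite -[leRHS]mul1r ler_wpM2r ?nc_ge0.
Qed.

(** The powers of [star x * x] with exponent [2 ^ n] are again of the form [Ph W' z'] with weights
    in [[0, 1]]. The crude bound therefore holds for all of them with one constant, which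
    [cnorm_pow_bound] removes. *)
Lemma Ph_norm W z : weight W -> (forall v t, 0 <= W v t <= 1) ->
  cnorm (Ph W z) <= opnorm z.
Proof.
move=> hW W01; have [K K0 hK] := em_crude_bound P0 Q0 hmu.
apply: (@cnorm_pow_bound _ _ _ _ (K * (#|V|%:R * (N%:R * N%:R)))).
  exact: opnorm_ge0.
move=> n; set c := opnorm z.
have [W' [z' [hW' W'01 -> hz']]] : exists W' z', [/\ weight W',
    forall v t, 0 <= W' v t <= 1, (star (Ph W z) * Ph W z) ^+ (2 ^ n) = Ph W' z' &
    forall u, sqn (z' *m u) <= (c ^+ (2 ^ n.+1)) ^+ 2 * sqn u].
  elim: n => [|n [W' [z' [hW' W'01 e hz']]]].
    exists (fun v t => W v t * W v t), (adj z *m z); split.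
    - exact: weightM.
    - by move=> v t; have /andP[a b] := W01 v t; rewrite mulr_ge0 // mulr_ile1.
    - by rewrite expr1 Ph_star // PhM.
    by move=> u; exact: sqn_cstar_bound.
  exists (fun v t => W' v t * W' v t), (z' *m z'); split.
  - exact: weightM.
  - by move=> v t; have /andP[a b] := W'01 v t; rewrite mulr_ge0 // mulr_ile1.
  - by rewrite [X in _ ^+ X]expnS mulnC exprM e expr2 PhM.
  move=> u; rewrite -mulmxA; apply: le_trans (hz' _) _.
  rewrite [in leRHS]expnS mulnC exprM (expr2 ((c ^+ (2 ^ n.+1)) ^+ 2)) -mulrA.
  by rewrite ler_wpM2l ?sqr_ge0.
rewrite -mulrA; apply: hK => [|t i j t01]; first exact: ddrop_phi.
apply: phi_entry_bound => // [|a b]; first by rewrite exprn_ge0 // opnorm_ge0.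
have h := hz' (delta_mx b 0).
have sd : sqn (delta_mx b 0 : 'cV[C]_N) = 1.
  rewrite /sqn (bigD1 b) //= big1 ?addr0 => [|k kb].
    by rewrite mxE !eqxx nc1 expr1n.
  by rewrite mxE (negbTE kb) nc0 expr0n.
move: h; rewrite sd mulr1 => h.
rewrite -(@ler_pXn2r _ 2) ?nnegrE ?nc_ge0 ?exprn_ge0 ?opnorm_ge0 //.
apply: le_trans h; have := sqn_entry (z' *m delta_mx b 0) a.
by rewrite -colE mxE.
Qed.

End OrderZero.

Section CompletelyPositive.
Variables (R : realType) (Z : cstarType R) (P Q n : nat).
Hypotheses (P0 : (0 < P)%N) (Q0 : (0 < Q)%N).
Local Notation C := R[i].
Variable mu : (R -> 'M[C^o]_(P * Q)) -> Z.
Hypothesis hmu : dimdrop_embedding mu.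
Variable F : frame R P Q n.+1.

(** The square root [r] of the weight is a weight too, so [Ph (wt 0)] of [adj x *m y] is
    [star (Ph r x) * Ph r y]: entrywise, a matrix [star B * B] goes to a matrix of the same form. *)
Lemma Ph_cpc : exists g : {linear 'M[C]_n.+1 -> Z},
  cpc_order_zero g /\ g =1 Ph mu (wt (F := F) 0).
Proof.
have hw : weight (wt (F := F) 0) by apply: weight_wt; rewrite lexx ler0n.
have [g gE] : exists g : {linear 'M[C]_n.+1 -> Z}, g =1 Ph mu (wt (F := F) 0).
  apply: linear_of => c x y; rewrite (PhD hmu) // (PhZ hmu) //.
exists g; split=> //.
pose r (v : fV F) t := Num.sqrt (wt 0 v t).
have hr : weight r.
  apply: (weight_comp (h := fun x => Num.sqrt x)) hw _ _ _; rewrite ?sqrtr0 ?sqrtr1 //.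
  by move=> a; exact: contR_sqrt.
have rr z z' : Ph mu r z * Ph mu r z' = Ph mu (wt (F := F) 0) (z *m z').
  rewrite (PhM hmu) //; have -> // : (fun v t => r v t * r v t) = wt (F := F) 0.
  apply/funext => v; apply/funext => t; have /andP[w0 _] := wt01 0 v t.
  by rewrite -expr2 sqr_sqrtr.
split.
- move=> k X [B ->]; exists (map_mx (Ph mu r) B).
  apply/matrixP => i j; rewrite mxE gE.
  have -> : (star B * B) i j = \sum_l (adj (B l i) *m B l j).
    by rewrite mxE; apply: eq_bigr => l _; rewrite 2!mxE -mxstarE.
  have -> : (star (map_mx (Ph mu r) B) * map_mx (Ph mu r) B) i j =
      \sum_l (star (Ph mu r (B l i)) * Ph mu r (B l j)).
    by rewrite mxE; apply: eq_bigr => l _; rewrite !mxE.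
  rewrite (Ph_sum hmu) //; apply: eq_bigr => l _.
  by rewrite (Ph_star hmu) // rr.
- by move=> x; rewrite gE; apply: Ph_norm => // v t; exact: wt01.
move=> a b _ _ ab; rewrite !gE (PhM hmu) //.
by rewrite (ab : a *m b = 0) (Ph0 hmu) //; exact: weightM.
Qed.

End CompletelyPositive.

(** * Frames in the range of a path; comparison *)

Lemma ltn_pair k' k m b : (k' < m)%N -> (k < b)%N -> (k' * b + k < m * b)%N.
Proof.
move=> h1 h2; apply: (@leq_trans (k'.+1 * b)); last by rewrite leq_mul2r h1 orbT.
by rewrite mulSn addnC ltn_add2r.
Qed.

Lemma eqn_pair k' k l' l b : (k < b)%N -> (l < b)%N ->
  (k' * b + k == l' * b + l)%N = (k' == l') && (k == l).
Proof.
move=> kb lb; apply/eqP/andP => [e|[/eqP-> /eqP->] //].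
have b0 : (0 < b)%N by exact: leq_ltn_trans kb.
split; apply/eqP.
  by move: (congr1 (divn^~ b) e); rewrite !divnMDl // !divn_small // !addn0.
by move: (congr1 (modn^~ b) e); rewrite !modnMDl !modn_small.
Qed.

Lemma adj_mul_cols (R : realType) d N M (F G : 'I_N -> 'cV[R[i]]_d) (a : 'I_N -> 'I_N -> R[i]) :
  M = \matrix_(i, j) a i j -> (forall i j, dot (F i) (G j) = a i j) ->
  adj (\matrix_(i, j) F j i 0) *m (\matrix_(i, j) G j i 0) = M.
Proof.
move=> -> h; apply/matrixP => i j; rewrite !mxE -h dotE.
by apply: eq_bigr => k _; rewrite !mxE.
Qed.

(** * Frames in the range of a path *)

Section CellFrame.
Variables (R : realType) (P Q N : nat).
Hypotheses (P0 : (0 < P)%N) (Q0 : (0 < Q)%N) (N0 : (0 < N)%N).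
Local Notation C := R[i].
Local Notation d := (P * Q)%N.

Lemma bmult_gt0 s : (0 < bmult P Q s)%N.
Proof. by case: s. Qed.

Lemma cRe_natM (n : nat) (z : C) : complex.Re (n%:R * z) = n%:R * complex.Re z.
Proof. by rewrite -(rmorph_nat (real_complex R)) cReMr. Qed.

(** Vectors are chosen in one block and copied by [emb] into all of them, which accounts for the
    multiples of [b]; the remaining [M] modulo [b] groups are filled in without regard to the
    blocks. The index lists the group first, then the copy, then the component in the [N]-tuple. *)
Lemma block_frame (s : bool) (h : 'M[C]_d) (a : 'M[C]_(bsize P Q s)) M :
  h = blockop a -> subunit h ->
  (forall r, (r < N * M)%N -> r%:R < complex.Re (\tr h)) -> (N * M <= d)%N ->
  exists (u : nat -> 'cV[C]_(bsize P Q s)) (v : nat -> 'cV[C]_d),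
    [/\ orthon (N * M) v, in_range (N * M) (N * M) h v &
      forall k' (k : 'I_(bmult P Q s)) al, (k' < M %/ bmult P Q s)%N -> (al < N)%N ->
        v ((k' * bmult P Q s + k) * N + al)%N = emb R k *m u (k' * N + al)%N].
Proof.
move=> ha sh ht NMd; set b := bmult P Q s; set m := (M %/ b)%N.
have b0 : (0 < b)%N := bmult_gt0 s.
have mb : (m * b <= M)%N by exact: leq_divM.
have tra : complex.Re (\tr h) = b%:R * complex.Re (\tr a).
  by rewrite ha tr_blockop cRe_natM.
have sa : subunit a by apply: (subunit_block b0); rewrite -ha.
have [u [ou ru _]] : exists u, [/\ orthon (N * m) u, in_range (N * m) (N * m) a u &
    forall r, (r < 0)%N -> u r = 0].
  apply: (@orthon_extend _ _ (N * m) 0 (N * m) a (fun=> 0)) => //.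
  - move=> r rm; have : (r * b < N * M)%N.
      apply: (@leq_trans (N * m * b)); first by rewrite ltn_pmul2r.
      by rewrite -mulnA leq_mul2l mb orbT.
    move=> /ht; rewrite tra natrM mulrC ltr_pM2l ?ltr0n //.
  by rewrite -(leq_pmul2r b0) (bsize_mult P Q s) (leq_trans _ NMd) // -mulnA leq_mul2l mb orbT.
pose kk r : 'I_b := Ordinal (ltn_pmod (r %/ N) b0).
pose rho r := (r %/ N %/ b * N + r %% N)%N.
pose w r := emb R (kk r) *m u (rho r).
have rho_lt r : (r < N * (m * b))%N -> (rho r < N * m)%N.
  move=> h1; have h2 : (r %/ N %/ b < m)%N.
    by rewrite ltn_divLR // ltn_divLR // mulnC.
  by rewrite [ltnRHS]mulnC; exact: ltn_pair h2 (ltn_pmod _ N0).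
have ow : orthon (N * (m * b)) w.
  apply: (orthon_emb (rho := rho) (k := kk) ou) => // r r' _ _ e1 /(congr1 val) /= e2.
  have e3 : (r %% N = r' %% N)%N.
    by move: (congr1 (modn^~ N) e1); rewrite /rho !modnMDl !modn_mod.
  have e4 : (r %/ N %/ b = r' %/ N %/ b)%N.
    by move: (congr1 (divn^~ N) e1); rewrite /rho !divnMDl // !(divn_small (ltn_pmod _ N0)) !addn0.
  by rewrite (divn_eq r N) (divn_eq (r %/ N) b) e2 e3 e4 -divn_eq -divn_eq.
have wr r : (r < N * (m * b))%N -> exists x, w r = h *m x.
  move=> rm; have [x ex] := ru _ (rho_lt _ rm) (rho_lt _ rm).
  by exists (emb R (kk r) *m x); rewrite /w ex !mulmxA ha blockop_emb.
have [v [ov rv ev]] := @orthon_extend _ _ (N * M) (N * (m * b)) (N * M) h w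
  sh ht NMd (leq_mul (leqnn N) mb) ow (fun r h1 _ => wr r h1).
exists u, v; split=> // k' k al hk' hal.
have lt1 : (k' * b + k < m * b)%N by exact: ltn_pair.
have dE : (((k' * b + k) * N + al) %/ N = k' * b + k)%N by rewrite divnMDl // divn_small // addn0.
have kE : kk ((k' * b + k) * N + al)%N = k.
  by apply: val_inj; rewrite /= dE modnMDl modn_small.
have rE : rho ((k' * b + k) * N + al)%N = (k' * N + al)%N.
  by rewrite /rho dE divnMDl // divn_small // addn0 modnMDl modn_small.
rewrite ev; first by rewrite /w kE rE.
by rewrite [ltnRHS]mulnC ltn_pair.
Qed.

(** The block-compatible families at the two ends are joined by [orthonormal_frame], and [N]
    consecutive vectors form one isometry. At the end [s], fewer than [bmult P Q s] of the [M]
    members fail to fit. *)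
Lemma cell_frame (h : R -> 'M[C]_d) M : ddrop h ->
  (forall t, 0 <= t <= 1 -> subunit (h t)) ->
  (forall t r, 0 <= t <= 1 -> (r < N * M)%N -> r%:R < complex.Re (\tr (h t))) ->
  (N * M <= d)%N ->
  exists F : frame R P Q N, [/\ #|fV F| = M,
    forall s, #|fVs F s| = (M %/ bmult P Q s)%N &
    forall v t, 0 <= t <= 1 -> exists X, fY (f := F) v t = h t *m X].
Proof.
move=> /ddrop_blockP[ch eh] sh ht NMd.
have s01 (s : bool) : 0 <= (s%:R : R) <= 1 by case: s; rewrite lexx ler01.
have hb (s : bool) : exists uv : (nat -> 'cV[C]_(bsize P Q s)) * (nat -> 'cV[C]_d),
    [/\ orthon (N * M) uv.2, in_range (N * M) (N * M) (h s%:R) uv.2 &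
      forall k' (k : 'I_(bmult P Q s)) al, (k' < M %/ bmult P Q s)%N -> (al < N)%N ->
        uv.2 ((k' * bmult P Q s + k) * N + al)%N = emb R k *m uv.1 (k' * N + al)%N].
  have [a ha] := eh s.
  have [u [v H]] := @block_frame s (h s%:R) a M ha (sh _ (s01 s)) (fun r => ht _ r (s01 s)) NMd.
  by exists (u, v).
pose u s := sval (cid (hb s)); have hu s := svalP (cid (hb s)).
have frange s r : (r < N * M)%N -> exists x, (sval (cid (hb s))).2 r = fam (N * M) (h s%:R) r *m x.
  by move=> rn; have [_ h1 _] := hu s; rewrite /fam rn; exact: h1.
have o s : orthon (N * M) (sval (cid (hb s))).2 by case: (hu s).
have [v [cv ov rv ev]] := orthonormal_frame ch sh ht NMd (o false) (o true)
  (frange false) (frange true).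
have vE (s : bool) r : (r < N * M)%N -> v r s%:R = (sval (cid (hb s))).2 r.
  by move=> /ev[e0 e1]; case: s.
pose Y (k : 'I_M) t : 'M[C]_(d, N) := \matrix_(i, j) v (k * N + j)%N t i 0.
have idx (k : 'I_M) (j : 'I_N) : (k * N + j < N * M)%N by rewrite [ltnRHS]mulnC ltn_pair.
have ffi_lt s (x : 'I_(M %/ bmult P Q s) * 'I_(bmult P Q s)) :
    (x.1 * bmult P Q s + x.2 < M)%N.
  by apply: leq_trans (ltn_pair (ltn_ord _) (ltn_ord _)) (leq_divM _ _).
pose fi s x : 'I_M := Ordinal (@ffi_lt s x).
pose W s (k : 'I_(M %/ bmult P Q s)) : 'M[C]_(bsize P Q s, N) :=
  \matrix_(i, j) (sval (cid (hb s))).1 (k * N + j)%N i 0.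
have cY k : contM (Y k).
  by move=> i j; apply: contC_eq (cv _ i 0) => t _; rewrite mxE.
have oY k k' t : 0 <= t <= 1 -> adj (Y k t) *m Y k' t = (k == k')%:R%:M.
  move=> t01; apply: (adj_mul_cols (F := fun j => v (k * N + j)%N t)
    (G := fun j => v (k' * N + j)%N t) (a := fun i j => (k == k')%:R *+ (i == j))) => [|i j].
    by apply/matrixP => i j; rewrite !mxE.
  rewrite ov // eqn_pair // -[(k == k')%B]/(k == k' :> nat) -[(i == j)%B]/(i == j :> nat).
  by case: (_ == _ :> nat); case: (_ == _ :> nat).
have iY s : injective (fi s).
  move=> [k' k] [l' l] /(congr1 val)/eqP /=; rewrite eqn_pair //.
  by move=> /andP[/eqP/val_inj-> /eqP/val_inj->].
have eY s k' k : Y (fi s (k', k)) s%:R = emb R k *m W s k'.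
  apply/matrixP => i j; rewrite !mxE vE ?idx //=.
  have [_ _ ->] := hu s => //; rewrite mxE; apply: eq_bigr => l _; congr (_ * _).
  by rewrite !mxE.
exists (Frame cY oY iY eY); split=> //= [|s|k t t01]; try by rewrite card_ord.
have /choice[x hx] : forall j : 'I_N, exists x, v (k * N + j)%N t = h t *m x.
  by move=> j; exact: (rv t t01 _ (idx k j) (idx k j)).
exists (\matrix_(i, j) x j i 0); apply/matrixP => i j; rewrite !mxE hx mxE.
by apply: eq_bigr => l _; rewrite !mxE.
Qed.

End CellFrame.

Lemma sum_nat_pair (V : nmodType) n m b (F : nat -> V) : n = (m * b)%N ->
  \sum_(0 <= r < n) F r = \sum_(0 <= i < m) \sum_(0 <= k < b) F (i * b + k)%N.
Proof.
move=> ->; elim: m => [|m IH]; first by rewrite mul0n !big_geq.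
rewrite big_nat_recr //= -IH mulSn addnC.
rewrite (@big_cat_nat _ _ _ (m * b) 0 (m * b + b)) ?leq_addr //=.
congr (_ + _).
rewrite -{1}[(m * b)%N]add0n big_addn addnC addnK.
by apply: eq_bigr => k _; rewrite addnC.
Qed.

Section Complement.
Variables (R : realType) (P Q : nat).
Hypotheses (P0 : (0 < P)%N) (Q0 : (0 < Q)%N).
Local Notation C := R[i].
Local Notation d := (P * Q)%N.

(* The orthogonal complement of the family lies in the range of [f], so that it is
   killed by whatever annihilates [f]. *)
Lemma complement_frame (s : bool) (T : finType) (f : R -> 'M[C]_d) :
  ddrop f -> (forall t, 0 <= t <= 1 -> subunit (f t)) -> (#|T| <= bsize P Q s)%N ->
  (forall t r, 0 <= t <= 1 -> (r < (bsize P Q s - #|T|) * bmult P Q s)%N ->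
    r%:R < complex.Re (\tr (f t))) ->
  exists (G : T * 'I_(bmult P Q s) -> R -> 'cV[C]_d) (g : T -> 'cV[C]_(bsize P Q s)),
  [/\ forall x, contM (G x),
      forall t x y, 0 <= t <= 1 -> dot (G x t) (G y t) = (x == y)%:R,
      forall t (c : 'M[C]_d), 0 <= t <= 1 -> c *m f t = 0 ->
        c *m (\sum_x G x t *m adj (G x t)) = c &
      forall x k, G (x, k) s%:R = emb R k *m g x].
Proof.
move=> /ddrop_blockP[cf ef] sf Tb hf; set b := bmult P Q s.
have b0 : (0 < b)%N by exact: bmult_gt0.
have s01 (e : bool) : 0 <= (e%:R : R) <= 1 by case: e; rewrite lexx ler01.
(* The first [n1] blocks are filled with vectors in the range of [f]; the last ones, as many as [T]
   has elements, form the family [G]. *)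
set n1 := (bsize P Q s - #|T|)%N in hf *.
have bsE : (bsize P Q s * b = d)%N by exact: bsize_mult.
have [a ha] := ef s.
have sa : subunit a by apply: (subunit_block b0); rewrite -ha; exact: sf.
have [u [ou ru _]] : exists u, [/\ orthon (bsize P Q s) u, in_range n1 (bsize P Q s) a u &
    forall r, (r < 0)%N -> u r = 0].
  apply: (@orthon_extend _ _ (bsize P Q s) 0 n1 a (fun=> 0)) => //.
  move=> r rm; have : (r * b < n1 * b)%N by rewrite ltn_pmul2r.
  by move=> /(hf _ _ (s01 s)); rewrite ha tr_blockop cRe_natM natrM mulrC ltr_pM2l ?ltr0n.
pose kk r : 'I_b := Ordinal (ltn_pmod r b0).
pose w r := emb R (kk r) *m u (r %/ b)%N.
have ow : orthon d w.
  apply: (orthon_emb (rho := divn^~ b) (k := kk) ou) => [r|r r' _ _ e1 /(congr1 val) /= e2].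
    by rewrite -bsE ltn_divLR.
  by rewrite (divn_eq r b) e1 e2 -divn_eq.
have rw r : (r < d)%N -> exists x, w r = fam (n1 * b) (f s%:R) r *m x.
  move=> rd; rewrite /fam; case: ifP => rn; last by exists (w r); rewrite mul1mx.
  have r1 : (r %/ b < n1)%N by rewrite ltn_divLR.
  have [x ex] := ru _ (leq_trans r1 (leq_subr _ _)) r1.
  by exists (emb R (kk r) *m x); rewrite /w ex !mulmxA ha blockop_emb.
have [w' [ow' rw' _]] : exists u, [/\ orthon d u, in_range (n1 * b) d (f (~~ s)%:R) u &
    forall r, (r < 0)%N -> u r = 0].
  apply: (@orthon_extend _ _ d 0 (n1 * b) _ (fun=> 0)) => //; first exact: sf.
  by move=> r; exact: hf.
have rw'' r : (r < d)%N -> exists x, w' r = fam (n1 * b) (f (~~ s)%:R) r *m x.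
  move=> rd; rewrite /fam; case: ifP => rn; last by exists (w' r); rewrite mul1mx.
  exact: rw'.
have [v [cv ov rv ev]] : exists v : nat -> R -> 'cV[C]_d, [/\ forall r, contM (v r),
    forall t, 0 <= t <= 1 -> orthon d (v ^~ t),
    forall t, 0 <= t <= 1 -> in_range (n1 * b) d (f t) (v ^~ t) &
    forall r, (r < d)%N -> v r s%:R = w r].
  pose W e := if e == s then w else w'.
  have hW e : orthon d (W e) /\ forall r, (r < d)%N ->
      exists x, W e r = fam (n1 * b) (f e%:R) r *m x.
    rewrite /W; case: eqVneq => [->|es] //; have -> // : e = ~~ s by case: (e) (s) es => -[].
  have [v [cv ov rv ev]] := orthonormal_frame cf sf hf (leqnn d) (hW false).1 (hW true).1
    (hW false).2 (hW true).2.
  exists v; split=> // r /ev[e0 e1]; have <- : W s = w by rewrite /W eqxx.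
  by case: (s).
pose ix (x : T * 'I_b) := ((n1 + enum_rank x.1) * b + x.2)%N.
have ixd x : (ix x < d)%N.
  rewrite -bsE; apply: ltn_pair => //.
  apply: (@leq_trans (n1 + #|T|)); first by rewrite ltn_add2l.
  by rewrite subnK.
have ixE x y : (ix x == ix y) = (x == y).
  rewrite eqn_pair // eqn_add2l; case: x y => [x k] [y l] /=.
  by rewrite xpair_eqE -(inj_eq enum_rank_inj).
exists (fun x => v (ix x)), (fun x => u (n1 + enum_rank x)%N); split=> //.
- by move=> t x y t01; rewrite ov // ixE.
- move=> t c t01 cf0; rewrite -[RHS]mulmx1 -(orthon_full (ov t t01)) /proj.
  pose H r := c *m (v r t *m adj (v r t)).
  rewrite [RHS]mulmx_sumr [RHS](_ : _ = \sum_(0 <= r < d) H r); last by rewrite big_mkord.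
  rewrite (@sum_nat_pair _ d (n1 + #|T|) b); last by rewrite subnK.
  rewrite (@big_cat_nat _ _ _ n1 0 (n1 + #|T|)%N) ?leq_addr //=.
  (* The summands of the first [n1] blocks lie in the range of [f] and are killed by [c], so [c]
     sees only those of [G]. *)
  rewrite [X in _ = X + _]big_nat_cond [X in _ = X + _]big1 ?add0r => [|i]; last first.
    rewrite andbT => /andP[_ i1]; rewrite big_nat_cond big1 // => k; rewrite andbT => /andP[_ kb].
    have h1 : (i * b + k < n1 * b)%N by exact: ltn_pair.
    have h2 : (i * b + k < d)%N by apply: leq_trans h1 _; rewrite -bsE leq_mul2r leq_subr orbT.
    by have [x ex] := rv t t01 _ h2 h1; rewrite /H ex !mulmxA cf0 !mul0mx.
  rewrite -{1}[n1]add0n big_addn addnC addnK big_mkord mulmx_sumr.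
  rewrite (reindex (@enum_rank T)) /=; last exact: onW_bij (@enum_rank_bij T).
  rewrite -(pair_bigA _ (fun x k => c *m (v (ix (x, k)) t *m adj (v (ix (x, k)) t)))) /=.
  apply: eq_bigr => x _; rewrite big_mkord; apply: eq_bigr => k _.
  by rewrite /H /ix /= (addnC n1).
move=> x k; rewrite ev ?ixd // /w /ix /= divnMDl // divn_small // addn0.
congr (emb R _ *m _); apply: val_inj; rewrite /= modnMDl modn_small //.
Qed.

End Complement.

(** * Comparison inside one building block *)

Section Comparison.
Variables (R : realType) (P Q N : nat).
Hypotheses (P0 : (0 < P)%N) (Q0 : (0 < Q)%N).
Local Notation C := R[i].
Local Notation d := (P * Q)%N.
Variables (F : frame R P Q N) (al : bool -> 'I_N).
Hypothesis al_inj : al false != al true.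
Variables b f : R -> 'M[C]_d.
Hypotheses (hb : ddrop b) (hf : ddrop f).
Hypothesis sf : forall t, 0 <= t <= 1 -> subunit (f t).
Hypothesis bf : forall t, 0 <= t <= 1 -> b t *m f t = 0.
Hypothesis hFs : forall s, (#|fVs F s| <= bsize P Q s)%N.
Hypothesis htr : forall s t r, 0 <= t <= 1 ->
  (r < (bsize P Q s - #|fVs F s|) * bmult P Q s)%N -> r%:R < complex.Re (\tr (f t)).

Lemma adjY_phi (W : fV F -> R -> R) (z : 'M[C]_N) v t : 0 <= t <= 1 ->
  adj (fY v t) *m phi W z t = (W v t)%:C *: (z *m adj (fY v t)).
Proof.
move=> t01; rewrite /phi mulmx_sumr (bigD1 v) //= big1 ?addr0 => [|w wv].
  by rewrite -scalemxAr !mulmxA f_orth // eqxx mul1mx.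
rewrite -scalemxAr !mulmxA f_orth // eq_sym (negbTE wv).
by rewrite -scalemx1 scale0r !mul0mx scaler0.
Qed.

(** The transition takes place in the middle third: where [chi s] is nonzero, the ramp attached to
    the opposite end has already reached one. *)
Let chi (s : bool) t : R := if s then 1 - clamp (2 - 3 * t) else clamp (2 - 3 * t).

Let chi01 s t : 0 <= chi s t.
Proof. by case: s => /=; [rewrite subr_ge0 clamp_le1 | exact: clamp_ge0]. Qed.

Let chi_sum t : \sum_s chi s t = 1.
Proof. by rewrite big_bool /= subrK. Qed.

Let contR_chi s : contR (chi s).
Proof.
have h : contR (fun t : R => clamp (2 - 3 * t)).
  apply: contR_clamp; apply: contRD (contR_cst 2) _; apply: contRN.
  exact: contRM (contR_cst 3) (@contR_id R).
by case: s => //=; exact: contRD (contR_cst 1) (contRN h).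
Qed.

Let chi_end (s e : bool) : chi s e%:R = (s == e)%:R.
Proof.
have c0 : clamp (2 - 3 * false%:R : R) = 1 by rewrite clamp_eq1 // mulr0n; lra.
have c1 : clamp (2 - 3 * true%:R : R) = 0 by rewrite clamp_eq0 // mulr1n; lra.
by case: s; case: e; rewrite /chi ?c0 ?c1 ?subrr ?subr0.
Qed.

Let chi_wt s t x : chi s t != 0 -> wt 0 (@ffi R P Q N F s x) t = 1.
Proof.
have h : forall e, chi (~~ e) t != 0 -> ramp e 0 t = 1.
  move=> e; rewrite /ramp => h; apply: clamp_eq1; move: h; rewrite leNgt => h.
  apply/negP => h'; move/eqP: h; apply; move: h'.
  case: e => /= h'; first by rewrite clamp_eq0 //; lra.
  by rewrite clamp_eq1 ?subrr //; lra.
move=> hs; have e1 c : fac c s (@ffi R P Q N F s x) t = 1 by rewrite /fac codom_f.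
have e2 : fac 0 (~~ s) (@ffi R P Q N F s x) t = 1.
  by rewrite /fac; case: (_ \in _) => //; apply: h; rewrite negbK.
by rewrite /wt; move: e1 e2; case: (s) (x) => y /= -> ->; rewrite mulr1.
Qed.

Let unit_pair : 'M[C]_N := delta_mx (al false) (al false) + delta_mx (al true) (al true).

(* Where [chi s] is nonzero, the vectors of the frame belonging to the block structure
   at [s] have weight one, and [S s] is a partial isometry from their [al s]-components
   onto a space whose complement [b] kills.  The two pieces can be glued by [chi]
   since the components [al false] and [al true] are orthogonal. *)
Lemma comparison : exists v, [/\ ddrop v,
  forall t, 0 <= t <= 1 -> v t *m adj (v t) = b t *m adj (b t) &
  forall t, 0 <= t <= 1 ->
    v t *m phi (fun x t => wt (F := F) 0 x t * wt 0 x t) unit_pair t *m adj (v t) =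
    b t *m adj (b t)].
Proof.
pose cf s := complement_frame P0 Q0 hf sf (hFs s) (htr (s := s)).
pose G s := sval (cid (cf s)).
have hG s : exists g, [/\ forall x, contM (G s x),
      forall t x y, 0 <= t <= 1 -> dot (G s x t) (G s y t) = (x == y)%:R,
      forall t (c : 'M[C]_d), 0 <= t <= 1 -> c *m f t = 0 ->
        c *m (\sum_x G s x t *m adj (G s x t)) = c &
      forall x k, G s (x, k) s%:R = emb R k *m g x] by exact: (svalP (cid (cf s))).
pose yv s x t : 'cV[C]_d := fY (@ffi R P Q N F s x) t *m delta_mx (al s) 0.
pose S s t : 'M[C]_d := \sum_x G s x t *m adj (yv s x t).
pose v t := b t *m \sum_(s : bool) ((Num.sqrt (chi s t))%:C *: S s t).
have expand t (X : 'M[C]_d) : 0 <= t <= 1 ->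
    (forall s s' x x', chi s t != 0 -> adj (yv s x t) *m X *m yv s' x' t =
       ((s == s') && (@ffi R P Q N F s x == @ffi R P Q N F s' x'))%:R%:M) ->
    v t *m X *m adj (v t) = b t *m adj (b t).
  move=> t01 hX; have SX s s' : chi s t != 0 -> S s t *m X *m adj (S s' t) =
      (s == s')%:R *: \sum_x G s x t *m adj (G s x t).
    move=> cs; rewrite /S mulmx_suml mulmx_suml.
    have E x x' : G s x t *m adj (yv s x t) *m X *m adj (G s' x' t *m adj (yv s' x' t)) =
        ((s == s') && (@ffi R P Q N F s x == @ffi R P Q N F s' x'))%:R *:
          (G s x t *m adj (G s' x' t)).
      rewrite adjM adjK.
      have -> : G s x t *m adj (yv s x t) *m X *m (yv s' x' t *m adj (G s' x' t)) =
          G s x t *m (adj (yv s x t) *m X *m yv s' x' t) *m adj (G s' x' t).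
        by rewrite !mulmxA.
      by rewrite hX // mul_mx_scalar -scalemxAl.
    have [ss'|ss'] := eqVneq s s'; last first.
      rewrite scale0r big1 // => x _; rewrite adj_sum mulmx_sumr big1 // => x' _.
      by rewrite E (negbTE ss') scale0r.
    subst s'; rewrite scale1r; apply: eq_bigr => x _.
    rewrite adj_sum mulmx_sumr (bigD1 x) //= big1 ?addr0 => [|x' x'x].
      by rewrite E !eqxx scale1r.
    by rewrite E eqxx (inj_eq (@f_inj R P Q N F s)) eq_sym (negbTE x'x) scale0r.
  pose U := \sum_(s : bool) ((Num.sqrt (chi s t))%:C *: S s t).
  have -> : v t *m X *m adj (v t) = b t *m (U *m X *m adj U) *m adj (b t).
    by rewrite /v adjM !mulmxA.
  congr (_ *m _); rewrite /U adj_sum mulmx_suml mulmx_suml.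
  rewrite (eq_bigr (fun s => (chi s t)%:C *: \sum_x G s x t *m adj (G s x t))); last first.
    move=> s _; rewrite mulmx_sumr -!scalemxAl.
    have [c0|c0] := eqVneq (chi s t) 0.
      by rewrite c0 sqrtr0 !scale0r big1 // => s' _; rewrite mul0mx.
    rewrite (bigD1 s) //= big1 ?addr0 => [|s' s's].
      rewrite adjZ conjc_real -scalemxAr -scalemxAl SX // eqxx scale1r scalerA -rmorphM.
      by rewrite -expr2 sqr_sqrtr.
    rewrite adjZ conjc_real -scalemxAr -scalemxAl SX // eq_sym (negbTE s's).
    by rewrite scale0r !scaler0.
  rewrite mulmx_sumr (eq_bigr (fun s => (chi s t)%:C *: b t)) => [|s _].
    by rewrite -scaler_suml -rmorph_sum chi_sum scale1r.
  by rewrite -scalemxAr; have [g [_ _ -> //]] := hG s; exact: bf.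
have yv_dot t s s' x x' : 0 <= t <= 1 -> adj (yv s x t) *m yv s' x' t =
   ((s == s') && (@ffi R P Q N F s x == @ffi R P Q N F s' x'))%:R%:M.
  move=> t01; rewrite /yv adjM -mulmxA (mulmxA (adj (fY _ t))) f_orth //.
  rewrite mul_scalar_mx -scalemxAr adj_delta mul_delta_mx_cond.
  have -> : (al s == al s') = (s == s').
    by case: s x => x; case: s' x' => x'; rewrite ?eqxx ?(negbTE al_inj) // eq_sym (negbTE al_inj).
  apply/matrixP => i j; rewrite !ord1 !mxE; case: (s == s'); case: (_ == _);
  by rewrite /= ?mulr1n ?mulr0n ?mxE ?mulr1 ?mulr0 ?mul0r ?eqxx.
exists v; split.
- apply/ddrop_blockP; split=> [|e].
    have [cb _ _] := hb; apply: contM_mul cb _; apply: contM_sum => s _.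
    apply: contMZ; first exact: contR_sqrt.
    apply: contM_sum => x _; apply: contM_mul; first by have [g []] := hG s.
    apply/contM_adj/contM_mul; [exact: f_cont | exact: contM_cst].
  have [_ /(_ e)[a ha]] := (ddrop_blockP _).1 hb; have [g [_ _ _ hg]] := hG e.
  exists (a *m \sum_x g x *m adj (fU x *m delta_mx (al e) 0)).
  rewrite /v ha (bigD1 e) //= big1 ?addr0 => [|s se]; last first.
    by rewrite chi_end (negbTE se) sqrtr0 scale0r.
  rewrite chi_end eqxx sqrtr1 scale1r.
  rewrite blockopM.
  congr (_ *m _); rewrite /S /blockop.
  pose H x k := G e (x, k) e%:R *m adj (yv e (x, k) e%:R).
  rewrite (eq_bigr (fun x => H x.1 x.2)) => [|[x k] _ //].
  rewrite -(pair_bigA _ H) exchange_big; apply: eq_bigr => k _.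
  rewrite mulmx_sumr mulmx_suml; apply: eq_bigr => x _.
  by rewrite /H /yv hg f_end !adjM !mulmxA.
- move=> t t01; rewrite -[v t]mulmx1; rewrite adjM adj1 mul1mx -mulmxA.
  rewrite mulmxA; apply: expand => // s s' x x' _; rewrite mulmx1; exact: yv_dot.
move=> t t01; apply: expand => // s s' x x' cs.
rewrite [in LHS]/yv adjM -(mulmxA (adj (delta_mx (al s) 0))) adjY_phi //.
rewrite (chi_wt x cs) mulr1 scale1r !mulmxA -(mulmxA _ (adj (fY _ t))) f_orth //.
rewrite mul_mx_scalar -scalemxAl adj_delta.
have -> : delta_mx 0 (al s) *m unit_pair *m delta_mx (al s') 0 = (s == s')%:R%:M :> 'M[C]_1.
  have ft : (al true == al false) = false by rewrite eq_sym (negbTE al_inj).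
  have D1 : delta_mx 0 0 = 1%:M :> 'M[C]_1.
    by apply/matrixP => i j; rewrite !ord1 !mxE eqxx.
  case: (s); case: (s'); rewrite mulmxDr !mul_delta_mx_cond ?eqxx ?ft ?(negbTE al_inj)
    ?mulr1n ?mulr0n ?addr0 ?add0r mul_delta_mx_cond ?eqxx ?ft ?(negbTE al_inj) ?mulr1n ?mulr0n ?D1 //;
  by apply/matrixP => i j; rewrite !mxE mul0rn.
by rewrite scale_scalar_mx -natrM mulnb andbC.
Qed.

End Comparison.

(** * Cells of the unit interval *)

Section Cells.
Variables (R : realType) (K S : nat).
Hypothesis K0 : (0 < K)%N.
Implicit Types (s j : nat) (t : R).

(* For each shift [s < S] the interval is cut into [K + 1] cells; the cut points of
   different shifts are far apart compared to the width of the ramps. *)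
Definition cell_pos s t : R := K%:R * t + (1 - s.+1%:R / S.+1%:R).
(** With the factor [4 * S.+1], the inner cut-off is one at distance [1 / (2 * S.+1)] from the cut
    points, half the spacing of the cut points of different shifts. *)
Definition cell_depth s j t : R :=
  4 * S.+1%:R * Num.min (cell_pos s t - j%:R) (j.+1%:R - cell_pos s t).
Definition outer s j t : R := clamp (cell_depth s j t).
Definition inner s j t : R := clamp (cell_depth s j t - 1).
Definition cell_corner j : corner :=
  if j == 0%N then AtZero else if j == K then AtOne else Inside.
Definition cell_ref s j : R :=
  if j == 0%N then 0 else if j == K then 1 else (j%:R - 1 + s.+1%:R / S.+1%:R) / K%:R.

Let S1 : 0 < S.+1%:R :> R. Proof. by []. Qed.
Let KR : 1 <= K%:R :> R. Proof. by rewrite ler1n. Qed.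

Let theta s : (s < S)%N -> 0 < (s.+1%:R / S.+1%:R : R) < 1.
Proof. by move=> sS; rewrite divr_gt0 // ltr_pdivrMr // mul1r ltr_nat. Qed.

Lemma contR_depth s j : contR (cell_depth s j).
Proof.
apply: contRM (contR_cst _) _; apply: contR_min; apply: contRD.
- apply: contRD (contR_cst _); exact: contRM (contR_cst _) (@contR_id R).
- exact: contR_cst.
- exact: contR_cst.
apply: contRN; apply: contRD (contR_cst _); exact: contRM (contR_cst _) (@contR_id R).
Qed.

Lemma depth_gt0 s j t : (0 < cell_depth s j t) =
  (j%:R < cell_pos s t) && (cell_pos s t < j.+1%:R).
Proof. by rewrite pmulr_rgt0 ?mulr_gt0 // lt_min !subr_gt0. Qed.

Lemma outer_neq0 s j t : outer s j t != 0 -> j%:R < cell_pos s t < j.+1%:R.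
Proof.
move=> h; rewrite -depth_gt0 ltNge; apply: contra h => h.
by rewrite /outer clamp_eq0.
Qed.

Lemma outer_inner s j t : outer s j t * inner s j t = inner s j t.
Proof.
have [h|h] := leP (cell_depth s j t) 1.
  by rewrite [inner _ _ _]clamp_eq0 ?mulr0 // subr_le0.
by rewrite [outer _ _ _]clamp_eq1 ?mul1r // ltW.
Qed.

Lemma outer_disjoint s j j' t : j != j' -> outer s j t * outer s j' t = 0.
Proof.
move=> jj'; apply/eqP; rewrite mulf_eq0 -[_ || _]negbK negb_or; apply/negP.
move=> /andP[/outer_neq0/andP[a1 a2] /outer_neq0/andP[b1 b2]].
have := lt_trans a1 b2; have := lt_trans b1 a2; rewrite !ltr_nat !ltnS => h1 h2.
by move: jj'; rewrite eqn_leq h1 h2.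
Qed.

Let admissible_clamp s j (h : R -> R) : (s < S)%N -> (j <= K)%N -> contR h ->
  (forall t, h t <= cell_depth s j t) ->
  admissible (cell_corner j) (fun t => clamp (h t)).
Proof.
move=> sS jK ch hd; have /andP[t0 t1] := theta sS; split; first exact: contR_clamp.
  rewrite /cell_corner; have [//|j0] := eqVneq j 0%N => _.
  rewrite clamp_eq0 // (le_trans (hd _)) // leNgt depth_gt0; apply/negP => /andP[h1 _].
  have j1 : 1 <= j%:R :> R by rewrite ler1n lt0n.
  by move: h1 t0 j1; rewrite /cell_pos mulr0 add0r; move: (s.+1%:R / S.+1%:R) => th; lra.
rewrite /cell_corner; have [j0 _|j0] := eqVneq j 0%N.
  rewrite clamp_eq0 // (le_trans (hd _)) // leNgt depth_gt0; apply/negP => /andP[_].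
  rewrite /cell_pos mulr1 j0 -[1%:R]/(1 : R); have := KR; move: t0 t1.
  by move: (s.+1%:R / S.+1%:R) => th; lra.
have [//|jK'] := eqVneq j K => _.
rewrite clamp_eq0 // (le_trans (hd _)) // leNgt depth_gt0; apply/negP => /andP[_].
have : j.+1%:R <= K%:R :> R by rewrite ler_nat ltn_neqAle jK'.
by rewrite /cell_pos mulr1; move: t0 t1; move: (s.+1%:R / S.+1%:R) => th; lra.
Qed.

Lemma admissible_outer s j : (s < S)%N -> (j <= K)%N ->
  admissible (cell_corner j) (outer s j).
Proof. by move=> sS jK; exact: (admissible_clamp sS jK (contR_depth s j) (fun t => lexx _)). Qed.

Lemma admissible_inner s j : (s < S)%N -> (j <= K)%N ->
  admissible (cell_corner j) (inner s j).
Proof.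
move=> sS jK; apply: (@admissible_clamp s j (fun t => cell_depth s j t - 1)) => // [|t].
  exact: contRD (@contR_depth _ _) (contR_cst _).
by rewrite gerBl.
Qed.

Lemma cell_ref01 s j : (s < S)%N -> (j <= K)%N -> 0 <= cell_ref s j <= 1.
Proof.
move=> sS jK; have /andP[t0 t1] := theta sS; rewrite /cell_ref.
have [_|j0] := eqVneq j 0%N; first by rewrite lexx ler01.
have [_|jK'] := eqVneq j K; first by rewrite lexx ler01.
have j1 : 1 <= j%:R :> R by rewrite ler1n lt0n.
have : j%:R <= K%:R :> R by rewrite ler_nat.
have K00 : 0 < K%:R :> R by have := KR; lra.
move: t0 t1; move: (s.+1%:R / S.+1%:R) => th t0 t1 jK2.
by rewrite ler_pdivrMr // mul1r divr_ge0 ?(ltW K00) //; lra.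
Qed.

Lemma cell_ref_near s j t : (s < S)%N -> (j <= K)%N -> 0 <= t <= 1 ->
  outer s j t != 0 -> `|t - cell_ref s j| < K%:R^-1.
Proof.
move=> sS jK /andP[t0 t1] /outer_neq0; have /andP[th0 th1] := theta sS.
rewrite /cell_pos /cell_ref; set th := _ / _ in th0 th1 *.
have K00 : 0 < K%:R :> R by have := KR; lra.
have KV : K%:R * K%:R^-1 = 1 :> R by rewrite mulfV // gt_eqF.
move=> /andP[]; rewrite -natr1 => h1 h2.
rewrite -(ltr_pM2l K00) KV -{1}(gtr0_norm K00) -normrM mulrBr.
move: h1 h2; have [->|j0] := eqVneq j 0%N => h1 h2.
  by rewrite mulr0 subr0 ltr_norml; have : 0 <= K%:R * t; [rewrite mulr_ge0 // ltW | lra].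
have : K%:R * t <= K%:R by rewrite ler_piMr // ltW.
move: h1 h2; have [->|jK'] := eqVneq j K => h1 h2 h3; first by rewrite mulr1 ltr_norml; lra.
by rewrite [K%:R * (_ / _)]mulrC divfK ?gt_eqF // ltr_norml; lra.
Qed.

(** At each point at most one shift loses mass. After integration against an arbitrary probability
    measure, one of the [S] shifts loses at most [1 / S]. *)
Lemma inner_sum t : 0 <= t <= 1 ->
  \sum_(s < S) (1 - \sum_(j < K.+1) inner s j t) <= 1.
Proof.
(* In this scale the cut points of shift [s] become the integers [i * S.+1 + s.+1], so a number
   determines the shift; two bad shifts would give the same integer. *)
move=> /andP[t0 t1]; pose w : R := S.+1%:R * (K%:R * t + 1).
have sum_ge0 (s : 'I_S) (A : pred 'I_K.+1) : 0 <= \sum_(j < K.+1 | A j) inner s j t.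
  by apply: sumr_ge0 => j _; exact: clamp_ge0.
(* a shift is bad at [t] only if one of its cut points is near [t] *)
have bad (s : 'I_S) : 0 < 1 - \sum_(j < K.+1) inner s j t ->
    exists i, `|w - (i * S.+1 + s.+1)%:R| < 1 / 2.
  have /andP[th0 th1] := theta (ltn_ord s).
  move=> hs; set x := cell_pos s t.
  have x0 : 0 <= x.
    rewrite /x /cell_pos; move: th1; move: (s.+1%:R / S.+1%:R) => th th1.
    by have : 0 <= K%:R * t; [rewrite mulr_ge0 | lra].
  have xK : x < K.+1%:R.
    rewrite /x /cell_pos -[K.+1%:R]natr1; move: th0; move: (s.+1%:R / S.+1%:R) => th th0.
    by have : K%:R * t <= K%:R; [rewrite ler_piMr | lra].
  have /andP[j1 j2] := truncn_itv x0; set j := Num.truncn x in j1 j2.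
  have jK : (j < K.+1)%N by rewrite -(ltr_nat R) (le_lt_trans j1).
  have : cell_depth s j t < 2.
    rewrite ltNge; apply: contraL hs => h; rewrite -leNgt subr_le0.
    rewrite (bigD1 (Ordinal jK)) //= [inner _ _ _]clamp_eq1; first by rewrite lerDl.
    by rewrite lerBrDr.
  have wE i : w - (i * S.+1 + s.+1)%:R = S.+1%:R * (x - i%:R).
    rewrite /w /x /cell_pos natrD natrM; field; by rewrite gt_eqF.
  rewrite /cell_depth -/x; case: (leP (x - j%:R) (j.+1%:R - x)) => _ h.
    exists j; rewrite wE normrM gtr0_norm // ger0_norm ?subr_ge0 //.
    by move: h; nra.
  exists j.+1; rewrite wE normrM gtr0_norm // ler0_norm ?subr_le0 ?(ltW j2) //.
  by rewrite opprB; move: h; nra.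
have [[s0 h0]|h] := pselect (exists s : 'I_S, 0 < 1 - \sum_(j < K.+1) inner s j t).
  rewrite (bigD1 s0) //= -[leRHS]addr0; apply: lerD.
    by rewrite gerBl.
  apply: sumr_le0 => s ss0; rewrite leNgt; apply/negP => h1.
  have [i hi] := bad _ h1; have [i' hi'] := bad _ h0.
  have e : (i * S.+1 + s.+1 = i' * S.+1 + s0.+1)%N.
    have : `|(i * S.+1 + s.+1)%:R - (i' * S.+1 + s0.+1)%:R : R| < 1.
      by move: hi hi'; rewrite !ltr_norml; lra.
    move: (_ + _)%N (_ + _)%N => m n; rewrite ltr_norml => /andP[h2 h3].
    have a : m%:R < n.+1%:R :> R by rewrite -natr1; lra.
    have b : n%:R < m.+1%:R :> R by rewrite -natr1; lra.
    by apply/eqP; move: a b; rewrite !ltr_nat !ltnS eqn_leq => -> ->.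
  move/eqP: e; rewrite eqn_pair ?ltnS // => /andP[_]; rewrite eqSS => /eqP/val_inj e.
  by move: ss0; rewrite e eqxx.
apply: (le_trans _ ler01); apply: sumr_le0 => s _; rewrite leNgt; apply/negP => hs.
by apply: h; exists s.
Qed.

End Cells.

Lemma contR_sum (R : realType) (I : Type) (r : seq I) (F : I -> R -> R) :
  (forall i, contR (F i)) -> contR (fun t => \sum_(i <- r) F i t).
Proof.
move=> h; elim: r => [|i r IH].
  by apply: contC_eq (contR_cst 0) => t _; rewrite big_nil.
by apply: contC_eq (contRD (h i) IH) => t _; rewrite big_cons.
Qed.

Record cells (R : realType) (J : finType) (cs : J -> corner) (gp g : J -> R -> R) : Prop := {
  c_outer : forall j, admissible (cs j) (gp j);
  c_inner : forall j, admissible (cs j) (g j);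
  c_outer01 : forall j t, 0 <= gp j t <= 1;
  c_inner01 : forall j t, 0 <= g j t <= 1;
  c_absorb : forall j t, gp j t * g j t = g j t;
  c_disj : forall j j' t, j != j' -> gp j t * gp j' t = 0
}.

(** * Cells adapted to finitely many functions and to the trace *)

Section ExistsCells.
Variables (R : realType) (Z : cstarType R) (P Q : nat).
Hypotheses (P0 : (0 < P)%N) (Q0 : (0 < Q)%N).
Local Notation C := R[i].
Local Notation d := (P * Q)%N.
Variable mu : (R -> 'M[C^o]_(P * Q)) -> Z.
Hypothesis hmu : dimdrop_embedding mu.
Variable tau : {linear Z -> C^o}.
Hypothesis htau : tracial_state tau.

Lemma cRe_ge0 (z : C) : 0 <= z -> 0 <= complex.Re z.
Proof. by rewrite lecE => /andP[]. Qed.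

(** The trace on central scalar functions, that is, integration against a probability measure on the
    interval. *)
Definition scalar_trace (g : R -> R) : R :=
  complex.Re (tau (mu (fun t => (g t)%:C%:M))).

Lemma scalar_traceD g h : contR g -> contR h ->
  scalar_trace (fun t => g t + h t) = scalar_trace g + scalar_trace h.
Proof.
move=> cg ch; rewrite /scalar_trace -cReD -[in RHS]linearD -(emD hmu); try exact: contR_ddrop.
congr (complex.Re (tau (mu _))); apply/funext => t.
by rewrite rmorphD raddfD.
Qed.

Lemma scalar_trace_sum (I : finType) (g : I -> R -> R) : (forall i, contR (g i)) ->
  scalar_trace (fun t => \sum_i g i t) = \sum_i scalar_trace (g i).
Proof.
move=> cg; rewrite /scalar_trace -cRe_sum -[in RHS]linear_sum -(em_sum hmu); last first.
  by move=> i _; exact: contR_ddrop.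
congr (complex.Re (tau (mu _))); apply/funext => t.
by rewrite rmorph_sum raddf_sum.
Qed.

Lemma scalar_trace_ge0 g : contR g -> (forall t, 0 <= t <= 1 -> 0 <= g t) ->
  0 <= scalar_trace g.
Proof.
move=> cg g0; have [_ pos _] := htau; apply: cRe_ge0.
have hs : ddrop (fun t => (Num.sqrt (g t))%:C%:M : 'M[C]_d).
  by apply: contR_ddrop; exact: contR_sqrt.
have -> // : mu (fun t => (g t)%:C%:M) =
    star (mu (fun t => (Num.sqrt (g t))%:C%:M)) * mu (fun t => (Num.sqrt (g t))%:C%:M).
rewrite -(em_star hmu) // -(emM hmu) //; last exact: ddrop_adj.
apply: (em_eq hmu); [exact: contR_ddrop | exact: ddropM (ddrop_adj hs) hs |].
move=> t t01; have -> : adj ((Num.sqrt (g t))%:C%:M : 'M[C]_d) = (Num.sqrt (g t))%:C%:M.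
  by rewrite -scalemx1 adjZ adj1 conjc_real.
by rewrite -scalar_mxM -rmorphM -expr2 sqr_sqrtr ?g0.
Qed.

Lemma scalar_trace1 : scalar_trace (fun=> 1) = 1.
Proof. by rewrite /scalar_trace (em1 hmu); have [-> _ _] := htau. Qed.

Lemma scalar_traceB g h : contR g -> contR h ->
  scalar_trace (fun t => g t - h t) = scalar_trace g - scalar_trace h.
Proof.
move=> cg ch; apply/eqP; rewrite eq_sym subr_eq -scalar_traceD //; last exact: contRD cg (contRN ch).
by apply/eqP; congr scalar_trace; apply/funext => t; rewrite subrK.
Qed.

Lemma scalar_trace_le g h : contR g -> contR h ->
  (forall t, 0 <= t <= 1 -> g t <= h t) -> scalar_trace g <= scalar_trace h.
Proof.
move=> cg ch gh; rewrite -subr_ge0 -scalar_traceB //; apply: scalar_trace_ge0.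
  exact: contRD ch (contRN cg).
by move=> t t01; rewrite subr_ge0 gh.
Qed.

Lemma unit_span (s : corner) (X : 'M[C]_d) :
  (s = AtZero -> exists a : 'M[C]_P, X = kron a 1%:M) ->
  (s = AtOne -> exists b : 'M[C]_Q, X = kron 1%:M b) ->
  exists x : 'I_(usize P Q s) -> 'I_(usize P Q s) -> C,
    X = \sum_a \sum_b x a b *: unitmx_of R a b.
Proof.
case: s => h0 h1.
- have [a ->] := h0 erefl; exists a; rewrite {1}[a]matrix_sum_delta kron_suml.
  by apply: eq_bigr => i _; rewrite kron_suml; apply: eq_bigr => j _; rewrite kronZl.
- have [a ->] := h1 erefl; exists a; rewrite {1}[a]matrix_sum_delta kron_sumr.
  by apply: eq_bigr => i _; rewrite kron_sumr; apply: eq_bigr => j _; rewrite kronZr.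
by exists X; exact: matrix_sum_delta.
Qed.

(** The measure given by the trace is unknown and may charge any fixed choice of cut points, hence
    the averaging over more than [1 / eta] shifts. The number [K] comes from uniform continuity. *)
Lemma exists_cells (I : finType) (f : I -> R -> 'M[C]_d) (dl eta : R) :
  (forall i, ddrop (f i)) -> 0 < dl -> 0 < eta ->
  exists (J : finType) (cs : J -> corner) (gp g : J -> R -> R),
  [/\ cells cs gp g,
    forall i, exists x : forall j : J, 'I_(usize P Q (cs j)) -> 'I_(usize P Q (cs j)) -> C,
      forall j t u v, 0 <= t <= 1 -> gp j t != 0 ->
        nc ((f i t - \sum_a \sum_b x j a b *: unitmx_of R a b) u v) <= dl &
    1 - eta <= scalar_trace (fun t => \sum_j g j t)].
Proof.
move=> hf dl0 eta0.
pose FF (x : I * 'I_d * 'I_d) t := f x.1.1 t x.1.2 x.2.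
have [w w0 hw] : exists2 w, 0 < w & forall x s t, 0 <= s <= 1 -> 0 <= t <= 1 ->
    `|s - t| < w -> nc (FF x s - FF x t) < dl.
  by apply: contC_unif_fam => // x; have [cf _ _] := hf x.1.1; exact: cf.
pose K := (Num.truncn w^-1).+1; pose S := (Num.truncn eta^-1).+1.
have wK : K%:R^-1 < w.
  rewrite -[w]invrK ltf_pV2 ?posrE ?invr_gt0 //.
  have ws : 0 <= w^-1 by rewrite invr_ge0 ltW.
  by have /andP[_] := truncn_itv ws.
have eS : 1 < S%:R * eta.
  rewrite -ltr_pdivrMr // mul1r.
  have es : 0 <= eta^-1 by rewrite invr_ge0 ltW.
  by have /andP[_] := truncn_itv es.
have cin s j : contR (inner K S s j : R -> R).
  by apply: contR_clamp; apply: contRD (contR_cst _); exact: contR_depth.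
have csum s : contR (fun t : R => \sum_(j < K.+1) inner K S s j t).
  by apply: contR_sum => j; exact: cin.
have ccsum s : contR (fun t : R => 1 - \sum_(j < K.+1) inner K S s j t).
  exact: contRD (contR_cst 1) (contRN (csum s)).
have [s hs] : exists s : 'I_S, 1 - eta <= scalar_trace (fun t => \sum_(j < K.+1) inner K S s j t).
  apply: contrapT => h.
  have : scalar_trace (fun t => \sum_(s < S) (1 - \sum_(j < K.+1) inner K S s j t)) <= 1.
    rewrite -[leRHS]scalar_trace1; apply: scalar_trace_le; last by move=> t t01; exact (@inner_sum R K S t t01).
      by apply: contR_sum => s; exact: ccsum.
    exact: contR_cst.
  rewrite scalar_trace_sum => [|s]; last exact: ccsum.
  rewrite leNgt => /negP; apply; apply: (lt_le_trans eS).
  have -> : S%:R * eta = \sum_(s < S) eta by rewrite sumr_const card_ord mulr_natl.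
  apply: ler_sum => s _; rewrite scalar_traceB ?scalar_trace1 //; last exact: contR_cst.
  rewrite lerBrDr -lerBrDl leNgt; apply/negP => h'; apply: h; exists s.
  exact: ltW.
exists 'I_K.+1, (fun j : 'I_K.+1 => cell_corner K j),
  (fun j : 'I_K.+1 => outer K S s j), (fun j : 'I_K.+1 => inner K S s j).
split => //.
- split=> [j|j|j t|j t|j t|j j' t jj'].
  + by apply: admissible_outer => //; rewrite -ltnS.
  + by apply: admissible_inner => //; rewrite -ltnS.
  + by rewrite /outer clamp_ge0 clamp_le1.
  + by rewrite /inner clamp_ge0 clamp_le1.
  + exact: outer_inner.
  exact: outer_disjoint.
move=> i; have [_ [a ha] [b hb]] := hf i.
have hx (j : 'I_K.+1) : exists x : 'I_(usize P Q (cell_corner K j)) ->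
    'I_(usize P Q (cell_corner K j)) -> C,
    f i (cell_ref R K S s j) = \sum_a \sum_b x a b *: unitmx_of R a b.
  apply: unit_span; rewrite /cell_corner /cell_ref; case: (eqVneq (j : nat) 0%N) => // j0.
  - by exists a.
  - by case: eqP.
  case: eqP => // _ _; by exists b.
exists (fun j => sval (cid (hx j))) => j t u v t01 gj.
rewrite -(svalP (cid (hx j))) !mxE; apply: ltW; apply: (hw (i, u, v)) => //=.
  by apply: cell_ref01 => //; rewrite -ltnS.
by apply: lt_trans wK; apply: cell_ref_near => //; rewrite -ltnS.
Qed.

End ExistsCells.

Section CellElements.
Variables (R : realType) (Z : cstarType R) (P Q : nat).
Hypotheses (P0 : (0 < P)%N) (Q0 : (0 < Q)%N).
Local Notation C := R[i].
Variable mu : (R -> 'M[C^o]_(P * Q)) -> Z.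
Hypothesis hmu : dimdrop_embedding mu.
Variables (J : finType) (cs : J -> corner) (gp g : J -> R -> R).
Hypothesis hc : cells cs gp g.
Local Notation ix j := ('I_(usize P Q (cs j))).

Definition cell_base j : ix j := Ordinal (usize_gt0 P0 Q0 (cs j)).
Definition cell_unit j (a : ix j) : Z := el mu (gp j) a (cell_base j).
Definition cell_core j : Z := el mu (g j) (cell_base j) (cell_base j).
Definition cell_sum (x : forall j, ix j -> ix j -> C) : Z :=
  \sum_j \sum_a \sum_b x j a b *: el mu (gp j) a b.

Lemma cell_unit_core j (a b : ix j) :
  el mu (gp j) a b * cell_core j = (b == cell_base j)%:R *: el mu (g j) a (cell_base j).
Proof.
rewrite /cell_core (elM hmu); [|exact: (c_outer hc)|exact: (c_inner hc)].
congr (_ *: _); apply: (el_eq hmu).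
- apply: admissibleM; first exact: (c_outer hc).
  by have [] := c_inner hc j.
- exact: (c_inner hc).
by move=> t _; rewrite (c_absorb hc).
Qed.

Lemma cell_cross j j' (a b : ix j) (c e : ix j') : j != j' ->
  el mu (gp j) a b * el mu (gp j') c e = 0.
Proof.
move=> jj'; rewrite /el -(emM hmu); [|exact/ddrop_unitR/(c_outer hc)..].
rewrite -(em0 hmu); congr mu; apply/funext => t.
by rewrite -scalemxAl -scalemxAr scalerA -rmorphM (c_disj hc _ jj') scale0r.
Qed.

Lemma cell_unit_orth j (a b : ix j) :
  star (cell_unit a) * cell_unit b * cell_core j = (a == b)%:R *: cell_core j.
Proof.
rewrite /cell_unit (el_star hmu _ _ (c_outer hc _)) -mulrA cell_unit_core eqxx scale1r.
rewrite (elM hmu); [|exact: (c_outer hc)|exact: (c_inner hc)].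
congr (_ *: _); apply: (el_eq hmu).
- apply: admissibleM; first exact: (c_outer hc).
  by have [] := c_inner hc j.
- exact: (c_inner hc).
by move=> t _; rewrite (c_absorb hc).
Qed.

Lemma cell_unit_cross j j' (a : ix j) (b : ix j') : j != j' ->
  star (cell_unit a) * cell_unit b = 0.
Proof.
by move=> jj'; rewrite /cell_unit (el_star hmu _ _ (c_outer hc _)) cell_cross.
Qed.

Lemma cell_sum_unit x j (a : ix j) :
  cell_sum x * (cell_unit a * cell_core j) = \sum_c x j c a *: (cell_unit c * cell_core j).
Proof.
rewrite /cell_sum mulr_suml (bigD1 j) //= [X in _ + X]big1 ?addr0 => [|j' jj']; last first.
  rewrite mulr_suml big1 // => c _; rewrite mulr_suml big1 // => b _.
  by rewrite -scalerAl /cell_unit mulrA cell_cross // mul0r scaler0.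
rewrite mulr_suml; apply: eq_bigr => c _.
rewrite mulr_suml (bigD1 a) //= big1 ?addr0 => [|b ba].
  rewrite -scalerAl /cell_unit !cell_unit_core eqxx scale1r; congr (_ *: _).
  rewrite (elM hmu); [|exact: (c_outer hc)|exact: (c_inner hc)].
  rewrite eqxx !scale1r; apply: (el_eq hmu).
  - apply: admissibleM; first exact: (c_outer hc).
    by have [] := c_inner hc j.
  - exact: (c_inner hc).
  by move=> t _; rewrite (c_absorb hc).
rewrite -scalerAl /cell_unit cell_unit_core eqxx scale1r.
rewrite (elM hmu); [|exact: (c_outer hc)|exact: (c_inner hc)].
by rewrite (negbTE ba) scale0r scaler0.
Qed.

Lemma cell_sum_star x : star (cell_sum x) = cell_sum (fun j a b => conjc (x j b a)).
Proof.
rewrite /cell_sum star_sum; apply: eq_bigr => j _; rewrite star_sum [RHS]exchange_big /=.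
apply: eq_bigr => a _; rewrite star_sum; apply: eq_bigr => b _.
by rewrite starZc (el_star hmu _ _ (c_outer hc _)).
Qed.

Lemma cell_sumE x : cell_sum x = mu (fun t => \sum_j (gp j t)%:C *: \sum_a \sum_b x j a b *: unitmx_of R a b) /\
  ddrop (fun t => \sum_j (gp j t)%:C *: \sum_a \sum_b x j a b *: unitmx_of R a b).
Proof.
have hd j (a b : ix j) : ddrop (fun t => x j a b *: ((gp j t)%:C *: unitmx_of R a b)).
  by apply: ddropZ; exact/ddrop_unitR/(c_outer hc).
have hs j : ddrop (fun t => \sum_a \sum_b x j a b *: ((gp j t)%:C *: unitmx_of R a b)).
  by apply: ddrop_sum => a _; apply: ddrop_sum => b _; exact: hd.
have e : (fun t => \sum_j (gp j t)%:C *: \sum_a \sum_b x j a b *: unitmx_of R a b) =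
   (fun t => \sum_j \sum_a \sum_b x j a b *: ((gp j t)%:C *: unitmx_of R a b)).
  apply/funext => t; apply: eq_bigr => j _; rewrite scaler_sumr; apply: eq_bigr => a _.
  by rewrite scaler_sumr; apply: eq_bigr => b _; rewrite !scalerA mulrC.
rewrite e; split; last by apply: ddrop_sum => j _; exact: hs.
rewrite (em_sum hmu) => [|j _]; last exact: hs.
apply: eq_bigr => j _; rewrite (em_sum hmu) => [|a _]; last by apply: ddrop_sum => b _; exact: hd.
apply: eq_bigr => a _; rewrite (em_sum hmu) => [|b _]; last exact: hd.
apply: eq_bigr => b _; rewrite (emZ hmu) //; exact/ddrop_unitR/(c_outer hc).
Qed.

(** The central function [\sum_j gp j]. Nothing is controlled near the cut points, so an element is
    close to a cell sum only after multiplication by it; on the frames built from the cells it acts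
    as a unit. *)
Definition cell_id : Z := cell_sum (fun j a b => (a == b)%:R).

Lemma cell_sum_near (K dl : R) (f : R -> 'M[C]_(P * Q)) (x : forall j, ix j -> ix j -> C) :
  0 <= dl -> (forall f c, ddrop f ->
    (forall t i j, 0 <= t <= 1 -> nc (f t i j) <= c) -> cnorm (mu f) <= K * c) ->
  ddrop f ->
  (forall j t u v, 0 <= t <= 1 -> gp j t != 0 ->
        nc ((f t - \sum_a \sum_b x j a b *: unitmx_of R a b) u v) <= dl) ->
  cnorm (mu f * cell_id - cell_sum x) <= K * dl /\
  cnorm (cell_id * mu f - cell_sum x) <= K * dl.
Proof.
move=> dl0 hK hf hx; have [ex dx] := cell_sumE x.
have [ei di] := cell_sumE (fun j (a b : ix j) => (a == b)%:R).
pose D t := \sum_j (gp j t)%:C *: (f t - \sum_a \sum_b x j a b *: unitmx_of R a b).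
have idE t : \sum_j (gp j t)%:C *: (\sum_a \sum_b (a == b :> ix j)%:R *: unitmx_of R a b) =
    \sum_j (gp j t)%:C *: 1%:M.
  apply: eq_bigr => j _; congr (_ *: _); rewrite -(sum_unitmx_of R P Q (cs j)).
  apply: eq_bigr => a _; rewrite (bigD1 a) //= eqxx scale1r big1 ?addr0 // => b ba.
  by rewrite eq_sym (negbTE ba) scale0r.
have dD : ddrop (fun t => f t *m (\sum_j (gp j t)%:C *: \sum_a \sum_b (a == b :> ix j)%:R *: unitmx_of R a b)
    + (-1) *: \sum_j (gp j t)%:C *: \sum_a \sum_b x j a b *: unitmx_of R a b).
  by apply: ddropD; [exact: ddropM | exact: ddropZ].
have DE t : f t *m (\sum_j (gp j t)%:C *: \sum_a \sum_b (a == b :> ix j)%:R *: unitmx_of R a b)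
    + (-1) *: (\sum_j (gp j t)%:C *: \sum_a \sum_b x j a b *: unitmx_of R a b) = D t.
  rewrite idE mulmx_sumr scaleN1r -sumrB; apply: eq_bigr => j _.
  by rewrite -scalemxAr mulmx1 scalerBr.
have dD' : ddrop D by apply: ddrop_eq dD => t _; exact: DE.
have e1 : mu f * cell_id - cell_sum x = mu D.
  rewrite /cell_id ei ex -(emM hmu) // -scaleN1r -(emZ hmu) // -(emD hmu); [|exact: ddropM|exact: ddropZ].
  by congr mu; apply/funext.
have e2 : cell_id * mu f - cell_sum x = mu D.
  rewrite /cell_id ei ex -(emM hmu) // -scaleN1r -(emZ hmu) // -(emD hmu); [|exact: ddropM|exact: ddropZ].
  congr mu; apply/funext => t; rewrite -DE; congr (_ + _).
  rewrite idE mulmx_suml mulmx_sumr; apply: eq_bigr => j _.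
  by rewrite -scalemxAl -scalemxAr mulmx1 mul1mx.
rewrite e1 e2; suff h : cnorm (mu D) <= K * dl by split.
apply: hK => // t u v t01; rewrite /D.
have [[j0 hj0]|hno] := pselect (exists j, gp j t != 0); last first.
  rewrite big1 ?mxE ?nc0 // => j _; have [->|h] := eqVneq (gp j t) 0; first by rewrite scale0r.
  by exfalso; apply: hno; exists j.
rewrite (bigD1 j0) //= [X in _ + X]big1 ?addr0 => [|j jj0].
  rewrite mxE ncM nc_real; have /andP[h0 h1] := c_outer01 hc j0 t.
  rewrite ger0_norm //; apply: le_trans (hx _ _ u v t01 hj0).
  by rewrite ler_piMl ?nc_ge0.
have : gp j t * gp j0 t = 0 by exact: (c_disj hc).
by move/eqP; rewrite mulf_eq0 (negbTE hj0) orbF => /eqP->; rewrite scale0r.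
Qed.

End CellElements.

Section TensorFrame.
Variables (R : realType) (Z : cstarType R).
Local Notation C := R[i].
Variables (p q : nat -> nat).
Variable mu : forall k, (R -> 'M[C^o]_(p k * q k)) -> Z.
Arguments mu : clear implicits.
Hypotheses (p0 : forall k, (0 < p k)%N) (q0 : forall k, (0 < q k)%N).
Hypothesis hmu : forall k, dimdrop_embedding (mu k).
Hypothesis incl : forall k, DD mu k `<=` DD mu k.+1.
Variable k : nat.
Variables (J : finType) (cs : J -> corner) (gp g : J -> R -> R).
Hypothesis hc : cells cs gp g.
Local Notation ix j := ('I_(usize (p k) (q k) (cs j))).
Local Notation cunit a := (cell_unit (p0 k) (q0 k) (mu k) gp a).
Local Notation ccore j := (cell_core (p0 k) (q0 k) (mu k) cs g j).
Variables (l N : nat).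
Hypothesis kl : (k <= l)%N.
Variable Fc : J -> frame R (p l) (q l) N.
Hypothesis hFc : forall j v t, 0 <= t <= 1 ->
  exists X, fY (f := Fc j) v t = fib mu l (ccore j) t *m X.

Let DDel j (a b : ix j) (h : R -> R) : admissible (cs j) h -> DD mu l (el (mu k) h a b).
Proof.
by move=> hh; apply: (DD_le incl kl); apply: DD_mu; exact: ddrop_unitR.
Qed.

Let DDunit j (a : ix j) : DD mu l (cunit a).
Proof. exact/DDel/(c_outer hc). Qed.

Let DDcore j : DD mu l (ccore j).
Proof. exact/DDel/(c_inner hc). Qed.

Let DDsum x : DD mu l (cell_sum (mu k) (cs := cs) gp x).
Proof.
apply: DD_sum => // j _; apply: DD_sum => // a _; apply: DD_sum => // b _.
by apply: DDZ => //; exact/DDel/(c_outer hc).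
Qed.

Let V : finType := {j : J & (ix j * fV (Fc j))%type}.
Let mk j (a : ix j) v : V := Tagged (fun j => ix j * fV (Fc j))%type (a, v).
Let Y (v : V) t : 'M[C]_(p l * q l, N) :=
  fib mu l (cunit (tagged v).1) t *m fY (f := Fc (tag v)) (tagged v).2 t.

Let contY v : contM (Y v).
Proof.
by apply: contM_mul; [have [[]] := fibP (DDunit (tagged v).1) | exact: f_cont].
Qed.

Let orthY v v' t : 0 <= t <= 1 -> adj (Y v t) *m Y v' t = (v == v')%:R%:M.
Proof.
move=> t01; case: v v' => [j [a v]] [j' [a' v']]; rewrite /Y /=.
rewrite adjM -mulmxA (mulmxA (adj (fib _ _ _ _))) -fib_star // -fibM //; last exact: DD_star.
have [jj'|jj'] := eqVneq j j'; last first.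
  rewrite (cell_unit_cross _ _ (hmu k) hc) // fib0 // mul0mx mulmx0.
  rewrite (_ : _ == _ = false) ?raddf0 //; apply/eqP => e.
  by move/eqP: jj'; apply; exact: (congr1 tag e).
subst j'; have [X eX] := hFc v' t01; rewrite eX (mulmxA (fib mu l (star (cunit a) * cunit a') t)) -fibM //; last first.
  by apply: DDM => //; exact: DD_star.
rewrite (cell_unit_orth _ _ (hmu k) hc) fibZ // -scalemxAl -eX -scalemxAr f_orth //.
by rewrite scale_scalar_mx -natrM mulnb -tag_eqE /tag_eq /= eqxx tagged_asE xpair_eqE.
Qed.

Let Vs s : finType := {j : J & (ix j * fVs (Fc j) s)%type}.
Let fi s (x : Vs s * 'I_(bmult (p l) (q l) s)) : V :=
  mk (tagged x.1).1 (@ffi _ _ _ _ (Fc (tag x.1)) s ((tagged x.1).2, x.2)).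

Let injY s : injective (@fi s).
Proof.
move=> [[j [a v]] b] [[j' [a' v']] b']; rewrite /fi /mk /= => e.
have jj' := congr1 tag e; rewrite /= in jj'; subst j'.
move/eqP: e; rewrite -tag_eqE /tag_eq /= eqxx tagged_asE /= => /eqP[-> /f_inj[-> ->]] //.
Qed.

Let endY s : exists U : Vs s -> 'M[C]_(bsize (p l) (q l) s, N), forall v b,
  Y (@fi s (v, b)) s%:R = emb R b *m U v.
Proof.
have hU (v : Vs s) : exists U : 'M[C]_(bsize (p l) (q l) s, N), forall b,
    Y (@fi s (v, b)) s%:R = emb R b *m U.
  case: v => [j [a v]].
  have [hd _] := fibP (DDunit a); have [_ /(_ s)[w hw]] := (ddrop_blockP _).1 hd.
  exists (w *m fU v) => b; rewrite /Y /fi /mk /= f_end hw mulmxA blockop_emb.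
  by rewrite mulmxA.
by have /choice[U hU'] := hU; exists U.
Qed.

Let unit_act x j (a : ix j) v t : 0 <= t <= 1 ->
  fib mu l (cell_sum (mu k) (cs := cs) gp x) t *m Y (mk a v) t =
  \sum_c x j c a *: Y (mk c v) t.
Proof.
move=> t01; rewrite /Y /mk /=; have [X eX] := hFc v t01; rewrite eX.
rewrite mulmxA -fibM // mulmxA -fibM //; last exact: DDM.
rewrite -mulrA (cell_sum_unit _ _ (hmu k) hc) fib_sum //; last first.
  by move=> c; apply: DDZ => //; exact: DDM.
rewrite mulmx_suml; apply: eq_bigr => c _.
by rewrite fibZ ?fibM // -?scalemxAl ?mulmxA //; exact: DDM.
Qed.

(* The matrix units of a cell carry its frame, which lives in the range of the core,
   to orthogonal copies; as the weights do not depend on the copy, the resulting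
   order zero maps commute with linear combinations of the matrix units. *)
Lemma tensor_frame : exists F : frame R (p l) (q l) N,
  [/\ forall s, #|fVs F s| = (\sum_j usize (p k) (q k) (cs j) * #|fVs (Fc j) s|)%N,
    forall z t x, 0 <= t <= 1 ->
      fib mu l (cell_sum (mu k) (cs := cs) gp x) t *m phi (wt (F := F) 0) z t =
      phi (wt (F := F) 0) z t *m fib mu l (cell_sum (mu k) (cs := cs) gp x) t,
    forall z t, 0 <= t <= 1 ->
      fib mu l (cell_id (mu k) cs gp) t *m phi (wt (F := F) 0) z t = phi (wt (F := F) 0) z t &
    forall z t, 0 <= t <= 1 ->
      phi (wt (F := F) 0) z t *m fib mu l (cell_id (mu k) cs gp) t = phi (wt (F := F) 0) z t].
Proof.
pose U s := sval (cid (endY s)).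
have hU s v b : Y (@fi s (v, b)) s%:R = emb R b *m U s v by exact: (svalP (cid (endY s))).
pose F := Frame contY orthY injY hU; exists F.
have wE j (a b : ix j) v t : wt (F := F) 0 (mk a v) t = wt (F := F) 0 (mk b v) t.
  have cE s (c : ix j) : (mk c v \in codom (@ffi _ _ _ _ F s)) =
      (v \in codom (@ffi _ _ _ _ (Fc j) s)).
    apply/codomP/codomP => /= -[].
      move=> [[j' [a' v']] b'] e; have jj' := congr1 tag e; rewrite /= in jj'; subst j'.
      move/eqP: e; rewrite -tag_eqE /tag_eq /= eqxx tagged_asE /= => /eqP[_ ->].
      by exists (v', b').
    by move=> [v' b'] ->; exists (Tagged (fun j => ix j * fVs (Fc j) s)%type (c, v'), b').
  by rewrite /wt /fac !cE.
have sumV (G : V -> 'M[C]_(p l * q l)) : \sum_v G v = \sum_j \sum_a \sum_v G (mk (j := j) a v).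
  rewrite (eq_bigr (fun v : V => G (mk (tagged v).1 (tagged v).2))) => [|[j [a v]] _ //].
  rewrite -(sig_big_dep predT (fun _ _ => true)
    (fun j (x : ix j * fV (Fc j)) => G (mk x.1 x.2))) /=.
  by apply: eq_bigr => j _; rewrite -(pair_bigA _ (fun a v => G (mk a v))).
have act x z t : 0 <= t <= 1 ->
    fib mu l (cell_sum (mu k) (cs := cs) gp x) t *m phi (wt (F := F) 0) z t =
    \sum_j \sum_a \sum_c \sum_v (x j c a * (wt (F := F) 0 (mk a v) t)%:C) *:
      (Y (mk c v) t *m z *m adj (Y (mk a v) t)).
  move=> t01; rewrite /phi mulmx_sumr sumV; apply: eq_bigr => j _; apply: eq_bigr => a _.
  rewrite exchange_big; apply: eq_bigr => v _.
  rewrite -[@fY _ _ _ _ F (mk a v) t]/(Y (mk a v) t).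
  rewrite -scalemxAr -(mulmxA (Y (mk a v) t)).
  rewrite (mulmxA (fib mu l (cell_sum (mu k) (cs := cs) gp x) t) (Y (mk a v) t)) unit_act // mulmx_suml scaler_sumr; apply: eq_bigr => c _.
  by rewrite -!scalemxAl scalerA mulrC (mulmxA (Y (mk c v) t) z).
have cE (y : C) (r : R) : conjc (conjc y * r%:C) = y * r%:C.
  by case: y => a b; apply/eqP; rewrite eq_complex /=; apply/andP; split; apply/eqP; ring.
have comm z t x : 0 <= t <= 1 ->
    fib mu l (cell_sum (mu k) (cs := cs) gp x) t *m phi (wt (F := F) 0) z t =
    phi (wt (F := F) 0) z t *m fib mu l (cell_sum (mu k) (cs := cs) gp x) t.
  move=> t01; rewrite -[RHS]adjK adjM phi_adj -fib_star // (cell_sum_star (hmu k) hc).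
  rewrite !act // adj_sum; apply: eq_bigr => j _; rewrite exchange_big adj_sum.
  apply: eq_bigr => a _; rewrite adj_sum; apply: eq_bigr => c _.
  rewrite adj_sum; apply: eq_bigr => v _.
  rewrite adjZ cE adjM adjK (adjM (Y _ _)) adjK mulmxA.
  by rewrite (wE _ a c).
have cid_act z t : 0 <= t <= 1 -> fib mu l (cell_id (mu k) cs gp) t *m phi (wt (F := F) 0) z t =
    phi (wt (F := F) 0) z t.
  move=> t01; rewrite /cell_id act // /phi sumV; apply: eq_bigr => j _; apply: eq_bigr => a _.
  rewrite (bigD1 a) //= [X in _ + X]big1 ?addr0 => [|c ca].
    by apply: eq_bigr => v _; rewrite eqxx mul1r.
  by rewrite big1 // => v _; rewrite (negbTE ca) mul0r scale0r.
split => //; last by move=> z t t01; rewrite -comm // cid_act.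
move=> s /=; rewrite card_tagged sumnE big_map big_enum /=.
by apply: eq_bigr => j _; rewrite card_prod card_ord.
Qed.

End TensorFrame.

(** * Almost central frames that nearly exhaust the fibres *)

Section GoodFrame.
Variables (R : realType) (Z : cstarType R).
Local Notation C := R[i].
Variables (p q : nat -> nat).
Variable mu : forall k, (R -> 'M[C^o]_(p k * q k)) -> Z.
Arguments mu : clear implicits.
Hypotheses (p0 : forall k, (0 < p k)%N) (q0 : forall k, (0 < q k)%N).
Hypothesis hmu : forall k, dimdrop_embedding (mu k).
Hypothesis incl : forall k, DD mu k `<=` DD mu k.+1.
Hypothesis dense : forall x (e : R), 0 < e ->
  exists k, exists2 y, DD mu k y & cnorm (x - y) < e.
Hypothesis Zsimple : simple_cstar Z.
Variable tau : {linear Z -> C^o}.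
Hypothesis htau : tracial_state tau.
Hypothesis tau_unique : forall tau' : {linear Z -> C^o},
  tracial_state tau' -> tau' =1 tau.

(** The quadratic form of the fibre of [h] is the square norm of [u] minus that of its image under
    the fibre of [c]. *)
Lemma subunit_fib l (h c : Z) t : DD mu l c -> star c = c -> c * c = 1 - h ->
  0 <= t <= 1 -> subunit (fib mu l h t).
Proof.
move=> hc sc cc t01 u; have -> : h = 1 - c * c by rewrite cc opprB addrC subrK.
rewrite fibB ?fib1 ?fibM //; [|exact: DD1|exact: DDM].
rewrite mulmxBl mul1mx dotDr -scaleN1r dotZr mulN1r dot_sqn cReD cReN /= lerBlDr lerDl.
by rewrite -mulmxA -dot_adj -fib_star // sc dot_sqn sqn_ge0.
Qed.

Lemma subunit_core k (J : finType) (cs : J -> corner) (gp g : J -> R -> R) j l t :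
  cells cs gp g -> (k <= l)%N -> 0 <= t <= 1 ->
  subunit (fib mu l (cell_core (p0 k) (q0 k) (mu k) cs g j) t).
Proof.
move=> hc kl t01; pose r t := 1 - Num.sqrt (1 - g j t).
have hr : admissible (cs j) r.
  apply: (admissible_comp (phi := fun x => 1 - Num.sqrt (1 - x)) (c_inner hc j)).
    move=> a ca; apply: contRD (contR_cst 1) _; apply/contRN/contR_sqrt.
    exact: contRD (contR_cst 1) (contRN ca).
  by rewrite subr0 sqrtr1 subrr.
pose a0 := cell_base (p0 k) (q0 k) cs j.
apply: (@subunit_fib l _ (1 - el (mu k) r a0 a0)) => //.
- apply: DDB => //; first exact: DD1.
  by apply: (DD_le incl kl); apply: DD_mu; exact: ddrop_unitR.
- by rewrite starB star1 (el_star (hmu k) _ _ hr).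
rewrite mulrBl mul1r mulrBr mulr1 (elM (hmu k) _ _ _ _ hr hr) eqxx scale1r -addrA -opprD.
congr (1 - _); apply/eqP; rewrite addrA subr_eq; apply/eqP.
have hrr : admissible (cs j) (fun t => r t * r t) by apply: (admissibleM hr); case: hr.
rewrite /cell_core /el -!(emD (hmu k)); try exact: ddrop_unitR; try exact: (ddrop_unitR _ _ (c_inner hc j)).
congr (mu k); apply/funext => s; rewrite -!scalerDl -!rmorphD /=; congr (_%:C *: _).
have /andP[_ g1] := c_inner01 hc j s; rewrite /r.
have := sqr_sqrtr (_ : 0 <= 1 - g j s); rewrite subr_ge0 => /(_ g1); lra.
Qed.

Lemma trace_core k (J : finType) (cs : J -> corner) (gp g : J -> R -> R) j :
  cells cs gp g -> scalar_trace (mu k) tau (g j) =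
  (usize (p k) (q k) (cs j))%:R * complex.Re (tau (cell_core (p0 k) (q0 k) (mu k) cs g j)).
Proof.
move=> hc; have [_ _ tr] := htau; rewrite /cell_core (trace_el (p0 k) (q0 k) (hmu k) (T := tau)).
- rewrite eqxx mul1r -cRe_natM mulrA mulfV ?mul1r //.
  by rewrite pnatr_eq0 -lt0n usize_gt0.
- by move=> f f' _ _; rewrite linearD.
- by move=> c f _; rewrite linearZ.
- by move=> f f' _ _; exact: tr.
- exact: (c_inner hc).
by move=> t _; have /andP[] := c_inner01 hc j t.
Qed.

(** The loss [kap] is split in three: mass outside the inner cells, deviation of the fibre traces
    from [tau], and rounding of dimensions. The commutator bound rests on [tensor_frame], since the
    [x i] are near cell sums. *)
Lemma good_frame k N (T : finType) (x : T -> Z) (eps kap : R) : (0 < N)%N ->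
  (forall i, DD mu k (x i)) -> 0 < eps -> 0 < kap ->
  exists2 l0, (k <= l0)%N & forall l, (l0 <= l)%N ->
    exists F : frame R (p l) (q l) N,
    (forall s, (1 - kap) * (p l * q l)%:R <=
       (N * (#|fVs F s| * bmult (p l) (q l) s))%:R) /\
    (forall i z, cnorm (x i * Ph (mu l) (wt (F := F) 0) z - Ph (mu l) (wt (F := F) 0) z * x i)
       <= eps * opnorm z).
Proof.
move=> N0 hx eps0 kap0.
have [K K0 hK] := em_crude_bound (p0 k) (q0 k) (hmu k).
have dl0 : 0 < eps / (2 * K) by rewrite divr_gt0 // mulr_gt0.
have k3 : 0 < kap / 3 by rewrite divr_gt0.
have [J [cs [gp [g [hc hX hT]]]]] := exists_cells (hmu k) htau
  (fun i => (fibP (hx i)).1) dl0 k3.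
pose u j := usize (p k) (q k) (cs j); pose U := (\sum_j u j)%N.
pose core j := cell_core (p0 k) (q0 k) (mu k) cs g j.
pose Tj j := complex.Re (tau (core j)).
have hcore j : DD mu k (core j) by apply: DD_mu; exact/ddrop_unitR/(c_inner hc).
have hT' : 1 - kap / 3 <= \sum_j (u j)%:R * Tj j.
  rewrite (le_trans hT) // (scalar_trace_sum (hmu k)) => [|j]; last by have [] := c_inner hc j.
  by apply: ler_sum => j _; rewrite (trace_core _ _ hc).
(* The trace error in cell [j] is repeated by each of its [u j] matrix units, so the total error is
   [eta * U]; the successor avoids a division by zero. *)
pose eta := kap / (3 * U.+1%:R).
have eta0 : 0 < eta by rewrite divr_gt0 // mulr_gt0.
have etaU : eta * U%:R <= kap / 3.
  have : eta * (3 * U.+1%:R) = kap by rewrite /eta divfK // mulf_neq0 ?pnatr_eq0.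
  by rewrite -[U.+1%:R]natr1; lra.
have /choice[L hL] : forall j, exists l0, forall l t, (l0 <= l)%N -> 0 <= t <= 1 ->
    nc (trf mu l t (core j) - tau (core j)) < eta.
  move=> j; have [l0 _ h] := uniform_trace p0 q0 hmu incl dense tau_unique (hcore j) eta0.
  by exists l0.
(* Rounding costs at most [N + N * b] dimensions per unit; block sizes above [B] make each of the
   two contributions at most [kap / 6] of the total dimension. *)
pose B := (Num.truncn (6 * N%:R * U%:R / kap)).+1.
have hB : 6 * N%:R * U%:R <= kap * B%:R.
  have : 0 <= 6 * N%:R * U%:R / kap by rewrite divr_ge0 // ?mulr_ge0 // ltW.
  move=> /truncn_itv/andP[_ /ltW]; by rewrite -/B ler_pdivrMr // [B%:R * _]mulrC.
have [LB hLB] := growth p0 q0 hmu incl dense Zsimple B.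
pose Lmax := (\max_j L j)%N; pose l0 := maxn k (maxn LB Lmax).
exists l0; first exact: leq_maxl.
move=> l; rewrite /l0 !geq_max => /and3P[kl lB lL].
set d := (p l * q l)%N; set D : R := d%:R.
have d0 : 0 < D by rewrite ltr0n muln_gt0 p0 q0.
have NR : 0 < N%:R :> R by rewrite ltr0n.
have trE j t : 0 <= t <= 1 -> (Tj j - eta) * D < complex.Re (\tr (fib mu l (core j) t)).
  move=> t01; have hl : (L j <= l)%N by apply: leq_trans lL; exact: leq_bigmax.
  have := le_lt_trans (nc_Re _) (hL j l t hl t01); rewrite cReD cReN.
  have -> : complex.Re (\tr (fib mu l (core j) t)) = D * complex.Re (trf mu l t (core j)).
    by rewrite -cRe_natM /trf /ntr mulrCA mulfV ?mulr1 // pnatr_eq0 -lt0n muln_gt0 p0 q0.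
  by rewrite ltr_norml => /andP[h _]; rewrite mulrC ltr_pM2l //; move: h; rewrite /Tj; lra.
have Tle1 j : Tj j - eta <= 1.
  have t01 : 0 <= (0 : R) <= 1 by rewrite lexx ler01.
  have := trE j 0 t01; rewrite -ltr_pdivlMr // => /ltW/le_trans; apply.
  have -> : complex.Re (\tr (fib mu l (core j) 0)) / D = complex.Re (trf mu l 0 (core j)).
    rewrite /trf /ntr -(rmorph_nat (real_complex R)) -fmorphV mulrC [in RHS]mulrC cReMr //.
  apply: le_trans (ler_norm _) _; apply: le_trans (nc_Re _) _.
  apply: le_trans (trf_le p0 q0 hmu (DD_le incl kl (hcore j)) t01) _.
  by apply: (el_le1 (hmu k)); [exact: (c_inner hc) | move=> t _; exact: (c_inner01 hc)].
(* The number of [N]-tuples that the trace of the core guarantees in its range; the maximum covers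
   cells whose trace is below the error [eta]. *)
pose mass j := Num.max 0 (Tj j - eta) * D / N%:R.
have mass0 j : 0 <= mass j by rewrite !mulr_ge0 ?invr_ge0 ?(ltW d0) ?(ltW NR) // le_max lexx.
pose M j := Num.truncn (mass j).
have NM j : (N * M j)%:R <= Num.max 0 (Tj j - eta) * D.
  have /andP[h _] := truncn_itv (mass0 j).
  by rewrite natrM mulrC -ler_pdivlMr.
have NMd j : (N * M j <= d)%N.
  rewrite -(ler_nat R) (le_trans (NM j)) // -[leRHS]mul1r ler_wpM2r ?(ltW d0) //.
  by rewrite ge_max ler01 Tle1.
have NM2 j : (Tj j - eta) * D - N%:R <= (N * M j)%:R.
  have /andP[_ h] := truncn_itv (mass0 j).
  have : (Tj j - eta) * D <= N%:R * (M j).+1%:R.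
    rewrite /mass ltr_pdivrMr // in h; rewrite [leRHS]mulrC; apply: le_trans (ltW h).
    by rewrite ler_wpM2r ?(ltW d0) // le_max lexx orbT.
  by rewrite natrM -[(M j).+1%:R]natr1; lra.
have htr j t r : 0 <= t <= 1 -> (r < N * M j)%N ->
    r%:R < complex.Re (\tr (fib mu l (core j) t)).
  move=> t01 rM; apply: lt_trans (trE j t t01); rewrite -(ltr_nat R) in rM.
  have := lt_le_trans rM (NM j); have [h|h] := leP 0 (Tj j - eta) => //.
  by rewrite mul0r ltNge ler0n.
have hFj j : exists F : frame R (p l) (q l) N, [/\ #|fV F| = M j,
    forall s, #|fVs F s| = (M j %/ bmult (p l) (q l) s)%N &
    forall v t, 0 <= t <= 1 -> exists X, fY (f := F) v t = fib mu l (core j) t *m X].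
  apply: cell_frame => //.
  - by have [] := fibP (DD_le incl kl (hcore j)).
  - by move=> t t01; apply: subunit_core hc kl t01.
  by move=> t r; exact: htr.
pose Fc j := sval (cid (hFj j)).
have hFc j : [/\ #|fV (Fc j)| = M j,
    forall s, #|fVs (Fc j) s| = (M j %/ bmult (p l) (q l) s)%N &
    forall v t, 0 <= t <= 1 -> exists X, fY (f := Fc j) v t = fib mu l (core j) t *m X].
  exact: (svalP (cid (hFj j))).
have [F [cF comF idl idr]] := tensor_frame hmu incl hc kl (Fc := Fc)
  (fun j => let: And3 _ _ h := hFc j in h).
exists F; split.
- move=> s; rewrite cF; set b := bmult (p l) (q l) s.
  have b0 : (0 < b)%N by exact: bmult_gt0.
  have bR : 1 <= b%:R :> R by rewrite ler1n.
  have : \sum_j (u j)%:R * ((Tj j - eta) * D - N%:R - N%:R * b%:R) <=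
      (N * ((\sum_j u j * #|fVs (Fc j) s|) * b))%:R.
    rewrite natrM natrM natr_sum mulr_suml mulr_sumr; apply: ler_sum => j _.
    have [_ -> _] := hFc j; rewrite -/b natrM -mulrA mulrCA ler_wpM2l //.
    have h1 : (M j)%:R <= (M j %/ b)%:R * b%:R + b%:R :> R.
      rewrite -natrM -natrD ler_nat addnC -mulSn; exact/ltnW/ltn_ceil.
    have := NM2 j; rewrite natrM; nra.
  apply: le_trans.
  have -> : \sum_j (u j)%:R * ((Tj j - eta) * D - N%:R - N%:R * b%:R) =
      (\sum_j (u j)%:R * Tj j) * D - U%:R * (eta * D + N%:R + N%:R * b%:R).
    rewrite natr_sum !mulr_suml -sumrB; apply: eq_bigr => j _; ring.
  have hbs : B%:R <= (bsize (p l) (q l) s)%:R :> R.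
    by rewrite ler_nat ltnW //; have [h1 h2] := hLB l lB; case: (s).
  have DE : D = (bsize (p l) (q l) s)%:R * b%:R by rewrite -natrM bsize_mult.
  have h1 : 6 * N%:R * U%:R * b%:R <= kap * D.
    by rewrite DE mulrA ler_wpM2r // (le_trans hB) // ler_wpM2l // ltW.
  have h2 : N%:R * U%:R <= N%:R * U%:R * b%:R :> R by rewrite ler_peMr // mulr_ge0.
  have h3 : (1 - kap / 3) * D <= (\sum_j (u j)%:R * Tj j) * D by rewrite ler_wpM2r // ltW.
  have h4 : eta * U%:R * D <= kap / 3 * D by rewrite ler_wpM2r // ltW.
  have -> : U%:R * (eta * D + N%:R + N%:R * b%:R) =
      eta * U%:R * D + N%:R * U%:R + N%:R * U%:R * b%:R by ring.
  have h5 : 6 * (N%:R * U%:R * b%:R) <= kap * D by rewrite !mulrA.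
  have h6 : (1 - kap / 3) * D = D - kap / 3 * D by rewrite mulrBl mul1r.
  have h7 : (1 - kap) * D = D - kap * D by rewrite mulrBl mul1r.
  have h8 : kap / 3 * D = kap * D / 3 by rewrite mulrAC.
  rewrite h6 h8 in h3; rewrite h8 in h4; rewrite h7.
  move: h2 h3 h4 h5; move: (N%:R * U%:R : R) (N%:R * U%:R * b%:R : R) (kap * D) (eta * U%:R * D).
  by move: (_ * D) => *; lra.
move=> i z; have [X hXi] := hX i.
set Phi := Ph _ _ _.
have hw : weight (wt (F := F) 0) by apply: weight_wt; rewrite lexx ler0n.
have hphi : ddrop (phi (wt (F := F) 0) z) by exact: ddrop_phi.
have DX y : DD mu l (cell_sum (mu k) (cs := cs) gp y).
  apply: DD_sum => // j _; apply: DD_sum => // a _; apply: DD_sum => // c _.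
  by apply: DDZ => //; apply: (DD_le incl kl); apply: DD_mu; exact/ddrop_unitR/(c_outer hc).
have mulL y : DD mu l y -> y * Phi = mu l (fun t => fib mu l y t *m phi (wt (F := F) 0) z t).
  by move=> /fibP[hy e]; rewrite -[in LHS]e -(emM (hmu l)).
have mulR y : DD mu l y -> Phi * y = mu l (fun t => phi (wt (F := F) 0) z t *m fib mu l y t).
  by move=> /fibP[hy e]; rewrite -[in LHS]e -(emM (hmu l)).
have fd y : DD mu l y -> ddrop (fib mu l y) by move=> /fibP[].
have c1 : cell_sum (mu k) (cs := cs) gp X * Phi = Phi * cell_sum (mu k) (cs := cs) gp X.
  rewrite mulL // mulR //; apply: (em_eq (hmu l)) => [||t t01]; last exact: comF.
  - by apply: ddropM => //; exact: fd.
  - by apply: ddropM => //; exact: fd.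
have Did : DD mu l (cell_id (mu k) cs gp) by exact: DX.
have c2 : cell_id (mu k) cs gp * Phi = Phi.
  rewrite mulL // /Phi /Ph; apply: (em_eq (hmu l)) => // [|t t01]; last exact: idl.
  by apply: ddropM => //; exact: fd.
have c3 : Phi * cell_id (mu k) cs gp = Phi.
  rewrite mulR // /Phi /Ph; apply: (em_eq (hmu l)) => // [|t t01]; last exact: idr.
  by apply: ddropM => //; exact: fd.
have nPhi : cnorm Phi <= opnorm z.
  by apply: (Ph_norm (p0 l) (q0 l) (hmu l)) => // v t; exact: wt01.
have [n1 n2] := cell_sum_near (hmu k) hc (ltW dl0) hK (fibP (hx i)).1 hXi.
rewrite (fibP (hx i)).2 in n1 n2.
(* [Phi] absorbs [cell_id] on both sides and commutes with the cell sum, so only the two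
   approximation errors remain. *)
have -> : x i * Phi - Phi * x i = (x i * cell_id (mu k) cs gp - cell_sum (mu k) (cs := cs) gp X) * Phi
    - Phi * (cell_id (mu k) cs gp * x i - cell_sum (mu k) (cs := cs) gp X).
  by rewrite mulrBl mulrBr -mulrA c2 mulrA c3 c1 opprB addrA subrK.
have KE : K * (eps / (2 * K)) = eps / 2.
  by field; rewrite gt_eqF.
rewrite KE in n1 n2.
apply: le_trans (cnormD _ _) _; rewrite cnormN.
have -> : eps * opnorm z = eps / 2 * opnorm z + opnorm z * (eps / 2).
  by rewrite [X in _ = _ + X]mulrC -mulrDl -splitr.
apply: lerD; apply: le_trans (cnormM _ _) _; apply: ler_pM => //; exact: cnorm_ge0.
Qed.

End GoodFrame.

(** * Absorption *)

Section Absorption.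
Variables (R : realType) (A Z : cstarType R).
Local Notation C := R[i].
Variables (p q : nat -> nat).
Variable mu : forall k, (R -> 'M[C^o]_(p k * q k)) -> Z.
Arguments mu : clear implicits.
Hypotheses (p0 : forall k, (0 < p k)%N) (q0 : forall k, (0 < q k)%N).
Hypothesis hmu : forall k, dimdrop_embedding (mu k).
Hypothesis incl : forall k, DD mu k `<=` DD mu k.+1.
Hypothesis dense : forall x (e : R), 0 < e ->
  exists k, exists2 y, DD mu k y & cnorm (x - y) < e.
Hypothesis Zsimple : simple_cstar Z.
Variable tau : {linear Z -> C^o}.
Hypothesis htau : tracial_state tau.
Hypothesis tau_unique : forall tau' : {linear Z -> C^o},
  tracial_state tau' -> tau' =1 tau.
(** The commuting copies of [Z] and [A] inside [A] that the isomorphism provides; [th] enters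
    through commutation and density of the sums. *)
Variables (pi : {lrmorphism Z -> A}) (th : A -> A).
Hypothesis spi : star_hom pi.
Hypothesis comm : forall a z, th a * pi z = pi z * th a.
Hypothesis span : forall y (e : R), 0 < e -> exists s : seq (A * Z),
  cnorm (y - \sum_(u <- s) th u.1 * pi u.2) < e.

Lemma approx_span (y : A) (e : R) : 0 < e -> exists k (s : seq (A * Z)),
  (forall u, u \in s -> DD mu k u.2) /\ cnorm (y - \sum_(u <- s) th u.1 * pi u.2) < e.
Proof.
move=> e0; have e2 : 0 < e / 2 by rewrite divr_gt0.
have [s hs] := span y e2.
suff [k [s' [h1 h2]]] : exists k (s' : seq (A * Z)), (forall u, u \in s' -> DD mu k u.2) /\
    cnorm (\sum_(u <- s) th u.1 * pi u.2 - \sum_(u <- s') th u.1 * pi u.2) < e / 2.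
  exists k, s'; split=> //; apply: le_lt_trans (cnorm_tri (\sum_(u <- s) th u.1 * pi u.2) _ _) _.
  by rewrite [ltRHS](splitr e) ltrD.
elim: s {hs} (e / 2) e2 => [|[a z] s IH] d d0.
  by exists 0%N, [::]; split=> //; rewrite !big_nil subrr cnorm0.
have d2 : 0 < d / 2 by rewrite divr_gt0.
have [k1 [s1 [hs1 h1]]] := IH _ d2.
have M0 : 0 < cnorm (th a) + 1 by rewrite ltr_wpDl // cnorm_ge0.
have d3 : 0 < d / 2 / (cnorm (th a) + 1) by rewrite divr_gt0.
have [k2 [z' hz' zz]] := dense z d3.
exists (maxn k1 k2), ((a, z') :: s1); split.
  move=> u; rewrite inE => /orP[/eqP-> /=|/hs1 hu].
    by apply: (DD_le incl _ hz'); exact: leq_maxr.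
  by apply: (DD_le incl _ hu); exact: leq_maxl.
rewrite !big_cons opprD addrACA /= -mulrBr -raddfB.
apply: le_lt_trans (cnormD _ _) _; rewrite [ltRHS](splitr d) ler_ltD //.
apply: le_trans (cnormM _ _) _.
have h2 : cnorm (pi (z - z')) <= d / 2 / (cnorm (th a) + 1).
  exact: le_trans (star_hom_contractive spi _) (ltW zz).
apply: (@le_trans _ _ ((cnorm (th a) + 1) * (d / 2 / (cnorm (th a) + 1)))).
  by apply: ler_pM => //; [exact: cnorm_ge0 | exact: cnorm_ge0 | rewrite lerDl].
by rewrite mulrC divfK // gt_eqF.
Qed.

Lemma good_frame_seq k N (L : seq Z) (eps kap : R) : (0 < N)%N ->
  (forall x, x \in L -> DD mu k x) -> 0 < eps -> 0 < kap ->
  exists2 l0, (k <= l0)%N & forall l, (l0 <= l)%N ->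
    exists F : frame R (p l) (q l) N,
    (forall s, (1 - kap) * (p l * q l)%:R <=
       (N * (#|fVs F s| * bmult (p l) (q l) s))%:R) /\
    (forall x z, x \in L ->
      cnorm (x * Ph (mu l) (wt (F := F) 0) z - Ph (mu l) (wt (F := F) 0) z * x)
       <= eps * opnorm z).
Proof.
move=> N0 hL eps0 kap0.
have hx (i : 'I_(size L)) : DD mu k (nth 0 L i) by apply: hL; exact: mem_nth.
have [l0 kl0 h] := good_frame p0 q0 hmu incl dense Zsimple htau tau_unique N0 hx eps0 kap0.
exists l0 => // l /h[F [h1 h2]]; exists F; split=> // x z /(nthP 0)[i iL <-].
exact: (h2 (Ordinal iL)).
Qed.

(** Each [y] is near a sum of [th a * pi z], in which [th a] commutes with [pi] exactly, so the
    frame only has to almost commute with the finitely many [z]. *)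
Lemma comm_frame N (T : seq A) (eps kap : R) : (0 < N)%N -> 0 < eps -> 0 < kap ->
  exists l0, forall l, (l0 <= l)%N ->
    exists F : frame R (p l) (q l) N,
    (forall s, (1 - kap) * (p l * q l)%:R <=
       (N * (#|fVs F s| * bmult (p l) (q l) s))%:R) /\
    (forall y z, y \in T ->
      cnorm (y * pi (Ph (mu l) (wt (F := F) 0) z) - pi (Ph (mu l) (wt (F := F) 0) z) * y)
       <= eps * opnorm z).
Proof.
move=> N0 eps0 kap0; have e4 : 0 < eps / 4 by rewrite divr_gt0.
have [k [M [L [M0 hL hT]]]] : exists k (M : R) (L : seq Z), [/\ 0 < M,
    forall x, x \in L -> DD mu k x &
    forall y, y \in T -> exists s : seq (A * Z), [/\ forall u, u \in s -> u.2 \in L,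
      \sum_(u <- s) cnorm (th u.1) <= M & cnorm (y - \sum_(u <- s) th u.1 * pi u.2) < eps / 4]].
  elim: T => [|y T [k [M [L [M0 hL hT]]]]]; first by exists 0%N, 1, [::].
  have [k1 [s [hs sy]]] := approx_span y e4.
  have S0 : 0 <= \sum_(u <- s) cnorm (th u.1) by apply: sumr_ge0 => u _; exact: cnorm_ge0.
  exists (maxn k k1), (M + \sum_(u <- s) cnorm (th u.1)), ([seq u.2 | u <- s] ++ L); split.
  - by rewrite ltr_wpDr.
  - move=> x; rewrite mem_cat => /orP[/mapP[u us ->]|/hL hx].
      by apply: (DD_le incl _ (hs _ us)); exact: leq_maxr.
    by apply: (DD_le incl _ hx); exact: leq_maxl.
  move=> y'; rewrite inE => /orP[/eqP->|/hT[s' [h1 h2 h3]]].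
    exists s; split=> //; last by rewrite lerDr ltW.
    by move=> u us; rewrite mem_cat map_f.
  exists s'; split=> //; first by move=> u /h1 h; rewrite mem_cat h orbT.
  by rewrite (le_trans h2) // lerDl.
(* [M] bounds the coefficients of all approximating sums, so these contribute [eps / 2]; the
   approximation error [eps / 4] enters twice. *)
have e2M : 0 < eps / 2 / M by rewrite !divr_gt0.
have [l0 _ h] := good_frame_seq N0 hL e2M kap0.
exists l0 => l /h[F [h1 h2]]; exists F; split=> // y z /hT[s [hs sM sy]].
set Phi := Ph _ _ z; set S := \sum_(u <- s) _ in sy.
have hw : weight (wt (F := F) 0) by apply: weight_wt; rewrite lexx ler0n.
have nPhi : cnorm (pi Phi) <= opnorm z.
  apply: le_trans (star_hom_contractive spi _) _.
  by apply: (Ph_norm (p0 l) (q0 l) (hmu l)) => // v t; exact: wt01.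
have hS : cnorm (S * pi Phi - pi Phi * S) <= eps / 2 * opnorm z.
  have -> : S * pi Phi - pi Phi * S = \sum_(u <- s) th u.1 * pi (u.2 * Phi - Phi * u.2).
    rewrite /S mulr_suml mulr_sumr -sumrB; apply: eq_bigr => u _.
    by rewrite rmorphB !rmorphM mulrBr !mulrA -comm.
  apply: le_trans (cnorm_sum _ _ _) _.
  apply: (@le_trans _ _ (\sum_(u <- s) cnorm (th u.1) * (eps / 2 / M * opnorm z))).
    rewrite big_seq [leRHS]big_seq; apply: ler_sum => u us; apply: le_trans (cnormM _ _) _.
    apply: ler_wpM2l; first exact: cnorm_ge0.
    apply: le_trans (star_hom_contractive spi _) _; apply: h2; exact: hs.
  rewrite -mulr_suml; apply: (@le_trans _ _ (M * (eps / 2 / M * opnorm z))).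
    by rewrite ler_wpM2r // mulr_ge0 ?opnorm_ge0 // ltW.
  by rewrite mulrA [M * _]mulrC divfK ?gt_eqF.
have -> : y * pi Phi - pi Phi * y = (S * pi Phi - pi Phi * S) +
    ((y - S) * pi Phi - pi Phi * (y - S)).
  have aux (a b c d : A) : a - b = c - d + (a - c - (b - d)).
    have -> : a - c - (b - d) = a - b - (c - d).
      by rewrite !opprB addrACA [RHS]addrACA (addrC (- c)).
    by rewrite [RHS]addrC subrK.
  by rewrite mulrBl mulrBr; exact: aux.
apply: le_trans (cnormD _ _) _.
have h3 : cnorm ((y - S) * pi Phi - pi Phi * (y - S)) <= eps / 4 * opnorm z + opnorm z * (eps / 4).
  apply: le_trans (cnormB _ _) _; apply: lerD; apply: le_trans (cnormM _ _) _;
    by apply: ler_pM => //; try exact: cnorm_ge0; exact: ltW.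
by move: hS h3; move: (cnorm _) (cnorm _) => a b; lra.
Qed.

End Absorption.

(** * Comparing the defect with a frame of a later stage *)

Section StageComparison.
Variables (R : realType) (Z : cstarType R).
Local Notation C := R[i].
Variables (p q : nat -> nat).
Variable mu : forall k, (R -> 'M[C^o]_(p k * q k)) -> Z.
Arguments mu : clear implicits.
Hypotheses (p0 : forall k, (0 < p k)%N) (q0 : forall k, (0 < q k)%N).
Hypothesis hmu : forall k, dimdrop_embedding (mu k).
Hypothesis incl : forall k, DD mu k `<=` DD mu k.+1.

(** At stage [l1] the pointwise normalised trace [W] is at least [1 - 2 * kap], by
    inclusion-exclusion over the two ends. The excess is a square, and a fibre trace of any later
    stage is positive on it. *)
Lemma fib_phi_trace l1 l2 N (F : frame R (p l1) (q l1) N) (kap : R) t :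
  (l1 <= l2)%N -> 0 <= t <= 1 ->
  (forall s, (1 - kap) * (p l1 * q l1)%:R <=
     (N * (#|fVs F s| * bmult (p l1) (q l1) s))%:R) ->
  1 - 2 * kap <= complex.Re (trf mu l2 t (Ph (mu l1) (wt (F := F) 1) 1%:M)).
Proof.
move=> l12 t01 hF; set d := (p l1 * q l1)%N in hF.
have D0 : 0 < d%:R :> R by rewrite ltr0n muln_gt0 p0 q0.
have hw : weight (wt (F := F) 1) by apply: weight_wt; rewrite ler01 ler1n.
pose W s : R := N%:R * (\sum_v wt (F := F) 1 v s) / d%:R.
have cW : contR W.
  apply: contRM (contR_cst _); apply: contRM (contR_cst _) _.
  by apply: contR_sum => v; case: hw.
have Wge s : 1 - 2 * kap <= W s.
  rewrite ler_pdivlMr //; have h := sum_wt_ge F 1 s.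
  have h2 : (N%:R * #|fV F|%:R : R) <= d%:R by rewrite -natrM ler_nat frame_le.
  have := hF false; have := hF true; rewrite natrM => h3; rewrite natrM => h4.
  move: h; rewrite !card_prod !card_ord => h.
  have := ler_wpM2l (ler0n R N) h; rewrite !mulrBr !mulrDr => h5.
  by apply: le_trans h5; move: h2 h3 h4; lra.
pose Tr x := trf mu l2 t x.
have TD f f' : ddrop f -> ddrop f' -> Tr (mu l1 f + mu l1 f') = Tr (mu l1 f) + Tr (mu l1 f').
  move=> hf hf'; rewrite /Tr /trf fibD //; first by rewrite ntrD.
    exact: (DD_le incl l12 (DD_mu _ hf)).
  exact: (DD_le incl l12 (DD_mu _ hf')).
have TZ c f : ddrop f -> Tr (c *: mu l1 f) = c * Tr (mu l1 f).
  move=> hf; rewrite /Tr /trf fibZ //; first by rewrite ntrZ.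
  exact: (DD_le incl l12 (DD_mu _ hf)).
have Ttr f f' : ddrop f -> ddrop f' -> Tr (mu l1 f * mu l1 f') = Tr (mu l1 f' * mu l1 f).
  move=> hf hf'; have h1 := DD_le incl l12 (DD_mu mu hf).
  by have h2 := DD_le incl l12 (DD_mu mu hf'); rewrite /Tr /trf (fibM hmu h1 h2 t01) (fibM hmu h2 h1 t01) ntr_mulC.
have hphi := ddrop_phi 1%:M hw.
rewrite -/(Tr _) /Ph (trace_center (p0 l1) (q0 l1) (hmu l1) TD TZ Ttr hphi).
have nE s : 0 <= s <= 1 -> ntr (phi (wt (F := F) 1) 1%:M s) = (W s)%:C.
  move=> s01; rewrite /ntr tr_phi1 // /W -(rmorph_nat (real_complex R)).
  by rewrite -(rmorph_nat (real_complex R) (p l1 * q l1)) -fmorphV -!rmorphM.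
have hcW : ddrop (fun s => (W s)%:C%:M : 'M[C]_(p l1 * q l1)) by exact: contR_ddrop.
have -> : mu l1 (fun s => (ntr (phi (wt (F := F) 1) 1%:M s))%:M) = mu l1 (fun s => (W s)%:C%:M).
  apply: (em_eq (hmu l1)) => // [|s s01]; last by rewrite nE.
  by apply: ddrop_eq hcW => s s01; rewrite nE.
pose r s := Num.sqrt (W s - (1 - 2 * kap)).
have cr : contR r by apply: contR_sqrt; apply: contRD cW (contRN (contR_cst _)).
have hr : ddrop (fun s => (r s)%:C%:M : 'M[C]_(p l1 * q l1)) by exact: contR_ddrop.
have E : mu l1 (fun s => (W s)%:C%:M) = (1 - 2 * kap)%:C *: mu l1 (fun=> 1%:M) +
    star (mu l1 (fun s => (r s)%:C%:M)) * mu l1 (fun s => (r s)%:C%:M).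
  have h1 : ddrop (fun=> 1%:M : 'M[C]_(p l1 * q l1)).
    exact: (@ddrop_scalar R (p l1) (q l1) (fun=> 1) (contC_cst 1)).
  rewrite -(em_star (hmu l1)) // -(emM (hmu l1)) ?ddrop_adj //; last exact: ddrop_adj.
  have h2 := ddropM (ddrop_adj hr) hr; have h3 := ddropZ (1 - 2 * kap)%:C h1.
  rewrite -(emZ (hmu l1)) // -(emD (hmu l1)) //; apply: (em_eq (hmu l1)) => //.
    exact: ddropD.
  move=> s s01; have -> : adj ((r s)%:C%:M : 'M[C]_(p l1 * q l1)) = (r s)%:C%:M.
    by rewrite -scalemx1 adjZ adj1 conjc_real.
  rewrite -scalar_mxM -rmorphM -expr2 sqr_sqrtr ?subr_ge0 // scalemx1 -raddfD -rmorphD.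
  by congr (_%:C%:M); rewrite addrC subrK.
have hr2 := DD_le incl l12 (DD_mu mu hr).
rewrite E /Tr /trf fibD //; first last.
- by apply: DDM => //; exact: DD_star.
- by apply: DDZ => //; rewrite (em1 (hmu l1)); exact: DD1.
rewrite fibZ //; last by rewrite (em1 (hmu l1)); exact: DD1.
rewrite (em1 (hmu l1)) fib1 // ntrD ntrZ ntr1 // mulr1 cReD.
have [s s0 sE] := trf_pos hmu hr2 t01; rewrite /trf in sE.
by rewrite sE /= lerDl.
Qed.

(** [F2] fills half of the space with [2 * m.+1] components, so one component covers a fraction of
    at least [1 / (4 * m.+1)]. This dominates the fraction [2 * kap] that [f] may leave uncovered,
    and the dimension count of [comparison] is met. *)
Lemma stage_comparison l1 l2 (n m : nat) (F1 : frame R (p l1) (q l1) n)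
    (F2 : frame R (p l2) (q l2) (m.+1 + m.+1)) (kap : R) :
  (l1 <= l2)%N ->
  (forall s, (1 - kap) * (p l1 * q l1)%:R <=
     (n * (#|fVs F1 s| * bmult (p l1) (q l1) s))%:R) ->
  (forall s, (1 - 1 / 2 : R) * (p l2 * q l2)%:R <=
     ((m.+1 + m.+1) * (#|fVs F2 s| * bmult (p l2) (q l2) s))%:R) ->
  8 * kap * m.+1%:R <= 1 ->
  exists v : Z,
    v * star v = 1 - Ph (mu l1) (wt (F := F1) 0) 1%:M /\
    v * Ph (mu l2) (fun x t => wt (F := F2) 0 x t * wt 0 x t)
      (delta_mx (lshift m.+1 ord0) (lshift m.+1 ord0) +
       delta_mx (rshift m.+1 ord0) (rshift m.+1 ord0)) * star v =
      1 - Ph (mu l1) (wt (F := F1) 0) 1%:M.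
Proof.
move=> l12 h1 h2 hk.
have w1 : weight (wt (F := F1) 1) by apply: weight_wt; rewrite ler01 ler1n.
have w0 : weight (wt (F := F1) 0) by apply: weight_wt; rewrite lexx ler0n.
have w2 : weight (wt (F := F2) 0) by apply: weight_wt; rewrite lexx ler0n.
have c02 : 0 <= (0 : R) <= 2 by rewrite lexx ler0n.
have c12 : 0 <= (1 : R) <= 2 by rewrite ler01 ler1n.
have dd0 := ddrop_defect F1 c02; have dd1 := ddrop_defect F1 c12.
pose b := mu l1 (defect F1 0); pose f := Ph (mu l1) (wt (F := F1) 1) 1%:M.
have hb : DD mu l2 b by apply: (DD_le incl l12); exact: DD_mu.
have hf : DD mu l2 f by apply: (DD_le incl l12); apply: DD_mu; exact: ddrop_phi.
have sb : star b = b.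
  by rewrite /b -(em_star (hmu l1)) //; congr (mu l1); apply/funext => t; rewrite defect_adj.
have defect2 c : 0 <= c <= 2 -> mu l1 (defect F1 c) * mu l1 (defect F1 c) =
    1 - Ph (mu l1) (wt (F := F1) c) 1%:M.
  move=> hc; have hd := ddrop_defect F1 hc; have hw := weight_wt F1 hc.
  have hp := ddropZ (-1) (ddrop_phi 1%:M hw).
  have h1' : ddrop (fun=> 1%:M : 'M[C]_(p l1 * q l1)).
    exact: (@ddrop_scalar R (p l1) (q l1) (fun=> 1) (contC_cst 1)).
  rewrite -(emM (hmu l1)) // -(em1 (hmu l1)) -[X in _ - X]scale1r -scaleNr /Ph.
  rewrite -(emZ (hmu l1)); last exact: ddrop_phi.
  rewrite -(emD (hmu l1)) //; apply: (em_eq (hmu l1)); [exact: ddropM | exact: ddropD |].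
  by move=> t t01; rewrite defect_sq // scaleN1r.
have bf : b * f = 0.
  rewrite /b /f /Ph -(emM (hmu l1)) //; last exact: ddrop_phi.
  rewrite -(em0 (hmu l1)); apply: (em_eq (hmu l1)); [|exact: ddrop0|].
    by apply: ddropM => //; exact: ddrop_phi.
  by move=> t t01; rewrite defect_orth.
have sf t : 0 <= t <= 1 -> subunit (fib mu l2 f t).
  move=> t01; apply: (subunit_fib hmu (c := mu l1 (defect F1 1))) => //.
  - by apply: (DD_le incl l12); exact: DD_mu.
  - by rewrite -(em_star (hmu l1)) //; congr (mu l1); apply/funext => s; rewrite defect_adj.
  exact: defect2.
have bft t : 0 <= t <= 1 -> fib mu l2 b t *m fib mu l2 f t = 0.
  by move=> t01; rewrite -fibM // bf fib0.
set d := (p l2 * q l2)%N in h2.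
have D0 : 0 < d%:R :> R by rewrite ltr0n muln_gt0 p0 q0.
have hFs s : (#|fVs F2 s| <= bsize (p l2) (q l2) s)%N.
  have b0 := bmult_gt0 (p0 l2) (q0 l2) s.
  rewrite -(leq_pmul2r b0) bsize_mult.
  have := frame_le F2; have := card_codom (@f_inj _ _ _ _ F2 s); rewrite card_prod card_ord => e.
  have := max_card (mem (codom (@ffi _ _ _ _ F2 s))); rewrite e => h3 h4.
  by apply: leq_trans h3 _; apply: leq_trans h4; rewrite leq_pmull.
have htr s t r : 0 <= t <= 1 -> (r < (bsize (p l2) (q l2) s - #|fVs F2 s|) * bmult (p l2) (q l2) s)%N ->
    r%:R < complex.Re (\tr (fib mu l2 f t)).
  move=> t01 hr; have := fib_phi_trace l12 t01 h1; rewrite -/f => h3.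
  have e : complex.Re (\tr (fib mu l2 f t)) = d%:R * complex.Re (trf mu l2 t f).
    by rewrite -cRe_natM /trf /ntr mulrCA mulfV ?mulr1 // pnatr_eq0 -lt0n muln_gt0 p0 q0.
  have hr2 : r%:R < d%:R - (#|fVs F2 s| * bmult (p l2) (q l2) s)%:R :> R.
    rewrite -natrB; last by rewrite /d -(bsize_mult (p l2) (q l2) s) leq_mul2r hFs orbT.
    by rewrite ltr_nat /d -(bsize_mult (p l2) (q l2) s) -mulnBl.
  have h4 := h2 s; rewrite natrM natrD -natr1 in h4.
  rewrite e; apply: lt_le_trans hr2 _.
  have h5 : d%:R * (1 - 2 * kap) <= d%:R * complex.Re (trf mu l2 t f).
    by rewrite ler_wpM2l // ltW.
  apply: le_trans h5; move: h4; rewrite natr1 => h4.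
  have M0 : 0 < m.+1%:R :> R by [].
  move: h4 hk M0 D0; move: (_ * bmult _ _ _)%N => y.
  move: (m.+1%:R : R) (d%:R : R) (y%:R : R) => M D Y h4 hk' M0 D0'.
  suff : 2 * kap * D * M <= Y * M by rewrite ler_pM2r //; lra.
  have : 8 * kap * M * D <= 1 * D by rewrite ler_wpM2r // ltW.
  lra.
have al_inj : lshift m.+1 (ord0 : 'I_m.+1) != rshift m.+1 (ord0 : 'I_m.+1).
  by rewrite eq_lrshift.
have [v0 [hv vv vpv]] := @comparison R (p l2) (q l2) (m.+1 + m.+1) (p0 l2) (q0 l2) F2
  (fun s => if s then rshift m.+1 ord0 else lshift m.+1 ord0) al_inj
  (fib mu l2 b) (fib mu l2 f) (fibP hb).1 (fibP hf).1 sf bft hFs htr.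
exists (mu l2 v0); rewrite -(defect2 0) // -/b -{2 4}sb.
have bb := (fibP hb).2; have hbd := (fibP hb).1.
have bbE : b * star b = mu l2 (fun t => fib mu l2 b t *m adj (fib mu l2 b t)).
  by rewrite -{1 2}bb -(em_star (hmu l2)) // -(emM (hmu l2)) //; exact: ddrop_adj.
have hbb : ddrop (fun t => fib mu l2 b t *m adj (fib mu l2 b t)).
  by apply: ddropM => //; exact: ddrop_adj.
have hva := ddrop_adj hv; have hww := weightM w2 w2.
rewrite bbE -(em_star (hmu l2)) // -(emM (hmu l2)) // /Ph; split.
  by apply: (em_eq (hmu l2)) => //; exact: ddropM.
rewrite -(emM (hmu l2)) //; last exact: ddrop_phi.
have hp := ddropM hv (ddrop_phi (delta_mx (lshift m.+1 ord0) (lshift m.+1 ord0) +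
       delta_mx (rshift m.+1 ord0) (rshift m.+1 ord0)) hww).
rewrite -(emM (hmu l2)) //; apply: (em_eq (hmu l2)) => //; exact: ddropM.
Qed.

End StageComparison.

(** * Passage to [A] *)

Section TracialAbsorption.
Variables (R : realType) (A Z : cstarType R).
Local Notation C := R[i].
Variables (p q : nat -> nat).
Variable mu : forall k, (R -> 'M[C^o]_(p k * q k)) -> Z.
Arguments mu : clear implicits.
Hypotheses (p0 : forall k, (0 < p k)%N) (q0 : forall k, (0 < q k)%N).
Hypothesis hmu : forall k, dimdrop_embedding (mu k).
Hypothesis incl : forall k, DD mu k `<=` DD mu k.+1.
Hypothesis dense : forall x (e : R), 0 < e ->
  exists k, exists2 y, DD mu k y & cnorm (x - y) < e.
Hypothesis Zsimple : simple_cstar Z.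
Variable tau : {linear Z -> C^o}.
Hypothesis htau : tracial_state tau.
Hypothesis tau_unique : forall tau' : {linear Z -> C^o},
  tracial_state tau' -> tau' =1 tau.
Variables (pi : {lrmorphism Z -> A}) (th : A -> A).
Hypothesis spi : star_hom pi.
Hypothesis comm : forall a z, th a * pi z = pi z * th a.
Hypothesis span : forall y (e : R), 0 < e -> exists s : seq (A * Z),
  cnorm (y - \sum_(u <- s) th u.1 * pi u.2) < e.
Hypothesis Asimple : simple_cstar A.

Lemma cpc_comp n (g : {linear 'M[C]_n.+1 -> Z}) : cpc_order_zero g ->
  exists h : {linear 'M[C]_n.+1 -> A}, cpc_order_zero h /\ forall x, h x = pi (g x).
Proof.
move=> [cp cc oz].
have [h hE] : exists h : {linear 'M[C]_n.+1 -> A}, h =1 (fun x => pi (g x)).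
  by apply: linear_of => c x y; rewrite !linearP.
exists h; split=> //; split.
- move=> k X /cp[B hB]; exists (map_mx pi B).
  apply/matrixP => i j; rewrite mxE hE; move/matrixP/(_ i j): hB; rewrite mxE => ->.
  have sE (D : starRingType) (Y : 'M[D]_k.+1) u v : (star Y) u v = star (Y v u).
    by rewrite !mxE.
  rewrite mxE rmorph_sum mxE; apply: eq_bigr => l _.
  rewrite rmorphM (sE Z) (sE A) [in RHS]mxE [X in _ = _ * X]mxE; congr (_ * _).
  exact: spi.
- by move=> x; rewrite hE; exact: le_trans (star_hom_contractive spi _) (cc x).
by move=> a b ha hb ab; rewrite !hE -rmorphM oz // rmorph0.
Qed.

(** Moving [psi (E i)] past [x i * a * star (x j)] costs little and brings it next to
    [psi (adj (E j))]. As [E i *m adj (E j)] vanishes off the diagonal and equals [U] on it, the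
    double sum collapses, and the relation on the [x i] leaves the element compared by [v]. *)
Lemma cuntz_approx l1 n (F1 : frame R (p l1) (q l1) n) m (a : A) (x : 'I_m.+1 -> A) (kap e : R) :
  (forall s, (1 - kap) * (p l1 * q l1)%:R <=
     (n * (#|fVs F1 s| * bmult (p l1) (q l1) s))%:R) ->
  8 * kap * m.+1%:R <= 1 -> \sum_i x i * a * star (x i) = 1 -> 0 < e ->
  exists X : A, cnorm (1 - pi (Ph (mu l1) (wt (F := F1) 0) 1%:M) - X * a * star X) <= e.
Proof.
move=> h1 hk xa e0.
pose E (i : 'I_m.+1) : 'M[C]_(m.+1 + m.+1) :=
  delta_mx (lshift m.+1 ord0) (lshift m.+1 i) + delta_mx (rshift m.+1 ord0) (rshift m.+1 i).
pose U : 'M[C]_(m.+1 + m.+1) := delta_mx (lshift m.+1 ord0) (lshift m.+1 ord0) +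
       delta_mx (rshift m.+1 ord0) (rshift m.+1 ord0).
have EE i j : E i *m adj (E j) = (i == j)%:R *: U.
  rewrite /E /U adjD !adj_delta mulmxDl !mulmxDr !mul_delta_mx_cond.
  rewrite (inj_eq (@lshift_inj _ _)) (inj_eq (@rshift_inj _ _)) eq_lrshift eq_rlshift.
  by rewrite !mulr0n addr0 add0r; case: (i == j); rewrite ?mulr1n ?scale1r ?mulr0n ?scale0r ?addr0.
pose y (u : 'I_m.+1 * 'I_m.+1) := x u.1 * a * star (x u.2).
pose c := 1 - Ph (mu l1) (wt (F := F1) 0) 1%:M.
pose Sg := \sum_i \sum_j opnorm (E i) * opnorm (adj (E j)).
have Sg0 : 0 <= Sg by apply: sumr_ge0 => i _; apply: sumr_ge0 => j _; rewrite mulr_ge0 ?opnorm_ge0.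
have M0 : 0 < cnorm c * Sg + 1 by rewrite ltr_wpDl // mulr_ge0 // cnorm_ge0.
have e20 : 0 < e / (cnorm c * Sg + 1) by rewrite divr_gt0.
have k20 : 0 < 1 / 2 :> R by rewrite divr_gt0.
have [l0 hl0] := comm_frame p0 q0 hmu incl dense Zsimple htau tau_unique spi comm span
  [seq y u | u : 'I_m.+1 * 'I_m.+1] (ltn0Sn (m + m.+1)) e20 k20.
pose l2 := maxn l0 l1; have [F2 [h2 hc]] := hl0 l2 (leq_maxl _ _).
have [v [vv vpv]] := stage_comparison p0 q0 hmu incl (leq_maxr l0 l1) h1 h2 hk.
have w2 : weight (wt (F := F2) 0) by apply: weight_wt; rewrite lexx ler0n.
pose psi z := pi (Ph (mu l2) (wt (F := F2) 0) z).
have psiS z : star (psi z) = psi (adj z) by rewrite /psi -spi (Ph_star (hmu l2)).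
have psiN z : cnorm (psi z) <= opnorm z.
  apply: le_trans (star_hom_contractive spi _) _.
  by apply: (Ph_norm (p0 l2) (q0 l2) (hmu l2)) => // w t; exact: wt01.
exists (pi v * \sum_i psi (E i) * x i).
pose T i j := psi (E i) * y (i, j) * psi (adj (E j)).
pose T' i j := y (i, j) * (psi (E i) * psi (adj (E j))).
have XaX : pi v * (\sum_i psi (E i) * x i) * a * star (pi v * \sum_i psi (E i) * x i) =
    pi v * (\sum_i \sum_j T i j) * star (pi v).
  rewrite starM star_sum !mulrA -(mulrA (pi v)) -(mulrA (pi v)); congr (_ * _ * _).
  rewrite mulr_suml mulr_suml; apply: eq_bigr => i _; rewrite mulr_sumr; apply: eq_bigr => j _.
  by rewrite starM psiS /T /y /= !mulrA.
have T'E : \sum_i \sum_j T' i j =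
    pi (Ph (mu l2) (fun x t => wt (F := F2) 0 x t * wt 0 x t) U).
  have psiM i j : psi (E i) * psi (adj (E j)) = (i == j)%:R *:
      pi (Ph (mu l2) (fun x t => wt (F := F2) 0 x t * wt 0 x t) U).
    rewrite /psi -rmorphM (PhM (hmu l2)) // EE (PhZ (hmu l2)); last exact: weightM.
    exact: linearZ_LR.
  transitivity (\sum_i x i * a * star (x i) *
      pi (Ph (mu l2) (fun x t => wt (F := F2) 0 x t * wt 0 x t) U)).
    apply: eq_bigr => i _; rewrite (bigD1 i) //= big1 ?addr0 => [|j ji].
      by rewrite /T' psiM eqxx scale1r.
    by rewrite /T' psiM eq_sym (negbTE ji) scale0r mulr0.
  by rewrite -mulr_suml xa mul1r.
have cE : 1 - pi (Ph (mu l1) (wt (F := F1) 0) 1%:M) = pi v * (\sum_i \sum_j T' i j) * star (pi v).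
  by rewrite T'E -spi -!rmorphM vpv rmorphB (rmorph1 pi).
rewrite XaX cE -mulrBl -mulrBr.
have vN : cnorm (pi v) * cnorm (star (pi v)) <= cnorm c.
  rewrite cnorm_st -expr2; apply: (@le_trans _ _ (cnorm v ^+ 2)).
    rewrite ler_pXn2r ?nnegrE ?cnorm_ge0 //; exact: (star_hom_contractive spi).
  by rewrite -cnorm_starr vv.
have TT : cnorm (\sum_i \sum_j T' i j - \sum_i \sum_j T i j) <= e / (cnorm c * Sg + 1) * Sg.
  rewrite -sumrB /Sg mulr_sumr; apply: le_trans (cnorm_sum _ _ _) _; apply: ler_sum => i _.
  rewrite -sumrB mulr_sumr; apply: le_trans (cnorm_sum _ _ _) _; apply: ler_sum => j _.
  have -> : T' i j - T i j = (y (i, j) * psi (E i) - psi (E i) * y (i, j)) * psi (adj (E j)).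
    by rewrite mulrBl /T' mulrA.
  apply: le_trans (cnormM _ _) _; rewrite mulrA; apply: ler_pM (cnorm_ge0 _) (cnorm_ge0 _) _ (psiN _).
  by apply: hc; apply: map_f; rewrite mem_enum.
apply: le_trans (cnormM _ _) _; apply: le_trans (ler_wpM2r (cnorm_ge0 _) (cnormM _ _)) _.
rewrite mulrAC; apply: (@le_trans _ _ (cnorm c * (e / (cnorm c * Sg + 1) * Sg))).
  by apply: ler_pM => //; rewrite ?mulr_ge0 ?cnorm_ge0.
move: M0; set M := _ + 1 => M0.
have -> : cnorm c * (e / M * Sg) = e * (cnorm c * Sg / M) by ring.
by rewrite ler_piMr ?(ltW e0) // ler_pdivrMr // mul1r /M lerDl.
Qed.

Lemma tracial_absorption (T : seq A) (eps : R) (a : A) n : 0 < eps -> positive a -> a != 0 ->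
  exists phi : {linear 'M[C]_n.+1 -> A},
    [/\ cpc_order_zero phi, cuntz_sub (1 - phi 1) a &
      forall x y, opnorm x = 1 -> y \in T -> cnorm (phi x * y - y * phi x) < eps].
Proof.
move=> eps0 apos a0; have [s hs] := simple_full Asimple apos a0.
have [m sm] : exists m, size s = m.+1.
  case: s hs => [|x s] hs; last by exists (size s).
  by move/eqP: hs; rewrite big_nil eq_sym oner_eq0.
pose x (i : 'I_m.+1) := nth 0 s i.
have xa : \sum_i x i * a * star (x i) = 1.
  by rewrite -hs [RHS](big_nth 0) sm big_mkord.
(* The largest value allowed by [stage_comparison]. It depends on the number of terms needed to
   write 1 by means of [a], so [a] has to be treated before the first frame is chosen. *)
pose kap : R := (8 * m.+1%:R)^-1.
have kap0 : 0 < kap by rewrite invr_gt0 mulr_gt0.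
have hk : 8 * kap * m.+1%:R <= 1 by rewrite mulrAC mulfV // mulf_neq0 ?pnatr_eq0.
have e2 : 0 < eps / 2 by rewrite divr_gt0.
have [l1 h] := comm_frame p0 q0 hmu incl dense Zsimple htau tau_unique spi comm span
  T (ltn0Sn n) e2 kap0.
have [F1 [h1 hc]] := h l1 (leqnn l1).
have [g [gc gE]] := Ph_cpc (p0 l1) (q0 l1) (hmu l1) F1.
have [phi [pc pE]] := cpc_comp gc; exists phi; split=> //.
- have E1 : phi 1 = pi (Ph (mu l1) (wt (F := F1) 0) 1%:M) by rewrite pE gE.
  have /choice[X hX] : forall i : nat, exists X, cnorm (1 - phi 1 - X * a * star X) <= i.+1%:R^-1.
    move=> i; rewrite E1; apply: (cuntz_approx h1 hk xa); by rewrite invr_gt0.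
  exists X; apply/cvg0P => e e0; exists (Num.bound e^-1) => i hi.
  rewrite ger0_norm ?cnorm_ge0 //; apply: le_lt_trans (hX i) _.
  rewrite -[e]invrK ltf_pV2 ?posrE ?invr_gt0 //.
  have := archi_boundP (ltW (_ : 0 < e^-1)); rewrite invr_gt0 => /(_ e0) /lt_trans; apply.
  by rewrite ltr_nat ltnS.
move=> z y oz yT; rewrite cnorm_distC pE gE; apply: le_lt_trans (hc y z yT) _.
by rewrite oz mulr1 ltr_pdivrMr // ltr_pMr // ltr1n.
Qed.

End TracialAbsorption.

Lemma lrmorphism_of (K : pzRingType) (U V : algType K) (f : U -> V) :
  linear f -> f 1 = 1 -> {morph f : x y / x * y} ->
  exists g : {lrmorphism U -> V}, g =1 f.
Proof.
move=> fl f1 fM.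
pose L := GRing.isLinear.Build K U V *:%R f fl.
pose M := GRing.isMonoidMorphism.Build U V f (f1, fM).
by exists (HB.pack_for {lrmorphism U -> V} f L M).
Qed.

Lemma star_iso_inv (R : realType) (A B : starAlgType R) (f : {lrmorphism A -> B}) :
  star_hom f -> bijective f ->
  exists g : {lrmorphism B -> A}, [/\ star_hom g, cancel f g & cancel g f].
Proof.
move=> sf [h fK hK].
have hi : injective f by exact: can_inj fK.
have [g gE] : exists g : {lrmorphism B -> A}, g =1 h.
  apply: lrmorphism_of => [c x y||x y].
  - by rewrite -{1}(hK x) -{1}(hK y) -linearP fK.
  - by rewrite -(rmorph1 f) fK.
  by rewrite -{1}(hK x) -{1}(hK y) -rmorphM fK.
exists g; split=> [x|x|x]; rewrite ?gE ?fK ?hK //.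
by apply: hi; rewrite sf !hK.
Qed.

Lemma jiang_su_DD (R : realType) (Z : cstarType R) : jiang_su Z ->
  exists (p q : nat -> nat) (mu : forall k, (R -> 'M[R[i]^o]_(p k * q k)) -> Z),
  [/\ forall k, (0 < p k)%N /\ (0 < q k)%N, forall k, dimdrop_embedding (mu k),
    forall k, DD mu k `<=` DD mu k.+1 &
    forall x (e : R), 0 < e -> exists k, exists2 y, DD mu k y & cnorm (x - y) < e].
Proof.
move=> [_ _ [p [q [mu [pq hmu incl dns]]]]]; exists p, q, mu.
have DE k : DD mu k = mu k @` [set f | dimdrop f].
  apply/seteqP; split=> [x [h /dimdropP hh <-]|x [h /dimdropP hh <-]]; first by exists h.
  by exists h.
split=> // [k|k|x e e0]; first by case: (pq k).
  by rewrite !DE; exact: incl.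
have : cclosure (\bigcup_k (mu k @` [set f | dimdrop f])) x by rewrite dns.
by move=> /(_ e e0)[y [k _ hy] xy]; exists k, y => //; rewrite DE.
Qed.

(** These serve to exclude the complex numbers: an isomorphism of [A] with them would produce zero
    divisors in a field. *)
Lemma jiang_su_orthogonal (R : realType) (Z : cstarType R) : jiang_su Z ->
  exists x y : Z, [/\ x != 0, y != 0 & x * y = 0].
Proof.
move=> js; have [p [q [mu [pq hmu incl dense]]]] := jiang_su_DD js.
have p0 k : (0 < p k)%N by case: (pq k).
have q0 k : (0 < q k)%N by case: (pq k).
have [Zsimple _ _] := js.
have [l /(_ l (leqnn l))[pl _]] := growth p0 q0 hmu incl dense Zsimple 1.
have d1 : (1 < usize (p l) (q l) Inside)%N by rewrite /= (leq_trans pl) // leq_pmulr.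
pose a := Ordinal (ltnW d1); pose b := Ordinal d1.
have adm : admissible Inside (bump (1 / 2) (1 / 8) : R -> R) by apply: admissible_bump; lra.
have h01 : 0 <= (1 / 2 : R) <= 1 by lra.
have nz (c : 'I_(usize (p l) (q l) Inside)) : el (mu l) (bump (1 / 2) (1 / 8) : R -> R) c c != 0.
  apply: (em_neq0 (hmu l) (t := 1 / 2)) => //; first exact: ddrop_unitR.
  rewrite bump_eq1 ?subrr ?normr0 ?scale1r; [|lra|lra].
  by apply/eqP => /matrixP/(_ c c); rewrite !mxE !eqxx => /eqP; rewrite oner_eq0.
exists (el (mu l) (bump (1 / 2) (1 / 8)) a a), (el (mu l) (bump (1 / 2) (1 / 8)) b b).
by split=> //; rewrite (elM (hmu l) _ _ _ _ adm adm) scale0r.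
Qed.

Theorem proposition2p2 (R : realType) (A : cstarType R)
  (hsimple : simple_cstar A) (habs : Z_absorbing A) :
  tracially_Z_absorbing A.
Proof.
have [Z [B [js [al [be [tens _]]] [f [sf fbij]]]]] := habs.
have [g [sg fK gK]] := star_iso_inv sf fbij.
have [[sal sbe] cab indep dens] := tens.
have [pi piE] : exists pi : {lrmorphism Z -> A}, pi =1 (g \o be).
  apply: lrmorphism_of => [c x y||x y] /=; first by rewrite !linearP.
    by rewrite !rmorph1.
  by rewrite !rmorphM.
have spi : star_hom pi by move=> x; rewrite !piE /= sbe sg.
pose th a := g (al a).
have comm a z : th a * pi z = pi z * th a by rewrite piE /th /= -!rmorphM cab.
split.
- move=> [h [_ hbij]]; have [x [y [x0 y0 xy]]] := jiang_su_orthogonal js.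
  have pi0 z : z != 0 -> h (pi z) != 0.
    apply: contra_neq => hz.
    have pz : pi z = 0 by apply: (bij_inj hbij); rewrite hz rmorph0.
    have bz : be z = 0 by rewrite -[be z]gK -[g (be z)]/((g \o be) z) -piE pz rmorph0.
    apply: contrapT => /eqP z0.
    (* [be] is injective by the independence clause for a single elementary tensor: if a nonzero [z]
       had image zero, then [al 1 * be z = 0] would give [1 = 0] in [A]. *)
    have iz (c : 'I_1 -> R[i]) : \sum_i c i *: z = 0 -> forall i, c i = 0.
      rewrite big_ord1 => cz i; rewrite ord1; apply: contra_neq_eq z0 => c0.
      by rewrite -[z]scale1r -(mulVf c0) -scalerA cz scaler0.
    have sz : \sum_(i < 1) al 1 * be z = 0 by rewrite big_ord1 bz mulr0.
    by have /eqP := @indep 1%N (fun=> 1) (fun=> z) iz sz ord0; rewrite oner_eq0.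
  have := pi0 x x0; have := pi0 y y0 => hy hx.
  have : h (pi x) * h (pi y) == 0 :> R[i] by rewrite -(rmorphM h) -rmorphM xy !rmorph0.
  by rewrite mulf_eq0 (negbTE hx) (negbTE hy).
move=> F eps a n /finite_seqP[T ->] eps0 apos a0.
have [p [q [mu [pq hmu incl dense]]]] := jiang_su_DD js.
have p0 k : (0 < p k)%N by case: (pq k).
have q0 k : (0 < q k)%N by case: (pq k).
have [Zsimple [tau [htau tau_unique]] _] := js.
have span y e : 0 < e -> exists s : seq (A * Z),
    cnorm (y - \sum_(u <- s) th u.1 * pi u.2) < e.
  move=> e0; have : cclosure [set x | exists n (a : 'I_n -> A) (b : 'I_n -> Z),
                 x = \sum_i al (a i) * be (b i)] (f y) by rewrite dens.
  move=> /(_ e e0)[_ [m [c [d ->]]] h].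
  exists [seq (c i, d i) | i <- enum 'I_m]; apply: le_lt_trans h.
  apply: le_trans (star_hom_contractive sg _); rewrite big_map big_enum /= le_eqVlt.
  apply/orP; left; apply/eqP; congr cnorm; rewrite rmorphB; congr (_ - _); first by rewrite [RHS]fK.
  rewrite rmorph_sum.
  by apply: eq_bigr => i _; rewrite /th piE /= rmorphM.
have [phi [h1 h2 h3]] := tracial_absorption p0 q0 hmu incl dense Zsimple htau tau_unique
  spi comm span hsimple T n eps0 apos a0.
by exists phi.
Qed.
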